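(* The following expansion for the Riemann-Siegel theta function $\vartheta(t)$ holds: $$\vartheta(t)\sim \frac{1}{2}t\bigl(\log (t/2\pi)-1\bigr)-\frac{\pi}{8}+\frac{1}{2} \arctan(e^{-\pi t})$$ $$\quad+\frac{1}{2\pi}\sum_{m=1}^\infty\Bigl\{\sum_{r=N_{m-1}}^{N_m-1}\frac{(2r)!\, \zeta(2r+2,m)}{(2\pi t)^{2r+1}}-\sum_{r=2N_{m-1}}^{2N_m-1} \frac{(2r)!\, \zeta(2r+2,m)}{(4\pi t)^{2r+1}}\Bigr\}$$ $$\quad+\frac{1}{4\pi t^{1/2}}\sum_{k\geq 1} \frac{(-1)^{k-1}e^{-2\pi k t}}{k^{3/2}}\sum_{s=0}^\infty C_s(a_k)(\pi k t)^{-s}$$ as $t\to+\infty$, where $N_k\sim\pi kt$ is the optimal truncation index of the $k$th asymptotic series, with $N_0\equiv 0$, and the parameters $a_k$ are specified by $$a_k:=2(N_k-\pi kt)+1.$$ The first few coefficients $C_s(a)$ are $$C_0(a)=\tfrac{7}{6}-a,\qquad C_1(a)=\frac{1}{30\cdot 6^2}(136-495a+405a^2-90a^3),$$ $$C_2(a)=\frac{1}{1120\cdot 6^3}(-695-20538a+54180a^2-43680a^3+13860a^4-1512a^5),$$ $$C_3(a)=\frac{1}{1120\cdot 6^5}(-15953 + 55929 a + 388395 a^2 - 949410 a^3 + 767340 a^4 - 283500 a^5 + 49140 a^6 - 3240 a^7),$$ $$C_4(a)=\frac{1}{70400\cdot 6^8}(170640893 + 21630510 a - 598217400 a^2 - 2559569760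 a^3+ 6176233800 a^4 - 5034007440 a^5 + 2026775520 a^6 - 436233600 a^7 + 48114000 a^8 - 2138400 a^9),$$ $$C_5(a)=\frac{1}{25025\cdot 2^{11}\cdot 6^7}(-8649703370 - 28280511909 a + 27178306155 a^2 + 28170272130 a^3 + 154158404400 a^4 - 357524183016 a^5 + 292552139880 a^6 - 124352308080 a^7 + 30395645280 a^8 - 4313509200 a^9 + 330810480 a^{10} - 10614240 a^{11}).$$
   Context: The Riemann-Siegel theta function is defined for real $t$ by $$\vartheta(t)=\arg\Gamma(\tfrac12 it+\tfrac14)-\tfrac12 t\log\pi,$$ and satisfies $\vartheta(0)=0$. $\zeta(s,m)=\sum_{k=0}^\infty (k+m)^{-s}$ denotes the Hurwitz zeta function. For $k\ge1$, the $k$th asymptotic series is the component series $\frac1k\sum_{r\ge0}(2r)!/(2\pi kt)^{2r+1}$, with scale $2\pi kt$, arising when the Stirling series of $\log\Gamma(it)$ is decomposed into a sequence of series indexed by $k$. Its optimal truncation index $N_k$ is the one for which the series is truncated, for large $t$, near its least term; thus $N_k\sim\pi kt$. Coefficients $C_s(a)$: let $w$ and $\tau$ be related by $\tfrac12 w^2=\tau-\log \tau-1$, with the branch $w\sim \tau-1$ as $\tau\to1$, so that $\tau=1+w+\tfrac13w^2+\tfrac1{36}w^3-\cdots$. Define $A_s(a)$ and $B_s(a)$ by the expansions about $w=0$ $$\frac{\tau^{a-1}}{1+\tau}\,\frac{d\tau}{dw}=\frac12\sum_{s=0}^\infty A_s(a)w^s,\qquad \frac{\tau^{a-1}}{1-\tau}\,\frac{d\tau}{dw}=-\frac1w+\sum_{s=0}^\infty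 B_s(a)w^s,$$ and set $$C_s(a):=\Bigl(\tfrac12 A_{2s}(a)+B_{2s}(a)\Bigr)\frac{\Gamma(s+\frac12)}{\Gamma(\frac12)}\qquad(s\ge0).$$
   Formalization: Through k=1 the expansion is proved for every optimal N_k; the exponentials with k≥2 are proved under the added condition N_{2k}=2N_k (N_k within bounded distance of the least term), since otherwise the displayed formula is off at order e^{-4πt}. *)

(* Defs.v *)
From Stdlib Require Import Reals List Arith.
From Coquelicot Require Import Coquelicot.
Open Scope R_scope.

(* Euler's integral, with x^(z-1) = x^(Re z - 1) (cos (Im z ln x) + i sin (Im z ln x)).
   It converges, and is used, only for Re z > 0. *)
Definition Gamma (z : C) : C :=
  (RInt_gen (fun x => Rpower x (Re z - 1) * exp (- x) * cos (Im z * ln x))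
            (at_right 0) (Rbar_locally p_infty),
   RInt_gen (fun x => Rpower x (Re z - 1) * exp (- x) * sin (Im z * ln x))
            (at_right 0) (Rbar_locally p_infty)).

Definition polar (r phi : R) : C := (r * cos phi, r * sin phi).

(* theta(t) + (t/2) log pi is the branch of arg Gamma(1/4 + it/2) that is
   continuous on R and vanishes at t = 0; this determines theta uniquely. *)
Definition is_RS_theta (theta : R -> R) : Prop :=
  theta 0 = 0 /\
  (forall t : R, continuous theta t) /\
  (forall t : R,
     Gamma (1 / 4, t / 2) =
       polar (Cmod (Gamma (1 / 4, t / 2))) (theta t + t / 2 * ln PI)).

Definition hurwitz_zeta (s m : R) : R :=
  Series (fun k => Rpower (INR k + m) (- s)).

(* A a s and B a s are the coefficients A_s(a) and B_s(a); dtau is dtau/dw.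
   The relation forces tau 0 = 1, and the limit selects the branch
   w ~ tau - 1. *)
Definition are_AB_coefficients (A B : R -> nat -> R) : Prop :=
  exists (eps : R) (tau dtau : R -> R),
    0 < eps /\
    (forall w : R, Rabs w < eps ->
       0 < tau w /\ w ^ 2 / 2 = tau w - ln (tau w) - 1 /\
       is_derive tau w (dtau w)) /\
    is_lim (fun w => (tau w - 1) / w) 0 1 /\
    (forall a w : R, Rabs w < eps ->
       is_pseries (A a) w (2 * (Rpower (tau w) (a - 1) / (1 + tau w) * dtau w))) /\
    (forall a w : R, Rabs w < eps -> w <> 0 ->
       is_pseries (B a) w (Rpower (tau w) (a - 1) / (1 - tau w) * dtau w + / w)).

Definition C_coeff (A B : R -> nat -> R) (s : nat) (a : R) : R :=
  (/ 2 * A a (2 * s)%nat + B a (2 * s)%nat) *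
  (Re (Gamma (RtoC (INR s + / 2))) / Re (Gamma (RtoC (/ 2)))).

(* The sum of f r over m <= r <= n - 1, empty when n <= m. *)
Definition sum_range (f : nat -> R) (m n : nat) : R :=
  fold_right Rplus 0 (map f (seq m (n - m))).

Definition component_term (k : nat) (t : R) (r : nat) : R :=
  / INR k * (INR (fact (2 * r)) / (2 * PI * INR k * t) ^ (2 * r + 1)).

Definition is_least_term_index (k : nat) (t : R) (L : nat) : Prop :=
  forall r : nat, component_term k t L <= component_term k t r.

(* N k t is the truncation index N_k at t.  For each fixed k it stays within a
   bounded distance of the index of the least term of the k-th component series.
   The relation N_k ~ pi k t is uniform in k, and N_k is eventually
   nondecreasing in k, because all the N_k enter one infinite sum.  The distance
   bound is not uniform in k, so that choices such as N_k = k N_1 are included. *)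
Definition optimal_truncation (N : nat -> R -> nat) : Prop :=
  (forall t : R, N 0%nat t = 0%nat) /\
  Rbar_locally p_infty (fun t => forall k : nat, (N k t <= N (S k) t)%nat) /\
  (forall k : nat, (1 <= k)%nat ->
     exists D : R, Rbar_locally p_infty (fun t =>
       exists L : nat, is_least_term_index k t L /\
         Rabs (INR (N k t) - INR L) <= D)) /\
  (forall eps : R, 0 < eps ->
     Rbar_locally p_infty (fun t =>
       forall k : nat, (1 <= k)%nat ->
         Rabs (INR (N k t) / (PI * INR k * t) - 1) <= eps)).

(* The component series with scale 2 pi (2k) t occurs both in the expansion of
   log Gamma(it), as its component 2k, truncated at N_(2k), and in that of
   log Gamma(2it), as its component k, truncated at 2 N_k. *)
Definition compatible_truncation (N : nat -> R -> nat) : Prop :=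
  Rbar_locally p_infty (fun t =>
    forall k : nat, N (2 * k)%nat t = (2 * N k t)%nat).

Definition a_param (N : nat -> R -> nat) (k : nat) (t : R) : R :=
  2 * (INR (N k t) - PI * INR k * t) + 1.

Definition bracket (N : nat -> R -> nat) (t : R) (m : nat) : R :=
  sum_range (fun r => INR (fact (2 * r)) * hurwitz_zeta (2 * INR r + 2) (INR m)
                      / (2 * PI * t) ^ (2 * r + 1))
            (N (m - 1)%nat t) (N m t)
  - sum_range (fun r => INR (fact (2 * r)) * hurwitz_zeta (2 * INR r + 2) (INR m)
                        / (4 * PI * t) ^ (2 * r + 1))
              (2 * N (m - 1)%nat t) (2 * N m t).

Definition algebraic_part (N : nat -> R -> nat) (t : R) : R :=
  / 2 * t * (ln (t / (2 * PI)) - 1) - PI / 8 + / 2 * atan (exp (- PI * t))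
  + / (2 * PI) * Series (fun j => bracket N t (S j)).

(* E k stands for the inner sum over s. *)
Definition exponential_term (t : R) (E : nat -> R) (k : nat) : R :=
  (-1) ^ (k - 1) * exp (- 2 * PI * INR k * t) / Rpower (INR k) (3 / 2) * E k.

Definition exponential_part (t : R) (E : nat -> R) : R :=
  / (4 * PI * sqrt t) * Series (fun j => exponential_term t E (S j)).

Definition inner_sum (c : nat -> R -> R) (n : nat) (a x : R) : R :=
  sum_range (fun s => c s a / x ^ s) 0 n.

(* T(a,x) ~ sum_s c_s(a) x^(-s) as x -> +oo, uniformly for bounded a. *)
Definition has_inner_expansion (c : nat -> R -> R) (T : R -> R -> R) : Prop :=
  forall (n : nat) (bound : R),
    exists K : R, Rbar_locally p_infty (fun x =>
      forall a : R, Rabs a <= bound ->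
        Rabs (T a x - inner_sum c n a x) <= K / x ^ n).

(* Main.v *)
(* Gauss's product turns the argument of Gamma(1/4 + it/2) into a sum of arctangents
   arctan((t/2)/(j + 1/4)).  Euler-Maclaurin summation, with the Fourier series of the
   second Bernoulli polynomial, leaves sine and cosine transforms of 1/(1 + v^2) at
   s = 2 pi k t; both are identified through bounded solutions of y'' = y - r.  The
   cosine transforms add up to arctan(exp(-pi t)) / 2, and the sine transforms are
   Rem(s, 0), where Rem(s, M) is the principal value of
   int_0^oo exp(-su) u^M / (1 - u^2) du.  This gives an exact formula for theta.

   Expanding 1/(1 - u^2) geometrically, Rem(s, 0) is the sum of (2r)!/s^(2r+1) over r < N
   plus Rem(s, 2N).  Interchanging the sums over k and r produces the blocks of Hurwitz
   zeta values.  With s = 2 pi k t and N = N_k the saddle of exp(-su) u^(2N) lies close to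
   the pole u = 1, and the substitution w^2/2 = tau - log tau - 1 brings Rem(s, 2N) to a
   Gaussian integral whose density has the coefficients A_s(a)/2 + B_s(a); only the even
   ones contribute.  The terms k >= 2 of the exponential series, and the discrepancy
   between 2 N_k and N_(2k), are at most of order exp(-7 pi t / 2), hence negligible. *)

Require Import Defs.
From Stdlib Require Import Reals List Arith Lra Lia.
From Coquelicot Require Import Coquelicot.
Open Scope R_scope.

(** Two obstacles shape the proof. A pointwise estimate of Gamma gives its argument only modulo 2
    pi; the estimate for Gauss's product is therefore made uniform in s over [0, t], and continuity
    from s = 0 singles out the branch. Moreover a_k moves with t, so the Laplace expansion has to be
    uniform for bounded a. This rests on 1 - w F(a,w) = tau^a (1 - w F(0,w)), where F generates
    A_s/2 + B_s: the parameter enters only through exp (a ln tau), and ln tau = O(w).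

    No contour is rotated. A Fourier integral cut off at V and its candidate value differ by a
    solution of y'' = y - r, with x r(x) close to an oscillation of frequency V; integration of r
    against the Green function makes the difference O(1/V). The principal value is not handled as a
    limit of symmetric cut-offs either: u = exp y and folding at y = 0 turn it into an absolutely
    convergent integral.

    In the saddle substitution the pole reappears as a term 1/w. It cancels between the two sides of
    the saddle only for cut-offs symmetric in w, which are not symmetric in y; the strip between the
    two has length of second order and disappears in the limit. *)

(** The second branch restates an equation over a Coquelicot carrier type as one over [R], where
    [ring] finds its structure. *)
Ltac rring := first [ring | apply Rminus_diag_uniq; ring].

(** * Riemann integrals on compact intervals *)

Lemma RInt_split (f : R -> R) (a b c : R) :
  ex_RInt f a b -> ex_RInt f b c -> RInt f a c = RInt f a b + RInt f b c.
Proof. intros H1 H2. symmetry. exact (RInt_Chasles f a b c H1 H2). Qed.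

Lemma RInt_add (f g : R -> R) (a b : R) : ex_RInt f a b -> ex_RInt g a b ->
  RInt (fun x => f x + g x) a b = RInt f a b + RInt g a b.
Proof. intros; apply (RInt_plus f g); auto. Qed.

Lemma RInt_mulc (f : R -> R) (k a b : R) : ex_RInt f a b -> RInt (fun x => k * f x) a b = k * RInt f a b.
Proof. intros; apply (RInt_scal f); auto. Qed.

Lemma RInt_dom (f g : R -> R) (a b : R) :
  a <= b -> ex_RInt f a b -> ex_RInt g a b ->
  (forall x, a < x < b -> Rabs (f x) <= g x) -> Rabs (RInt f a b) <= RInt g a b.
Proof.
  intros Hab Hf Hg H.
  apply Rabs_le. split.
  - replace (- RInt g a b) with (RInt (fun x => - g x) a b) by (apply (RInt_opp g); exact Hg).
    apply RInt_le; try assumption.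
    + apply (ex_RInt_opp g); exact Hg.
    + intros x Hx. specialize (H x Hx). apply Rabs_le_between in H. apply H.
  - apply RInt_le; try assumption.
    intros x Hx. specialize (H x Hx). apply Rabs_le_between in H. apply H.
Qed.

Lemma RInt_dom_abs (f g : R -> R) (a b : R) :
  (forall x, Rmin a b <= x <= Rmax a b -> Rabs (f x) <= g x) ->
  ex_RInt f a b -> ex_RInt g a b -> Rabs (RInt f a b) <= Rabs (RInt g a b).
Proof.
  intros H Hf Hg. destruct (Rle_dec a b) as [L|L].
  - rewrite Rmin_left, Rmax_right in H by lra.
    eapply Rle_trans; [apply RInt_dom with (g := g)|apply Rle_abs]; auto.
    intros x Hx. apply H. lra.
  - rewrite Rmin_right, Rmax_left in H by lra.
    rewrite <- (opp_RInt_swap f b a), <- (opp_RInt_swap g b a) by (apply ex_RInt_swap; assumption).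
    unfold opp; simpl. rewrite !Rabs_Ropp.
    eapply Rle_trans; [apply RInt_dom with (g := g)|apply Rle_abs]; auto using ex_RInt_swap.
    lra. intros x Hx. apply H. lra.
Qed.

Lemma ex_RInt_cont (f : R -> R) (a b : R) :
  (forall x, Rmin a b <= x <= Rmax a b -> continuous f x) -> ex_RInt f a b.
Proof. intros H. apply (ex_RInt_continuous (V := R_CompleteNormedModule)); exact H. Qed.

Lemma RInt_FTC (F f : R -> R) (a b : R) :
  (forall x, Rmin a b <= x <= Rmax a b -> is_derive F x (f x)) ->
  (forall x, Rmin a b <= x <= Rmax a b -> continuous f x) ->
  RInt f a b = F b - F a.
Proof. intros H1 H2. apply is_RInt_unique. exact (is_RInt_derive F f a b H1 H2). Qed.

Lemma abs_RInt_const (f : R -> R) (a b M : R) :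
  a <= b -> ex_RInt f a b -> (forall x, a <= x <= b -> Rabs (f x) <= M) ->
  Rabs (RInt f a b) <= (b - a) * M.
Proof. intros; apply abs_RInt_le_const; auto. Qed.

(** * Improper integrals over the half-line *)

(** An epsilon form of [is_RInt_gen] on the half-line that also records integrability on every
    compact subinterval, so that limits combine without handling filters. *)
Definition IG (f : R -> R) (l : R) : Prop :=
  (forall a b, 0 < a -> 0 < b -> ex_RInt f a b) /\
  (forall eps, 0 < eps -> exists d Y, 0 < d /\ 0 < Y /\
     forall a b, 0 < a < d -> Y < b -> Rabs (RInt f a b - l) < eps).

Lemma IG_is_RInt_gen (f : R -> R) (l : R) :
  IG f l -> is_RInt_gen f (at_right 0) (Rbar_locally p_infty) l.
Proof.
  intros [Hex Hl]. unfold is_RInt_gen.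
  apply (filterlimi_lim_ext_loc (fun ab : R * R => RInt f (fst ab) (snd ab))).
  - exists (fun x => 0 < x) (fun x => 0 < x).
    + exists (mkposreal 1 Rlt_0_1). intros y _ Hy. exact Hy.
    + exists 0. auto.
    + intros x y Hx Hy. simpl. apply (RInt_correct f x y). auto.
  - apply filterlim_locally. intros eps.
    destruct (Hl eps (cond_pos eps)) as (d & Y & Hd & HY & H).
    exists (fun x => 0 < x < d) (fun x => Y < x).
    + exists (mkposreal d Hd). intros y By Hy. split; [exact Hy|].
      unfold ball in By; simpl in By. unfold AbsRing_ball, abs, minus, plus, opp in By; simpl in By.
      apply Rabs_def2 in By. lra.
    + exists Y. auto.
    + intros x y Hx Hy. simpl. unfold ball; simpl. unfold AbsRing_ball, abs, minus, plus, opp; simpl.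
      apply H; auto.
Qed.

Lemma IG_unique (f : R -> R) (l : R) :
  IG f l -> RInt_gen f (at_right 0) (Rbar_locally p_infty) = l.
Proof.
  intros H. apply is_RInt_gen_unique. apply IG_is_RInt_gen, H.
Qed.

Lemma IG_eq (f : R -> R) (l l' : R) : IG f l -> IG f l' -> l = l'.
Proof. intros H H'. rewrite <- (IG_unique f l H). apply IG_unique, H'. Qed.

Lemma IG_RInt_gen (f : R -> R) (l : R) :
  IG f l -> IG f (RInt_gen f (at_right 0) (Rbar_locally p_infty)).
Proof. intros H. rewrite (IG_unique f l H). exact H. Qed.

Lemma IG_val (f : R -> R) (l l' : R) : IG f l -> l = l' -> IG f l'.
Proof. intros H <-. exact H. Qed.

Lemma IG_ext (f g : R -> R) (l : R) : (forall x, 0 < x -> f x = g x) -> IG f l -> IG g l.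
Proof.
  intros E [Hex Hl].
  assert (E' : forall a b, 0 < a -> 0 < b -> forall x, Rmin a b < x < Rmax a b -> f x = g x).
  { intros a b Ha Hb x [Hx _]. apply E. revert Hx. unfold Rmin; destruct (Rle_dec a b); lra. }
  split.
  - intros a b Ha Hb. apply ex_RInt_ext with f; [apply E'; assumption|auto].
  - intros eps He. destruct (Hl eps He) as (d & Y & Hd & HY & H). exists d, Y. repeat split; auto.
    intros a b Ha Hb. rewrite <- (RInt_ext f g a b). auto. apply E'; lra.
Qed.

Lemma IG_plus (f g : R -> R) (l l' : R) : IG f l -> IG g l' -> IG (fun x => f x + g x) (l + l').
Proof.
  intros [Ef Hf] [Eg Hg]. split.
  - intros a b Ha Hb. apply (ex_RInt_plus f g); auto.
  - intros eps He. destruct (Hf (eps/2)) as (d & Y & Hd & HY & H); [lra|].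
    destruct (Hg (eps/2)) as (d' & Y' & Hd' & HY' & H'); [lra|].
    exists (Rmin d d'), (Rmax Y Y'). repeat split.
    + apply Rmin_glb_lt; auto.
    + eapply Rlt_le_trans; [exact HY|apply Rmax_l].
    + intros a b [Ha Ha'] Hb.
      assert (a < d) by (eapply Rlt_le_trans; [exact Ha'|apply Rmin_l]).
      assert (a < d') by (eapply Rlt_le_trans; [exact Ha'|apply Rmin_r]).
      assert (Y < b) by (eapply Rle_lt_trans; [|exact Hb]; apply Rmax_l).
      assert (Y' < b) by (eapply Rle_lt_trans; [|exact Hb]; apply Rmax_r).
      rewrite (RInt_plus f g) by (auto; apply Ef || apply Eg; lra).
      unfold plus; simpl.
      replace (RInt f a b + RInt g a b - (l + l'))
        with ((RInt f a b - l) + (RInt g a b - l')) by ring.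
      eapply Rle_lt_trans; [apply Rabs_triang|].
      specialize (H a b ltac:(lra) ltac:(lra)). specialize (H' a b ltac:(lra) ltac:(lra)). lra.
Qed.

Lemma IG_scal (f : R -> R) (k l : R) : IG f l -> IG (fun x => k * f x) (k * l).
Proof.
  intros [Ef Hf]. split.
  - intros a b Ha Hb. apply (ex_RInt_scal f); auto.
  - intros eps He. destruct (Hf (eps/(Rabs k + 1))) as (d & Y & Hd & HY & H).
    { apply Rdiv_lt_0_compat; [lra|]. pose proof (Rabs_pos k); lra. }
    exists d, Y. repeat split; auto. intros a b Ha Hb.
    rewrite (RInt_scal f) by (apply Ef; lra). unfold scal; simpl; unfold mult; simpl.
    rewrite <- Rmult_minus_distr_l, Rabs_mult.
    specialize (H a b Ha Hb). pose proof (Rabs_pos k).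
    apply Rle_lt_trans with (Rabs k * (eps / (Rabs k + 1))).
    + apply Rmult_le_compat_l; lra.
    + apply Rlt_le_trans with ((Rabs k + 1) * (eps / (Rabs k + 1))).
      * apply Rmult_lt_compat_r; [apply Rdiv_lt_0_compat|]; lra.
      * right. field. lra.
Qed.

Lemma IG_minus (f g : R -> R) (l l' : R) : IG f l -> IG g l' -> IG (fun x => f x - g x) (l - l').
Proof.
  intros H H'. apply IG_ext with (fun x => f x + (-1) * g x). intros; ring.
  replace (l - l') with (l + (-1) * l') by ring. apply IG_plus; auto. apply IG_scal; auto.
Qed.

Lemma IG_ge0 (f : R -> R) (l : R) : (forall x, 0 < x -> 0 <= f x) -> IG f l -> 0 <= l.
Proof.
  intros Hp [Ef Hf]. destruct (Rle_dec 0 l) as [|N]; auto. exfalso.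
  destruct (Hf (-l)) as (d & Y & Hd & HY & H); [lra|].
  set (a := Rmin (d/2) 1). set (b := Rmax (Y+1) 1).
  assert (Ha : 0 < a <= d/2) by (unfold a; split; [apply Rmin_glb_lt; lra|apply Rmin_l]).
  assert (Ha1 : a <= 1) by apply Rmin_r.
  assert (Hb : Y + 1 <= b) by apply Rmax_l. assert (Hb1 : 1 <= b) by apply Rmax_r.
  specialize (H a b ltac:(lra) ltac:(lra)).
  assert (0 <= RInt f a b).
  { apply RInt_ge_0; [lra|apply Ef; lra|]. intros x Hx. apply Hp. lra. }
  apply Rabs_def2 in H. lra.
Qed.

Lemma IG_le (f g : R -> R) (l l' : R) :
  (forall x, 0 < x -> f x <= g x) -> IG f l -> IG g l' -> l <= l'.
Proof.
  intros H H1 H2. assert (0 <= l' - l); [|lra].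
  apply IG_ge0 with (fun x => g x - f x). intros x Hx. specialize (H x Hx). lra.
  apply IG_minus; auto.
Qed.

Lemma IG_abs_le (f g : R -> R) (l l' : R) :
  (forall x, 0 < x -> Rabs (f x) <= g x) -> IG f l -> IG g l' -> Rabs l <= l'.
Proof.
  intros H H1 H2. apply Rabs_le. split.
  - replace (-l') with ((-1) * l') by ring.
    apply IG_le with (fun x => (-1) * g x) f; auto using IG_scal.
    intros x Hx. specialize (H x Hx). apply Rabs_le_between in H. lra.
  - apply IG_le with f g; auto.
    intros x Hx. specialize (H x Hx). apply Rabs_le_between in H. lra.
Qed.

Lemma pos_of_between (a b x : R) : 0 < a -> 0 < b -> Rmin a b <= x <= Rmax a b -> 0 < x.
Proof. intros Ha Hb [Hx _]. eapply Rlt_le_trans; [|exact Hx]. apply Rmin_glb_lt; auto. Qed.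

(** Comparison test through the Cauchy criterion: passing from one window to another changes the
    integral of [f] by two end pieces, each bounded by the corresponding piece of [g]. *)
Lemma IG_exists (f g : R -> R) (lg : R) :
  (forall x, 0 < x -> continuous f x) -> (forall x, 0 < x -> Rabs (f x) <= g x) ->
  IG g lg -> exists l, IG f l /\ Rabs l <= lg.
Proof.
  intros Cf Hfg Hg. assert (Hg' := Hg). destruct Hg' as [Eg Lg].
  assert (Ef : forall a b, 0 < a -> 0 < b -> ex_RInt f a b).
  { intros a b Ha Hb. apply ex_RInt_cont. intros x Hx. apply Cf, (pos_of_between a b); auto. }
  assert (FP : ProperFilter (filter_prod (at_right 0) (Rbar_locally p_infty))).
  { apply filter_prod_proper. }
  assert (C : exists l, filterlim (fun ab : R * R => RInt f (fst ab) (snd ab))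
     (filter_prod (at_right 0) (Rbar_locally p_infty)) (locally l)).
  { apply filterlim_locally_cauchy. intros eps.
    destruct (Lg (eps/4)) as (d & Y & Hd & HY & H); [apply Rdiv_lt_0_compat; [apply cond_pos|lra]|].
    exists (fun ab => 0 < fst ab < d /\ Y < snd ab). split.
    - exists (fun x => 0 < x < d) (fun x => Y < x).
      + exists (mkposreal d Hd). intros y By Hy. split; [exact Hy|].
        unfold ball in By; simpl in By. unfold AbsRing_ball, abs, minus, plus, opp in By; simpl in By.
        apply Rabs_def2 in By. lra.
      + exists Y. auto.
      + intros; simpl; auto.
    - intros [a b] [a' b'] [Ha Hb] [Ha' Hb']. simpl in *.
      unfold ball; simpl. unfold AbsRing_ball, abs, minus, plus, opp; simpl.
      assert (E1 : RInt f a' b' + - RInt f a b = RInt f a' a + RInt f b b').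
      { rewrite (RInt_split f a' a b') by (apply Ef; lra).
        rewrite (RInt_split f a b b') by (apply Ef; lra). rring. }
      rewrite E1.
      assert (B1 : Rabs (RInt f a' a) <= Rabs (RInt g a' a)).
      { apply RInt_dom_abs; auto; [|apply Ef; lra|apply Eg; lra].
        intros x Hx; apply Hfg, (pos_of_between a' a); auto; lra. }
      assert (B2 : Rabs (RInt f b b') <= Rabs (RInt g b b')).
      { apply RInt_dom_abs; auto; [|apply Ef; lra|apply Eg; lra].
        intros x Hx; apply Hfg, (pos_of_between b b'); auto; lra. }
      assert (G1 : RInt g a' a = (RInt g a' b - lg) - (RInt g a b - lg)).
      { rewrite (RInt_split g a' a b) by (apply Eg; lra). rring. }
      assert (G2 : RInt g b b' = (RInt g a b' - lg) - (RInt g a b - lg)).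
      { rewrite (RInt_split g a b b') by (apply Eg; lra). rring. }
      pose proof (H a b ltac:(lra) ltac:(lra)) as h1. pose proof (H a' b ltac:(lra) ltac:(lra)) as h2.
      pose proof (H a b' ltac:(lra) ltac:(lra)) as h3.
      eapply Rle_lt_trans; [apply Rabs_triang|].
      rewrite G1 in B1. rewrite G2 in B2.
      apply Rabs_def2 in h1. apply Rabs_def2 in h2. apply Rabs_def2 in h3.
      assert (Rabs ((RInt g a' b - lg) - (RInt g a b - lg)) < eps/2) by (apply Rabs_def1; lra).
      assert (Rabs ((RInt g a b' - lg) - (RInt g a b - lg)) < eps/2) by (apply Rabs_def1; lra).
      lra. }
  destruct C as [l Hl].
  assert (Hf : IG f l).
  { split; auto. intros eps He.
    destruct (proj1 (filterlim_locally _ _) Hl (mkposreal eps He)) as [P Q HP HQ H].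
    destruct HP as [d HP]. destruct HQ as [Y HQ].
    exists d, (Rmax Y 1). repeat split.
    - apply cond_pos.
    - eapply Rlt_le_trans; [apply Rlt_0_1|apply Rmax_r].
    - intros a b [Ha Hd] Hb. apply (H a b).
      + apply HP; auto. unfold ball; simpl. unfold AbsRing_ball, abs, minus, plus, opp; simpl.
        apply Rabs_def1; lra.
      + apply HQ. eapply Rle_lt_trans; [apply Rmax_l|exact Hb]. }
  exists l. split; auto. apply IG_abs_le with f g; auto.
Qed.

Lemma IG_deriv (F f : R -> R) (A B : R) :
  (forall x, 0 < x -> is_derive F x (f x)) -> (forall x, 0 < x -> continuous f x) ->
  filterlim F (at_right 0) (locally A) -> filterlim F (Rbar_locally p_infty) (locally B) ->
  IG f (B - A).
Proof.
  intros HF Cf HA HB. split.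
  - intros a b Ha Hb. apply ex_RInt_cont. intros x Hx. apply Cf, (pos_of_between a b); auto.
  - intros eps He. assert (He2 : 0 < eps/2) by lra.
    destruct (proj1 (filterlim_locally _ _) HA (mkposreal _ He2)) as [d Hd].
    destruct (proj1 (filterlim_locally _ _) HB (mkposreal _ He2)) as [Y HY].
    exists d, (Rmax Y 1). repeat split.
    + apply cond_pos.
    + eapply Rlt_le_trans; [apply Rlt_0_1|apply Rmax_r].
    + intros a b [Ha Hda] Hb.
      assert (Y < b) by (eapply Rle_lt_trans; [apply Rmax_l|exact Hb]).
      assert (1 < b) by (eapply Rle_lt_trans; [apply Rmax_r|exact Hb]).
      rewrite (RInt_FTC F).
      * specialize (HY b H). unfold ball in HY; simpl in HY.
        unfold AbsRing_ball, abs, minus, plus, opp in HY; simpl in HY.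
        assert (K : ball A (eps/2) (F a)).
        { apply Hd; auto. unfold ball; simpl. unfold AbsRing_ball, abs, minus, plus, opp; simpl.
          apply Rabs_def1; lra. }
        unfold ball in K; simpl in K.
        unfold AbsRing_ball, abs, minus, plus, opp in K; simpl in K.
        apply Rabs_def2 in HY. apply Rabs_def2 in K. apply Rabs_def1; lra.
      * intros x Hx. apply HF, (pos_of_between a b); auto; lra.
      * intros x Hx. apply Cf, (pos_of_between a b); auto; lra.
Qed.

(** * Oscillatory integrals *)

(* Integration by parts; the sign of the derivative makes [int |f'|] telescope. *)
Lemma osc_bound (f df : R -> R) (a b V c : R) :
  a <= b -> 0 < V ->
  (forall x, a <= x <= b -> is_derive f x (df x)) ->
  (forall x, a <= x <= b -> continuous df x) ->
  (forall x, a <= x <= b -> 0 <= df x) \/ (forall x, a <= x <= b -> df x <= 0) ->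
  Rabs (RInt (fun x => f x * cos (V * x + c)) a b) <= 2 * (Rabs (f a) + Rabs (f b)) / V.
Proof.
  intros Hab HV Hf Cdf Hs.
  assert (Cf : forall x, a <= x <= b -> continuous f x).
  { intros x Hx. apply (ex_derive_continuous (V := R_NormedModule)). exists (df x). auto. }
  assert (Cs : forall x, continuous (fun x => sin (V * x + c)) x).
  { intros x. apply (ex_derive_continuous (V := R_NormedModule)). auto_derive. auto. }
  assert (Cc : forall x, continuous (fun x => cos (V * x + c)) x).
  { intros x. apply (ex_derive_continuous (V := R_NormedModule)). auto_derive. auto. }
  assert (E1 : ex_RInt (fun x => df x * (sin (V * x + c) / V)) a b).
  { apply ex_RInt_cont. intros x Hx. rewrite Rmin_left, Rmax_right in Hx by lra.
    apply (continuous_mult (K := R_AbsRing)); [auto|].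
    apply (continuous_mult (K := R_AbsRing)); [auto|apply continuous_const]. }
  assert (E2 : ex_RInt (fun x => f x * cos (V * x + c)) a b).
  { apply ex_RInt_cont. intros x Hx. rewrite Rmin_left, Rmax_right in Hx by lra.
    apply (continuous_mult (K := R_AbsRing)); auto. }
  assert (I : RInt (fun x => df x * (sin (V * x + c) / V) + f x * cos (V * x + c)) a b
     = f b * (sin (V * b + c) / V) - f a * (sin (V * a + c) / V)).
  { apply (RInt_FTC (fun x => f x * (sin (V * x + c) / V))).
    - intros x Hx. rewrite Rmin_left, Rmax_right in Hx by lra.
      apply (is_derive_mult f (fun x => sin (V * x + c) / V) x (df x) (cos (V * x + c))).
      + auto.
      + auto_derive; [auto|]. field. lra.
      + intros; apply Rmult_comm.
    - intros x Hx. rewrite Rmin_left, Rmax_right in Hx by lra.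
      apply (continuous_plus (V := R_NormedModule)).
      + apply (continuous_mult (K := R_AbsRing)); [auto|].
        apply (continuous_mult (K := R_AbsRing)); [auto|apply continuous_const].
      + apply (continuous_mult (K := R_AbsRing)); auto. }
  rewrite (RInt_plus (fun x => df x * (sin (V * x + c) / V)) (fun x => f x * cos (V * x + c))) in I by auto.
  unfold plus in I; simpl in I.
  assert (Edf : ex_RInt df a b).
  { apply ex_RInt_cont. intros x Hx. rewrite Rmin_left, Rmax_right in Hx by lra. auto. }
  assert (Idf : RInt df a b = f b - f a).
  { apply RInt_FTC; intros x Hx; rewrite Rmin_left, Rmax_right in Hx by lra; auto. }
  assert (HVi : 0 < / V) by (apply Rinv_0_lt_compat; auto).
  assert (sb : forall x, Rabs (sin x / V) <= / V).
  { intros x. unfold Rdiv. rewrite Rabs_mult, (Rabs_right (/ V)) by lra.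
    rewrite <- (Rmult_1_l (/ V)) at 2. apply Rmult_le_compat_r; [lra|].
    apply Rabs_le. apply SIN_bound. }
  assert (J : Rabs (RInt (fun x => df x * (sin (V * x + c) / V)) a b)
                <= (Rabs (f a) + Rabs (f b)) / V).
  { destruct Hs as [Hs|Hs].
    - apply Rle_trans with (RInt (fun x => / V * df x) a b).
      + apply RInt_dom; auto. apply (ex_RInt_scal df); auto.
        intros x Hx. rewrite Rabs_mult, (Rabs_right (df x)) by (apply Rle_ge, Hs; lra).
        rewrite Rmult_comm. apply Rmult_le_compat_r; auto. apply Hs; lra.
      + rewrite (RInt_scal df) by auto. unfold scal; simpl; unfold mult; simpl. rewrite Idf.
        rewrite Rmult_comm. unfold Rdiv. apply Rmult_le_compat_r; [lra|].
        pose proof (Rle_abs (f b)). pose proof (Rle_abs (- f a)). rewrite Rabs_Ropp in *. lra.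
    - apply Rle_trans with (RInt (fun x => - / V * df x) a b).
      + apply RInt_dom; auto. apply (ex_RInt_scal df); auto.
        intros x Hx. rewrite Rabs_mult, (Rabs_left1 (df x)) by (apply Hs; lra).
        rewrite Rmult_comm. replace (- / V * df x) with (/ V * - df x) by ring.
        apply Rmult_le_compat_r; auto. specialize (Hs x ltac:(lra)); lra.
      + rewrite (RInt_scal df) by auto. unfold scal; simpl; unfold mult; simpl. rewrite Idf.
        replace (- / V * (f b - f a)) with ((f a - f b) * / V) by ring.
        unfold Rdiv. apply Rmult_le_compat_r; [lra|].
        pose proof (Rle_abs (f a)). pose proof (Rle_abs (- f b)). rewrite Rabs_Ropp in *. lra. }
  replace (RInt (fun x => f x * cos (V * x + c)) a b) with
    ((f b * (sin (V * b + c) / V) - f a * (sin (V * a + c) / V))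
      - RInt (fun x => df x * (sin (V * x + c) / V)) a b) by (rewrite <- I; ring).
  assert (K1 : Rabs (f b * (sin (V * b + c) / V)) <= Rabs (f b) / V).
  { rewrite Rabs_mult. apply Rmult_le_compat_l; [apply Rabs_pos|auto]. }
  assert (K2 : Rabs (f a * (sin (V * a + c) / V)) <= Rabs (f a) / V).
  { rewrite Rabs_mult. apply Rmult_le_compat_l; [apply Rabs_pos|auto]. }
  apply Rabs_le_between in J. apply Rabs_le_between in K1. apply Rabs_le_between in K2.
  unfold Rdiv in *. apply Rabs_le. split; lra.
Qed.

(** * Series *)

Lemma sum_SnR (a : nat -> R) (n : nat) : sum_n a (S n) = sum_n a n + a (S n).
Proof. exact (sum_Sn a n). Qed.

(** Partial sums of odd and of even length have the same limit because the terms tend to 0. *)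
Lemma is_series_even_odd (a : nat -> R) (le lo : R) :
  is_series (fun n => a (2 * n)%nat) le -> is_series (fun n => a (2 * n + 1)%nat) lo ->
  is_series a (le + lo).
Proof.
  intros He Ho.
  assert (E : forall n, sum_n a (2 * n + 1) = sum_n (fun n => a (2 * n)%nat) n + sum_n (fun n => a (2 * n + 1)%nat) n).
  { induction n.
    - simpl. rewrite sum_Sn, !sum_O. reflexivity.
    - replace (2 * S n + 1)%nat with (S (S (2 * n + 1))) by lia.
      rewrite 2!(sum_Sn a), IHn, !(sum_Sn _ n).
      replace (S (2 * n + 1)) with (2 * S n)%nat by lia.
      replace (S (2 * S n)) with (2 * S n + 1)%nat by lia. unfold plus; simpl. ring. }
  assert (E0 : forall n, sum_n a (2 * n) = sum_n a (2 * n + 1) - a (2 * n + 1)%nat).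
  { intros n. replace (2 * n + 1)%nat with (S (2 * n)) by lia. rewrite sum_Sn. unfold plus; simpl. rring. }
  assert (Z : is_lim_seq (fun n => a (2 * n + 1)%nat) 0) by (apply ex_series_lim_0; exists lo; auto).
  assert (L1 : is_lim_seq (fun n => sum_n a (2 * n + 1)) (le + lo)).
  { apply is_lim_seq_ext with (fun n => sum_n (fun n => a (2 * n)%nat) n + sum_n (fun n => a (2 * n + 1)%nat) n).
    intros; symmetry; apply E. apply is_lim_seq_plus'; auto. }
  assert (L0 : is_lim_seq (fun n => sum_n a (2 * n)) (le + lo)).
  { apply is_lim_seq_ext with (fun n => sum_n a (2 * n + 1) - a (2 * n + 1)%nat).
    intros; symmetry; apply E0. replace (le + lo) with (le + lo - 0) by ring. apply is_lim_seq_minus'; auto. }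
  change (is_lim_seq (sum_n a) (le + lo)). apply is_lim_seq_spec. apply is_lim_seq_spec in L1. apply is_lim_seq_spec in L0.
  intros eps. destruct (L1 eps) as [N1 H1]. destruct (L0 eps) as [N0 H0].
  exists (2 * (N1 + N0) + 2)%nat. intros n Hn.
  destruct (Nat.Even_or_Odd n) as [[m Hm]|[m Hm]]; subst n.
  - apply H0. lia.
  - apply H1. lia.
Qed.

(** Subtracting the even-indexed terms twice flips their signs. As the series starts at [d 1], these
    terms sit at odd j, where [e] carries them. *)
Lemma is_series_alternate (d : nat -> R) (l le : R) :
  is_series (fun j => d (S j)) l -> is_series (fun j => 2 * d (2 * S j)%nat) le ->
  is_series (fun j => (-1) ^ j * d (S j)) (l - le).
Proof.
  intros H H2.
  set (e := fun j => if Nat.even j then 0 else 2 * d (S j)).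
  assert (He : is_series e le).
  { replace le with (0 + le) by ring. apply is_series_even_odd.
    - apply is_series_ext with (fun _ => 0).
      + intros n. unfold e. rewrite Nat.even_mul. reflexivity.
      + change (is_lim_seq (sum_n (fun _ => 0)) 0). apply is_lim_seq_ext with (fun _ => 0).
        intros n. symmetry. rewrite sum_n_const. rring. apply is_lim_seq_const.
    - apply is_series_ext with (fun j => 2 * d (2 * S j)%nat); auto.
      intros n. unfold e. rewrite Nat.even_add, Nat.even_mul. simpl. do 2 f_equal. lia. }
  apply is_series_ext with (fun j => d (S j) - e j).
  - intros n. unfold e. destruct (Nat.Even_or_Odd n) as [[m Hm]|[m Hm]]; subst n.
    + rewrite Nat.even_mul. simpl Nat.even. simpl orb. cbv iota. rewrite pow_1_even. unfold minus, plus, opp; simpl. ring.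
    + rewrite Nat.even_add, Nat.even_mul. simpl Nat.even. simpl orb. simpl Bool.eqb. cbv iota.
      replace (2 * m + 1)%nat with (S (2 * m)) by lia. rewrite pow_1_odd.
      unfold minus, plus, opp; simpl. ring.
  - apply (is_series_minus (fun j => d (S j)) e); auto.
Qed.

(** * The remainder integral *)

Lemma at_right_continuous (F : R -> R) (x l : R) :
  F x = l -> continuous F x -> filterlim F (at_right x) (locally l).
Proof. intros <- H. exact (filterlim_filter_le_1 F (filter_le_within (F := locally x) _) H). Qed.

Lemma exp_ge_1 (x : R) : 1 + x <= exp x.
Proof. apply exp_ineq1_le. Qed.

(** A linear lower bound for the folded denominator; it absorbs the simple zero of the numerator at
    y = 0. *)
Lemma exp_gap (y : R) : 0 < y -> y <= exp y - exp (- y).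
Proof.
  intros Hy. pose proof (exp_ge_1 y). rewrite exp_Ropp.
  assert (/ exp y <= 1).
  { rewrite <- Rinv_1. apply Rinv_le_contravar; lra. }
  lra.
Qed.

Lemma lim_exp_neg : is_lim (fun y => exp (- y)) p_infty 0.
Proof.
  apply is_lim_comp with m_infty.
  - exact is_lim_exp_m.
  - apply (is_lim_opp (fun y => y) p_infty p_infty). apply is_lim_id.
  - exists 0. intros; discriminate.
Qed.

Lemma IG_exp_neg : IG (fun y => exp (- y)) 1.
Proof.
  replace 1 with (0 - (- exp (- 0))) by (rewrite Ropp_0, exp_0; ring).
  apply (IG_deriv (fun y => - exp (- y))).
  - intros x _. auto_derive; auto. ring.
  - intros x _. apply (ex_derive_continuous (V := R_NormedModule)). auto_derive. auto.
  - apply (at_right_continuous (fun y => - exp (- y))); [reflexivity|].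
    apply (ex_derive_continuous (V := R_NormedModule) (fun y => - exp (- y))). auto_derive. auto.
  - replace 0 with (- 0) by ring. apply (is_lim_opp (fun y => exp (- y)) p_infty 0). apply lim_exp_neg.
Qed.

(** This is exp (-su) u^M at u = exp y. *)
Definition Gk (s M y : R) : R := exp (- s * exp y + M * y).

(* The integrand of the remainder [PV int_0^oo exp (-su) u^M / (1 - u^2) du]
   after [u = exp y], folded at [y = 0] so that the principal value becomes an
   ordinary integral. *)
Definition Rk (s M y : R) : R := (Gk s M (- y) - Gk s M y) / (exp y - exp (- y)).

Definition Rem (s M : R) : R := RInt_gen (Rk s M) (at_right 0) (Rbar_locally p_infty).

Lemma Gk_pos (s M y : R) : 0 < Gk s M y.
Proof. apply exp_pos. Qed.

Lemma Rk_continuous (s M y : R) : 0 < y -> continuous (Rk s M) y.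
Proof.
  intros Hy. pose proof (exp_gap y Hy).
  apply (ex_derive_continuous (V := R_NormedModule)). unfold Rk, Gk. auto_derive. lra.
Qed.

(** For y <= 1 the mean value theorem gives a numerator of order y, with 3 as a bound for exp 1. For
    y > 1 the reciprocal of the denominator supplies the decay exp (- y). *)
Lemma Rk_bound (s M B : R) : 0 < s -> 0 <= M -> (forall y, Gk s M y <= B) ->
  forall y, 0 < y -> Rabs (Rk s M y) <= (6 * (M + 3 * s) + 2) * B * exp (- y).
Proof.
  intros Hs HM HB y Hy.
  assert (HBp : 0 < B) by (eapply Rlt_le_trans; [apply (Gk_pos s M 0)|apply HB]).
  pose proof (exp_gap y Hy) as Hg. pose proof (exp_pos (- y)) as He.
  unfold Rk, Rdiv. rewrite Rabs_mult, Rabs_inv, (Rabs_right (exp y - exp (- y))) by lra.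
  destruct (Rle_dec y 1) as [L|L].
  - assert (E3 : / 3 <= exp (- y)).
    { rewrite exp_Ropp. apply Rinv_le_contravar. apply exp_pos.
      apply Rle_trans with (exp 1); [|apply exp_le_3]. destruct L as [L|L]; [left; apply exp_increasing; auto|rewrite L; lra]. }
    assert (D : Rabs (Gk s M (- y) - Gk s M y) <= (M + 3 * s) * B * (2 * y)).
    { destruct (MVT_gen (Gk s M) y (- y) (fun c => (M - s * exp c) * Gk s M c)) as (c & Hc & E).
      - intros x _. unfold Gk. auto_derive; auto. ring.
      - intros x _. apply continuity_pt_filterlim. apply (ex_derive_continuous (V := R_NormedModule)).
        unfold Gk. auto_derive; auto.
      - rewrite Rmin_right, Rmax_left in Hc by lra.
        rewrite E, !Rabs_mult.
        assert (Rabs (- y - y) = 2 * y) as -> by (rewrite Rabs_left; lra).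
        apply Rmult_le_compat_r; [lra|].
        apply Rmult_le_compat; try apply Rabs_pos.
        + assert (exp c <= 3).
          { apply Rle_trans with (exp 1); [|apply exp_le_3].
            destruct (Rle_lt_or_eq_dec c 1) as [L'|L']; [lra|left; apply exp_increasing; auto|rewrite L'; lra]. }
          pose proof (exp_pos c). apply Rabs_le. split; nra.
        + rewrite Rabs_right by (left; apply Gk_pos). apply HB. }
    apply Rle_trans with ((M + 3 * s) * B * (2 * y) * / y).
    + apply Rmult_le_compat; auto. apply Rabs_pos. left; apply Rinv_0_lt_compat; lra.
      apply Rinv_le_contravar; auto.
    + replace ((M + 3 * s) * B * (2 * y) * / y) with (2 * ((M + 3 * s) * B)) by (field; lra).
      assert (0 <= (M + 3 * s) * B) by (apply Rmult_le_pos; lra).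
      apply Rle_trans with ((6 * ((M + 3 * s) * B) + 2 * B) * / 3); [lra|].
      replace ((6 * (M + 3 * s) + 2) * B) with (6 * ((M + 3 * s) * B) + 2 * B) by ring.
      apply Rmult_le_compat_l; lra.
  - assert (D : Rabs (Gk s M (- y) - Gk s M y) <= B).
    { pose proof (Gk_pos s M y). pose proof (Gk_pos s M (- y)). pose proof (HB y). pose proof (HB (- y)).
      apply Rabs_le; split; lra. }
    pose proof (exp_ge_1 y). assert (HE : exp (- y) <= / 2).
    { rewrite exp_Ropp. apply Rinv_le_contravar; lra. }
    assert (Hi : / (exp y - exp (- y)) <= 2 * exp (- y)).
    { apply Rle_trans with (/ (exp y / 2)).
      - apply Rinv_le_contravar; lra.
      - right. rewrite exp_Ropp. field. pose proof (exp_pos y); lra. }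
    apply Rle_trans with (B * (2 * exp (- y))).
    + apply Rmult_le_compat; auto. apply Rabs_pos. left; apply Rinv_0_lt_compat; lra.
    + assert (0 <= (M + 3 * s) * (B * exp (- y))).
      { apply Rmult_le_pos; [lra|]. apply Rmult_le_pos; lra. }
      nra.
Qed.

Lemma Rem_IG_bound (s M B : R) : 0 < s -> 0 <= M -> (forall y, Gk s M y <= B) ->
  IG (Rk s M) (Rem s M) /\ Rabs (Rem s M) <= (6 * (M + 3 * s) + 2) * B.
Proof.
  intros Hs HM HB.
  destruct (IG_exists (Rk s M) (fun y => (6 * (M + 3 * s) + 2) * B * exp (- y)) ((6 * (M + 3 * s) + 2) * B * 1)) as (l & Hl & Hb).
  - intros; apply Rk_continuous; auto.
  - intros; apply Rk_bound; auto.
  - apply IG_scal. apply IG_exp_neg.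
  - unfold Rem. rewrite (IG_unique _ _ Hl). split; auto. lra.
Qed.

Lemma exp_le (x y : R) : x <= y -> exp x <= exp y.
Proof. intros [H|H]. left; apply exp_increasing; auto. rewrite H; lra. Qed.

(** The exponent is largest at exp y = 1 + d, where it equals s (1 + d) (ln (1 + d) - 1); the bound
    follows from ln (1 + d) <= d. A relative deviation d from M = s thus costs only second order. *)
Lemma Gk_le_ratio (s d : R) : 0 < s -> -1 < d ->
  forall y, Gk s (s * (1 + d)) y <= exp (- s * (1 - d ^ 2)).
Proof.
  intros Hs Hd y. apply exp_le.
  assert (L : 1 + ln (1 + d) <= 1 + d) by (rewrite <- (exp_ln (1 + d)) at 2 by lra; apply exp_ge_1).
  assert (E : exp y = (1 + d) * exp (y - ln (1 + d))).
  { unfold Rminus. rewrite exp_plus, exp_Ropp, exp_ln by lra. field. lra. }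
  pose proof (exp_ge_1 (y - ln (1 + d))) as T.
  assert ((1 + d) * (1 + (y - ln (1 + d))) <= exp y) by (rewrite E; apply Rmult_le_compat_l; lra).
  assert ((1 + d) * ln (1 + d) <= (1 + d) * d) by (apply Rmult_le_compat_l; lra).
  assert (K : 1 - d ^ 2 <= exp y - (1 + d) * y) by nra.
  apply (Rmult_le_compat_l s) in K; [|lra]. lra.
Qed.

Lemma Gk_0_le (s : R) : 0 < s -> forall y, Gk s 0 y <= 1.
Proof.
  intros Hs y. rewrite <- exp_0. apply exp_le. pose proof (exp_pos y). nra.
Qed.

Lemma Gk_bounded (s M : R) : 0 < s -> 0 <= M -> exists B, forall y, Gk s M y <= B.
Proof.
  intros Hs HM. destruct (Req_dec M 0) as [->|N].
  - exists 1. apply Gk_0_le; auto.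
  - exists (exp (- s * (1 - (M / s - 1) ^ 2))). intros y.
    replace M with (s * (1 + (M / s - 1))) at 1 by (field; lra).
    apply Gk_le_ratio; auto. assert (0 < M / s) by (apply Rdiv_lt_0_compat; lra). lra.
Qed.

Lemma Rem_IG (s M : R) : 0 < s -> 0 <= M -> IG (Rk s M) (Rem s M).
Proof.
  intros Hs HM. destruct (Gk_bounded s M Hs HM) as [B HB]. apply (Rem_IG_bound s M B); auto.
Qed.

Lemma Gk_lim_p (s M : R) : 0 < s -> 0 <= M -> is_lim (Gk s M) p_infty 0.
Proof.
  intros Hs HM. destruct (Gk_bounded s (M + 1) Hs) as [B HB]; [lra|].
  assert (L : is_lim (fun y => B * exp (- y)) p_infty 0).
  { replace (Finite 0) with (Rbar_mult B 0) by (simpl; f_equal; ring).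
    apply is_lim_scal_l. apply lim_exp_neg. }
  apply (is_lim_le_le_loc (fun _ => 0) (fun y => B * exp (- y))).
  - exists 0. intros y _. split; [left; apply Gk_pos|].
    replace (Gk s M y) with (Gk s (M + 1) y * exp (- y)).
    + apply Rmult_le_compat_r; [left; apply exp_pos|apply HB].
    + unfold Gk. rewrite <- exp_plus. f_equal. ring.
  - apply is_lim_const.
  - exact L.
Qed.

Lemma Gk_lim_m (s M : R) : 0 < s -> 0 < M -> is_lim (fun y => Gk s M (- y)) p_infty 0.
Proof.
  intros Hs HM.
  assert (L : is_lim (fun y => exp (- (M * y))) p_infty 0).
  { apply (is_lim_comp (fun y => exp (- y)) (fun y => M * y) p_infty 0 p_infty).
    - apply lim_exp_neg.
    - pose proof (is_lim_scal_l (fun y => y) M p_infty p_infty (is_lim_id _)) as H. simpl in H.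
      destruct (Rle_dec 0 M) as [r|]; [|lra]. destruct (Rle_lt_or_eq_dec 0 M r); [exact H|lra].
    - exists 0. intros; discriminate. }
  apply (is_lim_le_le_loc (fun _ => 0) (fun y => exp (- (M * y)))).
  - exists 0. intros y _. split; [left; apply Gk_pos|]. apply exp_le.
    pose proof (exp_pos (- y)). nra.
  - apply is_lim_const.
  - exact L.
Qed.

(** Euler's integral for n! in the variable u = exp y, folded at y = 0; the induction step is an
    integration by parts. *)
Lemma IG_gamma_nat (s : R) (n : nat) : 0 < s ->
  IG (fun y => Gk s (INR n + 1) (- y) + Gk s (INR n + 1) y) (INR (fact n) / s ^ (n + 1)).
Proof.
  intros Hs. induction n as [|n IH].
  - replace (INR (fact 0) / s ^ (0 + 1)) with (0 - (-1 / s) + (0 - 0)) by (simpl; field; lra).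
    apply IG_ext with (fun y => (Gk s 1 (- y) + Gk s 1 y)).
    { intros; simpl; rewrite Rplus_0_l; auto. }
    replace (0 - (-1 / s) + (0 - 0)) with (/ s - 0) by (field; lra).
    apply (IG_deriv (fun y => (Gk s 0 (- y) - Gk s 0 y) / s)).
    + intros x _. unfold Gk. auto_derive; auto.
      replace (- s * exp (- x) + 1 * - x) with (- s * exp (- x) + 0 * - x + - x) by ring.
      replace (- s * exp x + 1 * x) with (- s * exp x + 0 * x + x) by ring.
      rewrite !(exp_plus _ (- x)), !(exp_plus _ x). field. lra.
    + intros x _. apply (ex_derive_continuous (V := R_NormedModule)). unfold Gk. auto_derive. auto.
    + apply (at_right_continuous (fun y => (Gk s 0 (- y) - Gk s 0 y) / s)).
      { rewrite Ropp_0; field; lra. }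
      apply (ex_derive_continuous (V := R_NormedModule)). unfold Gk. auto_derive. auto.
    + assert (L1 : is_lim (fun y => Gk s 0 (- y)) p_infty 1).
      { replace (Finite 1) with (Finite (exp (- s * 0 + 0))) by (rewrite Rmult_0_r, Rplus_0_l, exp_0; auto).
        apply (is_lim_comp_continuous (fun y => - s * exp (- y) + 0 * - y) exp).
        - apply is_lim_ext with (fun y => - s * exp (- y)). intros; ring.
          replace (Finite (- s * 0 + 0)) with (Rbar_mult (- s) 0) by (simpl; f_equal; ring).
          apply is_lim_scal_l. apply lim_exp_neg.
        - apply continuous_exp. }
      pose proof (Gk_lim_p s 0 Hs ltac:(lra)) as L2.
      assert (L3 : is_lim (fun y => (Gk s 0 (- y) - Gk s 0 y) / s) p_infty (/ s)); [|exact L3].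
      replace (/ s) with ((1 - 0) * / s) by ring.
      apply (is_lim_scal_r (fun y => Gk s 0 (- y) - Gk s 0 y) (/ s) p_infty (1 - 0)).
      apply (is_lim_minus' (fun y => Gk s 0 (- y)) (Gk s 0)); auto.
  - assert (Hn : 0 <= INR n) by apply pos_INR.
    assert (E : IG (fun y => (Gk s (INR (S n) + 1) (- y) + Gk s (INR (S n) + 1) y)
        - (INR n + 1) / s * (Gk s (INR n + 1) (- y) + Gk s (INR n + 1) y)) (0 - 0)).
    { apply (IG_deriv (fun y => (Gk s (INR n + 1) (- y) - Gk s (INR n + 1) y) / s)).
      - intros x _. rewrite S_INR. unfold Gk. auto_derive; auto.
        replace (- s * exp (- x) + (INR n + 1 + 1) * - x) with (- s * exp (- x) + (INR n + 1) * - x + - x) by ring.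
        replace (- s * exp x + (INR n + 1 + 1) * x) with (- s * exp x + (INR n + 1) * x + x) by ring.
        rewrite !(exp_plus _ (- x)), !(exp_plus _ x). field. lra.
      - intros x _. apply (ex_derive_continuous (V := R_NormedModule)). unfold Gk. auto_derive. auto.
      - apply (at_right_continuous (fun y => (Gk s (INR n + 1) (- y) - Gk s (INR n + 1) y) / s)).
        { rewrite Ropp_0; field; lra. }
        apply (ex_derive_continuous (V := R_NormedModule)). unfold Gk. auto_derive. auto.
      - assert (L3 : is_lim (fun y => (Gk s (INR n + 1) (- y) - Gk s (INR n + 1) y) / s) p_infty 0); [|exact L3].
        replace 0 with ((0 - 0) * / s) by ring.
        apply (is_lim_scal_r (fun y => Gk s (INR n + 1) (- y) - Gk s (INR n + 1) y) (/ s) p_infty (0 - 0)).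
        apply (is_lim_minus' (fun y => Gk s (INR n + 1) (- y)) (Gk s (INR n + 1))).
        + apply Gk_lim_m; lra.
        + apply Gk_lim_p; lra. }
    pose proof (IG_plus _ _ _ _ E (IG_scal _ ((INR n + 1) / s) _ IH)) as F. cbv beta in F.
    replace (INR (fact (S n)) / s ^ (S n + 1)) with
      (0 - 0 + (INR n + 1) / s * (INR (fact n) / s ^ (n + 1))).
    + eapply IG_ext; [|exact F]. intros; cbv beta; ring.
    + rewrite fact_simpl, mult_INR, S_INR. simpl. field.
      split; [apply pow_nonzero|]; lra.
Qed.

(** One geometric step: u^n / (1 - u^2) = u^n + u^(n+2) / (1 - u^2). *)
Lemma Rem_step (s : R) (n : nat) : 0 < s ->
  Rem s (INR n) = INR (fact n) / s ^ (n + 1) + Rem s (INR (n + 2)).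
Proof.
  intros Hs. pose proof (pos_INR n).
  assert (H1 : IG (Rk s (INR n)) (Rem s (INR n))) by (apply Rem_IG; auto; apply pos_INR).
  assert (H2 : IG (Rk s (INR (n + 2))) (Rem s (INR (n + 2)))) by (apply Rem_IG; auto; apply pos_INR).
  pose proof (IG_plus _ _ _ _ (IG_gamma_nat s n Hs) H2) as H3. cbv beta in H3.
  eapply IG_eq; [exact H1|]. eapply IG_ext; [|exact H3].
  intros y Hy. cbv beta. unfold Rk, Gk. rewrite plus_INR. simpl (INR 2).
  pose proof (exp_gap y Hy).
  replace (- s * exp (- y) + (INR n + 1) * - y) with (- s * exp (- y) + INR n * - y + - y) by ring.
  replace (- s * exp y + (INR n + 1) * y) with (- s * exp y + INR n * y + y) by ring.
  replace (- s * exp (- y) + (INR n + (1 + 1)) * - y) with (- s * exp (- y) + INR n * - y + - y + - y) by ring.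
  replace (- s * exp y + (INR n + (1 + 1)) * y) with (- s * exp y + INR n * y + y + y) by ring.
  rewrite !(exp_plus _ (- y)), !(exp_plus _ y).
  set (u := exp (- s * exp (- y) + INR n * - y)). set (v := exp (- s * exp y + INR n * y)).
  assert (E : exp (- y) * exp y = 1) by (rewrite <- exp_plus, Rplus_opp_l, exp_0; auto).
  assert (N : exp y - exp (- y) <> 0) by lra.
  apply (Rmult_eq_reg_r (exp y - exp (- y))); auto.
  unfold Rdiv. rewrite Rmult_plus_distr_r, !Rmult_assoc, !Rinv_l, !Rmult_1_r by auto.
  clearbody u v.
  replace ((u * exp (- y) + v * exp y) * (exp y - exp (- y)) + (u * (exp (- y) * exp (- y)) - v * (exp y * exp y)))
    with ((u - v) * (exp (- y) * exp y)) by ring. rewrite E. ring.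
Qed.

Lemma Rem_truncate (s : R) (N : nat) : 0 < s ->
  Rem s 0 = sum_range (fun r => INR (fact (2 * r)) / s ^ (2 * r + 1)) 0 N + Rem s (INR (2 * N)).
Proof.
  intros Hs. unfold sum_range. rewrite Nat.sub_0_r. induction N as [|N IH].
  - simpl. ring.
  - rewrite IH, (Rem_step s (2 * N) Hs). rewrite seq_S, map_app, fold_right_app. simpl Nat.add.
    replace (N + (N + 0))%nat with (2 * N)%nat by lia.
    replace (2 * S N)%nat with (2 * N + 2)%nat by lia.
    assert (F : forall l a, fold_right Rplus a l = fold_right Rplus 0 l + a).
    { induction l; intros; simpl; [ring|]. rewrite IHl; ring. }
    simpl map. simpl (fold_right Rplus 0 (_ :: _)). rewrite (F _ (_ + 0)).
    replace (N + (N + 0))%nat with (2 * N)%nat by lia. ring.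
Qed.

(** For |d| <= 1/4 the exponent of [Gk_le_ratio] is at most - 15 s / 16. The linear prefactor, at
    most 25.5 s + 2, is below 500 exp (s / 16), which leaves 7 / 8. *)
Lemma Rem_crude (s M : R) : 0 < s -> Rabs (M / s - 1) <= / 4 ->
  Rabs (Rem s M) <= 500 * exp (- (7 / 8) * s).
Proof.
  intros Hs HM. set (d := M / s - 1) in *.
  apply Rabs_le_between in HM.
  assert (EM : M = s * (1 + d)) by (unfold d; field; lra).
  assert (HM0 : 0 <= M) by (rewrite EM; apply Rmult_le_pos; lra).
  destruct (Rem_IG_bound s M (exp (- s * (1 - d ^ 2))) Hs HM0) as [_ HB].
  { rewrite EM. apply Gk_le_ratio; lra. }
  eapply Rle_trans; [exact HB|].
  assert (d ^ 2 <= / 16) by nra.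
  apply Rle_trans with ((6 * (M + 3 * s) + 2) * exp (- s * (15 / 16))).
  { apply Rmult_le_compat_l; [lra|]. apply exp_le. nra. }
  assert (6 * (M + 3 * s) + 2 <= 500 * exp (s / 16)).
  { pose proof (exp_ge_1 (s / 16)). rewrite EM.  nra. }
  replace (- (7 / 8) * s) with (s / 16 + - s * (15 / 16)) by field. rewrite exp_plus, <- Rmult_assoc.
  apply Rmult_le_compat_r; [left; apply exp_pos|auto].
Qed.

(** * Bounded solutions of [y'' = y - r] *)

Lemma cosh_incr (c x : R) : 0 <= c <= x -> cosh c <= cosh x.
Proof.
  intros H. unfold cosh.
  assert (E : exp x + exp (- x) - (exp c + exp (- c)) = (exp x - exp c) * (1 - exp (- x - c))).
  { unfold Rminus. rewrite exp_plus, !exp_Ropp. field. split; apply Rgt_not_eq, exp_pos. }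
  assert (0 <= exp x - exp c) by (pose proof (exp_le c x ltac:(lra)); lra).
  assert (0 <= 1 - exp (- x - c)).
  { pose proof (exp_le (- x - c) 0 ltac:(lra)) as h. rewrite exp_0 in h. lra. }
  pose proof (Rmult_le_pos _ _ H0 H1). lra.
Qed.

Lemma sinh_le (x : R) : 0 <= x -> 0 <= sinh x <= x * cosh x.
Proof.
  intros Hx. destruct (MVT_gen sinh 0 x cosh) as (c & Hc & E).
  - intros t _. unfold sinh, cosh. auto_derive; auto. field.
  - intros t _. apply continuity_pt_filterlim. apply (ex_derive_continuous (V := R_NormedModule)).
    unfold sinh. auto_derive. auto.
  - rewrite Rmin_left, Rmax_right in Hc by lra. rewrite sinh_0 in E.
    pose proof (cosh_incr c x Hc). assert (0 < cosh c).
    { unfold cosh. pose proof (exp_pos c). pose proof (exp_pos (- c)). lra. }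
    split; nra.
Qed.

Lemma cosh_le_exp (x : R) : 0 <= x -> cosh x <= exp x.
Proof. intros H. unfold cosh. pose proof (exp_le (- x) x). lra. Qed.

(** The equation is paired with the homogeneous solution sinh; the boundary term at 0 vanishes with
    [y 0] and [sinh 0]. *)
Lemma ode_identity_sinh (y y1 r : R -> R) (s : R) :
  (forall x, is_derive y x (y1 x)) -> (forall x, is_derive y1 x (y x - r x)) ->
  (forall x, continuous r x) -> y 0 = 0 ->
  RInt (fun x => sinh x * r x) 0 s = y s * cosh s - y1 s * sinh s.
Proof.
  intros H1 H2 Hr H0.
  rewrite (RInt_FTC (fun x => y x * cosh x - y1 x * sinh x)).
  - cbv beta. rewrite H0, sinh_0. rring.
  - intros x _. unfold sinh, cosh. auto_derive.
    + repeat split; auto; eexists; eauto.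
    + assert (E1 : Derive (fun t : R => y t) x = y1 x) by (apply is_derive_unique, H1).
      assert (E2 : Derive (fun t : R => y1 t) x = y x - r x) by (apply is_derive_unique, H2).
      rewrite E1, E2. field.
  - intros x _. apply (continuous_mult (K := R_AbsRing)); auto.
    apply (ex_derive_continuous (V := R_NormedModule)). unfold sinh. auto_derive. auto.
Qed.

Lemma ode_identity_exp (y y1 r : R -> R) (s X : R) :
  (forall x, is_derive y x (y1 x)) -> (forall x, is_derive y1 x (y x - r x)) ->
  (forall x, continuous r x) ->
  RInt (fun x => exp (- x) * r x) s X = (y s + y1 s) * exp (- s) - (y X + y1 X) * exp (- X).
Proof.
  intros H1 H2 Hr.
  rewrite (RInt_FTC (fun x => - (y x + y1 x) * exp (- x))).
  - cbv beta. rring.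
  - intros x _. auto_derive.
    + repeat split; auto; eexists; eauto.
    + assert (E1 : Derive (fun t : R => y t) x = y1 x) by (apply is_derive_unique, H1).
      assert (E2 : Derive (fun t : R => y1 t) x = y x - r x) by (apply is_derive_unique, H2).
      rewrite E1, E2. field.
  - intros x _. apply (continuous_mult (K := R_AbsRing)); auto.
    apply (ex_derive_continuous (V := R_NormedModule)). auto_derive. auto.
Qed.

(** Variation of constants: the two pairings rebuild y(s) from the Green function sinh (min) exp (-
    max), and boundedness of y + y' excludes the growing solution. Since r enters only through
    integrals, its oscillation can be exploited. *)
Lemma ode_bound (y y1 r : R -> R) (s b1 b2 C : R) : 0 < s ->
  (forall x, is_derive y x (y1 x)) -> (forall x, is_derive y1 x (y x - r x)) ->
  (forall x, continuous r x) -> y 0 = 0 ->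
  (forall x, 0 <= x -> Rabs (y x + y1 x) <= C) ->
  Rabs (RInt (fun x => sinh x * r x) 0 s) <= b1 ->
  (forall X, s < X -> Rabs (RInt (fun x => exp (- x) * r x) s X) <= b2) ->
  Rabs (y s) <= sinh s * b2 + exp (- s) * b1.
Proof.
  intros Hs H1 H2 Hr H0 HC B1 B2.
  rewrite (ode_identity_sinh y y1 r s) in B1 by auto.
  assert (B3 : Rabs ((y s + y1 s) * exp (- s)) <= b2).
  { apply le_epsilon. intros eps He.
    (* Far enough that exp X >= 1 + X pushes the boundary term at X below eps. *)
    set (X := s + 1 + C / eps).
    assert (HC0 : 0 <= C) by (eapply Rle_trans; [apply Rabs_pos|apply (HC 0); lra]).
    assert (HCe : 0 <= C / eps) by (apply Rmult_le_pos; [lra|left; apply Rinv_0_lt_compat; lra]).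
    specialize (B2 X ltac:(unfold X; lra)). rewrite (ode_identity_exp y y1 r s X) in B2 by auto.
    assert (T : Rabs ((y X + y1 X) * exp (- X)) <= eps).
    { rewrite Rabs_mult, (Rabs_right (exp _)) by (left; apply exp_pos).
      apply Rle_trans with (C * exp (- X)).
      - apply Rmult_le_compat_r; [left; apply exp_pos|]. apply HC. unfold X; lra.
      - rewrite exp_Ropp. apply (Rmult_le_reg_r (exp X)); [apply exp_pos|].
        rewrite Rmult_assoc, Rinv_l, Rmult_1_r by (apply Rgt_not_eq, exp_pos).
        apply Rle_trans with (eps * (1 + X)).
        + unfold X. replace (eps * (1 + (s + 1 + C / eps))) with (eps * (2 + s) + C) by (field; lra). nra.
        + apply Rmult_le_compat_l; [lra|apply exp_ge_1]. }
    replace ((y s + y1 s) * exp (- s)) with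
      (((y s + y1 s) * exp (- s) - (y X + y1 X) * exp (- X)) + (y X + y1 X) * exp (- X)) by ring.
    eapply Rle_trans; [apply Rabs_triang|]. lra. }
  assert (E : y s = sinh s * ((y s + y1 s) * exp (- s)) + exp (- s) * (y s * cosh s - y1 s * sinh s)).
  { replace (sinh s * ((y s + y1 s) * exp (- s)) + exp (- s) * (y s * cosh s - y1 s * sinh s))
      with (y s * ((sinh s + cosh s) * exp (- s))) by ring.
    replace (sinh s + cosh s) with (exp s) by (unfold sinh, cosh; field).
    rewrite <- exp_plus, Rplus_opp_r, exp_0. ring. }
  rewrite E. eapply Rle_trans; [apply Rabs_triang|].
  rewrite !(Rabs_mult (sinh s)), !(Rabs_mult (exp (- s))).
  rewrite (Rabs_right (sinh s)) by (apply Rle_ge, sinh_le; lra).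
  rewrite (Rabs_right (exp (- s))) by (left; apply exp_pos).
  apply Rplus_le_compat; apply Rmult_le_compat_l; auto.
  - apply sinh_le; lra.
  - left; apply exp_pos.
Qed.

Lemma osc_tail (s X V c : R) : 0 < s < X -> 0 < V ->
  Rabs (RInt (fun x => exp (- x) / x * cos (V * x + c)) s X) <= 4 / (s * V).
Proof.
  intros Hs HV.
  eapply Rle_trans; [apply (osc_bound (fun x => exp (- x) / x) (fun x => - exp (- x) / x - exp (- x) / x ^ 2)); try lra|].
  - intros x Hx. auto_derive. lra. field. lra.
  - intros x Hx. apply (ex_derive_continuous (V := R_NormedModule)). auto_derive. split; [lra|]. split; auto. nra.
  - right. intros x Hx. pose proof (exp_pos (- x)).
    assert (0 < exp (- x) / x) by (apply Rdiv_lt_0_compat; lra).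
    assert (0 < exp (- x) / x ^ 2) by (apply Rdiv_lt_0_compat; [lra|nra]).
    unfold Rdiv in *. lra.
  - assert (B : forall x, s <= x -> Rabs (exp (- x) / x) <= / s).
    { intros x Hx. pose proof (exp_pos (- x)).
      rewrite Rabs_right by (left; apply Rdiv_lt_0_compat; lra).
      rewrite <- (Rmult_1_l (/ s)). apply Rmult_le_compat; try lra.
      left; apply Rinv_0_lt_compat; lra.
      rewrite <- exp_0. apply exp_le; lra. apply Rinv_le_contravar; lra. }
    pose proof (B s ltac:(lra)). pose proof (B X ltac:(lra)).
    replace (4 / (s * V)) with (2 * (/ s + / s) / V) by (field; lra).
    unfold Rdiv. apply Rmult_le_compat_r; [left; apply Rinv_0_lt_compat; lra|]. unfold Rdiv in *; lra.
Qed.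

Lemma osc_head (eta s V c : R) : 0 < eta <= s -> 0 < V ->
  Rabs (RInt (fun x => sinh x / x * cos (V * x + c)) eta s) <= 4 * exp s / V.
Proof.
  intros Hs HV.
  eapply Rle_trans; [apply (osc_bound (fun x => sinh x / x) (fun x => (x * cosh x - sinh x) / x ^ 2)); try lra|].
  - intros x Hx. unfold sinh, cosh. auto_derive. lra. field. lra.
  - intros x Hx. apply (ex_derive_continuous (V := R_NormedModule)). unfold sinh, cosh. auto_derive. nra.
  - left. intros x Hx. apply Rmult_le_pos; [|left; apply Rinv_0_lt_compat; nra].
    pose proof (sinh_le x). lra.
  - assert (B : forall x, 0 < x <= s -> Rabs (sinh x / x) <= exp s).
    { intros x Hx. pose proof (sinh_le x ltac:(lra)). pose proof (cosh_le_exp x ltac:(lra)).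
      pose proof (exp_le x s ltac:(lra)).
      rewrite Rabs_right by (apply Rle_ge, Rmult_le_pos; [lra|left; apply Rinv_0_lt_compat; lra]).
      apply (Rmult_le_reg_r x); [lra|]. unfold Rdiv. rewrite Rmult_assoc, Rinv_l by lra. nra. }
    pose proof (B s ltac:(lra)). pose proof (B eta ltac:(lra)).
    unfold Rdiv at 1 4. apply Rmult_le_compat_r; [left; apply Rinv_0_lt_compat; lra|]. lra.
Qed.

(** The oscillating part of r contributes O(1/V) by [osc_bound]; the error eps x + exp (- A x) is
    integrated directly. Applied to the difference of a truncated transform and its candidate value,
    this forces agreement as V grows. *)
Lemma ode_osc (y y1 r : R -> R) (s V c sg eps A C : R) : 0 < s -> 0 < V -> 0 <= eps -> 0 < A ->
  Rabs sg <= 1 ->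
  (forall x, is_derive y x (y1 x)) -> (forall x, is_derive y1 x (y x - r x)) ->
  (forall x, continuous r x) -> y 0 = 0 ->
  (forall x, 0 <= x -> Rabs (y x + y1 x) <= C) ->
  (forall x, 0 < x -> Rabs (x * r x - sg * cos (V * x + c)) <= eps * x + exp (- (A * x))) ->
  Rabs (y s) <= sinh s * (4 / (s * V) + eps + / (s * A)) + (4 / V + s * s * eps + / A).
Proof.
  intros Hs HV Heps HA Hsg H1 H2 Hr H0 HC Herr.
  replace (4 / V + s * s * eps + / A) with (exp (- s) * (4 * exp s / V + exp s * (s * s * eps) + exp s / A)).
  2:{ rewrite exp_Ropp. field. repeat split; try lra. apply Rgt_not_eq, exp_pos. }
  assert (Cd : forall x, 0 < x -> forall f, continuous f x -> continuous (fun x => f x / x) x).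
  { intros x Hx f Hf. apply (continuous_mult (K := R_AbsRing)); auto.
    apply (ex_derive_continuous (V := R_NormedModule)). auto_derive. lra. }
  assert (Cc : forall x, continuous (fun x => cos (V * x + c)) x).
  { intros x. apply (ex_derive_continuous (V := R_NormedModule)). auto_derive. auto. }
  assert (Csh : forall x, continuous sinh x).
  { intros x. apply (ex_derive_continuous (V := R_NormedModule)). unfold sinh. auto_derive. auto. }
  assert (Cex : forall x, continuous (fun x => exp (- x)) x).
  { intros x. apply (ex_derive_continuous (V := R_NormedModule)). auto_derive. auto. }
  set (e := fun x => x * r x - sg * cos (V * x + c)).
  assert (Ce : forall x, continuous e x).
  { intros x. unfold e. apply (continuous_minus (V := R_NormedModule)).
    - apply (continuous_mult (K := R_AbsRing)); auto. apply continuous_id.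
    - apply (continuous_mult (K := R_AbsRing)); auto. apply continuous_const. }
  assert (Sp : forall f, (forall x, continuous f x) -> forall a b, 0 < a <= b ->
     RInt (fun x => f x * r x) a b = sg * RInt (fun x => f x / x * cos (V * x + c)) a b + RInt (fun x => f x / x * e x) a b).
  { intros f Cf a b Hab.
    assert (X1 : ex_RInt (fun x => f x / x * cos (V * x + c)) a b).
    { apply ex_RInt_cont. intros x Hx. rewrite Rmin_left, Rmax_right in Hx by lra.
      apply (continuous_mult (K := R_AbsRing)); auto. apply Cd; auto. lra. }
    assert (X2 : ex_RInt (fun x => f x / x * e x) a b).
    { apply ex_RInt_cont. intros x Hx. rewrite Rmin_left, Rmax_right in Hx by lra.
      apply (continuous_mult (K := R_AbsRing)); auto. apply Cd; auto. lra. }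
    rewrite (RInt_ext _ (fun x => plus (scal sg (f x / x * cos (V * x + c))) (f x / x * e x))).
    - rewrite (RInt_plus (fun x => scal sg (f x / x * cos (V * x + c)))); auto.
      + rewrite (RInt_scal (fun x => f x / x * cos (V * x + c))) by auto. reflexivity.
      + apply (ex_RInt_scal (fun x => f x / x * cos (V * x + c))). auto.
    - intros x Hx. rewrite Rmin_left, Rmax_right in Hx by lra.
      unfold plus, scal, e; simpl; unfold mult; simpl. field. lra. }
  assert (Ib : forall f g F, (forall x, continuous f x) -> forall a b, 0 < a <= b ->
     (forall x, a <= x <= b -> 0 <= f x) ->
     (forall x, a <= x <= b -> f x / x * (eps * x + exp (- (A * x))) <= g x) ->
     (forall x, a <= x <= b -> is_derive F x (g x)) -> (forall x, a <= x <= b -> continuous g x) ->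
     Rabs (RInt (fun x => f x / x * e x) a b) <= F b - F a).
  { intros f g F Cf a b Hab Hf Hg HF Cg.
    rewrite <- (RInt_FTC F g a b); try (intros x Hx; rewrite Rmin_left, Rmax_right in Hx by lra; auto).
    apply RInt_dom; try lra.
    - apply ex_RInt_cont. intros x Hx. rewrite Rmin_left, Rmax_right in Hx by lra.
      apply (continuous_mult (K := R_AbsRing)); auto. apply Cd; auto. lra.
    - apply ex_RInt_cont. intros x Hx. rewrite Rmin_left, Rmax_right in Hx by lra. auto.
    - intros x Hx. eapply Rle_trans; [|apply Hg; lra].
      assert (0 <= f x / x) by (apply Rmult_le_pos; [apply Hf; lra|left; apply Rinv_0_lt_compat; lra]).
      rewrite Rabs_mult, (Rabs_right (f x / x)) by lra.
      apply Rmult_le_compat_l; auto. apply Herr. lra. }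
  assert (Hsgm : forall I B, Rabs I <= B -> Rabs (sg * I) <= B).
  { intros I B HI. rewrite Rabs_mult. pose proof (Rabs_pos I). pose proof (Rabs_pos sg). nra. }
  apply ode_bound with (y1 := y1) (r := r) (C := C); auto.
  - apply le_epsilon. intros t Ht.
    assert (Cr : forall x, continuous (fun x => sinh x * r x) x) by (intros x; apply (continuous_mult (K := R_AbsRing)); auto).
    (* The splitting of [r] into oscillation and error is singular at 0, so a short interval
       [0, eta] is bounded by the size of sinh x r(x) instead. *)
    assert (Ebd : exists D, 0 < D /\ forall x, 0 <= x <= s -> Rabs (sinh x * r x) <= D).
    { destruct (continuity_ab_maj (fun x => Rabs (sinh x * r x)) 0 s) as (m & Hm & _); [lra| |].
      - intros x _. apply continuity_pt_filterlim. apply (continuous_comp (fun x => sinh x * r x) Rabs); auto.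
        apply continuous_Rabs.
      - exists (Rabs (sinh m * r m) + 1). split; [pose proof (Rabs_pos (sinh m * r m)); lra|].
        intros x Hx. specialize (Hm x Hx). simpl in Hm. lra. }
    destruct Ebd as (D & HD & HDb).
    set (eta := Rmin s (t / D)).
    assert (He : 0 < eta <= s).
    { unfold eta; split; [apply Rmin_glb_lt; auto; apply Rdiv_lt_0_compat; lra|apply Rmin_l]. }
    assert (He2 : eta * D <= t).
    { apply Rle_trans with (t / D * D); [|right; field; lra]. apply Rmult_le_compat_r; [lra|apply Rmin_r]. }
    rewrite (RInt_split _ 0 eta s) by (apply ex_RInt_cont; auto).
    eapply Rle_trans; [apply Rabs_triang|]. rewrite Rplus_comm. apply Rplus_le_compat.
    + rewrite Sp by auto. eapply Rle_trans; [apply Rabs_triang|].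
      rewrite Rplus_assoc.
      apply Rplus_le_compat.
      * apply Hsgm. apply osc_head; auto.
      * eapply Rle_trans.
        { apply (Ib sinh (fun x => exp s * (s * eps + exp (- (A * x)))) (fun x => exp s * (s * eps * x - exp (- (A * x)) / A))); auto.
          - intros x Hx. apply sinh_le. lra.
          - intros x Hx. assert (sinh x / x <= exp s).
            { pose proof (sinh_le x ltac:(lra)). pose proof (cosh_le_exp x ltac:(lra)).
              pose proof (exp_le x s ltac:(lra)).
              apply (Rmult_le_reg_r x); [lra|]. unfold Rdiv. rewrite Rmult_assoc, Rinv_l by lra. nra. }
            pose proof (exp_pos (- (A * x))).
            apply Rle_trans with (exp s * (eps * x + exp (- (A * x)))).
            + apply Rmult_le_compat_r; auto. apply Rplus_le_le_0_compat; [|lra]. apply Rmult_le_pos; lra.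
            + apply Rmult_le_compat_l; [left; apply exp_pos|]. nra.
          - intros x Hx. auto_derive; auto. field. lra.
          - intros x Hx. apply (ex_derive_continuous (V := R_NormedModule)). auto_derive. auto. }
        pose proof (exp_pos s). pose proof (exp_pos (- (A * s))).
        assert (exp (- (A * eta)) <= 1) by (rewrite <- exp_0; apply exp_le; nra).
        assert (0 < / A) by (apply Rinv_0_lt_compat; auto).
        unfold Rdiv. rewrite <- Rmult_minus_distr_l, <- Rmult_plus_distr_l.
        apply Rmult_le_compat_l; [lra|].
        assert (s * eps * s - s * eps * eta <= s * s * eps).
        { assert (0 <= s * eps * eta); [|lra]. apply Rmult_le_pos; [apply Rmult_le_pos|]; lra. }
        assert (exp (- (A * eta)) * / A <= 1 * / A) by (apply Rmult_le_compat_r; lra).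
        assert (0 <= exp (- (A * s)) * / A) by (apply Rmult_le_pos; lra). lra.
    + eapply Rle_trans; [apply abs_RInt_const with (M := D); [lra|apply ex_RInt_cont; auto|]|lra].
      intros x Hx. apply HDb. lra.
  - intros X HX. rewrite Sp by (auto; lra). eapply Rle_trans; [apply Rabs_triang|].
    rewrite Rplus_assoc.
    apply Rplus_le_compat.
    + apply Hsgm. apply osc_tail; lra.
    + eapply Rle_trans.
      { apply (Ib (fun x => exp (- x)) (fun x => eps * exp (- x) + / s * exp (- (A * x)))
           (fun x => - eps * exp (- x) - / s * exp (- (A * x)) / A)); auto; try lra.
        - intros x Hx. left; apply exp_pos.
        - intros x Hx. pose proof (exp_pos (- (A * x))).
          assert (0 < exp (- x) <= 1) by (split; [apply exp_pos|rewrite <- exp_0; apply exp_le; lra]).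
          replace (exp (- x) / x * (eps * x + exp (- (A * x)))) with
            (eps * exp (- x) + / x * (exp (- x) * exp (- (A * x)))) by (field; lra).
          apply Rplus_le_compat_l. apply Rmult_le_compat.
          + left; apply Rinv_0_lt_compat; lra.
          + apply Rmult_le_pos; lra.
          + apply Rinv_le_contravar; lra.
          + nra.
        - intros x Hx. auto_derive; auto. field. lra.
        - intros x Hx. apply (ex_derive_continuous (V := R_NormedModule)). auto_derive. auto. }
      assert (0 < exp (- s) <= 1) by (split; [apply exp_pos|rewrite <- exp_0; apply exp_le; lra]).
      pose proof (exp_pos (- X)). pose proof (exp_pos (- (A * X))).
      assert (exp (- (A * s)) <= 1) by (rewrite <- exp_0; apply exp_le; nra).
      assert (0 < / A) by (apply Rinv_0_lt_compat; auto). assert (0 < / s) by (apply Rinv_0_lt_compat; auto).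
      rewrite Rinv_mult. unfold Rdiv.
      assert (0 <= eps * exp (- X)) by (apply Rmult_le_pos; lra).
      assert (eps * exp (- s) <= eps * 1) by (apply Rmult_le_compat_l; lra).
      assert (0 < / s * / A) by (apply Rmult_lt_0_compat; auto).
      assert (0 <= / s * / A * exp (- (A * X))) by (apply Rmult_le_pos; lra).
      assert (/ s * / A * exp (- (A * s)) <= / s * / A * 1) by (apply Rmult_le_compat_l; lra).
      lra.
Qed.

(** * The sine and cosine transforms of [1 / (1 + v^2)] *)

Ltac smooth := apply (ex_derive_continuous (V := R_NormedModule)); auto_derive.

Lemma is_derive_param (f df : R -> R -> R) (a b s : R) :
  (forall u v, is_derive (fun u => f u v) u (df u v)) ->
  (forall v, Rmin a b <= v <= Rmax a b -> continuity_2d_pt df s v) ->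
  (forall u v, Rmin a b <= v <= Rmax a b -> continuous (f u) v) ->
  is_derive (fun u => RInt (f u) a b) s (RInt (df s) a b).
Proof.
  intros H1 H2 H3.
  assert (E : forall u v, Derive (fun z => f z v) u = df u v) by (intros; apply is_derive_unique; auto).
  rewrite (RInt_ext (df s) (fun t => Derive (fun u => f u t) s)) by (intros; symmetry; apply E).
  apply (is_derive_RInt_param f a b s).
  - apply filter_forall. intros u t _. eexists; apply H1.
  - intros t Ht. apply continuity_2d_pt_ext with df; auto.
  - apply filter_forall. intros u. apply ex_RInt_cont. intros; apply H3; auto.
Qed.

Lemma continuous_param (f df : R -> R -> R) (a b s : R) :
  (forall u v, is_derive (fun u => f u v) u (df u v)) ->
  (forall v, Rmin a b <= v <= Rmax a b -> continuity_2d_pt df s v) ->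
  (forall u v, Rmin a b <= v <= Rmax a b -> continuous (f u) v) ->
  continuous (fun u => RInt (f u) a b) s.
Proof.
  intros. apply (ex_derive_continuous (V := R_NormedModule)). eexists. apply (is_derive_param f df); auto.
Qed.

Lemma c2d_unary (f : R -> R) (s v : R) : continuous f v -> continuity_2d_pt (fun _ v => f v) s v.
Proof.
  intros H. apply (continuity_1d_2d_pt_comp f (fun _ v => v)).
  apply continuity_pt_filterlim, H. apply continuity_2d_pt_id2.
Qed.

Lemma c2d_comp (h : R -> R) (g : R -> R -> R) (s v : R) :
  continuous h (g s v) -> continuity_2d_pt g s v -> continuity_2d_pt (fun u v => h (g u v)) s v.
Proof. intros. apply continuity_1d_2d_pt_comp; auto. apply continuity_pt_filterlim; auto. Qed.

(** The cut-off V makes differentiation under the integral sign elementary; what it removes is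
    controlled by [ode_osc]. *)
Definition Ksin (V s : R) : R := RInt (fun v => sin (s * v) * / (1 + v ^ 2)) 0 V.
Definition Kcos (V s : R) : R := RInt (fun v => cos (s * v) * / (1 + v ^ 2)) 0 V.

Lemma one_plus_sq (v : R) : 0 < 1 + v ^ 2.
Proof. nra. Qed.

Ltac c2d := repeat first
  [ apply continuity_2d_pt_plus | apply continuity_2d_pt_minus | apply continuity_2d_pt_opp | apply continuity_2d_pt_mult
  | apply continuity_2d_pt_id1 | apply continuity_2d_pt_id2 | apply continuity_2d_pt_const
  | apply (c2d_comp sin); [apply continuous_sin|] | apply (c2d_comp cos); [apply continuous_cos|]
  | apply (c2d_comp exp); [apply continuous_exp|] ].

Section Transform.
Variable V : R.
Hypothesis HV : 0 < V.
Variable w : R -> R.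
Hypothesis Cw : forall v, continuous w v.

Lemma c2d_w (s v : R) : continuity_2d_pt (fun _ v => w v) s v.
Proof. apply (c2d_unary w). auto. Qed.

Lemma is_derive_trans_sin (s : R) :
  is_derive (fun s => RInt (fun v => sin (s * v) * w v) 0 V) s (RInt (fun v => cos (s * v) * (v * w v)) 0 V).
Proof.
  apply (is_derive_param (fun s v => sin (s * v) * w v) (fun s v => cos (s * v) * (v * w v))).
  - intros u v. auto_derive; auto. rring.
  - intros v _. c2d; apply c2d_w.
  - intros u v _. apply (continuous_mult (K := R_AbsRing)); auto. smooth; auto.
Qed.

Lemma is_derive_trans_cos (s : R) :
  is_derive (fun s => RInt (fun v => cos (s * v) * w v) 0 V) s (- RInt (fun v => sin (s * v) * (v * w v)) 0 V).
Proof.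
  replace (- RInt (fun v => sin (s * v) * (v * w v)) 0 V) with (RInt (fun v => - (sin (s * v) * (v * w v))) 0 V).
  - apply (is_derive_param (fun s v => cos (s * v) * w v) (fun s v => - (sin (s * v) * (v * w v)))).
    + intros u v. auto_derive; auto. rring.
    + intros v _. c2d; apply c2d_w.
    + intros u v _. apply (continuous_mult (K := R_AbsRing)); auto. smooth; auto.
  - apply (RInt_opp (fun v => sin (s * v) * (v * w v))). apply ex_RInt_cont. intros v _.
    apply (continuous_mult (K := R_AbsRing)). smooth; auto. apply (continuous_mult (K := R_AbsRing)); auto. apply continuous_id.
Qed.
End Transform.

Lemma weight_continuous (v : R) : continuous (fun v => / (1 + v ^ 2)) v.
Proof. smooth. pose proof (one_plus_sq v); simpl in *; lra. Qed.

Lemma linear_weight_continuous (v : R) : continuous (fun v => v * / (1 + v ^ 2)) v.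
Proof. smooth. pose proof (one_plus_sq v); simpl in *; lra. Qed.

Lemma RInt_sub (f g : R -> R) (a b : R) : (forall x, continuous f x) -> (forall x, continuous g x) ->
  RInt (fun x => f x - g x) a b = RInt f a b - RInt g a b.
Proof. intros Hf Hg. apply (RInt_minus f g); apply ex_RInt_cont; auto. Qed.

(** v^2 / (1 + v^2) = 1 - 1 / (1 + v^2) turns the second derivative into [Ksin] minus an integral of
    sin (s v) alone. *)
Lemma Ksin_ode (V s : R) : 0 < V ->
  is_derive (Ksin V) s (RInt (fun v => cos (s * v) * (v * / (1 + v ^ 2))) 0 V) /\
  is_derive (fun s => RInt (fun v => cos (s * v) * (v * / (1 + v ^ 2))) 0 V) s
    (Ksin V s - RInt (fun v => sin (s * v)) 0 V).
Proof.
  intros HV. split.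
  - apply (is_derive_trans_sin V (fun v => / (1 + v ^ 2))). apply weight_continuous.
  - evar_last. apply (is_derive_trans_cos V (fun v => v * / (1 + v ^ 2))). apply linear_weight_continuous.
    unfold Ksin. rewrite <- RInt_sub.
    + rewrite <- (RInt_opp (fun v => sin (s * v) * (v * (v * / (1 + v ^ 2))))).
      * apply RInt_ext. intros x _. unfold opp; simpl. field. pose proof (one_plus_sq x); simpl in *; lra.
      * apply ex_RInt_cont. intros v _. smooth. pose proof (one_plus_sq v); simpl in *; lra.
    + intros x. smooth. pose proof (one_plus_sq x); simpl in *; lra.
    + intros x. smooth. auto.
Qed.

Lemma Kcos_ode (V s : R) : 0 < V ->
  is_derive (Kcos V) s (- RInt (fun v => sin (s * v) * (v * / (1 + v ^ 2))) 0 V) /\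
  is_derive (fun s => - RInt (fun v => sin (s * v) * (v * / (1 + v ^ 2))) 0 V) s
    (Kcos V s - RInt (fun v => cos (s * v)) 0 V).
Proof.
  intros HV. split.
  - apply (is_derive_trans_cos V (fun v => / (1 + v ^ 2))). apply weight_continuous.
  - evar_last. apply (is_derive_opp (fun s => RInt (fun v => sin (s * v) * (v * / (1 + v ^ 2))) 0 V)).
    apply (is_derive_trans_sin V (fun v => v * / (1 + v ^ 2))). apply linear_weight_continuous.
    unfold Kcos. rewrite <- RInt_sub.
    + rewrite <- (RInt_opp (fun v => cos (s * v) * (v * (v * / (1 + v ^ 2))))).
      * apply RInt_ext. intros x _. unfold opp; simpl. field. pose proof (one_plus_sq x); simpl in *; lra.
      * apply ex_RInt_cont. intros v _. smooth. pose proof (one_plus_sq v); simpl in *; lra.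
    + intros x. smooth. pose proof (one_plus_sq x); simpl in *; lra.
    + intros x. smooth. auto.
Qed.

Lemma trig_weight_bound (V : R) (g w : R -> R) : 0 < V ->
  (forall v, Rabs (g v) <= 1) -> (forall v, 0 <= v <= V -> Rabs (w v) <= 1) ->
  (forall v, continuous g v) -> (forall v, continuous w v) ->
  Rabs (RInt (fun v => g v * w v) 0 V) <= V.
Proof.
  intros HV Hg Hw Cg Cw. replace V with ((V - 0) * 1) at 2 by rring.
  apply abs_RInt_const; [lra| |].
  - apply ex_RInt_cont. intros v _. apply (continuous_mult (K := R_AbsRing)); auto.
  - intros x Hx. rewrite Rabs_mult. specialize (Hg x). specialize (Hw x Hx).
    pose proof (Rabs_pos (g x)). pose proof (Rabs_pos (w x)). nra.
Qed.

Lemma w0_bound (v : R) : Rabs (/ (1 + v ^ 2)) <= 1.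
Proof.
  pose proof (one_plus_sq v). rewrite Rabs_right by (left; apply Rinv_0_lt_compat; auto).
  rewrite <- Rinv_1. apply Rinv_le_contravar; [lra|]. nra.
Qed.

Lemma w1_bound (v : R) : Rabs (v * / (1 + v ^ 2)) <= 1.
Proof.
  pose proof (one_plus_sq v). rewrite Rabs_mult, (Rabs_right (/ _)) by (left; apply Rinv_0_lt_compat; auto).
  apply (Rmult_le_reg_r (1 + v ^ 2)); auto. rewrite Rmult_assoc, Rinv_l by lra.
  unfold Rabs; destruct (Rcase_abs v); nra.
Qed.

Lemma abs_sin (x : R) : Rabs (sin x) <= 1.
Proof. apply Rabs_le. apply SIN_bound. Qed.
Lemma abs_cos (x : R) : Rabs (cos x) <= 1.
Proof. apply Rabs_le. apply COS_bound. Qed.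

Lemma Ksin_bound (V s : R) : 0 < V ->
  Rabs (Ksin V s + RInt (fun v => cos (s * v) * (v * / (1 + v ^ 2))) 0 V) <= 2 * V.
Proof.
  intros HV. eapply Rle_trans; [apply Rabs_triang|]. replace (2 * V) with (V + V) by rring.
  apply Rplus_le_compat.
  - apply (trig_weight_bound V (fun v => sin (s * v))); auto.
    intros; apply abs_sin. intros; apply w0_bound. intros; smooth; auto. apply weight_continuous.
  - apply (trig_weight_bound V (fun v => cos (s * v))); auto.
    intros; apply abs_cos. intros; apply w1_bound. intros; smooth; auto. apply linear_weight_continuous.
Qed.

Lemma Kcos_bound (V s : R) : 0 < V ->
  Rabs (Kcos V s + - RInt (fun v => sin (s * v) * (v * / (1 + v ^ 2))) 0 V) <= 2 * V.
Proof.
  intros HV. eapply Rle_trans; [apply Rabs_triang|]. replace (2 * V) with (V + V) by rring.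
  rewrite Rabs_Ropp. apply Rplus_le_compat.
  - apply (trig_weight_bound V (fun v => cos (s * v))); auto.
    intros; apply abs_cos. intros; apply w0_bound. intros; smooth; auto. apply weight_continuous.
  - apply (trig_weight_bound V (fun v => sin (s * v))); auto.
    intros; apply abs_sin. intros; apply w1_bound. intros; smooth; auto. apply linear_weight_continuous.
Qed.

Lemma RInt_sin_lin (x V : R) : x * RInt (fun v => sin (x * v)) 0 V = 1 - cos (V * x).
Proof.
  transitivity (RInt (fun v => x * sin (x * v)) 0 V).
  { symmetry. apply (RInt_scal (fun v => sin (x * v))). apply ex_RInt_cont; intros; smooth; auto. }
  rewrite (RInt_FTC (fun v => - cos (x * v))).
  - rewrite Rmult_0_r, cos_0, (Rmult_comm V). rring.
  - intros v _. auto_derive; auto. rring.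
  - intros v _. smooth; auto.
Qed.

Lemma RInt_cos_lin (x V : R) : x * RInt (fun v => cos (x * v)) 0 V = sin (V * x).
Proof.
  transitivity (RInt (fun v => x * cos (x * v)) 0 V).
  { symmetry. apply (RInt_scal (fun v => cos (x * v))). apply ex_RInt_cont; intros; smooth; auto. }
  rewrite (RInt_FTC (fun v => sin (x * v))).
  - rewrite Rmult_0_r, sin_0, (Rmult_comm V). rring.
  - intros v _. auto_derive; auto. rring.
  - intros v _. smooth; auto.
Qed.

Lemma continuous_RInt_trig (V s : R) :
  continuous (fun s => RInt (fun v => sin (s * v)) 0 V) s /\
  continuous (fun s => RInt (fun v => cos (s * v)) 0 V) s.
Proof.
  split.
  - apply (continuous_param (fun s v => sin (s * v)) (fun s v => cos (s * v) * v)).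
    + intros u v. auto_derive; auto. rring.
    + intros; c2d.
    + intros; smooth; auto.
  - apply (continuous_param (fun s v => cos (s * v)) (fun s v => - sin (s * v) * v)).
    + intros u v. auto_derive; auto. rring.
    + intros; c2d.
    + intros; smooth; auto.
Qed.

Lemma RInt_weight_atan (V : R) : RInt (fun v => / (1 + v ^ 2)) 0 V = atan V.
Proof.
  rewrite (RInt_FTC atan).
  - rewrite atan_0. rring.
  - intros x _. evar_last. apply is_derive_atan. unfold Rsqr. f_equal. rring.
  - intros x _. apply weight_continuous.
Qed.

(** [Kcos V s] and [atan V * exp (- s)] agree at s = 0, and their difference solves the equation
    with r = sin (V x) / x; replacing [atan V] by pi / 2 costs another 1 / V. *)
Lemma Kcos_limit (s : R) : 0 < s ->
  exists C, 0 <= C /\ forall V, 0 < V -> Rabs (Kcos V s - PI / 2 * exp (- s)) <= C / V.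
Proof.
  intros Hs. exists (sinh s * (4 / s + / s) + 6).
  assert (0 <= sinh s) by (apply sinh_le; lra).
  assert (Hi : 0 < / s) by (apply Rinv_0_lt_compat; auto).
  split. { apply Rplus_le_le_0_compat; [apply Rmult_le_pos; [auto|unfold Rdiv; lra]|lra]. }
  intros V HV. assert (HVi : 0 < / V) by (apply Rinv_0_lt_compat; auto).
  assert (B : Rabs (Kcos V s - atan V * exp (- s)) <= sinh s * (4 / (s * V) + 0 + / (s * V)) + (4 / V + s * s * 0 + / V)).
  (* Here x r(x) is exactly an oscillation, so eps = 0; A = V turns the bound into one of order 1 /
     V. *)
  { apply (ode_osc (fun s => Kcos V s - atan V * exp (- s))
      (fun s => - RInt (fun v => sin (s * v) * (v * / (1 + v ^ 2))) 0 V + atan V * exp (- s))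
      (fun s => RInt (fun v => cos (s * v)) 0 V) s V (- (PI / 2)) 1 0 V (2 * V)); auto; try lra.
    - rewrite Rabs_right; lra.
    - intros x. evar_last. apply (is_derive_minus (Kcos V) (fun s => atan V * exp (- s))).
      exact (proj1 (Kcos_ode V x HV)). auto_derive; [auto|reflexivity]. unfold minus, plus, opp; simpl. rring.
    - intros x. evar_last.
      apply (is_derive_plus (fun s => - RInt (fun v => sin (s * v) * (v * / (1 + v ^ 2))) 0 V) (fun s => atan V * exp (- s))).
      exact (proj2 (Kcos_ode V x HV)). auto_derive; [auto|reflexivity]. unfold plus; simpl. rring.
    - intros x. apply continuous_RInt_trig.
    - unfold Kcos. rewrite Ropp_0, exp_0, <- RInt_weight_atan.
      rewrite (RInt_ext (fun v => cos (0 * v) * / (1 + v ^ 2)) (fun v => / (1 + v ^ 2))). rring.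
      intros v _. rewrite Rmult_0_l, cos_0. rring.
    - intros x Hx. pose proof (Kcos_bound V x HV).
      replace (Kcos V x - atan V * exp (- x) + (- RInt (fun v => sin (x * v) * (v * / (1 + v ^ 2))) 0 V + atan V * exp (- x)))
       with (Kcos V x + - RInt (fun v => sin (x * v) * (v * / (1 + v ^ 2))) 0 V) by rring. auto.
    - intros x Hx. rewrite RInt_cos_lin.
      replace (V * x + - (PI / 2)) with (- (PI / 2 - V * x)) by rring. rewrite cos_neg, cos_shift.
      rewrite Rmult_1_l, Rminus_eq_0, Rabs_R0. pose proof (exp_pos (- (V * x))). lra. }
  assert (A : Rabs (atan V - PI / 2) <= / V).
  { assert (E : PI / 2 - atan V = atan (/ V)) by (rewrite atan_inv by auto; rring).
    replace (atan V - PI / 2) with (- atan (/ V)) by lra. rewrite Rabs_Ropp.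
    rewrite Rabs_right.
    - destruct (MVT_gen atan 0 (/ V) (fun x => / (1 + x ^ 2))) as (c & _ & Ec).
      + intros x _. evar_last. apply is_derive_atan. unfold Rsqr. f_equal; rring.
      + intros x _. apply continuity_pt_filterlim, continuous_atan.
      + rewrite atan_0, !Rminus_0_r in Ec. rewrite Ec.
        pose proof (w0_bound c). pose proof (one_plus_sq c).
        rewrite Rabs_right in H0 by (left; apply Rinv_0_lt_compat; auto). nra.
    - left. rewrite <- atan_0. apply atan_increasing. auto. }
  replace (Kcos V s - PI / 2 * exp (- s)) with
    ((Kcos V s - atan V * exp (- s)) + (atan V - PI / 2) * exp (- s)) by rring.
  eapply Rle_trans; [apply Rabs_triang|].
  assert (Rabs ((atan V - PI / 2) * exp (- s)) <= / V).
  { rewrite Rabs_mult, (Rabs_right (exp _)) by (left; apply exp_pos).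
    assert (exp (- s) <= 1) by (rewrite <- exp_0; apply exp_le; lra).
    pose proof (Rabs_pos (atan V - PI / 2)). pose proof (exp_pos (- s)). nra. }
  replace ((sinh s * (4 / s + / s) + 6) / V) with
    (sinh s * (4 / (s * V) + 0 + / (s * V)) + (4 / V + s * s * 0 + / V) + / V) by (field; lra). lra.
Qed.

(** * The sine transform as a folded integral *)

Section Folded.
Variables d Y : R.
Hypothesis HdY : 0 < d < Y.
Let q (s : R) : R := RInt (Rk s 0) d Y.
Let q1 (s : R) : R :=
  RInt (fun y => (exp y * exp (- s * exp y) - exp (- y) * exp (- s * exp (- y))) * / (exp y - exp (- y))) d Y.
Let q2 (s : R) : R :=
  RInt (fun y => exp (- y) * exp (- s * exp (- y)) + exp y * exp (- s * exp y)) d Y.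

Let range (v : R) : Rmin d Y <= v <= Rmax d Y -> d <= v <= Y.
Proof. rewrite Rmin_left, Rmax_right by lra. auto. Qed.

Let gap (v : R) : d <= v <= Y -> exp v - exp (- v) <> 0.
Proof. intros H. pose proof (exp_gap v ltac:(lra)). lra. Qed.

Let Ci (v : R) : d <= v <= Y -> continuous (fun v => / (exp v - exp (- v))) v.
Proof. intros H. smooth. apply gap; auto. Qed.

Lemma folded_derive (s : R) : is_derive q s (q1 s).
Proof.
  unfold q, q1.
  apply is_derive_ext with (fun s => RInt (fun y => (exp (- s * exp (- y)) - exp (- s * exp y)) * / (exp y - exp (- y))) d Y).
  { intros t. apply RInt_ext. intros y _. unfold Rk, Gk, Rdiv. rewrite !Rmult_0_l, !Rplus_0_r. reflexivity. }
  apply (is_derive_param (fun s y => (exp (- s * exp (- y)) - exp (- s * exp y)) * / (exp y - exp (- y)))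
   (fun s y => (exp y * exp (- s * exp y) - exp (- y) * exp (- s * exp (- y))) * / (exp y - exp (- y)))).
  - intros u v. auto_derive; auto. rring.
  - intros v Hv. c2d. apply (c2d_unary (fun v => / (exp v - exp (- v)))). apply Ci, range; auto.
  - intros u v Hv. smooth. apply gap, range; auto.
Qed.

Lemma folded_derive2 (s : R) : is_derive q1 s (q s - q2 s).
Proof.
  evar_last.
  - apply (is_derive_param (fun s y => (exp y * exp (- s * exp y) - exp (- y) * exp (- s * exp (- y))) * / (exp y - exp (- y)))
     (fun s y => (exp (- y) ^ 2 * exp (- s * exp (- y)) - exp y ^ 2 * exp (- s * exp y)) * / (exp y - exp (- y)))).
    + intros u v. auto_derive; auto. rring.
    + intros v Hv. unfold pow. c2d. apply (c2d_unary (fun v => / (exp v - exp (- v)))). apply Ci, range; auto.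
    + intros u v Hv. smooth. apply gap, range; auto.
  - unfold q, q2. rewrite <- (RInt_minus (Rk s 0) (fun y => exp (- y) * exp (- s * exp (- y)) + exp y * exp (- s * exp y))).
    + apply RInt_ext. intros y Hy. unfold minus, plus, opp, Rk, Gk, Rdiv; simpl.
      rewrite !Rmult_0_l, !Rplus_0_r.
      assert (N : exp y - exp (- y) <> 0) by (apply gap, range; lra).
      assert (E : exp (- y) * exp y = 1) by (rewrite <- exp_plus, Rplus_opp_l, exp_0; auto).
      apply (Rmult_eq_reg_r (exp y - exp (- y))); auto.
      rewrite Rmult_plus_distr_r, !Rmult_assoc, Rinv_l, !Rmult_1_r by auto.
      replace (exp (- s * exp (- y)) - exp (- s * exp y) + - (exp (- y) * exp (- s * exp (- y)) + exp y * exp (- s * exp y)) * (exp y - exp (- y)))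
       with ((1 - exp (- y) * exp y) * exp (- s * exp (- y)) - (1 - exp (- y) * exp y) * exp (- s * exp y)
        + (exp (- y) * exp (- y) * exp (- s * exp (- y)) - exp y * exp y * exp (- s * exp y))) by rring.
      rewrite E. rring.
    + apply ex_RInt_cont. intros v Hv. apply Rk_continuous. apply range in Hv; lra.
    + apply ex_RInt_cont. intros v _. smooth. auto.
Qed.

Lemma folded_bound : exists C, forall s, 0 <= s -> Rabs (q s + q1 s) <= C.
Proof.
  exists ((Y - d) * (/ d) + (Y - d) * (2 * exp Y / d)). intros s Hs.
  assert (Eb : forall y, 0 < exp (- s * exp y) <= 1).
  { intros y. split; [apply exp_pos|]. rewrite <- exp_0. apply exp_le. pose proof (exp_pos y); nra. }
  assert (Hi : forall y, d <= y <= Y -> 0 < / (exp y - exp (- y)) <= / d).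
  { intros y Hy. pose proof (exp_gap y ltac:(lra)). split; [apply Rinv_0_lt_compat; lra|apply Rinv_le_contravar; lra]. }
  eapply Rle_trans; [apply Rabs_triang|]. apply Rplus_le_compat; apply abs_RInt_const; try lra.
  - apply ex_RInt_cont. intros v Hv. apply Rk_continuous. apply range in Hv; lra.
  - intros y Hy. unfold Rk, Gk, Rdiv. rewrite !Rmult_0_l, !Rplus_0_r, Rabs_mult.
    specialize (Hi y Hy). rewrite (Rabs_right (/ _)) by lra. rewrite <- (Rmult_1_l (/ d)).
    apply Rmult_le_compat; try lra. apply Rabs_pos.
    pose proof (Eb y). pose proof (Eb (- y)). apply Rabs_le; lra.
  - apply ex_RInt_cont. intros v Hv. smooth. apply gap, range; auto.
  - intros y Hy. rewrite Rabs_mult.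
    specialize (Hi y Hy). rewrite (Rabs_right (/ _)) by lra. unfold Rdiv.
    apply Rmult_le_compat; try lra. apply Rabs_pos.
    pose proof (Eb y). pose proof (Eb (- y)). pose proof (exp_le y Y ltac:(lra)). pose proof (exp_le (- y) Y ltac:(lra)).
    pose proof (exp_pos y). pose proof (exp_pos (- y)).
    assert (0 <= exp y * exp (- s * exp y) <= exp Y) by nra.
    assert (0 <= exp (- y) * exp (- s * exp (- y)) <= exp Y) by nra.
    apply Rabs_le; lra.
Qed.

(** The integrand of [q2] is an exact derivative. For x > 0 the result tends to 1 as d -> 0 and Y ->
    oo, which matches the constant in x int_0^V sin (x v) dv = 1 - cos (V x). *)
Lemma folded_rhs (x : R) : x * q2 x =
  (exp (- x * exp (- Y)) - exp (- x * exp Y)) - (exp (- x * exp (- d)) - exp (- x * exp d)).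
Proof.
  unfold q2.
  transitivity (RInt (fun y => x * (exp (- y) * exp (- x * exp (- y)) + exp y * exp (- x * exp y))) d Y).
  { symmetry. apply (RInt_scal (fun y => exp (- y) * exp (- x * exp (- y)) + exp y * exp (- x * exp y))).
    apply ex_RInt_cont; intros; smooth; auto. }
  rewrite (RInt_FTC (fun y => exp (- x * exp (- y)) - exp (- x * exp y))).
  - rring.
  - intros v _. auto_derive; auto. rring.
  - intros v _. smooth; auto.
Qed.

Lemma folded_rhs_continuous (s : R) : continuous q2 s.
Proof.
  apply (continuous_param (fun s y => exp (- y) * exp (- s * exp (- y)) + exp y * exp (- s * exp y))
    (fun s y => - (exp (- y) ^ 2 * exp (- s * exp (- y)) + exp y ^ 2 * exp (- s * exp y)))).
  - intros u v. auto_derive; auto. rring.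
  - intros v _. unfold pow. c2d.
  - intros u v _. smooth; auto.
Qed.

Lemma folded_zero : q 0 = 0.
Proof.
  unfold q. rewrite (RInt_ext _ (fun _ => 0)). rewrite RInt_const. apply Rmult_0_r.
  intros y _. unfold Rk, Gk. replace (- 0 * exp (- y) + 0 * - y) with 0 by rring. replace (- 0 * exp y + 0 * y) with 0 by rring.
  unfold Rdiv. rring.
Qed.

(** In x r(x) the constant 1 of [RInt_sin_lin] cancels against [folded_rhs] and leaves - cos (V x).
    The cut-offs account for the slope exp (- Y) + exp d - exp (- d) and for the term that decays at
    rate exp Y. *)
Lemma Ksin_folded (s V : R) : 0 < s -> 0 < V ->
  Rabs (Ksin V s - RInt (Rk s 0) d Y) <=
    sinh s * (4 / (s * V) + (exp (- Y) + (exp d - exp (- d))) + / (s * exp Y)) +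
    (4 / V + s * s * (exp (- Y) + (exp d - exp (- d))) + / exp Y).
Proof.
  intros Hs HV. destruct folded_bound as [C HC].
  pose proof (exp_gap d ltac:(lra)) as Hg. pose proof (exp_pos (- Y)).
  apply (ode_osc (fun s => Ksin V s - q s)
      (fun s => RInt (fun v => cos (s * v) * (v * / (1 + v ^ 2))) 0 V - q1 s)
      (fun s => RInt (fun v => sin (s * v)) 0 V - q2 s) s V 0 (-1) (exp (- Y) + (exp d - exp (- d))) (exp Y) (2 * V + C));
    auto; try lra.
  - apply exp_pos.
  - rewrite Rabs_left; lra.
  - intros x. apply (is_derive_minus (Ksin V) q). exact (proj1 (Ksin_ode V x HV)). apply folded_derive.
  - intros x. evar_last.
    apply (is_derive_minus (fun s => RInt (fun v => cos (s * v) * (v * / (1 + v ^ 2))) 0 V) q1).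
    exact (proj2 (Ksin_ode V x HV)). apply folded_derive2. unfold minus, plus, opp; simpl. rring.
  - intros x. apply (continuous_minus (V := R_NormedModule)). exact (proj1 (continuous_RInt_trig V x)). apply folded_rhs_continuous.
  - rewrite folded_zero. unfold Ksin. rewrite (RInt_ext _ (fun _ => 0)).
    + rewrite RInt_const. unfold scal; simpl; unfold mult; simpl. rring.
    + intros v _. rewrite Rmult_0_l, sin_0. rring.
  - intros x Hx. pose proof (Ksin_bound V x HV) as A1. specialize (HC x Hx).
    replace (Ksin V x - q x + (RInt (fun v => cos (x * v) * (v * / (1 + v ^ 2))) 0 V - q1 x)) with
     ((Ksin V x + RInt (fun v => cos (x * v) * (v * / (1 + v ^ 2))) 0 V) + - (q x + q1 x)) by rring.
    eapply Rle_trans; [apply Rabs_triang|]. rewrite Rabs_Ropp. lra.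
  - intros x Hx. rewrite Rmult_minus_distr_l, RInt_sin_lin, folded_rhs, Rplus_0_r.
    replace (1 - cos (V * x) -
      (exp (- x * exp (- Y)) - exp (- x * exp Y) - (exp (- x * exp (- d)) - exp (- x * exp d))) -
      -1 * cos (V * x)) with
      ((1 - exp (- x * exp (- Y))) + (exp (- x * exp (- d)) - exp (- x * exp d)) + exp (- x * exp Y)) by rring.
    replace (- (exp Y * x)) with (- x * exp Y) by rring.
    assert (0 <= 1 - exp (- x * exp (- Y)) <= x * exp (- Y)).
    { split.
      - assert (exp (- x * exp (- Y)) <= 1); [|lra]. rewrite <- exp_0; apply exp_le; nra.
      - pose proof (exp_ge_1 (- x * exp (- Y))). lra. }
    assert (0 <= exp (- x * exp (- d)) - exp (- x * exp d) <= x * (exp d - exp (- d))).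
    { split.
      - assert (exp (- x * exp d) <= exp (- x * exp (- d))); [|lra]. apply exp_le. nra.
      - replace (exp (- x * exp d)) with (exp (- x * exp (- d)) * exp (- (x * (exp d - exp (- d)))))
          by (rewrite <- exp_plus; f_equal; rring).
        pose proof (exp_ge_1 (- (x * (exp d - exp (- d))))).
        assert (exp (- x * exp (- d)) <= 1) by (rewrite <- exp_0; apply exp_le; pose proof (exp_pos (- d)); nra).
        pose proof (exp_pos (- x * exp (- d))).
        assert (0 <= x * (exp d - exp (- d))) by (apply Rmult_le_pos; lra). nra. }
    pose proof (exp_pos (- x * exp Y)). rewrite Rabs_right; lra.
Qed.
End Folded.

(** The cut-offs d and Y are removed at fixed V, so the constant does not depend on V. *)
Lemma Ksin_limit (s : R) : 0 < s ->
  exists C, 0 <= C /\ forall V, 0 < V -> Rabs (Ksin V s - Rem s 0) <= C / V.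
Proof.
  intros Hs. exists (sinh s * (4 / s) + 4).
  assert (Hsh : 0 <= sinh s) by (apply sinh_le; lra).
  assert (Hi : 0 < / s) by (apply Rinv_0_lt_compat; auto).
  split. { apply Rplus_le_le_0_compat; [apply Rmult_le_pos; [auto|unfold Rdiv; lra]|lra]. }
  intros V HV. apply le_epsilon. intros eps He.
  destruct (Rem_IG s 0 Hs ltac:(lra)) as [_ HL].
  destruct (HL (eps / 2)) as (d0 & Y0 & Hd0 & HY0 & H); [lra|].
  set (c := sinh s + s * s).
  set (c2 := sinh s / s + 1).
  assert (Hc2 : 0 < c2). { assert (0 <= sinh s / s) by (apply Rmult_le_pos; lra). unfold c2; lra. }
  assert (Hc : 0 < c) by (unfold c; nra).
  assert (L1 : is_lim (fun Y => (c + c2) * exp (- Y)) p_infty 0).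
  { replace (Finite 0) with (Rbar_mult (c + c2) 0) by (simpl; f_equal; rring). apply is_lim_scal_l. apply lim_exp_neg. }
  destruct (proj2 (is_lim_spec _ _ _) L1 (mkposreal (eps / 4) ltac:(lra))) as [Y1 HY1]. simpl in HY1.
  assert (L2 : continuous (fun d => c * (exp d - exp (- d))) 0) by (smooth; auto).
  destruct (proj1 (filterlim_locally _ _) L2 (mkposreal (eps / 4) ltac:(lra))) as [d1 Hd1].
  set (d := Rmin (d0 / 2) (d1 / 2)). set (Y := Rmax Y0 (Rmax Y1 d) + 1).
  assert (Hd : 0 < d) by (unfold d; apply Rmin_glb_lt; [lra|pose proof (cond_pos d1); lra]).
  assert (d <= d0 / 2) by apply Rmin_l. assert (d <= d1 / 2) by apply Rmin_r.
  assert (Y0 < Y /\ Y1 < Y /\ d < Y).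
  { pose proof (Rmax_l Y0 (Rmax Y1 d)). pose proof (Rmax_r Y0 (Rmax Y1 d)).
    pose proof (Rmax_l Y1 d). pose proof (Rmax_r Y1 d). unfold Y; lra. }
  specialize (H d Y ltac:(lra) ltac:(lra)).
  pose proof (Ksin_folded d Y ltac:(lra) s V Hs HV) as B.
  specialize (HY1 Y ltac:(lra)). rewrite Rminus_0_r in HY1.
  specialize (Hd1 d). unfold ball in Hd1; simpl in Hd1. unfold AbsRing_ball, abs, minus, plus, opp in Hd1; simpl in Hd1.
  pose proof (cond_pos d1).
  assert (Hd2 := Hd1 ltac:(rewrite Ropp_0, Rplus_0_r, Rabs_right; lra)).
  rewrite Ropp_0, exp_0 in Hd2.
  apply Rabs_def2 in HY1. apply Rabs_def2 in Hd2.
  assert (E : sinh s * (4 / (s * V) + (exp (- Y) + (exp d - exp (- d))) + / (s * exp Y)) +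
    (4 / V + s * s * (exp (- Y) + (exp d - exp (- d))) + / exp Y) =
    (sinh s * (4 / s) + 4) / V + (c + c2) * exp (- Y) + c * (exp d - exp (- d))).
  { unfold c, c2. rewrite (exp_Ropp Y). field. repeat split; try lra. apply Rgt_not_eq, exp_pos. }
  rewrite E in B.
  replace (Ksin V s - Rem s 0) with ((Ksin V s - RInt (Rk s 0) d Y) + (RInt (Rk s 0) d Y - Rem s 0)) by rring.
  eapply Rle_trans; [apply Rabs_triang|]. lra.
Qed.

(** * The Fourier series of the second Bernoulli polynomial *)

Lemma is_series_telescope (u : nat -> R) : is_lim_seq u 0 -> is_series (fun j => u j - u (S j)) (u 0%nat).
Proof.
  intros H. change (is_lim_seq (sum_n (fun j => u j - u (S j))) (u 0%nat)).
  apply is_lim_seq_ext with (fun n => u 0%nat - u (S n)).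
  - induction n.
    + rewrite sum_O. reflexivity.
    + rewrite sum_Sn, <- IHn. unfold plus; simpl. rring.
  - replace (Finite (u 0%nat)) with (Finite (u 0%nat - 0)) by (f_equal; rring).
    apply is_lim_seq_minus'. apply is_lim_seq_const. apply is_lim_seq_incr_1 in H. exact H.
Qed.

Lemma Series_ge0 (a : nat -> R) : (forall n, 0 <= a n) -> ex_series a -> 0 <= Series a.
Proof.
  intros H Ha. replace 0 with (Series (fun n => 0 * a n)) by (rewrite Series_scal_l; ring).
  apply Series_le; auto. intros n. specialize (H n). lra.
Qed.

Lemma lim_inv_shift (n : nat) : is_lim_seq (fun j => / INR (n + S j)) 0.
Proof.
  apply is_lim_seq_ext with (fun j => / INR (j + (n + 1))).
  { intros j. do 2 f_equal. lia. }
  apply (is_lim_seq_incr_n (fun j => / INR j) (n + 1)).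
  replace (Finite 0) with (Rbar_inv p_infty) by reflexivity.
  apply is_lim_seq_inv. apply is_lim_seq_INR. discriminate.
Qed.

(* Compared with [1/(k (k + 1))], which telescopes. *)
Lemma inv_sq_tail (n : nat) : ex_series (fun j => / INR (S (n + j)) ^ 2) /\
  0 <= Series (fun j => / INR (S (n + j)) ^ 2) <= 2 / INR (S n).
Proof.
  assert (T := is_series_telescope (fun j => 2 * / INR (S n + j))).
  assert (L : is_lim_seq (fun j => 2 * / INR (S n + j)) 0).
  { replace (Finite 0) with (Rbar_mult 2 0) by (simpl; f_equal; rring). apply is_lim_seq_scal_l.
    apply is_lim_seq_ext with (fun j => / INR (n + S j)). intros; do 2 f_equal; lia. apply lim_inv_shift. }
  specialize (T L).
  assert (B : forall j, 0 <= / INR (S (n + j)) ^ 2 <= 2 * / INR (S n + j) - 2 * / INR (S n + S j)).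
  { intros j. replace (S n + j)%nat with (S (n + j)) by lia. replace (S n + S j)%nat with (S (S (n + j))) by lia.
    pose proof (lt_0_INR (S (n + j)) ltac:(lia)) as H. rewrite (S_INR (S (n + j))). set (x := INR (S (n + j))) in *.
    assert (1 <= x) by (unfold x; apply (le_INR 1); lia).
    split. left; apply Rinv_0_lt_compat; nra.
    apply (Rmult_le_reg_r (x ^ 2 * (x + 1))). { apply Rmult_lt_0_compat; nra. }
    replace (/ x ^ 2 * (x ^ 2 * (x + 1))) with (x + 1) by (field; lra).
    replace ((2 * / x - 2 * / (x + 1)) * (x ^ 2 * (x + 1))) with (2 * x) by (field; lra). lra. }
  assert (E : ex_series (fun j => / INR (S (n + j)) ^ 2)).
  { apply (ex_series_le (K := R_AbsRing) (V := R_CompleteNormedModule)) with (fun j => 2 * / INR (S n + j) - 2 * / INR (S n + S j)).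
    - intros j. unfold norm; simpl; unfold abs; simpl. rewrite Rabs_right by (apply Rle_ge, B). apply B.
    - eexists; exact T. }
  split; auto. split.
  - apply Series_ge0; auto. apply B.
  - apply Rle_trans with (Series (fun j => 2 * / INR (S n + j) - 2 * / INR (S n + S j))).
    + apply Series_le; auto. eexists; exact T.
    + rewrite (is_series_unique _ _ T). rewrite Nat.add_0_r. unfold Rdiv. lra.
Qed.

Lemma ex_series_inv_sq : ex_series (fun j => / INR (S j) ^ 2).
Proof. exact (proj1 (inv_sq_tail 0)). Qed.

Lemma ex_series_dom (a b : nat -> R) : (forall n, Rabs (a n) <= b n) -> ex_series b -> ex_series a.
Proof. intros H Hb. apply (ex_series_le (K := R_AbsRing) (V := R_CompleteNormedModule)) with b; auto. Qed.

Lemma Series_dom (a b : nat -> R) : (forall n, Rabs (a n) <= b n) -> ex_series b -> Rabs (Series a) <= Series b.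
Proof.
  intros H Hb. assert (Ha : ex_series (fun n => Rabs (a n))).
  { apply ex_series_dom with b; auto. intros; rewrite Rabs_Rabsolu; auto. }
  eapply Rle_trans; [apply Series_Rabs; auto|]. apply Series_le; auto. intros; split; auto. apply Rabs_pos.
Qed.

Definition bterm (x : R) (j : nat) : R := cos (2 * PI * INR (S j) * x) / INR (S j) ^ 2.
(** This is pi^2 times the periodic second Bernoulli polynomial. Its value at 0 stays symbolic,
    since it cancels in the summation formula. *)
Definition Bper (x : R) : R := Series (bterm x).

Lemma bterm_bound (x : R) (j : nat) : Rabs (bterm x j) <= / INR (S j) ^ 2.
Proof.
  unfold bterm, Rdiv. pose proof (lt_0_INR (S j) ltac:(lia)).
  rewrite Rabs_mult, (Rabs_right (/ _)) by (left; apply Rinv_0_lt_compat; nra).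
  rewrite <- (Rmult_1_l (/ _)) at 2. apply Rmult_le_compat_r; [left; apply Rinv_0_lt_compat; nra|apply abs_cos].
Qed.

Lemma ex_bterm (x : R) : ex_series (bterm x).
Proof. apply ex_series_dom with (2 := ex_series_inv_sq). apply bterm_bound. Qed.

Lemma Bper_tail (x : R) (n : nat) : Rabs (Bper x - sum_n (bterm x) n) <= 2 / INR (S (S n)).
Proof.
  unfold Bper. rewrite (Series_incr_n (bterm x) (S n)) by (try lia; apply ex_bterm).
  rewrite sum_n_Reals. simpl pred.
  replace (sum_f_R0 (bterm x) n + Series (fun k => bterm x (S n + k)) - sum_f_R0 (bterm x) n)
    with (Series (fun k => bterm x (S n + k))) by rring.
  destruct (inv_sq_tail (S n)) as [E [_ B]].
  eapply Rle_trans; [|exact B]. apply Series_dom; auto. intros k. apply bterm_bound.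
Qed.

Lemma sum_bterm_continuous (n : nat) (x : R) : continuous (fun x => sum_n (bterm x) n) x.
Proof.
  induction n.
  - apply continuous_ext with (fun x => bterm x 0). intros; symmetry; apply sum_O.
    unfold bterm. smooth. auto.
  - apply continuous_ext with (fun x => plus (sum_n (bterm x) n) (bterm x (S n))).
    intros; symmetry; apply sum_Sn. apply (continuous_plus (V := R_NormedModule)); auto.
    unfold bterm. smooth. auto.
Qed.

Lemma archimed_inv (eps : R) : 0 < eps -> exists n : nat, 2 / INR (S (S n)) < eps.
Proof.
  intros He. destruct (nfloor_ex (2 / eps)) as [n Hn]. { apply Rmult_le_pos; [lra|left; apply Rinv_0_lt_compat; lra]. }
  exists n. pose proof (pos_INR n). rewrite !S_INR.
  apply (Rmult_lt_reg_r ((INR n + 1 + 1) / eps)). { apply Rdiv_lt_0_compat; lra. }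
  replace (2 / (INR n + 1 + 1) * ((INR n + 1 + 1) / eps)) with (2 / eps) by (field; lra).
  replace (eps * ((INR n + 1 + 1) / eps)) with (INR n + 1 + 1) by (field; lra). lra.
Qed.

Lemma Bper_continuous (x : R) : continuous Bper x.
Proof.
  apply filterlim_locally. intros eps.
  destruct (archimed_inv (eps / 3)) as [n Hn]. { pose proof (cond_pos eps); lra. }
  destruct (proj1 (filterlim_locally _ _) (sum_bterm_continuous n x) (mkposreal (eps / 3) ltac:(pose proof (cond_pos eps); lra))) as [d Hd].
  exists d. intros y Hy. specialize (Hd y Hy). revert Hd.
  unfold ball; simpl. unfold AbsRing_ball, abs, minus, plus, opp; simpl. intros Hd.
  pose proof (Bper_tail x n) as A1. pose proof (Bper_tail y n) as A2.
  apply Rabs_le_between in A1. apply Rabs_le_between in A2. apply Rabs_def2 in Hd. apply Rabs_def1; lra.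
Qed.

Lemma cos_period_nat (x : R) (k : nat) : cos (x + 2 * PI * INR k) = cos x.
Proof. replace (x + 2 * PI * INR k) with (x + 2 * INR k * PI) by rring. apply cos_period. Qed.

Lemma Bper_period (x : R) (m : nat) : Bper (x + INR m) = Bper x.
Proof.
  apply Series_ext. intros j. unfold bterm. f_equal.
  replace (2 * PI * INR (S j) * (x + INR m)) with (2 * PI * INR (S j) * x + 2 * PI * INR (S j * m)) by (rewrite mult_INR; rring).
  apply cos_period_nat.
Qed.

Lemma Bper_sym (x : R) : Bper (1 - x) = Bper x.
Proof.
  apply Series_ext. intros j. unfold bterm. f_equal.
  replace (2 * PI * INR (S j) * (1 - x)) with (- (2 * PI * INR (S j) * x) + 2 * PI * INR (S j)) by rring.
  rewrite cos_period_nat. apply cos_neg.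
Qed.

(** The product telescopes. For j <= n the frequencies run up to n + 1, whence 2 n + 3. *)
Lemma dirichlet_kernel (n : nat) (x : R) :
  sin (PI * x) * (1 + 2 * sum_n (fun j => cos (2 * PI * INR (S j) * x)) n) = sin ((2 * INR n + 3) * PI * x).
Proof.
  assert (K : forall A B, sin (A - B) + 2 * sin B * cos A = sin (A + B)).
  { intros. rewrite sin_minus, sin_plus. rring. }
  induction n.
  - rewrite sum_O. simpl INR.
    replace ((2 * 0 + 3) * PI * x) with (2 * PI * 1 * x + PI * x) by rring.
    rewrite <- K. replace (2 * PI * 1 * x - PI * x) with (PI * x) by rring. rring.
  - rewrite sum_Sn. unfold plus; simpl plus.
    rewrite !S_INR in *.
    replace ((2 * (INR n + 1) + 3) * PI * x) with (2 * PI * (INR n + 1 + 1) * x + PI * x) by rring.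
    rewrite <- K. replace (2 * PI * (INR n + 1 + 1) * x - PI * x) with ((2 * INR n + 3) * PI * x) by rring.
    rewrite <- IHn. change (@Hierarchy.plus R_AbelianMonoid) with Rplus. cbv beta. simpl. rring.
Qed.

Definition sterm (x : R) (j : nat) : R := - (2 * PI) * (sin (2 * PI * INR (S j) * x) / INR (S j)).

Lemma sum_bterm_derive (n : nat) (x : R) :
  is_derive (fun x => sum_n (bterm x) n) x (sum_n (sterm x) n).
Proof.
  assert (T : forall j, is_derive (fun x => bterm x j) x (sterm x j)).
  { intros j. unfold bterm, sterm. pose proof (lt_0_INR (S j) ltac:(lia)) as Hk.
    revert Hk. generalize (INR (S j)). intros k Hk. auto_derive; auto. field. lra. }
  induction n.
  - rewrite sum_O. apply is_derive_ext with (fun x => bterm x 0); auto. intros; symmetry; apply sum_O.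
  - rewrite sum_Sn. apply is_derive_ext with (fun x => plus (sum_n (bterm x) n) (bterm x (S n))).
    intros; symmetry; apply sum_Sn. apply (is_derive_plus (fun x => sum_n (bterm x) n)); auto.
Qed.

Lemma sum_sterm_derive (n : nat) (x : R) :
  is_derive (fun x => sum_n (sterm x) n) x (- (4 * PI ^ 2) * sum_n (fun j => cos (2 * PI * INR (S j) * x)) n).
Proof.
  assert (T : forall j, is_derive (fun x => sterm x j) x (- (4 * PI ^ 2) * cos (2 * PI * INR (S j) * x))).
  { intros j. unfold sterm. pose proof (lt_0_INR (S j) ltac:(lia)) as Hk.
    revert Hk. generalize (INR (S j)). intros k Hk. auto_derive; auto. field. lra. }
  induction n.
  - rewrite sum_O. apply is_derive_ext with (fun x => sterm x 0); auto. intros; symmetry; apply sum_O.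
  - rewrite sum_Sn. apply is_derive_ext with (fun x => plus (sum_n (sterm x) n) (sterm x (S n))).
    intros; symmetry; apply sum_Sn. evar_last.
    apply (is_derive_plus (fun x => sum_n (sterm x) n)); [exact IHn|apply T].
    unfold plus; simpl. change (@Hierarchy.plus R_AbelianMonoid) with Rplus. rring.
Qed.

(** Both the differentiated series and 2 x - 1 vanish at 1/2, which makes 1/2 the base point for
    integrating the second derivative. *)
Lemma sum_sterm_half (n : nat) : sum_n (sterm (/ 2)) n = 0.
Proof.
  assert (T : forall j, sterm (/ 2) j = 0).
  { intros j. unfold sterm. replace (2 * PI * INR (S j) * / 2) with (0 + INR (S j) * PI) by field.
    assert (S0 : forall k, sin (INR k * PI) = 0).
    { intros k. apply sin_eq_0_1. exists (Z.of_nat k). rewrite <- INR_IZR_INZ. reflexivity. }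
    rewrite Rplus_0_l, S0. unfold Rdiv. rring. }
  induction n. rewrite sum_O; auto. rewrite sum_Sn, IHn, T. unfold plus; simpl. rring.
Qed.

(* The second derivative of the difference is a Dirichlet kernel, whose integral
   is small by [osc_bound]. *)
Lemma sum_sterm_bound (n : nat) (x : R) : 0 < x <= / 2 ->
  Rabs (sum_n (sterm x) n - PI ^ 2 * (2 * x - 1)) <= 4 * PI * (/ sin (PI * x) + 1) / (2 * INR n + 3).
Proof.
  intros Hx. pose proof PI_RGT_0 as HP. pose proof (pos_INR n).
  assert (Sp : forall u, x <= u <= / 2 -> 0 < sin (PI * u)) by (intros; apply sin_gt_0; nra).
  assert (E : RInt (fun u => / sin (PI * u) * cos ((2 * INR n + 3) * PI * u + - (PI / 2))) x (/ 2)
     = / (2 * PI ^ 2) * (sum_n (sterm x) n - PI ^ 2 * (2 * x - 1))).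
  { rewrite (RInt_FTC (fun u => - / (2 * PI ^ 2) * (sum_n (sterm u) n - PI ^ 2 * (2 * u - 1)))).
    - rewrite sum_sterm_half. apply Rminus_diag_uniq. field. lra.
    - intros u Hu. rewrite Rmin_left, Rmax_right in Hu by lra. evar_last.
      + apply (is_derive_scal (fun u => sum_n (sterm u) n - PI ^ 2 * (2 * u - 1))).
        apply (is_derive_minus (fun u => sum_n (sterm u) n) (fun u => PI ^ 2 * (2 * u - 1))).
        apply sum_sterm_derive. auto_derive; [auto|reflexivity].
      + replace ((2 * INR n + 3) * PI * u + - (PI / 2)) with (- (PI / 2 - (2 * INR n + 3) * PI * u)) by rring.
        rewrite cos_neg, cos_shift, <- dirichlet_kernel. specialize (Sp u Hu).
        unfold minus, plus, opp; simpl. apply Rminus_diag_uniq. field. split; lra.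
    - intros u Hu. rewrite Rmin_left, Rmax_right in Hu by lra. specialize (Sp u Hu). smooth. lra. }
  assert (B : Rabs (RInt (fun u => / sin (PI * u) * cos ((2 * INR n + 3) * PI * u + - (PI / 2))) x (/ 2))
     <= 2 * (Rabs (/ sin (PI * x)) + Rabs (/ sin (PI * / 2))) / ((2 * INR n + 3) * PI)).
  { apply (osc_bound (fun u => / sin (PI * u)) (fun u => - (PI * cos (PI * u)) / sin (PI * u) ^ 2)); try lra.
    - nra.
    - intros u Hu. specialize (Sp u Hu). auto_derive. lra. field. lra.
    - intros u Hu. specialize (Sp u Hu). smooth. apply Rgt_not_eq. nra.
    - right. intros u Hu. pose proof (Sp u Hu). assert (0 <= cos (PI * u)) by (apply cos_ge_0; nra).
      assert (0 < / sin (PI * u) ^ 2) by (apply Rinv_0_lt_compat; nra).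
      assert (0 <= PI * cos (PI * u) * / sin (PI * u) ^ 2); [|unfold Rdiv; lra].
      apply Rmult_le_pos; [apply Rmult_le_pos|]; lra. }
  rewrite E in B. rewrite Rabs_mult in B.
  rewrite (Rabs_right (/ (2 * PI ^ 2))) in B by (left; apply Rinv_0_lt_compat; nra).
  replace (PI * / 2) with (PI / 2) in B by reflexivity. rewrite sin_PI2, Rinv_1, Rabs_R1 in B.
  rewrite (Rabs_right (/ sin (PI * x))) in B by (left; apply Rinv_0_lt_compat, Sp; lra).
  apply (Rmult_le_compat_l (2 * PI ^ 2)) in B; [|nra].
  rewrite <- Rmult_assoc, Rinv_r, Rmult_1_l in B by nra. eapply Rle_trans; [exact B|].
  right. field. split; [|lra]. specialize (Sp x ltac:(lra)). lra.
Qed.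

(** The derivative of the partial sum minus the quadratic is O(1/n) uniformly on [x, 1/2], so in the
    limit the difference takes the same value at x and at 1/2. *)
Lemma Bper_quadratic_open (x : R) : 0 < x <= / 2 ->
  Bper x - PI ^ 2 * (x ^ 2 - x) = Bper (/ 2) - PI ^ 2 * ((/ 2) ^ 2 - / 2).
Proof.
  intros Hx. pose proof PI_RGT_0 as HP.
  set (C := 4 * PI * (/ sin (PI * x) + 1)).
  assert (Sp : forall u, x <= u <= / 2 -> 0 < sin (PI * u)) by (intros; apply sin_gt_0; nra).
  assert (HC : 0 < C). { unfold C. assert (0 < / sin (PI * x)) by (apply Rinv_0_lt_compat, Sp; lra). nra. }
  apply Rminus_diag_uniq. apply Rabs_eq_0. apply Rle_antisym; [|apply Rabs_pos].
  apply le_epsilon. intros eps He.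
  destruct (archimed_inv (eps / (C + 2))) as [n Hn]. { apply Rdiv_lt_0_compat; lra. }
  pose proof (Bper_tail x n) as A1. pose proof (Bper_tail (/ 2) n) as A2.
  destruct (MVT_gen (fun u => sum_n (bterm u) n - PI ^ 2 * (u ^ 2 - u)) (/ 2) x
    (fun u => sum_n (sterm u) n - PI ^ 2 * (2 * u - 1))) as (c & Hc & Ec).
  - intros u _. apply (is_derive_minus (fun u => sum_n (bterm u) n) (fun u => PI ^ 2 * (u ^ 2 - u))).
    apply sum_bterm_derive. auto_derive; auto. ring.
  - intros u _. apply continuity_pt_filterlim.
    apply (continuous_minus (V := R_NormedModule) (fun u => sum_n (bterm u) n) (fun u => PI ^ 2 * (u ^ 2 - u))).
    apply sum_bterm_continuous. smooth; auto.
  - rewrite Rmin_right, Rmax_left in Hc by lra.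
    pose proof (sum_sterm_bound n c ltac:(lra)) as B.
    assert (B2 : Rabs (sum_n (sterm c) n - PI ^ 2 * (2 * c - 1)) <= C * (2 / INR (S (S n)))).
    { eapply Rle_trans; [exact B|]. pose proof (pos_INR n). rewrite !S_INR. unfold Rdiv.
      apply Rmult_le_compat.
      - pose proof (Rinv_0_lt_compat _ (Sp c Hc)). nra.
      - left; apply Rinv_0_lt_compat; lra.
      - unfold C. apply Rmult_le_compat_l; [lra|]. apply Rplus_le_compat_r.
        apply Rinv_le_contravar. apply Sp; lra. apply sin_incr_1; nra.
      - apply (Rmult_le_reg_r ((2 * INR n + 3) * (INR n + 1 + 1))). nra.
        replace (/ (2 * INR n + 3) * ((2 * INR n + 3) * (INR n + 1 + 1))) with (INR n + 1 + 1) by (field; lra).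
        replace (2 * / (INR n + 1 + 1) * ((2 * INR n + 3) * (INR n + 1 + 1))) with (2 * (2 * INR n + 3)) by (field; lra).
        lra. }
    assert (B3 : Rabs ((sum_n (sterm c) n - PI ^ 2 * (2 * c - 1)) * (x - / 2)) <= C * (2 / INR (S (S n)))).
    { rewrite Rabs_mult. assert (Rabs (x - / 2) <= 1) by (apply Rabs_le; lra).
      pose proof (Rabs_pos (x - / 2)). pose proof (Rabs_pos (sum_n (sterm c) n - PI ^ 2 * (2 * c - 1))). nra. }
    rewrite <- Ec in B3.
    assert (E2 : (C + 2) * (2 / INR (S (S n))) < eps).
    { apply (Rmult_lt_compat_l (C + 2)) in Hn; [|lra]. replace ((C + 2) * (eps / (C + 2))) with eps in Hn by (field; lra). auto. }
    apply Rabs_le_between in A1. apply Rabs_le_between in A2. apply Rabs_le_between in B3.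
    rewrite Rplus_0_l. apply Rabs_le. lra.
Qed.

(** Continuity of [Bper] carries the formula to 0, where the differentiated series gives no control;
    the reflection x -> 1 - x covers the other half. *)
Lemma Bper_quadratic (x : R) : 0 <= x <= 1 -> Bper x = Bper 0 + PI ^ 2 * (x ^ 2 - x).
Proof.
  assert (E0 : Bper 0 = Bper (/ 2) - PI ^ 2 * ((/ 2) ^ 2 - / 2)).
  { set (f := fun x => Bper x - PI ^ 2 * (x ^ 2 - x)).
    assert (Cf : continuous f 0).
    { apply (continuous_minus (V := R_NormedModule) Bper (fun x => PI ^ 2 * (x ^ 2 - x))).
      apply Bper_continuous. smooth; auto. }
    assert (L1 : filterlim f (at_right 0) (locally (f 0))) by (apply at_right_continuous; auto).
    assert (L2 : filterlim f (at_right 0) (locally (Bper (/ 2) - PI ^ 2 * ((/ 2) ^ 2 - / 2)))).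
    { apply filterlim_ext_loc with (fun _ => Bper (/ 2) - PI ^ 2 * ((/ 2) ^ 2 - / 2)).
      - exists (mkposreal (/ 2) ltac:(lra)). intros y Hy Hy0. symmetry. apply Bper_quadratic_open.
        unfold ball in Hy; simpl in Hy. unfold AbsRing_ball, abs, minus, plus, opp in Hy; simpl in Hy.
        apply Rabs_def2 in Hy. lra.
      - apply filterlim_const. }
    pose proof (filterlim_locally_unique f _ _ L1 L2) as E. unfold f in E at 1. rewrite <- E. rring. }
  assert (H : forall x, 0 <= x <= / 2 -> Bper x = Bper 0 + PI ^ 2 * (x ^ 2 - x)).
  { intros y Hy. destruct (Req_dec y 0) as [->|N]. rring.
    pose proof (Bper_quadratic_open y ltac:(lra)). lra. }
  intros Hx. destruct (Rle_dec x (/ 2)). apply H; lra.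
  rewrite <- Bper_sym, H by lra. rring.
Qed.

(** * Euler-Maclaurin summation of the arctangents *)

Section EulerMaclaurin.
Variable tau : R.
Hypothesis Ht : 0 < tau.

(** For x > 0 this is arctan (tau / x), in a form that is smooth at 0, where the summation begins.
    [g] is minus its derivative and [H] an antiderivative. *)
Let h (x : R) : R := PI / 2 - atan (x / tau).
Let g (x : R) : R := tau / (tau ^ 2 + x ^ 2).
Let dg (x : R) : R := - (2 * tau * x) / (tau ^ 2 + x ^ 2) ^ 2.
Let H (x : R) : R := x * h x + tau / 2 * ln (tau ^ 2 + x ^ 2).

Let den (x : R) : 0 < tau ^ 2 + x ^ 2.
Proof. nra. Qed.

Let g_derive (x : R) : is_derive g x (dg x).
Proof. unfold g, dg. pose proof (den x). auto_derive. lra. field. lra. Qed.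

Let h_derive (x : R) : is_derive h x (- g x).
Proof.
  unfold h, g. pose proof (den x). auto_derive; auto. unfold Rsqr. field. repeat split; try lra; nra.
Qed.

Let H_derive (x : R) : is_derive H x (h x).
Proof.
  pose proof (den x). unfold H. evar_last.
  - apply (is_derive_plus (fun x => x * h x) (fun x => tau / 2 * ln (tau ^ 2 + x ^ 2))).
    + apply (is_derive_mult (fun x => x) h x 1 (- g x)). apply (is_derive_id x). apply h_derive. intros; apply Rmult_comm.
    + apply (is_derive_scal (fun x => ln (tau ^ 2 + x ^ 2)) x (tau / 2) (2 * x / (tau ^ 2 + x ^ 2))).
      auto_derive. auto. field. lra.
  - unfold plus, mult; simpl. unfold g. apply Rminus_diag_uniq. field. lra.
Qed.

Let dg_cont (x : R) : continuous dg x.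
Proof. unfold dg. smooth. pose proof (den x). apply Rgt_not_eq. nra. Qed.

Let dg_neg (x : R) : 0 <= x -> dg x <= 0.
Proof.
  intros Hx. unfold dg, Rdiv. pose proof (den x).
  assert (0 < / (tau ^ 2 + x ^ 2) ^ 2) by (apply Rinv_0_lt_compat, pow_lt; auto).
  assert (0 <= 2 * tau * x * / (tau ^ 2 + x ^ 2) ^ 2); [|lra].
  apply Rmult_le_pos; [|lra]. apply Rmult_le_pos; lra.
Qed.

Let g_cont (x : R) : continuous g x.
Proof. apply (ex_derive_continuous (V := R_NormedModule)). eexists; apply g_derive. Qed.

Let h_cont (x : R) : continuous h x.
Proof. apply (ex_derive_continuous (V := R_NormedModule)). eexists; apply h_derive. Qed.

Let shifted_cont (x : R) : continuous (fun x => Bper (x - / 4)) x.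
Proof. apply (continuous_comp (fun x => x - / 4) Bper). smooth; auto. apply Bper_continuous. Qed.

Let integrand_cont (x : R) : continuous (fun x => Bper (x - / 4) * dg x) x.
Proof. apply (continuous_mult (K := R_AbsRing)); auto. Qed.

(* On each half of the cell [Bper] is a quadratic, and the integrand has the
   elementary antiderivative [B0 g + 2 pi^2 (p g / 2 + p' h / 2 - H)]. *)
Let piece (c e a b : R) : a <= b ->
  (forall x, a < x < b -> Bper (x - / 4) = Bper 0 + PI ^ 2 * ((x - c) ^ 2 + e * (x - c))) ->
  let F x := Bper 0 * g x + 2 * PI ^ 2 * (((x - c) ^ 2 + e * (x - c)) / 2 * g x + (x - c + e / 2) * h x - H x) in
  RInt (fun x => Bper (x - / 4) * dg x) a b = F b - F a.
Proof.
  intros Hab Hq F.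
  rewrite (RInt_ext _ (fun x => (Bper 0 + PI ^ 2 * ((x - c) ^ 2 + e * (x - c))) * dg x)).
  - apply (RInt_FTC F).
    + intros x _. unfold F.
      assert (D1 : is_derive (fun x => Bper 0 * g x) x (Bper 0 * dg x)) by (apply (is_derive_scal g); auto).
      assert (D2 : is_derive (fun x => ((x - c) ^ 2 + e * (x - c)) / 2) x (x - c + e / 2)) by (auto_derive; auto; field).
      assert (D3 : is_derive (fun x => x - c + e / 2) x 1) by (auto_derive; auto; rring).
      assert (D4 := is_derive_mult _ g x _ _ D2 (g_derive x) Rmult_comm).
      assert (D5 := is_derive_mult _ h x _ _ D3 (h_derive x) Rmult_comm).
      assert (D6 := is_derive_minus _ _ _ _ _ (is_derive_plus _ _ _ _ _ D4 D5) (H_derive x)).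
      assert (D7 := is_derive_plus _ _ _ _ _ D1 (is_derive_scal _ _ (2 * PI ^ 2) _ D6)).
      evar_last. exact D7. unfold plus, minus, mult, opp; simpl. apply Rminus_diag_uniq. unfold plus, opp; simpl. field.
    + intros x _. apply (continuous_mult (K := R_AbsRing)); auto. smooth; auto.
  - intros x Hx. rewrite Rmin_left, Rmax_right in Hx by lra. rewrite Hq; auto.
Qed.

(** The kink of the periodic quadratic at m + 1/4 produces the summand [h (INR m + / 4)]. The cell
    ends at integers, off the nodes, so terms in [h / 4] and [Bper (- / 4)] remain at its ends. *)
Let cell (m : nat) :
  - Bper (- / 4) * (g (INR m + 1) - g (INR m)) + RInt (fun x => Bper (x - / 4) * dg x) (INR m) (INR m + 1)
  = 2 * PI ^ 2 * (h (INR m + / 4) + / 4 * (h (INR m + 1) - h (INR m)) - (H (INR m + 1) - H (INR m))).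
Proof.
  assert (Q : Bper (- / 4) = Bper 0 + PI ^ 2 * (- 3 / 16)).
  { rewrite <- (Bper_period (- / 4) 1). simpl INR. rewrite Bper_quadratic by lra. field. }
  rewrite (RInt_split _ _ (INR m + / 4)) by (apply ex_RInt_cont; auto).
  rewrite (piece (INR m + / 4) 1 (INR m) (INR m + / 4)); [|lra|].
  2:{ intros x Hx. replace (x - / 4) with (x - / 4 - INR m + INR m) by rring. rewrite Bper_period.
      rewrite <- (Bper_period _ 1). simpl INR. rewrite Bper_quadratic by lra. rring. }
  rewrite (piece (INR m + / 4) (-1) (INR m + / 4) (INR m + 1)); [|lra|].
  2:{ intros x Hx. replace (x - / 4) with (x - / 4 - INR m + INR m) by rring. rewrite Bper_period.
      rewrite Bper_quadratic by lra. rring. }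
  rewrite Q. apply Rminus_diag_uniq. field.
Qed.

Lemma euler_maclaurin (n : nat) :
  - Bper (- / 4) * (g (INR (S n)) - g 0) + RInt (fun x => Bper (x - / 4) * dg x) 0 (INR (S n))
  = 2 * PI ^ 2 * (sum_n (fun j => h (INR j + / 4)) n + / 4 * (h (INR (S n)) - h 0) - (H (INR (S n)) - H 0)).
Proof.
  induction n as [|n IH].
  - rewrite sum_O. pose proof (cell 0) as C. simpl INR in *. rewrite Rplus_0_l in C. exact C.
  - rewrite sum_SnR. rewrite (RInt_split _ 0 (INR (S n))) by (apply ex_RInt_cont; auto).
    pose proof (cell (S n)) as C. rewrite (S_INR (S n)).
    set (I1 := RInt _ 0 _) in *. set (I2 := RInt _ (INR (S n)) _) in *.
    replace (- Bper (- / 4) * (g (INR (S n) + 1) - g 0) + (I1 + I2)) with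
     ((- Bper (- / 4) * (g (INR (S n)) - g 0) + I1) + (- Bper (- / 4) * (g (INR (S n) + 1) - g (INR (S n))) + I2)) by rring.
    rewrite IH, C. rring.
Qed.

(** One integration by parts turns the k-th Fourier term of the Euler-Maclaurin remainder into this
    integral divided by pi k. *)
Let cf (k b : R) : R := RInt (fun x => sin (2 * PI * k * (x - / 4)) * g x) 0 b.

Let bt_cont (j : nat) (x : R) : continuous (fun x => bterm (x - / 4) j * dg x) x.
Proof. apply (continuous_mult (K := R_AbsRing)); auto. unfold bterm. smooth; auto. Qed.

Let cf_parts (j n : nat) : cf (INR (S j)) (INR (S n)) / (PI * INR (S j)) =
  / (2 * PI ^ 2) * (- bterm (- / 4) j * (g (INR (S n)) - g 0) + RInt (fun x => bterm (x - / 4) j * dg x) 0 (INR (S n))).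
Proof.
  pose proof PI_RGT_0 as HP. pose proof (lt_0_INR (S j) ltac:(lia)) as Hk.
  assert (E : RInt (fun x => bterm (x - / 4) j * dg x - 2 * PI / INR (S j) * (sin (2 * PI * INR (S j) * (x - / 4)) * g x)) 0 (INR (S n))
     = bterm (- / 4) j * (g (INR (S n)) - g 0)).
  { rewrite (RInt_FTC (fun x => bterm (x - / 4) j * g x)).
    - rewrite Rminus_0_l. replace (bterm (INR (S n) - / 4) j) with (bterm (- / 4) j). rring.
      unfold bterm. f_equal. replace (2 * PI * INR (S j) * (INR (S n) - / 4)) with
        (2 * PI * INR (S j) * - / 4 + 2 * PI * INR (S j * S n)) by (rewrite mult_INR; rring).
      symmetry. apply cos_period_nat.
    - intros x _. evar_last.
      + apply (is_derive_mult (fun x => bterm (x - / 4) j) g x (sterm (x - / 4) j) (dg x)); [|auto|intros; apply Rmult_comm].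
        unfold bterm, sterm. revert Hk. generalize (INR (S j)). intros k Hk. auto_derive; auto. unfold Rminus. field. lra.
      + match goal with |- plus (mult ?a ?b) (mult ?c ?d) = ?r => change (a * b + c * d = r) end. unfold sterm. apply Rminus_diag_uniq. set (k := INR (S j)) in *. field. lra.
    - intros x _. apply (continuous_minus (V := R_NormedModule) (fun x => bterm (x - / 4) j * dg x)). auto.
      apply (continuous_mult (K := R_AbsRing)). apply continuous_const. apply (continuous_mult (K := R_AbsRing)); auto. smooth; auto. }
  assert (C2 : forall x, continuous (fun x => sin (2 * PI * INR (S j) * (x - / 4)) * g x) x).
  { intros x. apply (continuous_mult (K := R_AbsRing)); auto. smooth; auto. }
  rewrite RInt_sub in E; auto.
  2:{ intros x. apply (continuous_mult (K := R_AbsRing)); auto. apply continuous_const. }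
  assert (E2 : RInt (fun x => 2 * PI / INR (S j) * (sin (2 * PI * INR (S j) * (x - / 4)) * g x)) 0 (INR (S n))
     = 2 * PI / INR (S j) * cf (INR (S j)) (INR (S n))).
  { apply (RInt_scal (fun x => sin (2 * PI * INR (S j) * (x - / 4)) * g x)). apply ex_RInt_cont; auto. }
  rewrite E2 in E.
  replace (RInt (fun x => bterm (x - / 4) j * dg x) 0 (INR (S n))) with
    (bterm (- / 4) j * (g (INR (S n)) - g 0) + 2 * PI / INR (S j) * cf (INR (S j)) (INR (S n))) by (rewrite <- E; rring).
  apply Rminus_diag_uniq. set (k := INR (S j)) in *. field. lra.
Qed.

Let cf_sum (K n : nat) : sum_n (fun j => cf (INR (S j)) (INR (S n)) / (PI * INR (S j))) K =
  / (2 * PI ^ 2) * (- sum_n (bterm (- / 4)) K * (g (INR (S n)) - g 0)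
     + RInt (fun x => sum_n (bterm (x - / 4)) K * dg x) 0 (INR (S n))).
Proof.
  induction K as [|K IH].
  - rewrite !sum_O, cf_parts. do 2 f_equal. apply RInt_ext. intros x _. rewrite sum_O. reflexivity.
  - rewrite !sum_SnR, IH, cf_parts.
    rewrite (RInt_ext (fun x => sum_n (bterm (x - / 4)) (S K) * dg x)
       (fun x => sum_n (bterm (x - / 4)) K * dg x + bterm (x - / 4) (S K) * dg x)).
    + rewrite (RInt_add (fun x => sum_n (bterm (x - / 4)) K * dg x)).
      * rring.
      * apply ex_RInt_cont. intros x _. apply (continuous_mult (K := R_AbsRing)); auto.
        apply (continuous_comp (fun x => x - / 4) (fun x => sum_n (bterm x) K)). smooth; auto. apply sum_bterm_continuous.
      * apply ex_RInt_cont. intros x _. apply bt_cont.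
    + intros x _. rewrite sum_SnR. rring.
Qed.

Let g_pos (x : R) : 0 < g x.
Proof. unfold g. apply Rdiv_lt_0_compat; auto. Qed.

Let g_decr (x y : R) : 0 <= x <= y -> g y <= g x.
Proof.
  intros Hxy. unfold g, Rdiv. apply Rmult_le_compat_l; [lra|]. apply Rinv_le_contravar; [apply den|nra].
Qed.

(** The Fourier sums converge uniformly and [g] is monotone, so exchanging sum and integral costs at
    most the uniform tail times the total drop of [g]. *)
Let cf_series (n : nat) : is_series (fun j => cf (INR (S j)) (INR (S n)) / (PI * INR (S j)))
  (sum_n (fun j => h (INR j + / 4)) n + / 4 * (h (INR (S n)) - h 0) - (H (INR (S n)) - H 0)).
Proof.
  pose proof PI_RGT_0 as HP. pose proof (pos_INR (S n)) as HN.
  set (L := sum_n (fun j => h (INR j + / 4)) n + / 4 * (h (INR (S n)) - h 0) - (H (INR (S n)) - H 0)).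
  change (is_lim_seq (sum_n (fun j => cf (INR (S j)) (INR (S n)) / (PI * INR (S j)))) L).
  apply is_lim_seq_spec. intros eps. set (D := g 0 - g (INR (S n))).
  assert (HD : 0 <= D) by (unfold D; pose proof (g_decr 0 (INR (S n)) ltac:(lra)); lra).
  destruct (archimed_inv (eps * PI ^ 2 / (D + 1))) as [K0 HK0].
  { apply Rdiv_lt_0_compat; [|lra]. apply Rmult_lt_0_compat; [apply cond_pos|nra]. }
  exists K0. intros K HK. rewrite cf_sum.
  assert (EL : L = / (2 * PI ^ 2) * (- Bper (- / 4) * (g (INR (S n)) - g 0) + RInt (fun x => Bper (x - / 4) * dg x) 0 (INR (S n)))).
  { rewrite euler_maclaurin. unfold L. field. lra. }
  rewrite EL.
  assert (Cs : forall x, continuous (fun x => sum_n (bterm (x - / 4)) K * dg x) x).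
  { intros x. apply (continuous_mult (K := R_AbsRing)); auto.
    apply (continuous_comp (fun x => x - / 4) (fun x => sum_n (bterm x) K)). smooth; auto. apply sum_bterm_continuous. }
  assert (B : Rabs (RInt (fun x => sum_n (bterm (x - / 4)) K * dg x) 0 (INR (S n)) - RInt (fun x => Bper (x - / 4) * dg x) 0 (INR (S n)))
      <= 2 / INR (S (S K)) * D).
  { rewrite <- RInt_sub by auto.
    replace (2 / INR (S (S K)) * D) with (RInt (fun x => - (2 / INR (S (S K))) * dg x) 0 (INR (S n))).
    - apply RInt_dom; auto.
      + apply ex_RInt_cont. intros x _. apply (continuous_minus (V := R_NormedModule) (fun x => sum_n (bterm (x - / 4)) K * dg x)); auto.
      + apply ex_RInt_cont. intros x _. apply (continuous_mult (K := R_AbsRing)); auto. apply continuous_const.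
      + intros x Hx. rewrite <- Rmult_minus_distr_r, Rabs_mult.
        assert (dg x <= 0) by (apply dg_neg; lra).
        rewrite (Rabs_left1 (dg x)) by auto. rewrite Rabs_minus_sym.
        pose proof (Bper_tail (x - / 4) K). nra.
    - transitivity (- (2 / INR (S (S K))) * RInt dg 0 (INR (S n))).
      + apply (RInt_scal dg). apply ex_RInt_cont; auto.
      + rewrite (RInt_FTC g); auto. unfold D. rring. }
  pose proof (Bper_tail (- / 4) K) as T.
  set (I1 := RInt (fun x => sum_n (bterm (x - / 4)) K * dg x) 0 (INR (S n))) in *.
  set (I2 := RInt (fun x => Bper (x - / 4) * dg x) 0 (INR (S n))) in *.
  assert (W : 2 / INR (S (S K)) <= 2 / INR (S (S K0))).
  { unfold Rdiv. apply Rmult_le_compat_l; [lra|]. apply Rinv_le_contravar. apply lt_0_INR; lia. apply le_INR; lia. }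
  set (w := 2 / INR (S (S K))) in *. assert (Hw : 0 < w) by (unfold w; apply Rdiv_lt_0_compat; [lra|apply lt_0_INR; lia]).
  set (b0 := Bper (- / 4)) in *. set (bK := sum_n (bterm (- / 4)) K) in *.
  replace (/ (2 * PI ^ 2) * (- bK * (g (INR (S n)) - g 0) + I1) - / (2 * PI ^ 2) * (- b0 * (g (INR (S n)) - g 0) + I2))
    with (/ (2 * PI ^ 2) * (- (b0 - bK) * D + (I1 - I2))) by (unfold D; rring).
  assert (P2 : 0 < / (2 * PI ^ 2)) by (apply Rinv_0_lt_compat; nra).
  rewrite Rabs_mult, (Rabs_right (/ _)) by lra.
  assert (Rabs (- (b0 - bK) * D + (I1 - I2)) <= 2 * w * D).
  { eapply Rle_trans; [apply Rabs_triang|]. rewrite Rabs_mult, Rabs_Ropp, (Rabs_right D) by lra.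
    assert (Rabs (b0 - bK) * D <= w * D) by (apply Rmult_le_compat_r; [lra|exact T]). lra. }
  apply Rle_lt_trans with (/ (2 * PI ^ 2) * (2 * w * D)); [apply Rmult_le_compat_l; lra|].
  assert (w * (D + 1) < eps * PI ^ 2).
  { apply Rle_lt_trans with (2 / INR (S (S K0)) * (D + 1)). apply Rmult_le_compat_r; lra.
    apply (Rmult_lt_compat_r (D + 1)) in HK0; [|lra].
    replace (eps * PI ^ 2 / (D + 1) * (D + 1)) with (eps * PI ^ 2) in HK0 by (field; lra). auto. }
  apply (Rmult_lt_reg_l (PI ^ 2)); [nra|].
  replace (PI ^ 2 * (/ (2 * PI ^ 2) * (2 * w * D))) with (w * D) by (field; lra). lra.
Qed.

(** The limit of [cf (INR k) b] as b -> +oo: with x = tau v the phase 2 pi k (x - 1/4) splits, by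
    the addition formula, into the sine and cosine transforms at 2 pi k tau. *)
Definition fcoef (t : R) (k : nat) : R :=
  cos (PI * INR k / 2) * Rem (2 * PI * INR k * t) 0 - sin (PI * INR k / 2) * (PI / 2 * exp (- (2 * PI * INR k * t))).

Let cf_transform (k : nat) (b : R) : cf (INR k) b =
  cos (PI * INR k / 2) * Ksin (b / tau) (2 * PI * INR k * tau) - sin (PI * INR k / 2) * Kcos (b / tau) (2 * PI * INR k * tau).
Proof.
  unfold cf, Ksin, Kcos.
  assert (W : forall x, 0 < 1 + x ^ 2) by (intros; nra).
  assert (S1 : RInt (fun x => sin (2 * PI * INR k * (x - / 4)) * g x) (tau * 0 + 0) (tau * (b / tau) + 0) =
     RInt (fun v => tau * (sin (2 * PI * INR k * ((tau * v + 0) - / 4)) * g (tau * v + 0))) 0 (b / tau)).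
  { symmetry. apply (RInt_comp_lin (fun x => sin (2 * PI * INR k * (x - / 4)) * g x)).
    apply ex_RInt_cont. intros x _. apply (continuous_mult (K := R_AbsRing)); auto. smooth; auto. }
  replace (tau * 0 + 0) with 0 in S1 by rring. replace (tau * (b / tau) + 0) with b in S1 by (field; lra).
  rewrite S1.
  rewrite (RInt_ext _ (fun v => cos (PI * INR k / 2) * (sin (2 * PI * INR k * tau * v) * / (1 + v ^ 2))
      - sin (PI * INR k / 2) * (cos (2 * PI * INR k * tau * v) * / (1 + v ^ 2)))).
  - rewrite RInt_sub.
    + f_equal. apply (RInt_scal (fun v => sin (2 * PI * INR k * tau * v) * / (1 + v ^ 2))).
      apply ex_RInt_cont. intros x _. smooth. specialize (W x). simpl in W. lra.
      apply (RInt_scal (fun v => cos (2 * PI * INR k * tau * v) * / (1 + v ^ 2))).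
      apply ex_RInt_cont. intros x _. smooth. specialize (W x). simpl in W. lra.
    + intros x. smooth. specialize (W x). simpl in W. lra.
    + intros x. smooth. specialize (W x). simpl in W. lra.
  - intros v _. replace (2 * PI * INR k * (tau * v + 0 - / 4)) with (2 * PI * INR k * tau * v - PI * INR k / 2) by field.
    rewrite sin_minus. unfold g. specialize (W v). apply Rminus_diag_uniq. field. split; try lra; nra.
Qed.

(** The oscillation yields a factor 1/k. Together with the factor 1/k of the series it gives a
    majorant 1/k^2, uniform in the upper end. *)
Let cf_tail (k : nat) (a b : R) : (0 < k)%nat -> 0 <= a <= b -> Rabs (cf (INR k) b - cf (INR k) a) <= 2 * g a / (PI * INR k).
Proof.
  intros Hk Hab. pose proof PI_RGT_0 as HP. pose proof (lt_0_INR k Hk) as HK.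
  assert (C2 : forall x, continuous (fun x => sin (2 * PI * INR k * (x - / 4)) * g x) x).
  { intros x. apply (continuous_mult (K := R_AbsRing)); auto. smooth; auto. }
  unfold cf. rewrite (RInt_split _ 0 a b) by (apply ex_RInt_cont; auto).
  replace (RInt (fun x => sin (2 * PI * INR k * (x - / 4)) * g x) 0 a + RInt (fun x => sin (2 * PI * INR k * (x - / 4)) * g x) a b -
      RInt (fun x => sin (2 * PI * INR k * (x - / 4)) * g x) 0 a) with
    (RInt (fun x => sin (2 * PI * INR k * (x - / 4)) * g x) a b) by rring.
  rewrite (RInt_ext _ (fun x => g x * cos (2 * PI * INR k * x + - (PI * INR k / 2 + PI / 2)))).
  - eapply Rle_trans; [apply (osc_bound g dg); auto; try lra|].
    + apply Rmult_lt_0_compat; lra.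
    + right. intros x Hx. apply dg_neg; lra.
    + pose proof (g_pos a). pose proof (g_pos b). rewrite !Rabs_right by lra. pose proof (g_decr a b Hab).
      replace (2 * g a / (PI * INR k)) with (2 * (g a + g a) / (2 * PI * INR k)) by (field; lra).
      unfold Rdiv. apply Rmult_le_compat_r; [|lra]. left; apply Rinv_0_lt_compat. apply Rmult_lt_0_compat; lra.
  - intros x _. replace (2 * PI * INR k * x + - (PI * INR k / 2 + PI / 2)) with (- (PI / 2 - 2 * PI * INR k * (x - / 4))) by field.
    rewrite cos_neg, cos_shift. rring.
Qed.

Let cf_limit (k : nat) (a : R) : (0 < k)%nat -> 0 <= a -> Rabs (fcoef tau k - cf (INR k) a) <= 2 * g a / (PI * INR k).
Proof.
  intros Hk Ha. pose proof PI_RGT_0 as HP. pose proof (lt_0_INR k Hk) as HK.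
  assert (Hs : 0 < 2 * PI * INR k * tau) by (apply Rmult_lt_0_compat; [apply Rmult_lt_0_compat|]; lra).
  destruct (Ksin_limit _ Hs) as (C1 & HC1 & L1). destruct (Kcos_limit _ Hs) as (C2 & HC2 & L2).
  apply le_epsilon. intros eps He.
  set (b := a + 1 + (C1 + C2) * tau / eps).
  assert (Hq : 0 <= (C1 + C2) * tau / eps) by (apply Rmult_le_pos; [nra|left; apply Rinv_0_lt_compat; lra]).
  assert (Hb : 0 < b) by (unfold b; lra).
  pose proof (cf_tail k a b Hk ltac:(unfold b; lra)) as T.
  assert (HV : 0 < b / tau) by (apply Rdiv_lt_0_compat; auto).
  specialize (L1 _ HV). specialize (L2 _ HV).
  assert (D : Rabs (fcoef tau k - cf (INR k) b) <= eps).
  { rewrite cf_transform. unfold fcoef.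
    set (K1 := Ksin _ _) in *. set (K2 := Kcos _ _) in *. set (R1 := Rem _ _) in *. set (R2 := PI / 2 * exp _) in *.
    replace (cos (PI * INR k / 2) * R1 - sin (PI * INR k / 2) * R2 - (cos (PI * INR k / 2) * K1 - sin (PI * INR k / 2) * K2))
     with (- (cos (PI * INR k / 2) * (K1 - R1)) + sin (PI * INR k / 2) * (K2 - R2)) by rring.
    eapply Rle_trans; [apply Rabs_triang|]. rewrite Rabs_Ropp, !Rabs_mult.
    pose proof (abs_cos (PI * INR k / 2)). pose proof (abs_sin (PI * INR k / 2)).
    pose proof (Rabs_pos (K1 - R1)). pose proof (Rabs_pos (K2 - R2)).
    assert (E : C1 / (b / tau) + C2 / (b / tau) <= eps).
    { replace (C1 / (b / tau) + C2 / (b / tau)) with ((C1 + C2) * tau / b) by (field; lra).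
      apply (Rmult_le_reg_r b); auto. unfold Rdiv at 1. rewrite Rmult_assoc, Rinv_l, Rmult_1_r by lra.
      unfold b. rewrite !Rmult_plus_distr_l. replace (eps * ((C1 + C2) * tau / eps)) with ((C1 + C2) * tau) by (field; lra). nra. }
    assert (Rabs (cos (PI * INR k / 2)) * Rabs (K1 - R1) <= 1 * Rabs (K1 - R1)) by (apply Rmult_le_compat_r; auto).
    assert (Rabs (sin (PI * INR k / 2)) * Rabs (K2 - R2) <= 1 * Rabs (K2 - R2)) by (apply Rmult_le_compat_r; auto).
    lra. }
  replace (fcoef tau k - cf (INR k) a) with ((fcoef tau k - cf (INR k) b) + (cf (INR k) b - cf (INR k) a)) by rring.
  eapply Rle_trans; [apply Rabs_triang|]. lra.
Qed.

(** The limit in n is taken inside the series by the majorant g(n+1) / k^2. The constants come from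
    H(0) = tau ln tau, from n h(n) -> tau and from h(0) / 4 = pi / 8. *)
Lemma arctan_sum_limit :
  ex_series (fun j => fcoef tau (S j) / (PI * INR (S j))) /\
  is_lim_seq (fun n => tau * ln (INR (S n)) - sum_n (fun j => atan (tau / (INR j + / 4))) n)
    (tau * ln tau - tau - PI / 8 - Series (fun j => fcoef tau (S j) / (PI * INR (S j)))).
Proof.
  pose proof PI_RGT_0 as HP.
  assert (Bd : forall n j, Rabs (fcoef tau (S j) / (PI * INR (S j)) - cf (INR (S j)) (INR (S n)) / (PI * INR (S j)))
     <= g (INR (S n)) * / INR (S j) ^ 2).
  { intros n j. pose proof (lt_0_INR (S j) ltac:(lia)) as Hk. pose proof (cf_limit (S j) (INR (S n)) ltac:(lia) (pos_INR _)) as B.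
    set (k := INR (S j)) in *. pose proof (g_pos (INR (S n))) as Hg.
    replace (fcoef tau (S j) / (PI * k) - cf k (INR (S n)) / (PI * k)) with ((fcoef tau (S j) - cf k (INR (S n))) * / (PI * k)) by (field; lra).
    rewrite Rabs_mult, (Rabs_right (/ (PI * k))) by (left; apply Rinv_0_lt_compat; nra).
    apply Rle_trans with (2 * g (INR (S n)) / (PI * k) * / (PI * k)).
    - apply Rmult_le_compat_r; auto. left; apply Rinv_0_lt_compat; nra.
    - replace (2 * g (INR (S n)) / (PI * k) * / (PI * k)) with (g (INR (S n)) * / k ^ 2 * (2 / PI ^ 2)) by (field; lra).
      rewrite <- (Rmult_1_r (g _ * / k ^ 2)) at 2. apply Rmult_le_compat_l.
      + apply Rmult_le_pos; [lra|left; apply Rinv_0_lt_compat; nra].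
      + assert (2 < PI) by (pose proof PI2_1; lra). apply (Rmult_le_reg_r (PI ^ 2)); [nra|].
        unfold Rdiv. rewrite Rmult_assoc, Rinv_l by nra. nra. }
  assert (Exd : forall n, ex_series (fun j => fcoef tau (S j) / (PI * INR (S j)) - cf (INR (S j)) (INR (S n)) / (PI * INR (S j)))).
  { intros n. apply ex_series_dom with (1 := Bd n). apply (ex_series_scal (g (INR (S n))) (fun j => / INR (S j) ^ 2)). apply ex_series_inv_sq. }
  assert (Ex : ex_series (fun j => fcoef tau (S j) / (PI * INR (S j)))).
  { apply ex_series_ext with (fun j => (fcoef tau (S j) / (PI * INR (S j)) - cf (INR (S j)) (INR 1) / (PI * INR (S j)))
       + cf (INR (S j)) (INR 1) / (PI * INR (S j))).
    - intros j. rring.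
    - apply (ex_series_plus (fun j => fcoef tau (S j) / (PI * INR (S j)) - cf (INR (S j)) (INR 1) / (PI * INR (S j)))).
      apply (Exd 0%nat). eexists; apply (cf_series 0). }
  split; auto.
  set (Sg := Series (fun j => fcoef tau (S j) / (PI * INR (S j)))).
  set (em := fun n => sum_n (fun j => h (INR j + / 4)) n + / 4 * (h (INR (S n)) - h 0) - (H (INR (S n)) - H 0)).
  set (C0 := Series (fun j => / INR (S j) ^ 2)).
  assert (Lim_n : is_lim_seq (fun n => INR (S n)) p_infty).
  { apply (is_lim_seq_incr_1 (fun n => INR n)). apply is_lim_seq_INR. }
  assert (Limg : is_lim_seq (fun n => g (INR (S n))) 0).
  { apply is_lim_seq_le_le with (fun _ => 0) (fun n => tau * / INR (S n)).
    - intros n. split. left; apply g_pos. unfold g, Rdiv. apply Rmult_le_compat_l; [lra|].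
      apply Rinv_le_contravar. apply lt_0_INR; lia. assert (1 <= INR (S n)) by (apply (le_INR 1); lia). nra.
    - apply is_lim_seq_const.
    - replace (Finite 0) with (Rbar_mult tau (Rbar_inv p_infty)) by (simpl; f_equal; rring).
      apply is_lim_seq_scal_l. apply is_lim_seq_inv; auto. discriminate. }
  assert (Lem : is_lim_seq em Sg).
  { assert (Hd : forall n, Rabs (em n - Sg) <= g (INR (S n)) * C0).
    { intros n. unfold Sg, em. rewrite <- (is_series_unique _ _ (cf_series n)).
      rewrite <- Series_minus by (try (eexists; apply (cf_series n)); auto).
      rewrite <- Rabs_Ropp, <- Series_opp. unfold C0. rewrite <- Series_scal_l.
      apply Series_dom.
      - intros j. rewrite Ropp_minus_distr. apply Bd.
      - apply (ex_series_scal (g (INR (S n))) (fun j => / INR (S j) ^ 2)). apply ex_series_inv_sq. }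
    apply is_lim_seq_ext with (fun n => Sg + (em n - Sg)). intros; rring.
    replace (Finite Sg) with (Finite (Sg + 0)) by (f_equal; rring).
    apply is_lim_seq_plus'; [apply is_lim_seq_const|].
    apply is_lim_seq_abs_0.
    apply is_lim_seq_le_le with (fun _ => 0) (fun n => g (INR (S n)) * C0).
    - intros n; split; auto. apply Rabs_pos.
    - apply is_lim_seq_const.
    - replace (Finite 0) with (Rbar_mult 0 C0) by (simpl; f_equal; rring). apply is_lim_seq_scal_r; auto. }
  assert (Linv : is_lim_seq (fun n => / INR (S n)) 0).
  { replace (Finite 0) with (Rbar_inv p_infty) by reflexivity. apply is_lim_seq_inv; auto. discriminate. }
  assert (hE : forall x, 0 < x -> h x = atan (tau / x)).
  { intros x Hx. unfold h. replace (tau / x) with (/ (x / tau)) by (field; lra).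
    rewrite atan_inv by (apply Rdiv_lt_0_compat; auto). reflexivity. }
  assert (Lh : is_lim_seq (fun n => h (INR (S n))) 0).
  { apply is_lim_seq_ext with (fun n => atan (tau * / INR (S n))).
    { intros n. symmetry. apply hE. apply lt_0_INR; lia. }
    rewrite <- atan_0. apply is_lim_seq_continuous. apply continuity_pt_filterlim, continuous_atan.
    replace (Finite 0) with (Rbar_mult tau 0) by (simpl; f_equal; rring). apply is_lim_seq_scal_l; auto. }
  assert (Lnh : is_lim_seq (fun n => INR (S n) * h (INR (S n))) tau).
  { apply is_lim_seq_ext with (fun n => tau * (atan (tau * / INR (S n)) / (tau * / INR (S n)))).
    { intros n. pose proof (lt_0_INR (S n) ltac:(lia)). rewrite hE by auto. change (tau / INR (S n)) with (tau * / INR (S n)). field. lra. }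
    replace (Finite tau) with (Rbar_mult tau 1) by (simpl; f_equal; rring). apply is_lim_seq_scal_l.
    apply (is_lim_comp_seq (fun y => atan y / y) (fun n => tau * / INR (S n)) 0 1).
    - assert (D : is_derive atan 0 1). { evar_last. apply is_derive_atan. unfold Rsqr. field. }
      apply is_derive_Reals in D. apply is_lim_spec. intros eps. destruct (D eps (cond_pos eps)) as [d Hd].
      exists d. intros y Hy Hy0. specialize (Hd y Hy0). rewrite Rplus_0_l, atan_0, Rminus_0_r in Hd. apply Hd.
      unfold ball in Hy; simpl in Hy. unfold AbsRing_ball, abs, minus, plus, opp in Hy; simpl in Hy.
      rewrite Ropp_0, Rplus_0_r in Hy. auto.
    - exists 0%nat. intros n _ E. injection E. apply Rmult_integral_contrapositive. split; [lra|]. apply Rinv_neq_0_compat. apply (not_0_INR (S n)). lia.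
    - replace (Finite 0) with (Rbar_mult tau 0) by (simpl; f_equal; rring). apply is_lim_seq_scal_l; auto. }
  assert (Lln : is_lim_seq (fun n => tau / 2 * ln (tau ^ 2 + INR (S n) ^ 2) - tau * ln (INR (S n))) 0).
  { apply is_lim_seq_ext with (fun n => tau / 2 * ln (1 + (tau * / INR (S n)) ^ 2)).
    { intros n. pose proof (lt_0_INR (S n) ltac:(lia)) as Hk. set (k := INR (S n)) in *.
      replace (tau ^ 2 + k ^ 2) with (k * k * (1 + (tau * / k) ^ 2)) by (field; lra).
      rewrite !ln_mult; try nra. }
    replace (Finite 0) with (Rbar_mult (tau / 2) 0) by (simpl; f_equal; rring). apply is_lim_seq_scal_l.
    rewrite <- ln_1. apply (is_lim_seq_continuous ln).
    - apply continuity_pt_filterlim, continuous_ln; lra.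
    - replace (Finite 1) with (Finite (1 + 0 * 0)) by (f_equal; rring).
      apply is_lim_seq_plus'. apply is_lim_seq_const.
      apply is_lim_seq_ext with (fun n => (tau * / INR (S n)) * (tau * / INR (S n))). intros; rring.
      assert (L0 : is_lim_seq (fun n => tau * / INR (S n)) 0).
      { replace (Finite 0) with (Rbar_mult tau 0) by (simpl; f_equal; rring). apply is_lim_seq_scal_l; auto. }
      apply is_lim_seq_mult'; auto. }
  assert (h0 : h 0 = PI / 2) by (unfold h, Rdiv; rewrite Rmult_0_l, atan_0; rring).
  assert (H0 : H 0 = tau * ln tau).
  { unfold H. rewrite Rmult_0_l. replace (tau ^ 2 + 0 ^ 2) with (tau * tau) by rring. rewrite ln_mult by auto. field. }
  apply is_lim_seq_ext with (fun n => H 0 - / 4 * h 0 - em n + / 4 * h (INR (S n)) - INR (S n) * h (INR (S n))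
      - (tau / 2 * ln (tau ^ 2 + INR (S n) ^ 2) - tau * ln (INR (S n)))).
  { intros n. unfold em. unfold H at 2.
    rewrite (sum_n_ext (fun j => atan (tau / (INR j + / 4))) (fun j => h (INR j + / 4))).
    rring. intros j. symmetry. apply hE. pose proof (pos_INR j). lra. }
  replace (tau * ln tau - tau - PI / 8 - Sg) with (H 0 - / 4 * h 0 - Sg + / 4 * 0 - tau - 0) by (rewrite H0, h0; field).
  apply is_lim_seq_minus'; auto. apply is_lim_seq_minus'; auto. apply is_lim_seq_plus'.
  - apply is_lim_seq_minus'; auto. apply is_lim_seq_const.
  - replace (Finite (/ 4 * 0)) with (Rbar_mult (/ 4) 0) by reflexivity. apply is_lim_seq_scal_l; auto.
Qed.
End EulerMaclaurin.

(** * Evaluation of the arctangent sum *)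

(** The difference from a partial sum has derivative (-1)^(n+1) x^(2n+2) / (1 + x^2), so the mean
    value theorem bounds it by a power of q. *)
Lemma atan_series (q : R) : 0 <= q < 1 ->
  is_series (fun m => (-1) ^ m * q ^ (2 * m + 1) / INR (2 * m + 1)) (atan q).
Proof.
  intros Hq.
  set (S := fun x n => sum_n (fun m => (-1) ^ m * x ^ (2 * m + 1) / INR (2 * m + 1)) n).
  assert (D : forall n x, is_derive (fun x => atan x - S x n) x ((-1) ^ (n + 1) * x ^ (2 * n + 2) / (1 + x ^ 2))).
  { intros n x. pose proof (one_plus_sq x) as W. induction n.
    - apply is_derive_ext with (fun x => atan x - x).
      { intros t. unfold S. rewrite sum_O. simpl. field. }
      auto_derive; auto. unfold Rsqr. simpl. field. nra.
    - apply is_derive_ext with (fun x => (atan x - S x n) - (-1) ^ (n + 1) * x ^ (2 * n + 3) / INR (2 * n + 3)).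
      { intros t. unfold S. rewrite sum_SnR. replace (Datatypes.S n) with (n + 1)%nat by lia.
        replace (2 * (n + 1) + 1)%nat with (2 * n + 3)%nat by lia. rring. }
      evar_last.
      + apply (is_derive_minus (fun x => atan x - S x n) (fun x => (-1) ^ (n + 1) * x ^ (2 * n + 3) / INR (2 * n + 3)) x
          ((-1) ^ (n + 1) * x ^ (2 * n + 2) / (1 + x ^ 2)) ((-1) ^ (n + 1) * x ^ (2 * n + 2))).
        exact IHn. pose proof (lt_0_INR (2 * n + 3) ltac:(lia)) as Hk.
        auto_derive; auto. replace (n + (n + 0) + 3)%nat with (2 * n + 3)%nat by lia.
        replace (Init.Nat.pred (2 * n + 3)) with (2 * n + 2)%nat by lia.
        set (k := INR (2 * n + 3)) in *. field. lra.
      + match goal with |- minus ?a ?b = ?r => change (a - b = r) end.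
        replace (Datatypes.S n + 1)%nat with (Datatypes.S (n + 1)) by lia.
        replace (2 * Datatypes.S n + 2)%nat with (2 * n + 2 + 2)%nat by lia.
        rewrite (pow_add x (2 * n + 2) 2), <- (tech_pow_Rmult (-1) (n + 1)).
        set (A := (-1) ^ (n + 1)). set (Z := x ^ (2 * n + 2)). field. lra. }
  assert (B : forall n, Rabs (S q n - atan q) <= q ^ (2 * n + 2)).
  { intros n. destruct (MVT_gen (fun x => atan x - S x n) 0 q (fun x => (-1) ^ (n + 1) * x ^ (2 * n + 2) / (1 + x ^ 2))) as (c & Hc & E).
    - intros; apply D.
    - intros x _. apply continuity_pt_filterlim.
      apply (ex_derive_continuous (V := R_NormedModule) (fun x => atan x - S x n)). eexists; apply D.
    - rewrite Rmin_left, Rmax_right in Hc by lra.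
      assert (S0 : S 0 n = 0).
      { unfold S. clear. induction n. rewrite sum_O. simpl. field. rewrite sum_SnR, IHn.
        rewrite (pow_i (2 * Datatypes.S n + 1)) by lia. unfold Rdiv. rring. }
      rewrite S0, atan_0, !Rminus_0_r in E. rewrite Rabs_minus_sym, E; unfold Rdiv; rewrite !Rabs_mult, pow_1_abs.
      pose proof (w0_bound c) as W. rewrite (Rabs_right q) by lra.
      rewrite (Rabs_right (c ^ _)) by (apply Rle_ge, pow_le; lra).
      assert (c ^ (2 * n + 2) <= q ^ (2 * n + 2)) by (apply pow_incr; lra).
      assert (0 <= c ^ (2 * n + 2)) by (apply pow_le; lra).
      pose proof (Rabs_pos (/ (1 + c ^ 2))).
      assert (c ^ (2 * n + 2) * Rabs (/ (1 + c ^ 2)) <= q ^ (2 * n + 2) * 1) by (apply Rmult_le_compat; auto).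
      assert (0 <= c ^ (2 * n + 2) * Rabs (/ (1 + c ^ 2))) by (apply Rmult_le_pos; auto). nra. }
  change (is_lim_seq (sum_n (fun m => (-1) ^ m * q ^ (2 * m + 1) / INR (2 * m + 1))) (atan q)).
  apply is_lim_seq_ext with (fun n => atan q + (S q n - atan q)). { intros n. unfold S. rring. }
  replace (Finite (atan q)) with (Finite (atan q + 0)) by (f_equal; rring).
  apply is_lim_seq_plus'; [apply is_lim_seq_const|]. apply is_lim_seq_abs_0.
  apply is_lim_seq_le_le with (fun _ => 0) (fun n => q ^ n).
  - intros n. split. apply Rabs_pos. eapply Rle_trans; [apply B|].
    replace (2 * n + 2)%nat with (n + (n + 2))%nat by lia. rewrite pow_add.
    assert (0 <= q ^ n) by (apply pow_le; lra).
    assert (q ^ (n + 2) <= 1) by (rewrite <- (pow1 (n + 2)); apply pow_incr; lra).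
    assert (0 <= q ^ (n + 2)) by (apply pow_le; lra). nra.
  - apply is_lim_seq_const.
  - apply is_lim_seq_geom. rewrite Rabs_right; lra.
Qed.

Lemma cos_nat_PI (k : nat) : cos (INR k * PI) = (-1) ^ k.
Proof.
  induction k. simpl. rewrite Rmult_0_l. apply cos_0.
  rewrite S_INR, Rmult_plus_distr_r, Rmult_1_l, neg_cos, IHk. simpl. rring.
Qed.

Lemma sin_nat_PI (k : nat) : sin (INR k * PI) = 0.
Proof.
  induction k. simpl. rewrite Rmult_0_l. apply sin_0.
  rewrite S_INR, Rmult_plus_distr_r, Rmult_1_l, neg_sin, IHk. rring.
Qed.

(** The decay in s, which makes the sum of Rem / k converge, is read off from the oscillation of
    [Ksin V s], uniformly in V. *)
Lemma Rem_0_bound (s : R) : 0 < s -> Rabs (Rem s 0) <= 4 / s.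
Proof.
  intros Hs. destruct (Ksin_limit s Hs) as (C & HC & L).
  apply le_epsilon. intros eps He. set (V := 1 + C / eps).
  assert (Hq : 0 <= C / eps) by (apply Rmult_le_pos; [lra|left; apply Rinv_0_lt_compat; lra]).
  assert (HV : 0 < V) by (unfold V; lra). specialize (L V HV).
  assert (K : Rabs (Ksin V s) <= 4 / s).
  { unfold Ksin. rewrite (RInt_ext _ (fun v => / (1 + v ^ 2) * cos (s * v + - (PI / 2)))).
    - eapply Rle_trans; [apply (osc_bound (fun v => / (1 + v ^ 2)) (fun v => - (2 * v) / (1 + v ^ 2) ^ 2)); try lra|].
      + intros x _. pose proof (one_plus_sq x). auto_derive. simpl in *; lra. field. lra.
      + intros x _. pose proof (one_plus_sq x). smooth. apply Rgt_not_eq. simpl in *; nra.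
      + right. intros x Hx. pose proof (one_plus_sq x).
        assert (0 < / (1 + x ^ 2) ^ 2) by (apply Rinv_0_lt_compat, pow_lt; auto).
        assert (0 <= 2 * x * / (1 + x ^ 2) ^ 2) by (apply Rmult_le_pos; lra). unfold Rdiv. lra.
      + pose proof (w0_bound 0). pose proof (w0_bound V). unfold Rdiv.
        apply Rmult_le_compat_r; [left; apply Rinv_0_lt_compat; auto|]. lra.
    - intros v _. replace (s * v + - (PI / 2)) with (- (PI / 2 - s * v)) by rring. rewrite cos_neg, cos_shift. rring. }
  assert (C / V <= eps).
  { apply (Rmult_le_reg_r V); auto. unfold Rdiv. rewrite Rmult_assoc, Rinv_l, Rmult_1_r by lra.
    unfold V. replace (eps * (1 + C / eps)) with (eps + C) by (field; lra). lra. }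
  replace (Rem s 0) with (Ksin V s + - (Ksin V s - Rem s 0)) by rring.
  eapply Rle_trans; [apply Rabs_triang|]. rewrite Rabs_Ropp. lra.
Qed.

Lemma ex_series_Rem_0 (c : R) : 0 < c -> ex_series (fun j => Rem (c * INR (S j)) 0 / INR (S j)).
Proof.
  intros Hc. apply ex_series_dom with (fun j => (4 / c) * / INR (S j) ^ 2).
  - intros j. pose proof (lt_0_INR (S j) ltac:(lia)) as Hk. set (k := INR (S j)) in *.
    unfold Rdiv at 1. rewrite Rabs_mult, (Rabs_right (/ k)) by (left; apply Rinv_0_lt_compat; auto).
    apply Rle_trans with (4 / (c * k) * / k).
    + apply Rmult_le_compat_r; [left; apply Rinv_0_lt_compat; auto|]. apply Rem_0_bound. nra.
    + right. field. lra.
  - apply (ex_series_scal (4 / c) (fun j => / INR (S j) ^ 2)). apply ex_series_inv_sq.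
Qed.

(** cos (pi k / 2) vanishes for odd k and sin (pi k / 2) for even k. Because j = k - 1, the odd k
    are the even-indexed terms of the series. *)
Lemma fcoef_series (t : R) : 0 < t ->
  is_series (fun j => fcoef (t / 2) (S j) / (PI * INR (S j)))
   (- / 2 * atan (exp (- PI * t)) - / (2 * PI) *
      (Series (fun j => Rem (2 * PI * t * INR (S j)) 0 / INR (S j)) - Series (fun j => Rem (4 * PI * t * INR (S j)) 0 / INR (S j)))).
Proof.
  intros Ht. pose proof PI_RGT_0 as HP.
  set (A1 := Series (fun j => Rem (2 * PI * t * INR (S j)) 0 / INR (S j))).
  set (A2 := Series (fun j => Rem (4 * PI * t * INR (S j)) 0 / INR (S j))).
  assert (c1 : 0 < 2 * PI * t) by nra. assert (c2 : 0 < 4 * PI * t) by nra.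
  replace (- / 2 * atan (exp (- PI * t)) - / (2 * PI) * (A1 - A2))
    with (- / 2 * atan (exp (- PI * t)) + - / (2 * PI) * (A1 - A2)) by rring.
  apply is_series_even_odd.
  - assert (Q : 0 <= exp (- PI * t) < 1).
    { split. left; apply exp_pos. rewrite <- exp_0. apply exp_increasing. nra. }
    pose proof (is_series_scal (- / 2) _ _ (atan_series _ Q)) as T.
    apply is_series_ext with (2 := T). intros m.
    match goal with |- scal ?a ?b = ?r => change (a * b = r) end.
    unfold fcoef. replace (S (2 * m)) with (2 * m + 1)%nat by lia.
    pose proof (lt_0_INR (2 * m + 1) ltac:(lia)) as Hk.
    assert (E : PI * INR (2 * m + 1) / 2 = INR m * PI + PI / 2).
    { rewrite plus_INR, mult_INR. simpl. field. }
    rewrite E, cos_plus, sin_plus, cos_PI2, sin_PI2, cos_nat_PI, sin_nat_PI.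
    assert (Ex : exp (- (2 * PI * INR (2 * m + 1) * (t / 2))) = exp (- PI * t) ^ (2 * m + 1)).
    { generalize (2 * m + 1)%nat. intros k. induction k. simpl. rewrite <- exp_0. f_equal. rring.
      rewrite <- tech_pow_Rmult, <- IHk, <- exp_plus. f_equal. rewrite S_INR. field. }
    rewrite Ex. set (k := INR (2 * m + 1)) in *. field. lra.
  - assert (D : is_series (fun j => (-1) ^ j * (Rem (2 * PI * t * INR (S j)) 0 / INR (S j))) (A1 - A2)).
    { apply (is_series_alternate (fun k => Rem (2 * PI * t * INR k) 0 / INR k)).
      - apply Series_correct. apply ex_series_Rem_0; auto.
      - apply is_series_ext with (fun j => Rem (4 * PI * t * INR (S j)) 0 / INR (S j)).
        + intros j. pose proof (lt_0_INR (S j) ltac:(lia)). rewrite (mult_INR 2 (S j)). simpl (INR 2).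
          replace (2 * PI * t * ((1 + 1) * INR (S j))) with (4 * PI * t * INR (S j)) by rring. apply Rminus_diag_uniq. set (k := INR (S j)) in *. field. lra.
        + apply Series_correct. apply ex_series_Rem_0; auto. }
    pose proof (is_series_scal (- / (2 * PI)) _ _ D) as T.
    apply is_series_ext with (2 := T). intros m.
    match goal with |- scal ?a ?b = ?r => change (a * b = r) end.
    unfold fcoef. replace (S (2 * m + 1)) with (2 * S m)%nat by lia. rewrite mult_INR. simpl (INR 2).
    pose proof (lt_0_INR (S m) ltac:(lia)) as Hk.
    replace (PI * ((1 + 1) * INR (S m)) / 2) with (INR (S m) * PI) by field.
    rewrite cos_nat_PI, sin_nat_PI. rewrite <- tech_pow_Rmult.
    replace (2 * PI * ((1 + 1) * INR (S m)) * (t / 2)) with (2 * PI * t * INR (S m)) by field.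
    set (k := INR (S m)) in *. field. lra.
Qed.

(** * Euler's integral and Gauss's product *)

Definition gR (sg tau x : R) : R := Rpower x (sg - 1) * exp (- x) * cos (tau * ln x).
Definition gI (sg tau x : R) : R := Rpower x (sg - 1) * exp (- x) * sin (tau * ln x).

Lemma Rpower_pos (x y : R) : 0 < Rpower x y.
Proof. apply exp_pos. Qed.

(** The inequality x / (2 sg) <= exp (x / (2 sg)) raised to the power sg. *)
Lemma Rpower_exp_bound (sg x : R) : 0 < sg -> 0 < x ->
  Rpower x sg <= Rpower (2 * sg) sg * exp (x / 2).
Proof.
  intros Hs Hx.
  assert (H : x <= 2 * sg * exp (x / (2 * sg))).
  { pose proof (exp_ge_1 (x / (2 * sg))) as E. apply (Rmult_le_compat_l (2 * sg)) in E; [|lra].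
    replace (2 * sg * (1 + x / (2 * sg))) with (2 * sg + x) in E by (field; lra). lra. }
  eapply Rle_trans; [apply (Rle_Rpower_l x (2 * sg * exp (x / (2 * sg))) sg); lra|].
  right. unfold Rpower. rewrite ln_mult, ln_exp, <- exp_plus by (try apply exp_pos; lra).
  f_equal. field. lra.
Qed.

Lemma weight_derive (sg x : R) : 0 < x ->
  is_derive (fun x => - / (1 + Rpower x sg)) x (sg * Rpower x (sg - 1) / (1 + Rpower x sg) ^ 2).
Proof.
  intros Hx. pose proof (Rpower_pos x sg).
  replace (Rpower x (sg - 1)) with (Rpower x sg / x).
  - unfold Rpower in *. auto_derive. split; [auto|]. split; [lra|auto]. field. split; lra.
  - unfold Rminus. rewrite Rpower_plus, Rpower_Ropp, Rpower_1 by auto. reflexivity.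
Qed.

Lemma Rpower_lim_0 (sg : R) : 0 < sg -> filterlim (fun x => Rpower x sg) (at_right 0) (locally 0).
Proof.
  intros Hs. unfold Rpower.
  apply (filterlim_comp _ _ _ (fun x => sg * ln x) exp _ (Rbar_locally m_infty)).
  - apply (filterlim_comp _ _ _ ln (fun y => sg * y) _ (Rbar_locally m_infty)).
    + apply is_lim_ln_0.
    + pose proof (is_lim_scal_l (fun y => y) sg m_infty m_infty (is_lim_id _)) as H. simpl in H.
      destruct (Rle_dec 0 sg) as [r|]; [|lra]. destruct (Rle_lt_or_eq_dec 0 sg r); [exact H|lra].
  - exact is_lim_exp_m.
Qed.

Lemma Rpower_lim_p (sg : R) : 0 < sg -> is_lim (fun x => Rpower x sg) p_infty p_infty.
Proof.
  intros Hs. unfold Rpower.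
  apply (filterlim_comp _ _ _ (fun x => sg * ln x) exp _ (Rbar_locally p_infty)).
  - apply (filterlim_comp _ _ _ ln (fun y => sg * y) _ (Rbar_locally p_infty)).
    + apply is_lim_ln_p.
    + pose proof (is_lim_scal_l (fun y => y) sg p_infty p_infty (is_lim_id _)) as H. simpl in H.
      destruct (Rle_dec 0 sg) as [r|]; [|lra]. destruct (Rle_lt_or_eq_dec 0 sg r); [exact H|lra].
  - exact is_lim_exp_p.
Qed.

Lemma IG_weight (sg : R) : 0 < sg -> IG (fun x => sg * Rpower x (sg - 1) / (1 + Rpower x sg) ^ 2) 1.
Proof.
  intros Hs. apply (IG_val _ (0 - - / (1 + 0))); [|field].
  apply (IG_deriv (fun x => - / (1 + Rpower x sg))).
  - intros; apply weight_derive; auto.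
  - intros x Hx. pose proof (Rpower_pos x sg). unfold Rpower in *. smooth. split; [auto|]. split; [auto|].
    split; [|auto]. apply Rgt_not_eq. nra.
  - apply (filterlim_comp _ _ _ (fun x => Rpower x sg) (fun y => - / (1 + y)) _ (locally 0)).
    apply Rpower_lim_0; auto.
    apply (ex_derive_continuous (V := R_NormedModule) (fun y => - / (1 + y))). auto_derive. lra.
  - replace 0 with (- 0) by ring. apply (is_lim_opp (fun x => / (1 + Rpower x sg)) p_infty 0).
    apply (is_lim_inv (fun x => 1 + Rpower x sg) p_infty p_infty); [|discriminate].
    apply (is_lim_plus (fun _ => 1) (fun x => Rpower x sg) p_infty 1 p_infty p_infty).
    apply is_lim_const. apply Rpower_lim_p; auto. reflexivity.
Qed.

(* Dominated by a multiple of the derivative of [- 1 / (1 + x^sg)]. *)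
Lemma IG_gamma_exists (sg : R) (f : R -> R) : 0 < sg -> (forall x, 0 < x -> continuous f x) ->
  (forall x, 0 < x -> Rabs (f x) <= Rpower x (sg - 1) * exp (- x)) -> exists l, IG f l.
Proof.
  intros Hs Cf Hf. set (c := 1 + Rpower (2 * sg) sg).
  assert (Hc : 1 < c) by (unfold c; pose proof (Rpower_pos (2 * sg) sg); lra).
  destruct (IG_exists f (fun x => c ^ 2 / sg * (sg * Rpower x (sg - 1) / (1 + Rpower x sg) ^ 2)) (c ^ 2 / sg * 1)) as (l & Hl & _).
  - auto.
  - intros x Hx. eapply Rle_trans; [apply Hf; auto|].
    pose proof (Rpower_pos x sg) as P1. pose proof (Rpower_pos x (sg - 1)) as P2.
    replace (c ^ 2 / sg * (sg * Rpower x (sg - 1) / (1 + Rpower x sg) ^ 2)) with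
      (Rpower x (sg - 1) * (c ^ 2 / (1 + Rpower x sg) ^ 2)) by (field; lra).
    apply Rmult_le_compat_l; [lra|].
    assert (A : 1 + Rpower x sg <= c * exp (x / 2)).
    { pose proof (Rpower_exp_bound sg x Hs Hx). pose proof (exp_ge_1 (x / 2)). unfold c. lra. }
    assert (E : exp (- x) = / (exp (x / 2) * exp (x / 2))).
    { rewrite <- exp_plus, <- exp_Ropp. f_equal. field. }
    rewrite E. apply (Rmult_le_reg_r ((1 + Rpower x sg) ^ 2 * (exp (x / 2) * exp (x / 2)))).
    { pose proof (exp_pos (x / 2)). apply Rmult_lt_0_compat; nra. }
    pose proof (exp_pos (x / 2)) as E2.
    replace (/ (exp (x / 2) * exp (x / 2)) * ((1 + Rpower x sg) ^ 2 * (exp (x / 2) * exp (x / 2)))) with ((1 + Rpower x sg) ^ 2) by (field; lra).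
    replace (c ^ 2 / (1 + Rpower x sg) ^ 2 * ((1 + Rpower x sg) ^ 2 * (exp (x / 2) * exp (x / 2)))) with ((c * exp (x / 2)) ^ 2) by (field; lra).
    apply pow_incr. lra.
  - apply IG_scal, IG_weight; auto.
  - exists l; auto.
Qed.

Definition GamR (sg tau : R) : R := RInt_gen (gR sg tau) (at_right 0) (Rbar_locally p_infty).
Definition GamI (sg tau : R) : R := RInt_gen (gI sg tau) (at_right 0) (Rbar_locally p_infty).

Lemma gR_continuous (sg tau x : R) : 0 < x -> continuous (gR sg tau) x.
Proof. intros Hx. unfold gR, Rpower. smooth. auto. Qed.

Lemma gI_continuous (sg tau x : R) : 0 < x -> continuous (gI sg tau) x.
Proof. intros Hx. unfold gI, Rpower. smooth. auto. Qed.

Lemma trig_dom (A c : R) : 0 <= A -> Rabs c <= 1 -> Rabs (A * c) <= A.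
Proof. intros HA Hc. rewrite Rabs_mult, (Rabs_right A) by lra. pose proof (Rabs_pos c). nra. Qed.

Lemma IG_GamR (sg tau : R) : 0 < sg -> IG (gR sg tau) (GamR sg tau).
Proof.
  intros Hs. destruct (IG_gamma_exists sg (gR sg tau) Hs) as [l Hl].
  - intros; apply gR_continuous; auto.
  - intros x Hx. apply trig_dom. apply Rmult_le_pos; left. apply Rpower_pos. apply exp_pos. apply abs_cos.
  - unfold GamR. apply IG_RInt_gen with l; auto.
Qed.

Lemma IG_GamI (sg tau : R) : 0 < sg -> IG (gI sg tau) (GamI sg tau).
Proof.
  intros Hs. destruct (IG_gamma_exists sg (gI sg tau) Hs) as [l Hl].
  - intros; apply gI_continuous; auto.
  - intros x Hx. apply trig_dom. apply Rmult_le_pos; left. apply Rpower_pos. apply exp_pos. apply abs_sin.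
  - unfold GamI. apply IG_RInt_gen with l; auto.
Qed.

Lemma filterlim_dom0 (F : (R -> Prop) -> Prop) (f g : R -> R) : Filter F ->
  F (fun x => Rabs (f x) <= g x) -> filterlim g F (locally 0) -> filterlim f F (locally 0).
Proof.
  intros HF Hd Hg. apply filterlim_locally. intros eps.
  pose proof (proj1 (filterlim_locally _ _) Hg eps) as H.
  apply (filter_imp (fun x => Rabs (f x) <= g x /\ ball 0 eps (g x))); [|apply filter_and; auto].
  intros x [H1 H2]. revert H2. unfold ball; simpl. unfold AbsRing_ball, abs, minus, plus, opp; simpl.
  rewrite Ropp_0, !Rplus_0_r. intros H2. pose proof (Rle_abs (g x)). lra.
Qed.

Lemma boundary_lim (sg : R) (c : R -> R) : 0 < sg -> (forall x, Rabs (c x) <= 1) ->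
  filterlim (fun x => Rpower x sg * exp (- x) * c x) (at_right 0) (locally 0) /\
  is_lim (fun x => Rpower x sg * exp (- x) * c x) p_infty 0.
Proof.
  intros Hs Hc. split.
  - apply filterlim_dom0 with (fun x => Rpower x sg); [apply at_right_proper_filter|..|apply Rpower_lim_0; auto].
    exists (mkposreal 1 Rlt_0_1). intros x _ Hx.
    pose proof (Rpower_pos x sg). pose proof (exp_pos (- x)).
    eapply Rle_trans; [apply trig_dom; [apply Rmult_le_pos; lra|apply Hc]|].
    assert (exp (- x) <= 1) by (rewrite <- exp_0; apply exp_le; lra). nra.
  - apply (filterlim_dom0 (Rbar_locally p_infty)) with (fun x => Rpower (2 * sg) sg * exp (- (/ 2 * x))); [apply Rbar_locally_filter|..].
    + exists 0. intros x Hx.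
      pose proof (Rpower_pos x sg). pose proof (exp_pos (- x)).
      eapply Rle_trans; [apply trig_dom; [apply Rmult_le_pos; lra|apply Hc]|].
      apply Rle_trans with (Rpower (2 * sg) sg * exp (x / 2) * exp (- x)).
      * apply Rmult_le_compat_r; [lra|]. apply Rpower_exp_bound; auto.
      * right. rewrite Rmult_assoc, <- exp_plus. do 2 f_equal. field.
    + replace 0 with (Rpower (2 * sg) sg * 0) by ring.
      apply (is_lim_scal_l (fun x => exp (- (/ 2 * x))) (Rpower (2 * sg) sg) p_infty 0).
      apply (is_lim_comp (fun y => exp (- y)) (fun y => / 2 * y) p_infty 0 p_infty).
      * apply lim_exp_neg.
      * pose proof (is_lim_scal_l (fun y => y) (/ 2) p_infty p_infty (is_lim_id _)) as H. simpl in H.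
        destruct (Rle_dec 0 (/ 2)) as [r|]; [|lra]. destruct (Rle_lt_or_eq_dec 0 (/ 2) r); [exact H|lra].
      * exists 0. intros; discriminate.
Qed.

Lemma Rpower_pred (x sg : R) : 0 < x -> Rpower x (sg - 1) = Rpower x sg / x.
Proof. intros Hx. unfold Rminus. rewrite Rpower_plus, Rpower_Ropp, Rpower_1 by auto. reflexivity. Qed.

(** The functional equation Gamma (z + 1) = z Gamma (z), from the derivative of x^z exp (- x), whose
    boundary values vanish. *)
Lemma Gam_succ (sg tau : R) : 0 < sg ->
  GamR (sg + 1) tau = sg * GamR sg tau - tau * GamI sg tau /\
  GamI (sg + 1) tau = sg * GamI sg tau + tau * GamR sg tau.
Proof.
  intros Hs.
  assert (R0 := IG_GamR sg tau Hs). assert (I0 := IG_GamI sg tau Hs).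
  assert (R1 := IG_GamR (sg + 1) tau ltac:(lra)). assert (I1 := IG_GamI (sg + 1) tau ltac:(lra)).
  split.
  - assert (D : IG (fun x => sg * gR sg tau x - tau * gI sg tau x - gR (sg + 1) tau x) (0 - 0)).
    { apply (IG_deriv (fun x => Rpower x sg * exp (- x) * cos (tau * ln x))).
      - intros x Hx. unfold gR, gI. replace (sg + 1 - 1) with sg by ring. rewrite (Rpower_pred x sg) by auto.
        unfold Rpower. auto_derive. auto. field. lra.
      - intros x Hx. unfold gR, gI, Rpower. smooth. repeat split; auto.
      - apply boundary_lim; auto. intros; apply abs_cos.
      - apply boundary_lim; auto. intros; apply abs_cos. }
    assert (E := IG_minus _ _ _ _ (IG_minus _ _ _ _ (IG_scal _ sg _ R0) (IG_scal _ tau _ I0)) R1). cbv beta in E.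
    pose proof (IG_eq _ _ _ D E). lra.
  - assert (D : IG (fun x => sg * gI sg tau x + tau * gR sg tau x - gI (sg + 1) tau x) (0 - 0)).
    { apply (IG_deriv (fun x => Rpower x sg * exp (- x) * sin (tau * ln x))).
      - intros x Hx. unfold gR, gI. replace (sg + 1 - 1) with sg by ring. rewrite (Rpower_pred x sg) by auto.
        unfold Rpower. auto_derive. auto. field. lra.
      - intros x Hx. unfold gR, gI, Rpower. smooth. repeat split; auto.
      - apply boundary_lim; auto. intros; apply abs_sin.
      - apply boundary_lim; auto. intros; apply abs_sin. }
    assert (E := IG_minus _ _ _ _ (IG_plus _ _ _ _ (IG_scal _ sg _ I0) (IG_scal _ tau _ R0)) I1). cbv beta in E.
    pose proof (IG_eq _ _ _ D E). lra.
Qed.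

Lemma GamR_pos (sg : R) : 0 < sg -> 0 < GamR sg 0.
Proof.
  intros Hs.
  assert (P : forall x, 0 < x -> 0 < gR sg 0 x).
  { intros x Hx. unfold gR. rewrite Rmult_0_l, cos_0, Rmult_1_r. apply Rmult_lt_0_compat. apply Rpower_pos. apply exp_pos. }
  destruct (IG_GamR sg 0 Hs) as [Ex L].
  set (I := RInt (gR sg 0) 1 2).
  assert (HI : 0 < I). { apply RInt_gt_0; [lra|intros; apply P; lra|intros; apply gR_continuous; lra]. }
  destruct (L I HI) as (d & Y & Hd & HY & H).
  set (a := Rmin (d / 2) 1). set (b := Rmax (Y + 1) 2).
  assert (Ha : 0 < a <= d / 2) by (unfold a; split; [apply Rmin_glb_lt; lra|apply Rmin_l]).
  assert (Ha1 : a <= 1) by apply Rmin_r.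
  assert (Hb : Y + 1 <= b) by apply Rmax_l. assert (Hb1 : 2 <= b) by apply Rmax_r.
  specialize (H a b ltac:(lra) ltac:(lra)).
  rewrite (RInt_split _ a 1 b), (RInt_split _ 1 2 b) in H by (apply Ex; lra).
  assert (0 <= RInt (gR sg 0) a 1) by (apply RInt_ge_0; [lra|apply Ex; lra|intros; left; apply P; lra]).
  assert (0 <= RInt (gR sg 0) 2 b) by (apply RInt_ge_0; [lra|apply Ex; lra|intros; left; apply P; lra]).
  fold I in H. apply Rabs_def2 in H. lra.
Qed.

Lemma GamR_nat (n : nat) : GamR (INR n + 1) 0 = INR (fact n).
Proof.
  induction n.
  - simpl. rewrite Rplus_0_l. assert (E := IG_GamR 1 0 Rlt_0_1). apply (IG_eq _ _ 1) in E; auto.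
    apply IG_ext with (2 := IG_exp_neg). intros x Hx. unfold gR.
    rewrite Rminus_eq_0, Rpower_O, Rmult_0_l, cos_0 by auto. ring.
  - pose proof (pos_INR n). rewrite S_INR. destruct (Gam_succ (INR n + 1) 0) as [E _]; [lra|].
    rewrite E, IHn, fact_simpl, mult_INR, S_INR. ring.
Qed.

(** The factor y tames the logarithm at 0; it is supplied later by splitting one power of x off the
    weight. *)
Lemma ln_gap (y : R) : 0 < y -> y * Rabs (ln y) <= Rabs (y - 1) * (1 + y).
Proof.
  intros Hy.
  assert (L : forall x, 0 < x -> ln x <= x - 1).
  { intros x Hx. pose proof (exp_ge_1 (ln x)) as E. rewrite exp_ln in E by auto. lra. }
  destruct (Rle_dec 1 y) as [H|H].
  - assert (0 <= ln y) by (rewrite <- ln_1; destruct H as [H|H]; [left; apply ln_increasing; lra|rewrite <- H; lra]).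
    rewrite !Rabs_right by lra. specialize (L y Hy). nra.
  - assert (ln y < 0) by (rewrite <- ln_1; apply ln_increasing; lra).
    rewrite !Rabs_left by lra. pose proof (L (/ y) (Rinv_0_lt_compat y Hy)) as L2. rewrite ln_Rinv in L2 by auto.
    apply (Rmult_le_compat_l y) in L2; [|lra]. rewrite Rmult_minus_distr_l, Rinv_r in L2 by lra. nra.
Qed.

Lemma Rpower_gap (y sg : R) : 0 < y -> 0 < sg <= 1 -> Rabs (Rpower y sg - 1) <= Rabs (y - 1) /\ Rpower y sg <= 1 + y.
Proof.
  intros Hy Hs.
  destruct (Rle_dec 1 y) as [H|H].
  - assert (A : Rpower y sg <= y). { rewrite <- (Rpower_1 y) at 2 by auto. apply Rle_Rpower; lra. }
    assert (B : 1 <= Rpower y sg). { rewrite <- (Rpower_O y) by auto. apply Rle_Rpower; lra. }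
    rewrite !Rabs_right by lra. lra.
  - assert (ln y < 0) by (rewrite <- ln_1; apply ln_increasing; lra).
    assert (A : y <= Rpower y sg). { rewrite <- (Rpower_1 y) at 1 by auto. unfold Rpower. apply exp_le. nra. }
    assert (B : Rpower y sg <= 1). { rewrite <- (Rpower_O y) by auto. unfold Rpower. apply exp_le. nra. }
    split; [|lra]. rewrite !Rabs_left1 by lra. lra.
Qed.

Lemma sin_abs_le (x : R) : Rabs (sin x) <= Rabs x.
Proof.
  destruct (MVT_gen sin 0 x cos) as (c & _ & E).
  - intros; apply is_derive_sin.
  - intros; apply continuity_sin.
  - rewrite sin_0, !Rminus_0_r in E. rewrite E, Rabs_mult. pose proof (abs_cos c). pose proof (Rabs_pos x). nra.
Qed.

Lemma cos_abs_le (x : R) : Rabs (cos x - 1) <= Rabs x.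
Proof.
  destruct (MVT_gen cos 0 x (fun x => - sin x)) as (c & _ & E).
  - intros; apply is_derive_cos.
  - intros; apply continuity_cos.
  - rewrite cos_0, Rminus_0_r in E. rewrite E, Rabs_mult, Rabs_Ropp. pose proof (abs_sin c). pose proof (Rabs_pos x). nra.
Qed.

(* AM-GM majorant of [|y - 1| (1 + y)^2], in which [lam] is later taken of order [sqrt n]. *)
Definition dev_poly (lam y : R) : R := (lam * (y - 1) ^ 2 + / lam) * (1 + y ^ 2).

(** Bounds y^(sg + i tau) - 1 in real and imaginary parts by a polynomial, whose integrals against
    the Gamma weight are explicit. *)
Lemma phase_deviation (sg tau lam y : R) : 0 < y -> 0 < sg <= 1 -> 0 < lam ->
  y * Rabs (Rpower y sg * cos (tau * ln y) - 1) <= (1 + Rabs tau) * dev_poly lam y /\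
  y * Rabs (Rpower y sg * sin (tau * ln y)) <= (1 + Rabs tau) * dev_poly lam y.
Proof.
  intros Hy Hs Hl. destruct (Rpower_gap y sg Hy Hs) as [G1 G2]. pose proof (ln_gap y Hy) as G3.
  set (P := Rpower y sg) in *. assert (HP : 0 < P) by apply Rpower_pos.
  set (u := Rabs (y - 1)) in *. assert (Hu : 0 <= u) by apply Rabs_pos.
  pose proof (Rabs_pos tau) as Htau.
  assert (Hd : u * (1 + y) ^ 2 <= dev_poly lam y).
  { unfold dev_poly. assert (E : (y - 1) ^ 2 = u ^ 2) by (unfold u; rewrite pow2_abs; auto). rewrite E.
    assert (A : 2 * u <= lam * u ^ 2 + / lam).
    { assert (0 <= (lam * u - 1) ^ 2 * / lam) by (apply Rmult_le_pos; [apply pow2_ge_0|left; apply Rinv_0_lt_compat; auto]).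
      replace ((lam * u - 1) ^ 2 * / lam) with (lam * u ^ 2 + / lam - 2 * u) in H by (field; lra). lra. }
    assert (B : (1 + y) ^ 2 <= 2 * (1 + y ^ 2)) by nra.
    apply Rle_trans with (2 * u * (1 + y ^ 2)); [nra|]. apply Rmult_le_compat_r; nra. }
  assert (T : y * (P * (Rabs tau * Rabs (ln y))) <= Rabs tau * (u * (1 + y) ^ 2)).
  { replace (y * (P * (Rabs tau * Rabs (ln y)))) with (Rabs tau * (P * (y * Rabs (ln y)))) by ring.
    apply Rmult_le_compat_l; auto. apply Rle_trans with ((1 + y) * (u * (1 + y))); [|right; ring].
    apply Rmult_le_compat; try lra. apply Rmult_le_pos; [lra|apply Rabs_pos]. }
  split.
  - replace (P * cos (tau * ln y) - 1) with ((P - 1) + P * (cos (tau * ln y) - 1)) by ring.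
    assert (A : Rabs ((P - 1) + P * (cos (tau * ln y) - 1)) <= u + P * (Rabs tau * Rabs (ln y))).
    { eapply Rle_trans; [apply Rabs_triang|]. apply Rplus_le_compat; auto.
      rewrite Rabs_mult, (Rabs_right P) by lra. apply Rmult_le_compat_l; [lra|].
      rewrite <- Rabs_mult. apply cos_abs_le. }
    apply (Rmult_le_compat_l y) in A; [|lra]. rewrite Rmult_plus_distr_l in A.
    assert (y * u <= u * (1 + y) ^ 2) by nra.
    apply Rle_trans with ((1 + Rabs tau) * (u * (1 + y) ^ 2)); [lra|]. apply Rmult_le_compat_l; lra.
  - assert (A : Rabs (P * sin (tau * ln y)) <= P * (Rabs tau * Rabs (ln y))).
    { rewrite Rabs_mult, (Rabs_right P) by lra. apply Rmult_le_compat_l; [lra|].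
      rewrite <- Rabs_mult. apply sin_abs_le. }
    apply (Rmult_le_compat_l y) in A; [|lra].
    assert (0 <= u * (1 + y) ^ 2) by nra.
    apply Rle_trans with ((1 + Rabs tau) * (u * (1 + y) ^ 2)); [nra|]. apply Rmult_le_compat_l; lra.
Qed.

(* Fourth moments of the Gamma distribution of parameter [n], scaled to mean 1. *)
Lemma IG_dev_poly (n : nat) (lam : R) : (0 < n)%nat -> 0 < lam ->
  exists l, IG (fun x => INR n * (Rpower x (INR n - 1) * exp (- x) * dev_poly lam (x / INR n))) l /\
   l <= INR (fact n) * (lam * (15 / INR n) + 3 / lam).
Proof.
  intros Hn Hl. destruct n as [|m]; [lia|]. set (n := S m) in *. set (N := INR n).
  assert (HN : 1 <= N) by (unfold N; apply (le_INR 1); lia).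
  assert (M : forall p : nat, IG (fun x => Rpower x (N - 1 + INR p) * exp (- x)) (INR (fact (m + p)))).
  { intros p. rewrite <- GamR_nat. eapply IG_ext; [|apply IG_GamR; pose proof (pos_INR (m + p)); lra].
    intros x Hx. unfold gR. rewrite Rmult_0_l, cos_0, Rmult_1_r. do 2 f_equal.
    rewrite plus_INR. unfold N, n. rewrite S_INR. ring. }
  set (c0 := lam + / lam). set (c2 := 2 * lam + / lam).
  assert (I := IG_scal _ N _ (IG_plus _ _ _ _ (IG_plus _ _ _ _ (IG_plus _ _ _ _ (IG_plus _ _ _ _
     (IG_scal _ c0 _ (M 0%nat)) (IG_scal _ (- 2 * lam / N) _ (M 1%nat))) (IG_scal _ (c2 / N ^ 2) _ (M 2%nat)))
     (IG_scal _ (- 2 * lam / N ^ 3) _ (M 3%nat))) (IG_scal _ (lam / N ^ 4) _ (M 4%nat)))).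
  cbv beta in I. eexists. split.
  - eapply IG_ext; [|exact I]. intros x Hx. cbv beta. fold N.
    assert (Pp : forall p : nat, Rpower x (N - 1 + INR p) = Rpower x (N - 1) * x ^ p).
    { intros p. rewrite Rpower_plus, Rpower_pow by auto. reflexivity. }
    rewrite !Pp. unfold dev_poly, c0, c2. field. lra.
  - rewrite Nat.add_0_r, !Nat.add_succ_r, Nat.add_0_r.
    set (f := INR (fact m)).
    assert (Hf : 0 < f) by apply INR_fact_lt_0.
    assert (F1 : INR (fact (S m)) = N * f) by (rewrite fact_simpl, mult_INR; reflexivity).
    assert (F2 : INR (fact (S (S m))) = (N + 1) * (N * f)) by (rewrite fact_simpl, mult_INR, F1, S_INR; reflexivity).
    assert (F3 : INR (fact (S (S (S m)))) = (N + 2) * ((N + 1) * (N * f))).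
    { rewrite fact_simpl, mult_INR, F2, 2!S_INR. fold n. fold N. ring. }
    assert (F4 : INR (fact (S (S (S (S m))))) = (N + 3) * ((N + 2) * ((N + 1) * (N * f)))).
    { rewrite fact_simpl, mult_INR, F3, 3!S_INR. fold n. fold N. ring. }
    rewrite F4, F3, F2. change (fact n) with (fact (S m)). rewrite F1. unfold c0, c2.
    replace (N * ((lam + / lam) * f + - 2 * lam / N * (N * f) + (2 * lam + / lam) / N ^ 2 * ((N + 1) * (N * f)) +
       - 2 * lam / N ^ 3 * ((N + 2) * ((N + 1) * (N * f))) + lam / N ^ 4 * ((N + 3) * ((N + 2) * ((N + 1) * (N * f))))))
     with (N * f * (lam * (/ N + (N + 1) * (N + 6) / N ^ 3) + (2 + / N) / lam)) by (field; lra).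
    apply Rmult_le_compat_l; [nra|].
    assert (HNi : / N <= 1) by (rewrite <- Rinv_1; apply Rinv_le_contravar; lra).
    apply Rplus_le_compat.
    + apply Rmult_le_compat_l; [lra|].
      replace (15 / N) with (/ N + 14 * N ^ 2 / N ^ 3) by (field; lra).
      apply Rplus_le_compat_l. unfold Rdiv. apply Rmult_le_compat_r; [left; apply Rinv_0_lt_compat; nra|]. nra.
    + unfold Rdiv. apply Rmult_le_compat_r; [left; apply Rinv_0_lt_compat; auto|]. lra.
Qed.

(** The weight x^n exp (- x) concentrates near x = n, so Gamma (sg + n + 1 + i tau) is close to
    n^(sg + i tau) n!. The two combinations are the real and imaginary parts after division by n^(i
    tau). The choice lam = sqrt n balances 15 lam / n against 3 / lam and gives 18 / sqrt n. *)
Lemma Gam_asymptotic (sg tau : R) (n : nat) : 0 < sg <= 1 -> (0 < n)%nat ->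
  let a := tau * ln (INR n) in
  let R1 := GamR (sg + INR n + 1) tau in let I1 := GamI (sg + INR n + 1) tau in
  let q := / (Rpower (INR n) sg * INR (fact n)) in
  Rabs (q * (cos a * R1 + sin a * I1) - 1) <= 18 * (1 + Rabs tau) / sqrt (INR n) /\
  Rabs (q * (cos a * I1 - sin a * R1)) <= 18 * (1 + Rabs tau) / sqrt (INR n).
Proof.
  intros Hs Hn a R1 I1 q. set (N := INR n) in *.
  assert (HN : 1 <= N) by (unfold N; apply (le_INR 1); lia).
  assert (Hf : 0 < INR (fact n)) by apply INR_fact_lt_0.
  set (f := INR (fact n)) in *.
  assert (HP : 0 < Rpower N sg) by apply Rpower_pos.
  set (lam := sqrt N). assert (Hlam : 0 < lam) by (apply sqrt_lt_R0; lra).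
  assert (Hl2 : lam * lam = N) by (apply sqrt_sqrt; lra).
  destruct (IG_dev_poly n lam Hn Hlam) as (l & Hl & Bl). fold N in Hl, Bl. fold f in Bl.
  assert (Bl2 : l <= f * (18 / lam)).
  { eapply Rle_trans; [exact Bl|]. apply Rmult_le_compat_l; [lra|]. rewrite <- Hl2. right. field. lra. }
  assert (HR : IG (gR (sg + N + 1) tau) R1) by (apply IG_GamR; lra).
  assert (HI : IG (gI (sg + N + 1) tau) I1) by (apply IG_GamI; lra).
  assert (H0 : IG (fun x => Rpower x N * exp (- x)) f).
  { unfold f. rewrite <- GamR_nat. eapply IG_ext; [|apply IG_GamR; fold N; lra]. intros x Hx. unfold gR. fold N.
    rewrite Rmult_0_l, cos_0, Rmult_1_r. do 2 f_equal. ring. }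
  assert (Pw : forall x, 0 < x -> Rpower x (sg + N + 1 - 1) / Rpower N sg = Rpower x N * Rpower (x / N) sg).
  { intros x Hx. replace (sg + N + 1 - 1) with (N + sg) by ring. rewrite Rpower_plus.
    replace (Rpower x sg) with (Rpower (x / N) sg * Rpower N sg).
    - field. lra.
    - rewrite Rpower_mult_distr by (try apply Rdiv_lt_0_compat; lra). f_equal. field. lra. }
  assert (Pn : forall x, 0 < x -> Rpower x N = Rpower x (N - 1) * (N * (x / N))).
  { intros x Hx. replace N with (N - 1 + 1) at 1 by ring. rewrite Rpower_plus, Rpower_1 by auto. field. lra. }
  assert (Ln : forall x, 0 < x -> tau * ln (x / N) = tau * ln x - a).
  { intros x Hx. unfold a. rewrite ln_div by lra. ring. }
  assert (Bq : forall z, Rabs z <= (1 + Rabs tau) * l -> Rabs (/ f * z) <= 18 * (1 + Rabs tau) / lam).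
  { intros z Hz. rewrite Rabs_mult, (Rabs_right (/ f)) by (left; apply Rinv_0_lt_compat; auto).
    apply (Rmult_le_reg_l f); auto. rewrite <- Rmult_assoc, Rinv_r, Rmult_1_l by lra.
    eapply Rle_trans; [exact Hz|]. apply Rle_trans with ((1 + Rabs tau) * (f * (18 / lam))).
    - apply Rmult_le_compat_l; auto. pose proof (Rabs_pos tau); lra.
    - right. field. lra. }
  assert (Dom : forall x d, 0 < x -> x / N * Rabs d <= (1 + Rabs tau) * dev_poly lam (x / N) ->
     Rabs (Rpower x N * exp (- x) * d) <= (1 + Rabs tau) * (N * (Rpower x (N - 1) * exp (- x) * dev_poly lam (x / N)))).
  { intros x d Hx Hd. pose proof (exp_pos (- x)). pose proof (Rpower_pos x (N - 1)). pose proof (Rpower_pos x N).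
    rewrite Rabs_mult, (Rabs_right (_ * _)) by (apply Rle_ge, Rmult_le_pos; lra).
    rewrite (Pn x Hx).
    replace (Rpower x (N - 1) * (N * (x / N)) * exp (- x) * Rabs d) with (N * (Rpower x (N - 1) * exp (- x)) * (x / N * Rabs d)) by ring.
    replace ((1 + Rabs tau) * (N * (Rpower x (N - 1) * exp (- x) * dev_poly lam (x / N)))) with
      (N * (Rpower x (N - 1) * exp (- x)) * ((1 + Rabs tau) * dev_poly lam (x / N))) by ring.
    apply Rmult_le_compat_l; auto. apply Rmult_le_pos; [lra|apply Rmult_le_pos; lra]. }
  assert (Hlt := IG_scal _ (1 + Rabs tau) _ Hl). cbv beta in Hlt.
  split.
  - replace (q * (cos a * R1 + sin a * I1) - 1) with (/ f * (/ Rpower N sg * (cos a * R1 + sin a * I1) - f)) by (unfold q; field; lra).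
    apply Bq.
    assert (E := IG_minus _ _ _ _ (IG_scal _ (/ Rpower N sg) _ (IG_plus _ _ _ _ (IG_scal _ (cos a) _ HR) (IG_scal _ (sin a) _ HI))) H0).
    cbv beta in E. apply (IG_abs_le _ _ _ _ ) with (2 := E) (3 := Hlt). intros x Hx.
    assert (Hy : 0 < x / N) by (apply Rdiv_lt_0_compat; lra).
    destruct (phase_deviation sg tau lam (x / N) Hy Hs Hlam) as [D _].
    apply Dom in D; auto. eapply Rle_trans; [|exact D]. right. f_equal.
    unfold gR, gI. rewrite (Ln x Hx), cos_minus.
    replace (Rpower x N * exp (- x) * (Rpower (x / N) sg * (cos (tau * ln x) * cos a + sin (tau * ln x) * sin a) - 1)) with
     ((Rpower x N * Rpower (x / N) sg) * (exp (- x) * (cos (tau * ln x) * cos a + sin (tau * ln x) * sin a)) - Rpower x N * exp (- x)) by ring.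
    rewrite <- (Pw x Hx). field. lra.
  - replace (q * (cos a * I1 - sin a * R1)) with (/ f * (/ Rpower N sg * (cos a * I1 - sin a * R1))) by (unfold q; field; lra).
    apply Bq.
    assert (E := IG_scal _ (/ Rpower N sg) _ (IG_minus _ _ _ _ (IG_scal _ (cos a) _ HI) (IG_scal _ (sin a) _ HR))).
    cbv beta in E. apply (IG_abs_le _ _ _ _ ) with (2 := E) (3 := Hlt). intros x Hx.
    assert (Hy : 0 < x / N) by (apply Rdiv_lt_0_compat; lra).
    destruct (phase_deviation sg tau lam (x / N) Hy Hs Hlam) as [_ D].
    apply Dom in D; auto. eapply Rle_trans; [|exact D]. right. f_equal.
    unfold gR, gI. rewrite (Ln x Hx), sin_minus.
    replace (Rpower x N * exp (- x) * (Rpower (x / N) sg * (sin (tau * ln x) * cos a - cos (tau * ln x) * sin a))) with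
     ((Rpower x N * Rpower (x / N) sg) * (exp (- x) * (sin (tau * ln x) * cos a - cos (tau * ln x) * sin a))) by ring.
    rewrite <- (Pw x Hx). field. lra.
Qed.

(** * The argument of Gamma and the branch of theta *)

Lemma polar_factor (x y : R) : 0 < x ->
  let r := sqrt (x ^ 2 + y ^ 2) in let b := atan (y / x) in
  0 < r /\ x = r * cos b /\ y = r * sin b.
Proof.
  intros Hx r b. assert (Hr : 0 < r) by (apply sqrt_lt_R0; nra).
  assert (E : sqrt (1 + (y / x)²) = r / x).
  { unfold r. transitivity (sqrt (x ^ 2 + y ^ 2) / sqrt (x ^ 2)); [|rewrite sqrt_pow2 by lra; reflexivity].
    rewrite <- sqrt_div_alt by nra. f_equal. unfold Rsqr. field. lra. }
  split; auto. unfold b. rewrite cos_atan, sin_atan, E. split; field; lra.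
Qed.

(** Each factor j + sg + i tau of the iterated functional equation adds its argument arctan (tau /
    (j + sg)); the moduli are collected in an unspecified r > 0. *)
Lemma Gam_product (sg tau : R) (n : nat) : 0 < sg ->
  let S := sum_n (fun j => atan (tau / (INR j + sg))) n in
  exists r, 0 < r /\
    GamR (sg + INR n + 1) tau = r * (cos S * GamR sg tau - sin S * GamI sg tau) /\
    GamI (sg + INR n + 1) tau = r * (cos S * GamI sg tau + sin S * GamR sg tau).
Proof.
  intros Hs. induction n as [|n IH]; intros S.
  - unfold S. rewrite sum_O. simpl INR. rewrite Rplus_0_l, Rplus_0_r.
    destruct (polar_factor sg tau Hs) as (Hr & E1 & E2). destruct (Gam_succ sg tau Hs) as [G1 G2].
    exists (sqrt (sg ^ 2 + tau ^ 2)). split; auto. rewrite G1, G2.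
    set (r := sqrt _) in *. set (b := atan _) in *. set (X := GamR sg tau). set (Y := GamI sg tau).
    replace (r * (cos b * X - sin b * Y)) with ((r * cos b) * X - (r * sin b) * Y) by rring.
    replace (r * (cos b * Y + sin b * X)) with ((r * cos b) * Y + (r * sin b) * X) by rring.
    rewrite <- E1, <- E2. auto.
  - destruct IH as (r & Hr & E1 & E2). pose proof (pos_INR n) as Hn.
    destruct (polar_factor (INR (Datatypes.S n) + sg) tau) as (Hr' & F1 & F2). { rewrite S_INR; lra. }
    destruct (Gam_succ (sg + INR n + 1) tau) as [G1 G2]; [lra|].
    unfold S. rewrite sum_SnR. set (S0 := sum_n _ n) in *. set (b := atan _) in *. set (r' := sqrt _) in *.
    replace (sg + INR (Datatypes.S n) + 1) with (sg + INR n + 1 + 1) by (rewrite S_INR; rring).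
    exists (r * r'). split; [nra|]. rewrite G1, G2, E1, E2.
    set (X := GamR sg tau). set (Y := GamI sg tau). rewrite cos_plus, sin_plus.
    replace (sg + INR n + 1) with (INR (Datatypes.S n) + sg) by (rewrite S_INR; rring).
    split.
    - transitivity (r * ((r' * cos b) * (cos S0 * X - sin S0 * Y) - (r' * sin b) * (cos S0 * Y + sin S0 * X))); [|rring].
      rewrite <- F1, <- F2. rring.
    - transitivity (r * ((r' * cos b) * (cos S0 * Y + sin S0 * X) + (r' * sin b) * (cos S0 * X - sin S0 * Y))); [|rring].
      rewrite <- F1, <- F2. rring.
Qed.

(** The unknown modulus cancels in tan D = (rho sin D) / (rho cos D). *)
Lemma tan_small (D e : R) : Rabs D < PI / 2 -> 0 <= e <= / 2 -> forall rho,
  Rabs (rho * cos D - 1) <= e -> Rabs (rho * sin D) <= e -> Rabs D <= 2 * e.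
Proof.
  intros HD He rho H1 H2. apply Rabs_def2 in HD. apply Rabs_le_between in H1.
  assert (Hc : 0 < cos D) by (apply cos_gt_0; lra).
  assert (T : Rabs (tan D) <= 2 * e).
  { unfold tan. assert (Hrho : rho <> 0) by (intros ->; lra).
    replace (sin D / cos D) with (rho * sin D * / (rho * cos D)) by (field; split; lra).
    rewrite Rabs_mult, (Rabs_right (/ _)) by (left; apply Rinv_0_lt_compat; lra).
    apply Rle_trans with (e * / / 2); [|right; field].
    apply Rmult_le_compat; auto. apply Rabs_pos. left; apply Rinv_0_lt_compat; lra.
    apply Rinv_le_contravar; lra. }
  rewrite <- (atan_tan D) by lra. eapply Rle_trans; [|exact T].
  destruct (MVT_gen atan 0 (tan D) (fun x => / (1 + x ^ 2))) as (c & _ & Ec).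
  - intros x _. evar_last. apply is_derive_atan. unfold Rsqr. f_equal; rring.
  - intros x _. apply continuity_pt_filterlim, continuous_atan.
  - rewrite atan_0, !Rminus_0_r in Ec. rewrite Ec, Rabs_mult. pose proof (w0_bound c). pose proof (Rabs_pos (tan D)). nra.
Qed.

(** Selection of the branch: a continuous path that starts at 0 and keeps its cosine positive never
    reaches pi / 2 or - pi / 2. *)
Lemma continuous_small (D : R -> R) (t : R) : 0 <= t -> (forall s, continuous D s) -> D 0 = 0 ->
  (forall s, 0 <= s <= t -> 0 < cos (D s)) -> Rabs (D t) < PI / 2.
Proof.
  intros Ht HD H0 Hc. pose proof PI_RGT_0 as HP.
  destruct (Rlt_le_dec (Rabs (D t)) (PI / 2)) as [|L]; auto. exfalso.
  assert (Cy : continuity (fun s => Rabs (D s))).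
  { intros s. apply continuity_pt_filterlim. apply (continuous_comp D Rabs); auto. apply continuous_Rabs. }
  destruct (IVT_gen (fun s => Rabs (D s)) 0 t (PI / 2) Cy) as (s & Hs & E).
  - rewrite H0, Rabs_R0. rewrite Rmin_left, Rmax_right by lra. lra.
  - rewrite Rmin_left, Rmax_right in Hs by lra. specialize (Hc s Hs).
    assert (C : cos (D s) = cos (PI / 2)).
    { rewrite <- E. unfold Rabs. destruct (Rcase_abs (D s)); auto. rewrite cos_neg; auto. }
    rewrite C, cos_PI2 in Hc. lra.
Qed.

Lemma Gamma_parts (sg tau : R) : Gamma (sg, tau) = (GamR sg tau, GamI sg tau).
Proof. reflexivity. Qed.

(** The error bound at s <= t is dominated by the one at t, so for large n the phase error has
    positive cosine along all of [0, t]; [continuous_small] then places it in the principal branch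
    and [tan_small] makes it small. *)
Lemma theta_limit (theta : R -> R) (t : R) : is_RS_theta theta -> 0 < t ->
  is_lim_seq (fun n => t / 2 * ln (INR (S n)) - sum_n (fun j => atan (t / 2 / (INR j + / 4))) n)
    (theta t + t / 2 * ln PI).
Proof.
  intros (Th0 & ThC & ThG) Ht. pose proof PI_RGT_0 as HP.
  set (Th := fun t => theta t + t / 2 * ln PI).
  set (S := fun n t => sum_n (fun j => atan (t / 2 / (INR j + / 4))) n).
  set (e := fun n : nat => 18 * (1 + Rabs (t / 2)) / sqrt (INR n)).
  assert (Key : forall n s, (0 < n)%nat -> 0 <= s <= t -> exists rho, 0 <= rho /\
     Rabs (rho * cos (Th s + S n s - s / 2 * ln (INR n)) - 1) <= e n /\
     Rabs (rho * sin (Th s + S n s - s / 2 * ln (INR n))) <= e n).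
  { intros n s Hn Hs.
    pose proof (ThG s) as G. replace (1 / 4) with (/ 4) in G by field. rewrite Gamma_parts in G. unfold polar in G.
    set (m := Cmod _) in G. injection G as G1 G2. fold (Th s) in G1, G2.
    destruct (Gam_product (/ 4) (s / 2) n ltac:(lra)) as (r & Hr & E1 & E2). fold (S n s) in E1, E2.
    destruct (Gam_asymptotic (/ 4) (s / 2) n ltac:(lra) Hn) as [A1 A2].
    rewrite E1, E2, G1, G2 in A1, A2.
    set (q := / _) in A1, A2. set (a := s / 2 * ln (INR n)) in *.
    assert (He : 18 * (1 + Rabs (s / 2)) / sqrt (INR n) <= e n).
    { unfold e, Rdiv. apply Rmult_le_compat_r; [left; apply Rinv_0_lt_compat, sqrt_lt_R0, lt_0_INR; auto|].
      rewrite !Rabs_right; lra. }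
    exists (q * (r * m)). unfold Rminus at 2 3. rewrite !(cos_plus (Th s + S n s)), !(sin_plus (Th s + S n s)), cos_neg, sin_neg, cos_plus, sin_plus.
    split.
    { apply Rmult_le_pos; [|apply Rmult_le_pos; [lra|apply Cmod_ge_0]].
      left; apply Rinv_0_lt_compat, Rmult_lt_0_compat; [apply Rpower_pos|apply INR_fact_lt_0]. }
    split; (eapply Rle_trans; [|exact He]).
    - eapply Rle_trans; [|exact A1]. right. f_equal. rring.
    - eapply Rle_trans; [|exact A2]. right. f_equal. rring. }
  assert (Le : is_lim_seq e 0).
  { unfold e, Rdiv. replace (Finite 0) with (Rbar_mult (18 * (1 + Rabs (t * / 2))) (Rbar_inv p_infty)) by (simpl; f_equal; rring).
    apply is_lim_seq_scal_l. apply is_lim_seq_inv; [|discriminate].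
    apply (filterlim_comp _ _ _ INR sqrt _ (Rbar_locally p_infty)). apply is_lim_seq_INR. apply filterlim_sqrt_p. }
  assert (Ev : eventually (fun n => (0 < n)%nat /\ Rabs (Th t + S n t - t / 2 * ln (INR n)) <= 2 * e n)).
  { apply is_lim_seq_spec in Le. destruct (Le (mkposreal (/ 2) ltac:(lra))) as [N0 HN0]. simpl in HN0.
    exists (N0 + 1)%nat. intros n Hn. split; [lia|]. specialize (HN0 n ltac:(lia)). rewrite Rminus_0_r in HN0.
    assert (He : 0 <= e n <= / 2).
    { pose proof (Rle_abs (e n)). split; [|lra]. unfold e. apply Rmult_le_pos; [pose proof (Rabs_pos (t / 2)); lra|].
      left; apply Rinv_0_lt_compat, sqrt_lt_R0, lt_0_INR; lia. }
    destruct (Key n t ltac:(lia) ltac:(lra)) as (rho & _ & K1 & K2).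
    apply tan_small with rho; auto.
    apply (continuous_small (fun s => Th s + S n s - s / 2 * ln (INR n)) t); [lra| | |].
    - intros s. apply (continuous_minus (V := R_NormedModule) (fun s => Th s + S n s)); [|smooth; auto].
      apply (continuous_plus (V := R_NormedModule) Th (S n)).
      + apply (continuous_plus (V := R_NormedModule) theta (fun s => s / 2 * ln PI)). apply ThC. smooth; auto.
      + unfold S. clear. induction n.
        * apply continuous_ext with (fun s => atan (s / 2 / (INR 0 + / 4))). intros; rewrite sum_O; auto. smooth. auto.
        * apply continuous_ext with (fun s => sum_n (fun j => atan (s / 2 / (INR j + / 4))) n + atan (s / 2 / (INR (Datatypes.S n) + / 4))).
          intros; rewrite sum_SnR; auto.
          apply (continuous_plus (V := R_NormedModule) (fun s => sum_n (fun j => atan (s / 2 / (INR j + / 4))) n)); auto.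
          smooth. auto.
    - unfold Th. rewrite Th0. assert (S0 : S n 0 = 0).
      { unfold S. clear. assert (A : forall j, atan (0 / 2 / (INR j + / 4)) = 0).
        { intros j. unfold Rdiv. rewrite !Rmult_0_l. apply atan_0. }
        induction n. rewrite sum_O. apply A. rewrite sum_SnR, IHn, A. rring. }
      rewrite S0. field.
    - intros s Hs. destruct (Key n s ltac:(lia) Hs) as (rho' & Hrho & K1' & _).
      set (D := Th s + S n s - s / 2 * ln (INR n)) in *.
      apply Rabs_le_between in K1'. destruct (Rlt_le_dec 0 (cos D)); auto. nra. }
  assert (L0 : is_lim_seq (fun n => Th t + S n t - t / 2 * ln (INR n)) 0).
  { apply is_lim_seq_abs_0. apply is_lim_seq_le_le_loc with (fun _ => 0) (fun n => 2 * e n).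
    - revert Ev. apply filter_imp. intros n [_ H]. split; auto. apply Rabs_pos.
    - apply is_lim_seq_const.
    - replace (Finite 0) with (Rbar_mult 2 0) by (simpl; f_equal; rring). apply is_lim_seq_scal_l; auto. }
  (* After the shift the sum runs to n + 1 and holds one arctangent more than the statement; that
     term tends to 0. *)
  apply is_lim_seq_incr_1 in L0.
  apply is_lim_seq_ext with (fun n => Th t - (Th t + S (Datatypes.S n) t - t / 2 * ln (INR (Datatypes.S n)))
     + atan (t / 2 * / (INR (Datatypes.S n) + / 4))).
  { intros n. unfold S at 1. rewrite sum_SnR. fold (S n t). change (t / 2 / (INR (Datatypes.S n) + / 4)) with (t / 2 * / (INR (Datatypes.S n) + / 4)). unfold S. rring. }
  fold (Th t). replace (Finite (Th t)) with (Finite (Th t - 0 + 0)) by (f_equal; rring).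
  apply is_lim_seq_plus'.
  - apply is_lim_seq_minus'; auto. apply is_lim_seq_const.
  - rewrite <- atan_0. apply is_lim_seq_continuous. apply continuity_pt_filterlim, continuous_atan.
    replace (Finite 0) with (Rbar_mult (t / 2) (Rbar_inv p_infty)) by (simpl; f_equal; rring).
    apply is_lim_seq_scal_l. apply is_lim_seq_inv; [|discriminate].
    apply (is_lim_seq_plus _ _ p_infty (/ 4) p_infty); [|apply is_lim_seq_const|reflexivity].
    apply (is_lim_seq_incr_1 INR). apply is_lim_seq_INR.
Qed.

Lemma theta_exact (theta : R -> R) (t : R) : is_RS_theta theta -> 0 < t ->
  theta t = t / 2 * (ln (t / (2 * PI)) - 1) - PI / 8 + / 2 * atan (exp (- PI * t))
   + / (2 * PI) * (Series (fun j => Rem (2 * PI * t * INR (S j)) 0 / INR (S j))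
                   - Series (fun j => Rem (4 * PI * t * INR (S j)) 0 / INR (S j))).
Proof.
  intros Hth Ht. pose proof PI_RGT_0 as HP.
  pose proof (theta_limit theta t Hth Ht) as L1.
  destruct (arctan_sum_limit (t / 2) ltac:(lra)) as [_ L2].
  rewrite (is_series_unique _ _ (fcoef_series t Ht)) in L2.
  apply is_lim_seq_unique in L1. apply is_lim_seq_unique in L2. rewrite L1 in L2. apply Rbar_finite_eq in L2.
  replace (t / (2 * PI)) with (t / 2 / PI) by (field; lra). rewrite (ln_div (t / 2) PI) by lra.
  match type of L2 with _ = ?b => replace (theta t) with (b - t / 2 * ln PI) by (rewrite <- L2; rring) end.
  apply Rminus_diag_uniq. field. lra.
Qed.

(** * Functions represented by a power series on a disc *)

Definition conv (e : R) (a : nat -> R) (f : R -> R) : Prop :=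
  forall w, Rabs w < e -> is_pseries a w (f w).

(** Convergence at a point beyond |w| forces the terms to 0 there, which cannot happen outside the
    disc of convergence. *)
Lemma conv_radius (e : R) (a : nat -> R) (f : R -> R) (w : R) :
  conv e a f -> Rabs w < e -> Rbar_lt (Rabs w) (CV_radius a).
Proof.
  intros H Hw. apply Rbar_not_le_lt. intros Hle.
  set (x := (Rabs w + e) / 2).
  assert (Hx : Rabs w < x < e) by (unfold x; lra).
  pose proof (Rabs_pos w) as Hp.
  assert (Ax : Rabs x = x) by (apply Rabs_right; lra).
  apply (CV_disk_outside a x).
  - rewrite Ax. apply Rbar_le_lt_trans with (1 := Hle). simpl. lra.
  - assert (E : ex_series (fun k => scal (pow_n x k) (a k))) by (exists (f x); apply H; lra).
    apply ex_series_lim_0 in E. apply is_lim_seq_ext with (2 := E).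
    intros n. rewrite pow_n_pow. change (x ^ n * a n = a n * x ^ n). ring.
Qed.

Lemma conv_PSeries (e : R) (a : nat -> R) (f : R -> R) (w : R) : conv e a f -> Rabs w < e -> PSeries a w = f w.
Proof. intros H Hw. apply is_pseries_unique. auto. Qed.

Lemma conv_ext (e : R) (a : nat -> R) (f g : R -> R) :
  (forall w, Rabs w < e -> f w = g w) -> conv e a f -> conv e a g.
Proof. intros E H w Hw. rewrite <- E by auto. auto. Qed.

Lemma conv_coef (e : R) (a b : nat -> R) (f : R -> R) :
  (forall n, a n = b n) -> conv e a f -> conv e b f.
Proof. intros E H w Hw. apply is_pseries_ext with a; auto. Qed.

Lemma conv_plus (e : R) (a b : nat -> R) (f g : R -> R) :
  conv e a f -> conv e b g -> conv e (fun n => a n + b n) (fun w => f w + g w).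
Proof. intros Ha Hb w Hw. exact (is_pseries_plus a b w _ _ (Ha w Hw) (Hb w Hw)). Qed.

Lemma conv_scal (e c : R) (a : nat -> R) (f : R -> R) :
  conv e a f -> conv e (fun n => c * a n) (fun w => c * f w).
Proof. intros Ha w Hw. exact (is_pseries_scal c a w _ (Rmult_comm _ _) (Ha w Hw)). Qed.

Lemma conv_mult (e : R) (a b : nat -> R) (f g : R -> R) :
  conv e a f -> conv e b g -> conv e (PS_mult a b) (fun w => f w * g w).
Proof.
  intros Ha Hb w Hw. apply is_pseries_mult; auto; eapply conv_radius; eauto.
Qed.

Lemma conv_incr (e : R) (a : nat -> R) (f : R -> R) : conv e a f -> conv e (PS_incr_1 a) (fun w => w * f w).
Proof. intros Ha w Hw. exact (is_pseries_incr_1 a w _ (Ha w Hw)). Qed.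

Definition cst (c : R) (n : nat) : R := match n with O => c | S _ => 0 end.

Lemma conv_cst (e c : R) : conv e (cst c) (fun _ => c).
Proof.
  intros w _. change (is_lim_seq (sum_n (fun k => scal (pow_n w k) (cst c k))) c).
  apply is_lim_seq_ext with (fun _ => c); [|apply is_lim_seq_const].
  induction n.
  - rewrite sum_O. change (c = 1 * c). ring.
  - rewrite sum_Sn, <- IHn. rewrite pow_n_pow. change (c = c + w ^ S n * 0). ring.
Qed.

Lemma conv_unique (e : R) (a b : nat -> R) (f : R -> R) (n : nat) : 0 < e -> conv e a f -> conv e b f -> a n = b n.
Proof.
  intros He Ha Hb. apply PSeries_ext_recip.
  - rewrite <- Rabs_R0. eapply conv_radius; eauto. rewrite Rabs_R0; auto.
  - rewrite <- Rabs_R0. eapply conv_radius; eauto. rewrite Rabs_R0; auto.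
  - exists (mkposreal e He). intros y Hy. unfold ball in Hy; simpl in Hy.
    unfold AbsRing_ball, abs, minus, plus, opp in Hy; simpl in Hy. rewrite Ropp_0, Rplus_0_r in Hy.
    rewrite (conv_PSeries e a f), (conv_PSeries e b f); auto.
Qed.

Lemma conv_local_eq (e : R) (a : nat -> R) (f : R -> R) (w : R) : conv e a f -> Rabs w < e ->
  locally w (fun x => PSeries a x = f x).
Proof.
  intros H Hw. assert (Hd : 0 < e - Rabs w) by lra. exists (mkposreal _ Hd). intros y Hy.
  unfold ball in Hy; simpl in Hy. unfold AbsRing_ball, abs, minus, plus, opp in Hy; simpl in Hy.
  apply conv_PSeries with e; auto. replace y with (w + (y + - w)) by ring.
  eapply Rle_lt_trans; [apply Rabs_triang|]. lra.
Qed.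

Lemma conv_continuous (e : R) (a : nat -> R) (f : R -> R) (w : R) : conv e a f -> Rabs w < e -> continuous f w.
Proof.
  intros H Hw. apply continuous_ext_loc with (PSeries a).
  - apply conv_local_eq with e; auto.
  - apply continuity_pt_filterlim. apply PSeries_continuity. eapply conv_radius; eauto.
Qed.

Lemma conv_derive (e : R) (a : nat -> R) (f df : R -> R) :
  conv e a f -> (forall w, Rabs w < e -> is_derive f w (df w)) -> conv e (PS_derive a) df.
Proof.
  intros H Hd w Hw. pose proof (conv_radius e a f w H Hw) as Hr.
  replace (df w) with (Derive (PSeries a) w). apply is_pseries_derive; auto.
  apply is_derive_unique. apply is_derive_ext_loc with f; auto.
  apply filter_imp with (2 := conv_local_eq e a f w H Hw). intros; auto.
Qed.

Lemma Rabs_between_0 (w x : R) : Rmin 0 w <= x <= Rmax 0 w -> Rabs x <= Rabs w.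
Proof.
  intros H. unfold Rmin, Rmax in H. destruct (Rle_dec 0 w).
  - rewrite !Rabs_right; lra.
  - rewrite !Rabs_left1; lra.
Qed.

Lemma conv_int (e : R) (a : nat -> R) (f F : R -> R) :
  conv e a f -> (forall w, Rabs w < e -> is_derive F w (f w)) -> F 0 = 0 -> conv e (PS_Int a) F.
Proof.
  intros H Hd H0 w Hw.
  replace (F w) with (PSeries (PS_Int a) w).
  - apply PSeries_correct, CV_radius_inside. rewrite CV_radius_Int. eapply conv_radius; eauto.
  - pose proof (is_RInt_PSeries a w (conv_radius e a f w H Hw)) as I.
    rewrite <- (is_RInt_unique _ _ _ _ I). rewrite (RInt_FTC F).
    + rewrite H0. rring.
    + intros x Hx. apply Rabs_between_0 in Hx. rewrite (conv_PSeries e a f); auto; try lra. apply Hd. lra.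
    + intros x Hx. apply Rabs_between_0 in Hx. apply continuity_pt_filterlim, PSeries_continuity.
      eapply conv_radius; eauto. lra.
Qed.

(** * Taylor polynomials and their remainders *)

Definition psum (a : nat -> R) (w : R) (J : nat) : R := sum_range (fun j => a j * w ^ j) 0 J.

Lemma fold_plus (l : list R) (a : R) : fold_right Rplus a l = fold_right Rplus 0 l + a.
Proof. induction l; simpl; [ring|]. rewrite IHl; ring. Qed.

Lemma sum_range_0 (f : nat -> R) : sum_range f 0 0 = 0.
Proof. reflexivity. Qed.

Lemma sum_range_S (f : nat -> R) (n : nat) : sum_range f 0 (S n) = sum_range f 0 n + f n.
Proof.
  unfold sum_range. rewrite !Nat.sub_0_r, seq_S, map_app, fold_right_app. simpl. rewrite fold_plus. ring.
Qed.

Lemma sum_range_shift (f : nat -> R) (n : nat) : sum_range f 0 (S n) = f 0%nat + sum_range (fun j => f (S j)) 0 n.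
Proof.
  induction n. rewrite sum_range_S, !sum_range_0. ring.
  rewrite sum_range_S, IHn, (sum_range_S (fun j => f (S j))). ring.
Qed.

Lemma sum_range_ext (f g : nat -> R) (n : nat) : (forall j, (j < n)%nat -> f j = g j) -> sum_range f 0 n = sum_range g 0 n.
Proof.
  intros H. induction n; auto. rewrite !sum_range_S, IHn by (intros; apply H; lia). rewrite H by lia. reflexivity.
Qed.

Lemma sum_range_plus (f g : nat -> R) (n : nat) : sum_range (fun j => f j + g j) 0 n = sum_range f 0 n + sum_range g 0 n.
Proof. induction n. rewrite !sum_range_0; ring. rewrite !sum_range_S, IHn. ring. Qed.

Lemma sum_range_scal (f : nat -> R) (c : R) (n : nat) : sum_range (fun j => c * f j) 0 n = c * sum_range f 0 n.
Proof. induction n. rewrite !sum_range_0; ring. rewrite !sum_range_S, IHn. ring. Qed.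

Lemma sum_range_abs (f : nat -> R) (n : nat) : Rabs (sum_range f 0 n) <= sum_range (fun j => Rabs (f j)) 0 n.
Proof.
  induction n. rewrite !sum_range_0, Rabs_R0; lra. rewrite !sum_range_S. eapply Rle_trans; [apply Rabs_triang|]. lra.
Qed.

Lemma sum_range_le (f g : nat -> R) (n : nat) : (forall j, (j < n)%nat -> f j <= g j) -> sum_range f 0 n <= sum_range g 0 n.
Proof.
  intros H. induction n. rewrite !sum_range_0; lra. rewrite !sum_range_S. apply Rplus_le_compat. apply IHn; intros; apply H; lia. apply H; lia.
Qed.

Lemma conv_bounded (e d : R) (a : nat -> R) (f : R -> R) : 0 <= d < e -> conv e a f ->
  exists K, 0 <= K /\ forall w, Rabs w <= d -> Rabs (f w) <= K.
Proof.
  intros Hd H. assert (Ad : Rabs d = d) by (apply Rabs_right; lra).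
  assert (E := CV_disk_inside a d (conv_radius e a f d H ltac:(lra))).
  exists (Series (fun n => Rabs (a n * d ^ n))). split.
  - apply Series_ge0; auto. intros; apply Rabs_pos.
  - intros w Hw. rewrite <- (conv_PSeries e a f w H) by lra.
    apply (Series_dom (fun n => a n * w ^ n)); auto. intros n. rewrite !Rabs_mult. apply Rmult_le_compat_l; [apply Rabs_pos|].
    rewrite <- !RPow_abs, Ad. apply pow_incr. split; auto. apply Rabs_pos.
Qed.

Lemma conv_decr (e : R) (a : nat -> R) (f : R -> R) : 0 < e -> conv e a f ->
  exists g, conv e (fun n => a (S n)) g /\ forall w, Rabs w < e -> f w = a 0%nat + w * g w.
Proof.
  intros He H. set (g := PSeries (fun n => a (S n))).
  assert (C : conv e (fun n => a (S n)) g).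
  { intros w Hw. destruct (Req_dec w 0) as [->|N].
    - unfold g. apply PSeries_correct. apply CV_radius_inside.

      assert (X : ex_pseries (fun n => a (S n)) (e / 2)).
      { eexists. apply (is_pseries_decr_1 a (e / 2) (2 / e)). change (2 / e * (e / 2) = 1). field; lra.
        apply H. rewrite Rabs_right; lra. }
      rewrite Rabs_R0. apply Rbar_not_le_lt. intros Hle.
      apply (CV_disk_outside (fun n => a (S n)) (e / 2)).
      + eapply Rbar_le_lt_trans; [exact Hle|]. simpl. rewrite Rabs_right; lra.
      + apply ex_series_lim_0 in X. apply is_lim_seq_ext with (2 := X).
        intros n. rewrite pow_n_pow. match goal with |- scal ?x ?y = _ => change (x * y = y * x) end. ring.
    - apply PSeries_correct. eexists. apply (is_pseries_decr_1 a w (/ w)). change (/ w * w = 1). field; auto.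
      apply H; auto. }
  exists g. split; auto. intros w Hw.
  rewrite <- (conv_PSeries e a f w H Hw). unfold g.
  rewrite (PSeries_decr_1 a w). reflexivity. exists (f w). exact (H w Hw).
Qed.

(** Induction on J; [conv_decr] factors out one power of w at each step. *)
Lemma conv_tail (e d : R) (J : nat) (a : nat -> R) (f : R -> R) : 0 <= d < e -> conv e a f ->
  exists K, 0 <= K /\ forall w, Rabs w <= d -> Rabs (f w - psum a w J) <= K * Rabs w ^ J.
Proof.
  intros Hd. revert a f. induction J as [|J IH]; intros a f H.
  - destruct (conv_bounded e d a f Hd H) as (K & HK & B). exists K. split; auto. intros w Hw.
    unfold psum. rewrite sum_range_0, Rminus_0_r. simpl. rewrite Rmult_1_r. auto.
  - destruct (conv_decr e a f ltac:(lra) H) as (g & Hg & E). destruct (IH _ _ Hg) as (K & HK & B).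
    exists K. split; auto. intros w Hw. unfold psum. rewrite sum_range_shift, E by lra.
    rewrite (sum_range_ext _ (fun j => w * (a (S j) * w ^ j))) by (intros; simpl; ring).
    rewrite sum_range_scal.
    replace (a 0%nat + w * g w - (a 0%nat * w ^ 0 + w * sum_range (fun j => a (S j) * w ^ j) 0 J))
      with (w * (g w - sum_range (fun j => a (S j) * w ^ j) 0 J)) by (simpl; ring).
    rewrite Rabs_mult. specialize (B w Hw). unfold psum in B. pose proof (Rabs_pos w). simpl.
    apply (Rmult_le_compat_l (Rabs w)) in B; auto. lra.
Qed.

(** Identifies Taylor coefficients obtained by two routes. The constant term is read off at w = 0,
    then one factor w is cancelled. *)
Lemma jet_unique (J : nat) : forall (c : nat -> R) (d K : R), 0 < d ->
  (forall w, Rabs w <= d -> Rabs (psum c w J) <= K * Rabs w ^ J) -> forall j, (j < J)%nat -> c j = 0.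
Proof.
  induction J as [|J IH]; intros c d K Hd H j Hj; [lia|].
  assert (E : forall w, psum c w (S J) = c 0%nat + w * psum (fun j => c (S j)) w J).
  { intros w. unfold psum. rewrite sum_range_shift. rewrite (sum_range_ext _ (fun j => w * (c (S j) * w ^ j))) by (intros; simpl; ring).
    rewrite sum_range_scal. simpl. ring. }
  assert (C0 : c 0%nat = 0).
  { specialize (H 0). rewrite E, Rabs_R0, Rmult_0_l, Rplus_0_r in H. simpl in H. rewrite Rmult_0_l, Rmult_0_r in H.
    specialize (H ltac:(lra)). pose proof (Rabs_pos (c 0%nat)). destruct (Req_dec (c 0%nat) 0); auto.
    apply Rabs_pos_lt in H1. lra. }
  destruct j; auto.
  apply (IH (fun j => c (S j)) d (Rabs K) Hd); [|lia].
  (* the bound at w = 0 follows from continuity when J = 0, and otherwise from nearby points *)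
  assert (B : forall w, Rabs w <= d -> w <> 0 -> Rabs (psum (fun j => c (S j)) w J) <= Rabs K * Rabs w ^ J).
  { intros w Hw N. specialize (H w Hw). rewrite E, C0, Rplus_0_l, Rabs_mult in H. simpl in H.
    assert (0 < Rabs w) by (apply Rabs_pos_lt; auto).
    apply (Rmult_le_reg_l (Rabs w)); auto. pose proof (Rle_abs K). pose proof (pow_le (Rabs w) J (Rabs_pos w)).
    eapply Rle_trans; [exact H|]. replace (K * (Rabs w * Rabs w ^ J)) with (Rabs w * (K * Rabs w ^ J)) by ring.
    apply Rmult_le_compat_l; [lra|]. apply Rmult_le_compat_r; auto. }
  intros w Hw. destruct (Req_dec w 0) as [->|N]; auto.
  destruct J as [|J].
  - unfold psum. rewrite sum_range_0, Rabs_R0. simpl. pose proof (Rabs_pos K). lra.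
  - assert (E1 : psum (fun j => c (S j)) 0 (S J) = c 1%nat).
    { unfold psum. rewrite sum_range_shift. rewrite (sum_range_ext _ (fun j => 0)).
      - replace (sum_range (fun _ => 0) 0 J) with 0. simpl; ring.
        symmetry. clear. induction J. apply sum_range_0. rewrite sum_range_S, IHJ. ring.
      - intros; simpl; ring. }
    rewrite E1, Rabs_R0. simpl. rewrite Rmult_0_l, Rmult_0_r.
    apply le_epsilon. intros t Ht.
    set (p := fun w => psum (fun j => c (S j)) w (S J)).
    assert (Cp : continuous p 0).
    { unfold p, psum. clear. induction (S J) as [|n IH].
      - apply continuous_const.
      - apply continuous_ext with (fun w => sum_range (fun j => c (S j) * w ^ j) 0 n + c (S n) * w ^ n).
        intros; symmetry; apply sum_range_S. apply (continuous_plus (V := R_NormedModule) (fun w => sum_range (fun j => c (S j) * w ^ j) 0 n)); auto.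
        smooth. auto. }
    set (L := Rabs K + 1).
    destruct (proj1 (filterlim_locally _ _) Cp (mkposreal (t / 2) ltac:(lra))) as [d1 Hd1].
    (* The last two entries make the bound K w^(J+1) at most t / 2; d1 / 2 does the same for the
       variation of [p] from 0. *)
    assert (Hm : 0 < Rmin (Rmin d (d1 / 2)) (Rmin 1 (t / (2 * L)))).
    { pose proof (cond_pos d1). pose proof (Rabs_pos K). repeat apply Rmin_glb_lt; try lra.
      apply Rdiv_lt_0_compat; unfold L; lra. }
    set (w := Rmin (Rmin d (d1 / 2)) (Rmin 1 (t / (2 * L)))) in *.
    assert (Rabs w = w) by (apply Rabs_right; lra).
    assert (w <= d) by (unfold w; eapply Rle_trans; [apply Rmin_l|apply Rmin_l]).
    assert (w <= d1 / 2) by (unfold w; eapply Rle_trans; [apply Rmin_l|apply Rmin_r]).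
    assert (w <= 1) by (unfold w; eapply Rle_trans; [apply Rmin_r|apply Rmin_l]).
    assert (w <= t / (2 * L)) by (unfold w; eapply Rle_trans; [apply Rmin_r|apply Rmin_r]).
    specialize (B w ltac:(lra) ltac:(lra)). specialize (Hd1 w).
    unfold ball in Hd1; simpl in Hd1. unfold AbsRing_ball, abs, minus, plus, opp in Hd1; simpl in Hd1.
    pose proof (cond_pos d1). specialize (Hd1 ltac:(rewrite Ropp_0, Rplus_0_r; lra)).
    fold (p w) in B. unfold p in Hd1 at 2. rewrite E1 in Hd1.
    assert (w ^ S J <= w). { simpl. rewrite <- (Rmult_1_r w) at 3. apply Rmult_le_compat_l; [lra|]. rewrite <- (pow1 J). apply pow_incr; lra. }
    assert (Rabs K * Rabs w ^ S J <= t / 2).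
    { rewrite H0. apply Rle_trans with (L * w).
      - unfold L. pose proof (Rabs_pos K). pose proof (pow_le w (S J) ltac:(lra)). nra.
      - apply Rle_trans with (L * (t / (2 * L))). apply Rmult_le_compat_l; [unfold L; pose proof (Rabs_pos K); lra|auto].
        right. field. unfold L; pose proof (Rabs_pos K); lra. }
    replace (c 1%nat) with (p w + - (p w + - c 1%nat)) by ring.
    eapply Rle_trans; [apply Rabs_triang|]. rewrite Rabs_Ropp. lra.
Qed.

(** Each remainder is the derivative of the next one, so the mean value theorem propagates the
    bound. *)
Lemma exp_taylor (J : nat) (x : R) :
  Rabs (exp x - sum_range (fun i => x ^ i / INR (fact i)) 0 J) <= Rabs x ^ J * exp (Rabs x).
Proof.
  revert x. induction J as [|J IH]; intros x.
  - rewrite sum_range_0, Rminus_0_r. simpl. rewrite Rmult_1_l, Rabs_right by (left; apply exp_pos). apply exp_le, Rle_abs.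
  - set (f := fun J x => exp x - sum_range (fun i => x ^ i / INR (fact i)) 0 J).
    assert (D : forall J x, is_derive (f (S J)) x (f J x)).
    { clear. intros J. induction J; intros x; unfold f.
      - apply is_derive_ext with (fun x => exp x - 1). { intros t. rewrite sum_range_S, sum_range_0. simpl. field. }
        rewrite sum_range_0. auto_derive; auto. ring.
      - apply is_derive_ext with (fun x => f (S J) x - x ^ (S J) / INR (fact (S J))).
        { intros t. unfold f. rewrite (sum_range_S _ (S J)). rring. }
        evar_last. apply (is_derive_minus (f (S J)) (fun x => x ^ (S J) / INR (fact (S J))) x (f J x) (x ^ J / INR (fact J))).
        apply IHJ. pose proof (INR_fact_lt_0 J). rewrite fact_simpl, mult_INR. pose proof (lt_0_INR (S J) ltac:(lia)).
        set (k := INR (S J)) in *. set (F := INR (fact J)) in *.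
        apply is_derive_ext with (fun x => / (k * F) * x ^ S J). { intros; unfold Rdiv; rring. }
        assert (Dp : is_derive (fun x => x ^ S J) x (k * x ^ J)).
        { unfold k. evar_last. apply (is_derive_pow (fun x => x) (S J) x 1). apply (is_derive_id x). simpl pred. ring. }
        evar_last. apply (is_derive_scal _ x (/ (k * F)) _ Dp). field. lra.
        match goal with |- minus ?a ?b = ?r => change (a - b = r) end. unfold f. rewrite sum_range_S. ring. }
    destruct (MVT_gen (f (S J)) 0 x (f J)) as (c & Hc & E).
    + intros; apply D.
    + intros y _. apply continuity_pt_filterlim. apply (ex_derive_continuous (V := R_NormedModule) (f (S J))). eexists; apply D.
    + apply Rabs_between_0 in Hc.
      assert (f0 : f (S J) 0 = 0).
      { unfold f. rewrite exp_0, sum_range_shift, (sum_range_ext _ (fun _ => 0 * 0)).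
        rewrite sum_range_scal. simpl; field. intros; simpl; unfold Rdiv; ring. }
      rewrite f0, !Rminus_0_r in E. fold (f (S J) x). rewrite E, Rabs_mult. specialize (IH c). fold (f J c) in IH.
      rewrite Rmult_comm. simpl. rewrite Rmult_assoc. apply Rmult_le_compat_l; [apply Rabs_pos|].
      eapply Rle_trans; [exact IH|]. apply Rmult_le_compat.
      apply pow_le, Rabs_pos. left; apply exp_pos. apply pow_incr; split; auto; apply Rabs_pos. apply exp_le; auto.
Qed.

(** * Gaussian moments *)

Definition Gs (x : R) : R := RInt (fun v => exp (- (v * v))) 0 x.
(** The auxiliary integral of the classical real-variable evaluation of the Gaussian: its derivative
    is opposite to that of [Gs x ^ 2]. *)
Definition Es (x : R) : R := RInt (fun v => exp (- (x * x * (1 + v ^ 2))) * / (1 + v ^ 2)) 0 1.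

Lemma gauss_cont (x : R) : continuous (fun v => exp (- (v * v))) x.
Proof. smooth; auto. Qed.

Lemma Gs_derive (x : R) : is_derive Gs x (exp (- (x * x))).
Proof.
  apply (is_derive_RInt (fun v => exp (- (v * v))) Gs 0 x).
  - apply filter_forall. intros y. apply (RInt_correct (fun v => exp (- (v * v)))). apply ex_RInt_cont. intros; apply gauss_cont.
  - apply gauss_cont.
Qed.

Lemma Es_derive (x : R) : is_derive Es x (- 2 * exp (- (x * x)) * Gs x).
Proof.
  evar_last.
  - apply (is_derive_param (fun x v => exp (- (x * x * (1 + v ^ 2))) * / (1 + v ^ 2)) (fun x v => - 2 * x * exp (- (x * x * (1 + v ^ 2))))).
    + intros u v. pose proof (one_plus_sq v). auto_derive; auto. change (v * (v * 1)) with (v ^ 2). field. lra.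
    + intros v _. unfold pow. c2d.
    + intros u v _. smooth. pose proof (one_plus_sq v). simpl in *; lra.
  - assert (C : RInt (fun v => exp (- (v * v))) (x * 0 + 0) (x * 1 + 0) = RInt (fun v => x * exp (- ((x * v + 0) * (x * v + 0)))) 0 1).
    { symmetry. apply (RInt_comp_lin (fun v => exp (- (v * v)))). apply ex_RInt_cont. intros; apply gauss_cont. }
    replace (x * 0 + 0) with 0 in C by rring. replace (x * 1 + 0) with x in C by rring. unfold Gs. rewrite C.
    rewrite <- RInt_mulc by (apply ex_RInt_cont; intros; smooth; auto).
    apply RInt_ext. intros v _.
    replace (- (x * x * (1 + v ^ 2))) with (- (x * x) + - ((x * v + 0) * (x * v + 0))) by rring. rewrite exp_plus. rring.
Qed.

Lemma gauss_identity (x : R) : Gs x ^ 2 + Es x = PI / 4.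
Proof.
  assert (D : forall y, is_derive (fun x => Gs x ^ 2 + Es x) y 0).
  { intros y. evar_last. apply (is_derive_plus (fun x => Gs x ^ 2) Es). apply (is_derive_pow Gs 2). apply Gs_derive. apply Es_derive.
    match goal with |- plus ?a ?b = ?r => change (a + b = r) end. simpl. rring. }
  assert (E0 : Gs 0 ^ 2 + Es 0 = PI / 4).
  { unfold Gs, Es. rewrite RInt_point. rewrite (RInt_ext _ (fun v => / (1 + v ^ 2))).
    - rewrite RInt_weight_atan, atan_1. change (0 ^ 2 + PI / 4 = PI / 4). rring.
    - intros v _. rewrite !Rmult_0_l, Ropp_0, exp_0. rring. }
  rewrite <- E0. destruct (MVT_gen (fun x => Gs x ^ 2 + Es x) 0 x (fun _ => 0)) as (c & _ & E).
  - intros; apply D.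
  - intros y _. apply continuity_pt_filterlim. apply (ex_derive_continuous (V := R_NormedModule) (fun x => Gs x ^ 2 + Es x)). eexists; apply D.
  - lra.
Qed.

(** With p = sqrt pi / 2 >= 1/2, the identity reads (p - Gs) (p + Gs) = Es, and Es <= exp (-
    x^2). *)
Lemma gauss_bound (x : R) : 0 <= x -> Rabs (Gs x - sqrt PI / 2) <= 2 * exp (- (x * x)).
Proof.
  intros Hx. pose proof PI_RGT_0 as HP. pose proof (gauss_identity x) as I.
  assert (E : 0 <= Es x <= exp (- (x * x))).
  { split.
    - apply RInt_ge_0; [lra|apply ex_RInt_cont; intros v _; smooth; pose proof (one_plus_sq v); simpl in *; lra|].
      intros v _. apply Rmult_le_pos. left; apply exp_pos. left; apply Rinv_0_lt_compat, one_plus_sq.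
    - replace (exp (- (x * x))) with (RInt (fun _ => exp (- (x * x))) 0 1) by (rewrite RInt_const; change ((1 - 0) * exp (- (x * x)) = exp (- (x * x))); rring).
      apply RInt_le; [lra|apply ex_RInt_cont; intros v _; smooth; pose proof (one_plus_sq v); simpl in *; lra|apply ex_RInt_const|].
      intros v _. pose proof (w0_bound v) as W. rewrite Rabs_right in W by (left; apply Rinv_0_lt_compat, one_plus_sq).
      assert (0 < / (1 + v ^ 2)) by (apply Rinv_0_lt_compat, one_plus_sq).
      assert (exp (- (x * x * (1 + v ^ 2))) <= exp (- (x * x))) by (apply exp_le; nra).
      pose proof (exp_pos (- (x * x * (1 + v ^ 2)))). nra. }
  assert (G : 0 <= Gs x).
  { apply RInt_ge_0; [lra|apply ex_RInt_cont; intros; apply gauss_cont|]. intros; left; apply exp_pos. }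
  set (p := sqrt PI / 2).
  assert (Hp : p * p = PI / 4) by (unfold p; replace (sqrt PI / 2 * (sqrt PI / 2)) with (sqrt PI * sqrt PI / 4) by field; rewrite sqrt_sqrt by lra; reflexivity).
  assert (Hp0 : / 2 <= p). { unfold p. assert (1 <= sqrt PI). { rewrite <- sqrt_1. apply sqrt_le_1; try lra. pose proof PI2_1; lra. } lra. }
  assert (Q : (p - Gs x) * (p + Gs x) = Es x) by nra.
  rewrite Rabs_minus_sym. apply Rabs_le. split; nra.
Qed.

Lemma pow_le_exp (p : nat) : forall k, 0 < k -> exists C, 0 < C /\ forall x, 0 <= x -> x ^ p <= C * exp (k * x).
Proof.
  induction p as [|p IH]; intros k Hk.
  - exists 1. split; [lra|]. intros x Hx. simpl. rewrite Rmult_1_l. rewrite <- exp_0. apply exp_le. nra.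
  - destruct (IH (k / 2) ltac:(lra)) as (C & HC & H). exists (C * (2 / k)).
    assert (0 < 2 / k) by (apply Rdiv_lt_0_compat; lra). split; [nra|].
    intros x Hx. specialize (H x Hx). simpl.
    assert (X : x <= 2 / k * exp (k / 2 * x)).
    { pose proof (exp_ge_1 (k / 2 * x)) as E. apply (Rmult_le_compat_l (2 / k)) in E; [|lra].
      replace (2 / k * (1 + k / 2 * x)) with (2 / k + x) in E by (field; lra). lra. }
    replace (k * x) with (k / 2 * x + k / 2 * x) by field. rewrite exp_plus.
    replace (C * (2 / k) * (exp (k / 2 * x) * exp (k / 2 * x))) with ((2 / k * exp (k / 2 * x)) * (C * exp (k / 2 * x))) by rring.
    apply Rmult_le_compat; auto. apply pow_le; auto.
Qed.

Definition moment (e s : R) (j : nat) : R := RInt (fun w => w ^ (2 * j) * exp (- (s * w ^ 2 / 2))) 0 e.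

(* [rfact j] is [Gamma (j + 1/2) / Gamma (1/2)]. *)
Fixpoint rfact (j : nat) : R := match j with O => 1 | S j => (INR j + / 2) * rfact j end.

Lemma moment_cont (s : R) (j : nat) (w : R) : continuous (fun w => w ^ j * exp (- (s * w ^ 2 / 2))) w.
Proof. smooth; auto. Qed.

Lemma rfact_pos (j : nat) : 0 < rfact j.
Proof. induction j; simpl; [lra|]. pose proof (pos_INR j). nra. Qed.

Lemma moment_succ (e s : R) (j : nat) : 0 < s ->
  moment e s (S j) = (INR j + / 2) * (2 / s) * moment e s j - e ^ (2 * j + 1) * exp (- (s * e ^ 2 / 2)) / s.
Proof.
  intros Hs. unfold moment.
  assert (I : RInt (fun w => (2 * INR j + 1) * (w ^ (2 * j) * exp (- (s * w ^ 2 / 2))) - s * (w ^ (2 * S j) * exp (- (s * w ^ 2 / 2)))) 0 e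
     = e ^ (2 * j + 1) * exp (- (s * e ^ 2 / 2))).
  { rewrite (RInt_FTC (fun w => w ^ (2 * j + 1) * exp (- (s * w ^ 2 / 2)))).
    - rewrite (pow_i (2 * j + 1)) by lia. rring.
    - intros w _. evar_last.
      + apply (is_derive_mult (fun w => w ^ (2 * j + 1)) (fun w => exp (- (s * w ^ 2 / 2))) w ((2 * INR j + 1) * w ^ (2 * j)) (- (s * w) * exp (- (s * w ^ 2 / 2)))).
        * evar_last. apply (is_derive_pow (fun x => x) (2 * j + 1) w 1). apply (is_derive_id w).
          replace (Init.Nat.pred (2 * j + 1)) with (2 * j)%nat by lia. rewrite plus_INR, mult_INR. simpl (INR 2). simpl (INR 1). rring.
        * auto_derive; auto. change (s * (w * (w * 1)) * / 2) with (s * w ^ 2 / 2). field.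
        * intros; apply Rmult_comm.
      + match goal with |- plus (mult ?a ?b) (mult ?c ?d) = ?r => change (a * b + c * d = r) end.
        replace (2 * S j)%nat with (2 * j + 1 + 1)%nat by lia. rewrite (pow_add w (2 * j + 1)), (pow_add w (2 * j)). simpl (w ^ 1). rring.
    - intros w _. apply (continuous_minus (V := R_NormedModule) (fun w => (2 * INR j + 1) * (w ^ (2 * j) * exp (- (s * w ^ 2 / 2))))).
      + apply (continuous_mult (K := R_AbsRing)). apply continuous_const. apply moment_cont.
      + apply (continuous_mult (K := R_AbsRing) (fun _ => s)). apply continuous_const. apply moment_cont. }
  rewrite RInt_sub in I.
  - rewrite RInt_mulc in I by (apply ex_RInt_cont; intros; apply moment_cont).
    rewrite RInt_mulc in I by (apply ex_RInt_cont; intros; apply moment_cont).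
    set (I0 := RInt (fun w => w ^ (2 * j) * exp (- (s * w ^ 2 / 2))) 0 e) in *.
    set (I1 := RInt _ 0 e) in *. rewrite <- I. apply Rminus_diag_uniq. field. lra.
  - intros w. apply (continuous_mult (K := R_AbsRing)). apply continuous_const. apply moment_cont.
  - intros w. apply (continuous_mult (K := R_AbsRing) (fun _ => s)). apply continuous_const. apply moment_cont.
Qed.

Lemma moment_zero (e s : R) : 0 <= e -> 0 < s ->
  Rabs (moment e s 0 - sqrt (2 / s) * (sqrt PI / 2)) <= sqrt (2 / s) * 2 * exp (- (s * e ^ 2 / 2)).
Proof.
  intros He Hs. set (c := sqrt (s / 2)). assert (Hc : 0 < c) by (apply sqrt_lt_R0; lra).
  assert (Hcc : c * c = s / 2) by (apply sqrt_sqrt; lra).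
  assert (Ei : sqrt (2 / s) = / c).
  { unfold c. rewrite <- sqrt_inv. f_equal. field. lra. }
  assert (M : moment e s 0 = / c * Gs (c * e)).
  { assert (C : RInt (fun v => exp (- (v * v))) (c * 0 + 0) (c * e + 0) = RInt (fun v => c * exp (- ((c * v + 0) * (c * v + 0)))) 0 e).
    { symmetry. apply (RInt_comp_lin (fun v => exp (- (v * v)))). apply ex_RInt_cont. intros; apply gauss_cont. }
    replace (c * 0 + 0) with 0 in C by rring. rewrite Rplus_0_r in C. unfold Gs. rewrite C, <- RInt_mulc.
    - unfold moment. apply RInt_ext. intros v _. simpl (2 * 0)%nat. simpl (v ^ 0).
      replace ((c * v + 0) * (c * v + 0)) with (c * c * v ^ 2) by rring. rewrite Hcc.
      replace (s / 2 * v ^ 2) with (s * v ^ 2 / 2) by field. apply Rminus_diag_uniq. field. lra.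
    - apply ex_RInt_cont; intros; smooth; auto. }
  rewrite M, Ei. pose proof (gauss_bound (c * e) ltac:(nra)) as B.
  replace (c * e * (c * e)) with (s * e ^ 2 / 2) in B by (replace (c * e * (c * e)) with (c * c * e ^ 2) by rring; rewrite Hcc; field).
  rewrite <- Rmult_minus_distr_l, Rabs_mult. assert (0 < / c) by (apply Rinv_0_lt_compat; auto).
  rewrite (Rabs_right (/ c)) by lra. rewrite Rmult_assoc. apply Rmult_le_compat_l; lra.
Qed.

(** The truncated moments satisfy the recursion of the full Gaussian moments up to a boundary term
    at e, which is exponentially small in s. *)
Lemma moment_asymptotic (e : R) (j : nat) : 0 < e ->
  exists C, 0 <= C /\ forall s, 1 <= s ->
    Rabs (moment e s j - rfact j * (2 / s) ^ j * (sqrt (2 / s) * (sqrt PI / 2))) <= C * exp (- (s * e ^ 2 / 2)).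
Proof.
  intros He. induction j as [|j (C & HC & IH)].
  - exists 4. split; [lra|]. intros s Hs. simpl rfact. rewrite pow_O, !Rmult_1_l.
    eapply Rle_trans; [apply moment_zero; lra|].
    apply Rmult_le_compat_r; [left; apply exp_pos|].
    assert (sqrt (2 / s) <= 2); [|lra].
    apply Rle_trans with (sqrt 4). apply sqrt_le_1; try lra. left; apply Rdiv_lt_0_compat; lra.
    apply (Rmult_le_reg_r s); [lra|]. unfold Rdiv. rewrite Rmult_assoc, Rinv_l by lra. lra.
    right. replace 4 with (2 * 2) by rring. apply sqrt_square. lra.
  - exists ((INR j + / 2) * 2 * C + e ^ (2 * j + 1)). pose proof (pos_INR j).
    split. { apply Rplus_le_le_0_compat. apply Rmult_le_pos; nra. apply pow_le; lra. }
    intros s Hs. specialize (IH s Hs). rewrite moment_succ by lra. simpl rfact. change ((2 / s) ^ S j) with (2 / s * (2 / s) ^ j).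
    set (A := rfact j * (2 / s) ^ j * (sqrt (2 / s) * (sqrt PI / 2))) in *. set (E := exp (- (s * e ^ 2 / 2))) in *.
    replace ((INR j + / 2) * (2 / s) * moment e s j - e ^ (2 * j + 1) * E / s - (INR j + / 2) * rfact j * (2 / s * (2 / s) ^ j) * (sqrt (2 / s) * (sqrt PI / 2)))
     with ((INR j + / 2) * (2 / s) * (moment e s j - A) + - (e ^ (2 * j + 1) * E / s)) by (unfold A; field; lra).
    assert (HE : 0 < E) by apply exp_pos. assert (Hsi : 0 < / s <= 1) by (split; [apply Rinv_0_lt_compat; lra|rewrite <- Rinv_1; apply Rinv_le_contravar; lra]).
    assert (0 <= e ^ (2 * j + 1)) by (apply pow_le; lra).
    eapply Rle_trans; [apply Rabs_triang|]. rewrite Rabs_Ropp, Rabs_mult.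
    replace (((INR j + / 2) * 2 * C + e ^ (2 * j + 1)) * E) with ((INR j + / 2) * 2 * C * E + e ^ (2 * j + 1) * E) by rring.
    apply Rplus_le_compat.
    + rewrite (Rabs_right ((INR j + / 2) * (2 / s))) by (apply Rle_ge, Rmult_le_pos; unfold Rdiv; nra).
      replace ((INR j + / 2) * 2 * C * E) with (((INR j + / 2) * 2) * (C * E)) by rring.
      apply Rmult_le_compat; try apply Rabs_pos; auto.
      * apply Rmult_le_pos; unfold Rdiv; nra.
      * apply Rmult_le_compat_l; unfold Rdiv; lra.
    + rewrite Rabs_right. unfold Rdiv. rewrite <- (Rmult_1_r (e ^ (2 * j + 1) * E)) at 2. apply Rmult_le_compat_l; [nra|lra].
      apply Rle_ge. unfold Rdiv. apply Rmult_le_pos; nra.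
Qed.

(** * The coefficient series *)

Section Coefficients.
Variables (A B : R -> nat -> R) (eps : R) (tau dtau : R -> R).
Hypothesis Heps : 0 < eps.
Hypothesis Htau : forall w, Rabs w < eps ->
  0 < tau w /\ w ^ 2 / 2 = tau w - ln (tau w) - 1 /\ is_derive tau w (dtau w).
Hypothesis HA : forall a w, Rabs w < eps -> is_pseries (A a) w (2 * (Rpower (tau w) (a - 1) / (1 + tau w) * dtau w)).
Hypothesis HB : forall a w, Rabs w < eps -> w <> 0 -> is_pseries (B a) w (Rpower (tau w) (a - 1) / (1 - tau w) * dtau w + / w).

(** As 1 / (1 + tau) + 1 / (1 - tau) = 2 / (1 - tau^2), these are the coefficients of 2 tau^(a-1)
    tau' / (1 - tau^2) + 1 / w, the density that the saddle substitution produces. *)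
Definition Sc (a : R) (n : nat) : R := / 2 * A a n + B a n.
(** Defined by its series, so that its value at w = 0 is the continuous one. *)
Let F (a w : R) : R := PSeries (Sc a) w.
Let L (w : R) : R := ln (tau w).

Lemma tau_zero : tau 0 = 1.
Proof.
  destruct (Htau 0) as (P & E & _). { rewrite Rabs_R0; auto. }
  assert (Q : ln (tau 0) = tau 0 - 1) by lra.
  destruct (Req_dec (tau 0) 1) as [|N]; auto. exfalso.
  assert (ln (tau 0) <> 0). { intros Z. lra. }
  pose proof (exp_ineq1 (ln (tau 0)) H) as X. rewrite exp_ln in X by auto. lra.
Qed.

Lemma tau_ne_1 (w : R) : Rabs w < eps -> w <> 0 -> tau w <> 1.
Proof.
  intros Hw N E. destruct (Htau w Hw) as (_ & Q & _). rewrite E, ln_1 in Q.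
  assert (0 < w ^ 2) by (apply pow2_gt_0; auto). lra.
Qed.

Lemma locally_disc (w : R) : Rabs w < eps -> locally w (fun x => Rabs x < eps).
Proof.
  intros Hw. assert (Hd : 0 < eps - Rabs w) by lra. exists (mkposreal _ Hd). intros y Hy.
  unfold ball in Hy; simpl in Hy. unfold AbsRing_ball, abs, minus, plus, opp in Hy; simpl in Hy.
  replace y with (w + (y + - w)) by ring. eapply Rle_lt_trans; [apply Rabs_triang|]. lra.
Qed.

Lemma L_derive (w : R) : Rabs w < eps -> is_derive L w (dtau w / tau w).
Proof.
  intros Hw. destruct (Htau w Hw) as (P & _ & D). unfold L.
  evar_last. apply (is_derive_comp ln tau w (/ tau w) (dtau w)); [|exact D]. apply is_derive_ln; auto.
  unfold scal; simpl; unfold mult; simpl. unfold Rdiv. ring.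
Qed.

Lemma tau_ode (w : R) : Rabs w < eps -> dtau w * (tau w - 1) = w * tau w.
Proof.
  intros Hw. destruct (Htau w Hw) as (P & E & D).
  assert (D1 : is_derive (fun w => tau w - L w - 1) w (dtau w - dtau w / tau w - 0)).
  { apply (is_derive_minus (fun w => tau w - L w) (fun _ => 1)); [|apply (is_derive_const 1 w)].
    apply (is_derive_minus tau L); auto. apply L_derive; auto. }
  assert (D2 : is_derive (fun w => tau w - L w - 1) w w).
  { apply is_derive_ext_loc with (fun w => w ^ 2 / 2).
    - apply filter_imp with (2 := locally_disc w Hw). intros x Hx. apply Htau; auto.
    - auto_derive; auto. field. }
  apply is_derive_unique in D1. apply is_derive_unique in D2. rewrite D1 in D2.
  transitivity ((dtau w - dtau w / tau w - 0) * tau w); [field; lra|]. f_equal. exact D2.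
Qed.

Lemma conv_A (a : R) : conv eps (A a) (fun w => 2 * (Rpower (tau w) (a - 1) / (1 + tau w) * dtau w)).
Proof. intros w Hw. apply HA; auto. Qed.

Lemma conv_S (a : R) : conv eps (Sc a) (F a).
Proof.
  intros w Hw. apply PSeries_correct. destruct (Req_dec w 0) as [->|N].
  - eexists. apply (is_pseries_0 (Sc a)).
  - eexists. exact (is_pseries_plus _ _ _ _ _ (is_pseries_scal (/ 2) _ w _ (Rmult_comm _ _) (HA a w Hw)) (HB a w Hw N)).
Qed.

Lemma F_val (a w : R) : Rabs w < eps -> w <> 0 ->
  F a w = 2 * Rpower (tau w) (a - 1) * dtau w / (1 - tau w ^ 2) + / w.
Proof.
  intros Hw N. unfold F.
  assert (H : is_pseries (Sc a) w _) by
    exact (is_pseries_plus _ _ _ _ _ (is_pseries_scal (/ 2) _ w _ (Rmult_comm _ _) (HA a w Hw)) (HB a w Hw N)).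
  rewrite (is_pseries_unique _ _ _ H).
  match goal with |- plus (scal ?a ?b) ?c = ?r => change (a * b + c = r) end.
  destruct (Htau w Hw) as (P & _ & _). pose proof (tau_ne_1 w Hw N). field. repeat split; try lra; nra.
Qed.

Lemma Rpower_tau (a w : R) : Rpower (tau w) a = exp (a * L w).
Proof. reflexivity. Qed.

(** Multiplication by w clears the pole and leaves 2 w tau^(a-1) tau' / (tau^2 - 1), in which a
    occurs only through tau^a. The uniformity in a rests on this. *)
Lemma F_scaling (a w : R) : Rabs w < eps -> 1 - w * F a w = exp (a * L w) * (1 - w * F 0 w).
Proof.
  intros Hw. destruct (Req_dec w 0) as [->|N].
  - unfold L. rewrite tau_zero, ln_1, Rmult_0_r, exp_0. ring.
  - rewrite !F_val by auto. rewrite !Rpower_tau.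
    replace ((a - 1) * L w) with (a * L w + (0 - 1) * L w) by ring. rewrite exp_plus.
    destruct (Htau w Hw) as (P & _ & _). pose proof (tau_ne_1 w Hw N). field. split; auto. nra.
Qed.

(* [tau' / tau = (tau^-1 + 1) / (1 + tau) tau'], whence the series of [ln tau]. *)
Definition lser : nat -> R := PS_Int (fun n => / 2 * A 0 n + / 2 * A 1 n).

Lemma conv_L : conv eps lser L.
Proof.
  apply conv_int with (fun w => dtau w / tau w).
  - apply conv_ext with (2 := conv_plus _ _ _ _ _ (conv_scal _ (/ 2) _ _ (conv_A 0)) (conv_scal _ (/ 2) _ _ (conv_A 1))).
    intros w Hw. cbv beta. destruct (Htau w Hw) as (P & _ & _).
    replace (0 - 1) with (- (1)) by ring. replace (1 - 1) with 0 by ring.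
    rewrite Rpower_Ropp, Rpower_1, Rpower_O by auto. field. lra.
  - apply L_derive.
  - unfold L. rewrite tau_zero. apply ln_1.
Qed.

(** The coefficients of 1 - w F(a, w). The shift by one moves the even coefficients of [Sc] to odd
    places. *)
Definition tser (a : R) (n : nat) : R := match n with O => 1 | S k => - Sc a k end.

Lemma conv_T (a : R) : conv eps (tser a) (fun w => 1 - w * F a w).
Proof.
  apply conv_ext with (fun w => 1 + (-1) * (w * F a w)). { intros; ring. }
  apply conv_coef with (fun n => cst 1 n + (-1) * PS_incr_1 (Sc a) n).
  { intros [|n]; simpl. change (1 + -1 * 0 = 1). ring. ring. }
  apply (conv_plus eps (cst 1) (fun n => -1 * PS_incr_1 (Sc a) n) (fun _ => 1)). apply conv_cst.
  apply (conv_scal eps (-1) (PS_incr_1 (Sc a)) (fun w => w * F a w)). apply conv_incr. apply conv_S.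
Qed.

(** The coefficients of (ln tau)^i (1 - w F(0, w)). *)
Fixpoint pser (i : nat) : nat -> R := match i with O => tser 0 | S i => PS_mult lser (pser i) end.

Lemma conv_P (i : nat) : conv eps (pser i) (fun w => L w ^ i * (1 - w * F 0 w)).
Proof.
  induction i.
  - apply conv_ext with (2 := conv_T 0). intros; simpl; ring.
  - apply conv_ext with (2 := conv_mult _ _ _ _ _ conv_L IHi). intros; simpl; ring.
Qed.

(** The coefficients of 1 - w F(a, w) with exp (a ln tau) cut off after J terms; they are visibly
    polynomials in a. *)
Definition qcoef (J : nat) (a : R) (j : nat) : R := sum_range (fun i => a ^ i / INR (fact i) * pser i j) 0 J.

Lemma qcoef_psum (J J' : nat) (a w : R) :
  sum_range (fun i => a ^ i / INR (fact i) * psum (pser i) w J') 0 J = psum (qcoef J a) w J'.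
Proof.
  induction J as [|J IH].
  - unfold psum, qcoef. rewrite sum_range_0. symmetry. rewrite (sum_range_ext _ (fun _ => 0 * 0)).
    rewrite sum_range_scal; ring. intros; rewrite sum_range_0; ring.
  - rewrite sum_range_S, IH. unfold psum. rewrite <- sum_range_scal, <- sum_range_plus. apply sum_range_ext.
    intros j _. unfold qcoef. rewrite sum_range_S. ring.
Qed.

(** Since ln tau = O(w), cutting the exponential series of a ln tau after J terms costs O(w^J)
    uniformly for bounded a. Each of the J products that remain has a Taylor remainder free of a. *)
Lemma T_uniform_aux (bd d : R) (J : nat) : 0 <= bd -> 0 <= d < eps ->
  exists K, 0 <= K /\ forall a w, Rabs a <= bd -> Rabs w <= d ->
    Rabs (1 - w * F a w - psum (qcoef J a) w J) <= K * Rabs w ^ J.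
Proof.
  intros Hbd Hd.
  destruct (conv_tail eps d 1 lser L Hd conv_L) as (K1 & HK1 & B1).
  destruct (conv_bounded eps d _ _ Hd (conv_T 0)) as (K2 & HK2 & B2).
  assert (BL : forall w, Rabs w <= d -> Rabs (L w) <= K1 * Rabs w).
  { intros w Hw. specialize (B1 w Hw). unfold psum in B1. rewrite sum_range_S, sum_range_0 in B1. change (lser 0) with 0 in B1.
    replace (L w - (0 + 0 * w ^ 0)) with (L w) in B1 by ring. simpl in B1. lra. }
  assert (Hsum : forall n, exists K, 0 <= K /\ forall a w, Rabs a <= bd -> Rabs w <= d ->
     Rabs (sum_range (fun i => a ^ i / INR (fact i) * (L w ^ i * (1 - w * F 0 w) - psum (pser i) w J)) 0 n) <= K * Rabs w ^ J).
  { induction n as [|n (K & HK & H)].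
    - exists 0. split; [lra|]. intros. rewrite sum_range_0, Rabs_R0. lra.
    - destruct (conv_tail eps d J _ _ Hd (conv_P n)) as (K' & HK' & H').
      exists (K + bd ^ n * K'). split. { apply Rplus_le_le_0_compat; auto. apply Rmult_le_pos; auto. apply pow_le; auto. }
      intros a w Ha Hw. rewrite sum_range_S. eapply Rle_trans; [apply Rabs_triang|].
      rewrite Rmult_plus_distr_r. apply Rplus_le_compat; auto.
      rewrite Rabs_mult, Rmult_assoc. apply Rmult_le_compat; try apply Rabs_pos; auto.
      unfold Rdiv. rewrite Rabs_mult, <- RPow_abs. pose proof (INR_fact_lt_0 n) as Hf.
      assert (1 <= INR (fact n)) by (apply (le_INR 1); pose proof (lt_O_fact n); lia).
      assert (Rabs (/ INR (fact n)) <= 1).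
      { rewrite Rabs_right by (left; apply Rinv_0_lt_compat; auto). rewrite <- Rinv_1. apply Rinv_le_contravar; lra. }
      assert (Rabs a ^ n <= bd ^ n) by (apply pow_incr; split; auto; apply Rabs_pos).
      rewrite <- (Rmult_1_r (bd ^ n)). apply Rmult_le_compat; auto. apply pow_le, Rabs_pos. apply Rabs_pos. }
  destruct (Hsum J) as (K & HK & H).
  exists (K + (bd * K1) ^ J * exp (bd * (K1 * d)) * K2).
  split. { apply Rplus_le_le_0_compat; auto. apply Rmult_le_pos; auto. apply Rmult_le_pos; [apply pow_le; nra|left; apply exp_pos]. }
  intros a w Ha Hw. rewrite <- qcoef_psum, F_scaling by lra.
  set (m := 1 - w * F 0 w) in *.
  assert (E : sum_range (fun i => a ^ i / INR (fact i) * (L w ^ i * m - psum (pser i) w J)) 0 J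
     = m * sum_range (fun i => (a * L w) ^ i / INR (fact i)) 0 J - sum_range (fun i => a ^ i / INR (fact i) * psum (pser i) w J) 0 J).
  { rewrite <- sum_range_scal.
    replace (sum_range (fun j => m * ((a * L w) ^ j / INR (fact j))) 0 J) with
     (sum_range (fun i => a ^ i / INR (fact i) * (L w ^ i * m - psum (pser i) w J) + a ^ i / INR (fact i) * psum (pser i) w J) 0 J).
    rewrite sum_range_plus; ring. apply sum_range_ext. intros j _. rewrite Rpow_mult_distr. field. apply INR_fact_neq_0. }
  replace (exp (a * L w) * m - sum_range (fun i => a ^ i / INR (fact i) * psum (pser i) w J) 0 J) with
    (sum_range (fun i => a ^ i / INR (fact i) * (L w ^ i * m - psum (pser i) w J)) 0 J
      + (exp (a * L w) - sum_range (fun i => (a * L w) ^ i / INR (fact i)) 0 J) * m) by (rewrite E; ring).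
  eapply Rle_trans; [apply Rabs_triang|]. rewrite Rmult_plus_distr_r. apply Rplus_le_compat. apply H; auto.
  rewrite Rabs_mult. pose proof (exp_taylor J (a * L w)) as X. specialize (B2 w Hw). fold m in B2. specialize (BL w Hw).
  pose proof (Rabs_pos a). pose proof (Rabs_pos w). pose proof (Rabs_pos (L w)).
  assert (Y : Rabs (a * L w) <= bd * (K1 * Rabs w)) by (rewrite Rabs_mult; apply Rmult_le_compat; auto).
  assert (Z : Rabs (a * L w) ^ J * exp (Rabs (a * L w)) <= (bd * K1) ^ J * Rabs w ^ J * exp (bd * (K1 * d))).
  { apply Rmult_le_compat. apply pow_le, Rabs_pos. left; apply exp_pos.
    rewrite <- Rpow_mult_distr. apply pow_incr. split. apply Rabs_pos. rewrite Rmult_assoc. auto.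
    apply exp_le. eapply Rle_trans; [exact Y|]. apply Rmult_le_compat_l; auto. apply Rmult_le_compat_l; auto. }
  replace ((bd * K1) ^ J * exp (bd * (K1 * d)) * K2 * Rabs w ^ J) with ((bd * K1) ^ J * Rabs w ^ J * exp (bd * (K1 * d)) * K2) by ring.
  apply Rmult_le_compat; auto; try apply Rabs_pos. lra.
Qed.

(** Both coefficient sequences approximate the same function to order w^J, so [jet_unique]
    applies. *)
Lemma T_coef (J : nat) (a : R) (j : nat) : (j < J)%nat -> tser a j = qcoef J a j.
Proof.
  intros Hj. set (d := eps / 2). assert (Hd : 0 <= d < eps) by (unfold d; lra).
  destruct (conv_tail eps d J _ _ Hd (conv_T a)) as (K1 & HK1 & B1).
  destruct (T_uniform_aux (Rabs a) d J (Rabs_pos a) Hd) as (K2 & HK2 & B2).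
  apply Rminus_diag_uniq. apply (jet_unique J (fun j => tser a j - qcoef J a j) d (K1 + K2)); auto. unfold d; lra.
  intros w Hw. specialize (B1 w Hw). specialize (B2 a w (Rle_refl _) Hw).
  assert (E : psum (fun j => tser a j - qcoef J a j) w J = psum (tser a) w J - psum (qcoef J a) w J).
  { unfold psum. replace (sum_range (fun j => tser a j * w ^ j) 0 J) with
      (sum_range (fun j => (tser a j - qcoef J a j) * w ^ j + qcoef J a j * w ^ j) 0 J).
    rewrite sum_range_plus; ring. apply sum_range_ext; intros; ring. }
  rewrite E. replace (psum (tser a) w J - psum (qcoef J a) w J) with
   (- (1 - w * F a w - psum (tser a) w J) + (1 - w * F a w - psum (qcoef J a) w J)) by ring.
  eapply Rle_trans; [apply Rabs_triang|]. rewrite Rabs_Ropp. lra.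
Qed.

(** By [T_coef] the coefficient is a polynomial in a of degree below s + 2. The bound serves the
    terms with large k, whose parameters may grow with k t. *)
Lemma Sc_bound (s : nat) : exists K, 0 <= K /\ forall a, Rabs (Sc a s) <= K * (1 + Rabs a) ^ (s + 2).
Proof.
  exists (sum_range (fun i => Rabs (pser i (S s))) 0 (s + 2)). split.
  - rewrite <- (sum_range_0 (fun _ => 0)). generalize (s + 2)%nat. intros n. induction n. rewrite !sum_range_0; lra.
    rewrite (sum_range_S _ n). pose proof (Rabs_pos (pser n (S s))). lra.
  - intros a. assert (E : Sc a s = - qcoef (s + 2) a (S s)) by (rewrite <- T_coef by lia; simpl; ring).
    rewrite E, Rabs_Ropp. unfold qcoef. eapply Rle_trans; [apply sum_range_abs|].
    rewrite Rmult_comm, <- sum_range_scal. apply sum_range_le. intros j Hj. rewrite Rabs_mult. apply Rmult_le_compat_r; [apply Rabs_pos|].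
    unfold Rdiv. rewrite Rabs_mult, <- RPow_abs. pose proof (INR_fact_lt_0 j) as Hf. pose proof (Rabs_pos a).
    assert (1 <= INR (fact j)) by (apply (le_INR 1); pose proof (lt_O_fact j); lia).
    assert (Rabs (/ INR (fact j)) <= 1).
    { rewrite Rabs_right by (left; apply Rinv_0_lt_compat; auto). rewrite <- Rinv_1. apply Rinv_le_contravar; lra. }
    apply Rle_trans with ((1 + Rabs a) ^ j * 1).
    + apply Rmult_le_compat; auto. apply pow_le; auto. apply Rabs_pos. apply pow_incr; lra.
    + rewrite Rmult_1_r. apply Rle_pow; [lra|lia].
Qed.

Lemma F_uniform (bd d : R) (J : nat) : 0 <= bd -> 0 <= d < eps ->
  exists K, 0 <= K /\ forall a w, Rabs a <= bd -> Rabs w <= d -> w <> 0 ->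
    Rabs (F a w - psum (Sc a) w J) <= K * Rabs w ^ J.
Proof.
  intros Hbd Hd. destruct (T_uniform_aux bd d (S J) Hbd Hd) as (K & HK & H). exists K. split; auto.
  intros a w Ha Hw N. specialize (H a w Ha Hw).
  assert (E : psum (qcoef (S J) a) w (S J) = 1 - w * psum (Sc a) w J).
  { unfold psum. rewrite (sum_range_ext _ (fun j => tser a j * w ^ j)) by (intros; rewrite T_coef with (J := S J) by lia; ring).
    rewrite sum_range_shift. rewrite (sum_range_ext _ (fun j => - w * (Sc a j * w ^ j))) by (intros; simpl; ring).
    rewrite sum_range_scal. simpl. ring. }
  rewrite E in H. replace (1 - w * F a w - (1 - w * psum (Sc a) w J)) with (- (w * (F a w - psum (Sc a) w J))) in H by ring.
  rewrite Rabs_Ropp, Rabs_mult in H. simpl in H. assert (0 < Rabs w) by (apply Rabs_pos_lt; auto).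
  apply (Rmult_le_reg_l (Rabs w)); auto. lra.
Qed.

(* Only the even part survives integration against the Gaussian. *)
Lemma F_even_uniform (bd d : R) (n : nat) : 0 <= bd -> 0 <= d < eps ->
  exists K, 0 <= K /\ forall a w, Rabs a <= bd -> Rabs w <= d -> w <> 0 ->
    Rabs ((F a w + F a (- w)) / 2 - sum_range (fun j => Sc a (2 * j) * w ^ (2 * j)) 0 n) <= K * w ^ (2 * n).
Proof.
  intros Hbd Hd. destruct (F_uniform bd d (2 * n) Hbd Hd) as (K & HK & H). exists K. split; auto.
  intros a w Ha Hw N. pose proof (H a w Ha Hw N) as H1.
  pose proof (H a (- w) Ha ltac:(rewrite Rabs_Ropp; auto) ltac:(lra)) as H2. rewrite Rabs_Ropp in H2.
  assert (E : (psum (Sc a) w (2 * n) + psum (Sc a) (- w) (2 * n)) / 2 = sum_range (fun j => Sc a (2 * j) * w ^ (2 * j)) 0 n).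
  { clear. unfold psum. induction n. simpl (2 * 0)%nat. rewrite !sum_range_0. field.
    replace (2 * S n)%nat with (S (S (2 * n))) by lia. rewrite !sum_range_S. rewrite <- IHn.
    replace ((- w) ^ (2 * n)) with (w ^ (2 * n)).
    replace ((- w) ^ S (2 * n)) with (- w ^ S (2 * n)). field.
    simpl. replace ((- w) ^ (n + (n + 0))) with (w ^ (n + (n + 0))). ring.
    all: replace (n + (n + 0))%nat with (2 * n)%nat by lia; rewrite !pow_mult; f_equal; ring. }
  rewrite <- E.
  assert (Pw : Rabs w ^ (2 * n) = w ^ (2 * n)) by (rewrite !pow_mult, pow2_abs; reflexivity).
  rewrite Pw in H1, H2.
  replace ((F a w + F a (- w)) / 2 - (psum (Sc a) w (2 * n) + psum (Sc a) (- w) (2 * n)) / 2) with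
   (/ 2 * (F a w - psum (Sc a) w (2 * n)) + / 2 * (F a (- w) - psum (Sc a) (- w) (2 * n))) by field.
  eapply Rle_trans; [apply Rabs_triang|]. rewrite !Rabs_mult, (Rabs_right (/ 2)) by lra. lra.
Qed.
End Coefficients.

(** * Laplace's method for the remainder *)

(** The integrand weight at M = s + a - 1, rescaled by exp s so that the phase exp y - 1 - y
    vanishes at the saddle y = 0. *)
Definition Ea (s a y : R) : R := exp (- s * (exp y - 1 - y) + (a - 1) * y).

Lemma Ea_Gk (s a y : R) : exp s * Gk s (s + a - 1) y = Ea s a y.
Proof. unfold Gk, Ea. rewrite <- exp_plus. f_equal. rring. Qed.

(** Convexity: the tangents at z and - z lie below the exponential, and the slope 1 - exp (- z)
    serves both sides because it is at most exp z - 1. The condition y >= 2 z gives y - z >= y /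
    2. *)
Lemma phase_lower (z y : R) : 0 < z -> 2 * z <= y ->
  (1 - exp (- z)) / 2 * y <= exp y - 1 - y /\ (1 - exp (- z)) / 2 * y <= exp (- y) - 1 + y.
Proof.
  intros Hz Hy. assert (Tg : forall p q, exp p * (1 + (q - p)) <= exp q).
  { intros p q. replace (exp q) with (exp p * exp (q - p)) by (rewrite <- exp_plus; f_equal; rring).
    apply Rmult_le_compat_l; [left; apply exp_pos|apply exp_ge_1]. }
  pose proof (Tg z y) as T1. pose proof (Tg (- z) (- y)) as T2.
  pose proof (exp_ge_1 z) as G1. pose proof (exp_ge_1 (- z)) as G2.
  assert (Q : exp (- z) * exp z = 1) by (rewrite <- exp_plus, Rplus_opp_l, exp_0; auto).
  pose proof (exp_pos (- z)). pose proof (exp_pos z).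
  assert (L : exp (- z) < 1) by (rewrite <- exp_0; apply exp_increasing; lra).
  assert (L2 : 1 - exp (- z) <= exp z - 1) by nra.
  split.
  - assert ((exp z - 1) * (y - z) <= exp y - 1 - y) by nra.
    assert ((1 - exp (- z)) * (y / 2) <= (exp z - 1) * (y - z)) by (apply Rmult_le_compat; lra). lra.
  - assert ((1 - exp (- z)) * (y - z) <= exp (- y) - 1 + y) by nra.
    assert ((1 - exp (- z)) * (y / 2) <= (1 - exp (- z)) * (y - z)) by (apply Rmult_le_compat_l; lra). lra.
Qed.

Lemma Ea_tail (bd y0 : R) : 0 <= bd -> 0 < y0 -> exists s0 kap, 0 < kap /\ 0 < s0 /\
  forall s a Y sg, s0 <= s -> Rabs a <= bd -> y0 <= Y -> sg = 1 \/ sg = -1 ->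
    Rabs (RInt (fun y => Ea s a (sg * y) / (exp y - exp (- y))) y0 Y) <= / y0 * exp (- kap * s).
Proof.
  intros Hbd Hy0. set (z := y0 / 2). set (c := (1 - exp (- z)) / 2).
  assert (Hz : 0 < z) by (unfold z; lra).
  assert (Hc : 0 < c). { assert (exp (- z) < 1) by (rewrite <- exp_0; apply exp_increasing; lra). unfold c; lra. }
  (* Half of s c y pays for |a - 1| y and for an integrable exp (- y); the other half is at least c
     y0 s / 2. *)
  exists (2 * (bd + 2) / c), (c * y0 / 2). split; [nra|]. split; [apply Rdiv_lt_0_compat; lra|].
  intros s a Y sg Hs Ha HY Hsg. apply Rabs_le_between in Ha.
  assert (Hs2 : 2 * (bd + 2) <= s * c).
  { apply (Rmult_le_compat_r c) in Hs; [|lra]. unfold Rdiv in Hs. rewrite Rmult_assoc, Rinv_l in Hs by lra. lra. }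
  assert (Hs0 : 0 < s) by nra.
  assert (Bd : forall y, y0 <= y -> Ea s a (sg * y) <= exp (- (c * y0 / 2) * s) * exp (- y)).
  { intros y Hy. unfold Ea. rewrite <- exp_plus. apply exp_le.
    destruct (phase_lower z y Hz ltac:(unfold z; lra)) as [P1 P2]. fold c in P1, P2.
    assert (P : c * y <= exp (sg * y) - 1 - sg * y).
    { destruct Hsg as [->| ->]; [rewrite Rmult_1_l; auto|]. replace (-1 * y) with (- y) by rring. lra. }
    assert (Q : (a - 1) * (sg * y) <= (bd + 1) * y) by (destruct Hsg as [->| ->]; nra).
    apply (Rmult_le_compat_l s) in P; [|lra].
    assert (2 * (bd + 2) * y <= s * c * y) by (apply Rmult_le_compat_r; lra).
    assert (s * c * y0 <= s * c * y) by (apply Rmult_le_compat_l; nra). lra. }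
  assert (Ex : ex_RInt (fun y => Ea s a (sg * y) / (exp y - exp (- y))) y0 Y).
  { apply ex_RInt_cont. intros y Hy. rewrite Rmin_left, Rmax_right in Hy by lra. pose proof (exp_gap y ltac:(lra)).
    unfold Ea. smooth. lra. }
  assert (Hi : 0 < / y0) by (apply Rinv_0_lt_compat; auto).
  apply Rle_trans with (RInt (fun y => / y0 * exp (- (c * y0 / 2) * s) * exp (- y)) y0 Y).
  - apply RInt_dom; auto. apply ex_RInt_cont; intros; smooth; auto.
    intros y Hy. pose proof (exp_gap y ltac:(lra)). unfold Rdiv at 1. rewrite Rabs_mult, Rabs_right by (left; apply exp_pos).
    rewrite (Rabs_right (/ _)) by (left; apply Rinv_0_lt_compat; lra).
    rewrite (Rmult_comm (Ea _ _ _)), Rmult_assoc. apply Rmult_le_compat.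
    left; apply Rinv_0_lt_compat; lra. left; apply exp_pos. apply Rinv_le_contravar; lra. apply Bd; lra.
  - rewrite (RInt_FTC (fun y => - (/ y0 * exp (- (c * y0 / 2) * s)) * exp (- y))).
    + pose proof (exp_pos (- Y)). assert (exp (- y0) <= 1) by (rewrite <- exp_0; apply exp_le; lra).
      assert (0 < / y0 * exp (- (c * y0 / 2) * s)) by (apply Rmult_lt_0_compat; [auto|apply exp_pos]).
      set (W := / y0 * exp (- (c * y0 / 2) * s)) in *. nra.
    + intros y _. auto_derive; auto. rring.
    + intros y _. smooth. auto.
Qed.

Section Laplace.
Variables (A B : R -> nat -> R) (eps : R) (tau dtau : R -> R).
Hypothesis Heps : 0 < eps.
Hypothesis Htau : forall w, Rabs w < eps ->
  0 < tau w /\ w ^ 2 / 2 = tau w - ln (tau w) - 1 /\ is_derive tau w (dtau w).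
Hypothesis Hlim : is_lim (fun w => (tau w - 1) / w) 0 1.
Hypothesis HA : forall a w, Rabs w < eps -> is_pseries (A a) w (2 * (Rpower (tau w) (a - 1) / (1 + tau w) * dtau w)).
Hypothesis HB : forall a w, Rabs w < eps -> w <> 0 -> is_pseries (B a) w (Rpower (tau w) (a - 1) / (1 - tau w) * dtau w + / w).

Let F (a w : R) : R := PSeries (Sc A B a) w.
Let L (w : R) : R := ln (tau w).

(** The branch tau - 1 ~ w makes |ln tau| comparable to w. The lower bound w / 4 keeps the image of
    a cut-off at least linear in w. *)
Lemma window_exists : exists e0, 0 < e0 /\ e0 < eps /\ e0 <= / 2 /\
  forall w, 0 < w <= e0 -> w / 4 <= L w /\ w / 4 <= - L (- w).
Proof.
  apply is_lim_spec in Hlim. destruct (Hlim (mkposreal (/ 2) ltac:(lra))) as [d Hd]. simpl in Hd.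
  pose proof (cond_pos d) as Hdp.
  exists (Rmin (Rmin (eps / 2) (d / 2)) (/ 2)).
  assert (E1 : Rmin (Rmin (eps / 2) (d / 2)) (/ 2) <= eps / 2) by (eapply Rle_trans; [apply Rmin_l|apply Rmin_l]).
  assert (E2 : Rmin (Rmin (eps / 2) (d / 2)) (/ 2) <= d / 2) by (eapply Rle_trans; [apply Rmin_l|apply Rmin_r]).
  assert (E3 : Rmin (Rmin (eps / 2) (d / 2)) (/ 2) <= / 2) by apply Rmin_r.
  split. { repeat apply Rmin_glb_lt; lra. }
  split; [lra|]. split; auto.
  intros w Hw.
  assert (Hd' : forall v, Rabs v <= w -> v <> 0 -> Rabs ((tau v - 1) / v - 1) < / 2).
  { intros v Hv N. apply Hd; auto. unfold ball; simpl. unfold AbsRing_ball, abs, minus, plus, opp; simpl.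
    rewrite Ropp_0, Rplus_0_r. lra. }
  assert (Lg : forall x, 0 < x -> ln x <= x - 1).
  { intros x Hx. pose proof (exp_ge_1 (ln x)) as E. rewrite exp_ln in E by auto. lra. }
  split.
  - specialize (Hd' w ltac:(rewrite Rabs_right; lra) ltac:(lra)). apply Rabs_def2 in Hd'.
    assert (Q : (tau w - 1) / w * w = tau w - 1) by (field; lra).
    assert (T1 : 1 + w / 2 <= tau w <= 1 + 3 / 2 * w) by nra.
    pose proof (Lg (/ tau w) ltac:(apply Rinv_0_lt_compat; lra)) as G. rewrite ln_Rinv in G by lra. fold (L w) in G.
    assert (/ tau w <= 1 - w / 4); [|lra].
    apply (Rmult_le_reg_l (tau w)); [lra|]. rewrite Rinv_r by lra. nra.
  - specialize (Hd' (- w) ltac:(rewrite Rabs_Ropp, Rabs_right; lra) ltac:(lra)). apply Rabs_def2 in Hd'.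
    assert (Q : (tau (- w) - 1) / (- w) * w = - (tau (- w) - 1)) by (field; lra).
    destruct (Htau (- w)) as (P & _ & _). { rewrite Rabs_Ropp, Rabs_right; lra. }
    pose proof (Lg (tau (- w)) P) as G. fold (L (- w)) in G. nra.
Qed.

(** Away from 0, [tau_ode] gives dtau = w tau / (tau - 1), which is continuous because tau is
    differentiable. *)
Lemma dtau_continuous (w : R) : Rabs w < eps -> w <> 0 -> continuous dtau w.
Proof.
  intros Hw N. pose proof (tau_ne_1 eps tau dtau Htau) as Ne.
  assert (Ct : continuous tau w).
  { apply (ex_derive_continuous (V := R_NormedModule)). eexists. apply Htau; auto. }
  apply continuous_ext_loc with (fun w => w * tau w * / (tau w - 1)).
  - assert (Lc := locally_disc eps w Hw).
    assert (Ln : locally w (fun x => x <> 0)).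
    { assert (Hp : 0 < Rabs w) by (apply Rabs_pos_lt; auto). exists (mkposreal _ Hp). intros y Hy.
      unfold ball in Hy; simpl in Hy. unfold AbsRing_ball, abs, minus, plus, opp in Hy; simpl in Hy.
      intros ->. rewrite Rplus_0_l, Rabs_Ropp in Hy. lra. }
    apply filter_imp with (2 := filter_and _ _ Lc Ln). intros x [H1 H2].
    rewrite <- (tau_ode eps tau dtau Htau x H1). specialize (Ne x H1 H2). apply Rminus_diag_uniq. field. lra.
  - apply (continuous_mult (K := R_AbsRing)).
    + apply (continuous_mult (K := R_AbsRing)); auto. apply continuous_id.
    + apply (continuous_comp (fun w => tau w - 1) Rinv).
      * apply (continuous_minus (V := R_NormedModule) tau (fun _ => 1)); auto. apply continuous_const.
      * specialize (Ne w Hw N). apply continuous_Rinv. lra.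
Qed.

Lemma phase_L (s a w : R) : Rabs w < eps -> Ea s a (L w) = exp (- (s * w ^ 2 / 2)) * Rpower (tau w) (a - 1).
Proof.
  intros Hw. destruct (Htau w Hw) as (P & E & _). unfold Ea, L, Rpower. rewrite exp_ln, <- exp_plus by auto. f_equal.
  replace (s * w ^ 2 / 2) with (s * (w ^ 2 / 2)) by field. rewrite E. rring.
Qed.

(** The substitution y = ln tau(w) makes the phase quadratic and turns the kernel into F(a, w) with
    its pole 1 / w split off. *)
Lemma transform_density (s a w : R) : Rabs w < eps -> w <> 0 ->
  dtau w / tau w * (Ea s a (L w) / (exp (L w) - exp (- L w))) = - / 2 * (exp (- (s * w ^ 2 / 2)) * (F a w - / w)).
Proof.
  intros Hw N. unfold F. rewrite (F_val A B eps tau dtau Htau HA HB a w Hw N), phase_L by auto.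
  destruct (Htau w Hw) as (P & _ & _). pose proof (tau_ne_1 eps tau dtau Htau w Hw N).
  rewrite (exp_Ropp (L w)). unfold L. rewrite exp_ln by auto. field. repeat split; nra.
Qed.

Lemma dL_continuous (w : R) : Rabs w < eps -> w <> 0 -> continuous (fun w => dtau w / tau w) w.
Proof.
  intros Hw N. apply (continuous_mult (K := R_AbsRing)). apply dtau_continuous; auto.
  apply (continuous_comp tau Rinv). apply (ex_derive_continuous (V := R_NormedModule)). eexists. apply Htau; auto.
  apply continuous_Rinv. destruct (Htau w Hw); lra.
Qed.

Lemma Ea_quot_continuous (s a sg y : R) : 0 < y -> continuous (fun y => Ea s a (sg * y) / (exp y - exp (- y))) y.
Proof. intros Hy. pose proof (exp_gap y Hy). unfold Ea. smooth. lra. Qed.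

Lemma transform_right (s a om e0 : R) : 0 < om <= e0 -> e0 < eps -> (forall w, 0 < w <= e0 -> w / 4 <= L w /\ w / 4 <= - L (- w)) ->
  RInt (fun y => Ea s a (1 * y) / (exp y - exp (- y))) (L om) (L e0) =
  RInt (fun w => - / 2 * (exp (- (s * w ^ 2 / 2)) * (F a w - / w))) om e0.
Proof.
  intros Ho He HL.
  assert (C := is_RInt_comp (fun y => Ea s a (1 * y) / (exp y - exp (- y))) L (fun w => dtau w / tau w) om e0).
  rewrite Rmin_left, Rmax_right in C by lra.
  assert (I := is_RInt_unique _ _ _ _ (C ltac:(intros w Hw; apply Ea_quot_continuous; destruct (HL w ltac:(lra)); lra)
    ltac:(intros w Hw; split; [apply (L_derive eps tau dtau Htau)|apply dL_continuous]; try lra; rewrite Rabs_right; lra))).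
  rewrite <- I. apply RInt_ext. intros w Hw. rewrite Rmin_left, Rmax_right in Hw by lra.
  match goal with |- scal ?x ?y = _ => change (scal x y) with (x * y) end.
  rewrite Rmult_1_l. apply transform_density; [rewrite Rabs_right|]; lra.
Qed.

Lemma transform_left (s a om e0 : R) : 0 < om <= e0 -> e0 < eps -> (forall w, 0 < w <= e0 -> w / 4 <= L w /\ w / 4 <= - L (- w)) ->
  RInt (fun y => Ea s a (-1 * y) / (exp y - exp (- y))) (- L (- om)) (- L (- e0)) =
  RInt (fun w => / 2 * (exp (- (s * w ^ 2 / 2)) * (F a (- w) + / w))) om e0.
Proof.
  intros Ho He HL.
  assert (C := is_RInt_comp (fun y => Ea s a (-1 * y) / (exp y - exp (- y))) (fun w => - L (- w)) (fun w => dtau (- w) / tau (- w)) om e0).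
  rewrite Rmin_left, Rmax_right in C by lra.
  assert (An : forall w, om <= w <= e0 -> Rabs (- w) < eps) by (intros; rewrite Rabs_Ropp, Rabs_right; lra).
  assert (I := is_RInt_unique _ _ _ _ (C ltac:(intros w Hw; apply Ea_quot_continuous; destruct (HL w ltac:(lra)); lra)
    ltac:(intros w Hw; split; [
      evar_last; [apply (is_derive_opp (fun w => L (- w)));
        apply (is_derive_comp L (fun w => - w) w (dtau (- w) / tau (- w)) (-1)); [apply (L_derive eps tau dtau Htau); auto|auto_derive; auto]
       |match goal with |- opp (scal ?x ?y) = _ => change (opp (scal x y)) with (- (x * y)) end; rring]
      |apply (continuous_comp (fun w => - w) (fun w => dtau w / tau w)); [smooth; auto|apply dL_continuous; auto; lra]]))).
  rewrite <- I. apply RInt_ext. intros w Hw. rewrite Rmin_left, Rmax_right in Hw by lra.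
  match goal with |- scal ?x ?y = _ => change (scal x y) with (x * y) end.
  replace (-1 * - L (- w)) with (L (- w)) by rring. rewrite Ropp_involutive.
  pose proof (transform_density s a (- w) ltac:(apply An; lra) ltac:(lra)) as T.
  replace ((- w) ^ 2) with (w ^ 2) in T by rring.
  replace (exp (- L (- w)) - exp (L (- w))) with (- (exp (L (- w)) - exp (- L (- w)))) by rring.
  assert (Nz : exp (L (- w)) - exp (- L (- w)) <> 0).
  { destruct (HL w ltac:(lra)) as [_ H2]. pose proof (exp_gap (- L (- w)) ltac:(lra)) as G. rewrite Ropp_involutive in G. lra. }
  replace (dtau (- w) / tau (- w) * (Ea s a (L (- w)) / - (exp (L (- w)) - exp (- L (- w))))) with
    (- (dtau (- w) / tau (- w) * (Ea s a (L (- w)) / (exp (L (- w)) - exp (- L (- w)))))).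
  - rewrite T. replace (/ - w) with (- / w) by (field; lra). rring.
  - field. split; auto. destruct (Htau (- w)); [apply An; lra|lra].
Qed.

Let gw (s : R) (f : R -> R) (w : R) : R := f w * exp (- (s * w ^ 2 / 2)).

(** The terms 1 / w of the two sides cancel when both are cut at the same [om]. The corresponding
    cut-offs [L om] and [- L (- om)] in y differ, and the strip between them remains as a separate
    integral. *)
Lemma window_identity (s a om e0 Y : R) : 0 < s -> 0 < om <= e0 -> e0 < eps ->
  (forall w, 0 < w <= e0 -> w / 4 <= L w /\ w / 4 <= - L (- w)) -> L e0 <= Y -> - L (- e0) <= Y ->
  exp s * RInt (Rk s (s + a - 1)) (L om) Y =
   RInt (gw s (fun w => (F a w + F a (- w)) / 2)) om e0
   + RInt (fun y => Ea s a (-1 * y) / (exp y - exp (- y))) (L om) (- L (- om))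
   + RInt (fun y => Ea s a (-1 * y) / (exp y - exp (- y))) (- L (- e0)) Y
   - RInt (fun y => Ea s a (1 * y) / (exp y - exp (- y))) (L e0) Y.
Proof.
  intros Hs Ho He HL HY1 HY2.
  set (f1 := fun y => Ea s a (1 * y) / (exp y - exp (- y))). set (f2 := fun y => Ea s a (-1 * y) / (exp y - exp (- y))).
  destruct (HL om ltac:(lra)) as [P1 P2]. destruct (HL e0 ltac:(lra)) as [P3 P4].
  assert (Ex : forall sg p q, 0 < p -> 0 < q -> ex_RInt (fun y => Ea s a (sg * y) / (exp y - exp (- y))) p q).
  { intros sg p q Hp Hq. apply ex_RInt_cont. intros y Hy. apply Ea_quot_continuous, (pos_of_between p q); auto. }
  assert (E : exp s * RInt (Rk s (s + a - 1)) (L om) Y = RInt f2 (L om) Y - RInt f1 (L om) Y).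
  { rewrite <- RInt_mulc by (apply ex_RInt_cont; intros y Hy; apply Rk_continuous, (pos_of_between (L om) Y); auto; lra).
    rewrite (RInt_ext _ (fun y => minus (f2 y) (f1 y))).
    - apply (RInt_minus f2 f1); apply Ex; lra.
    - intros y Hy. unfold Rk, f1, f2. rewrite <- !Ea_Gk. replace (-1 * y) with (- y) by rring. rewrite Rmult_1_l.
      match goal with |- _ = minus ?x ?y => change (minus x y) with (x - y) end. unfold Rdiv. rring. }
  rewrite E.
  rewrite (RInt_split f2 (L om) (- L (- om)) Y) by (apply Ex; lra).
  rewrite (RInt_split f2 (- L (- om)) (- L (- e0)) Y) by (apply Ex; lra).
  rewrite (RInt_split f1 (L om) (L e0) Y) by (apply Ex; lra).
  unfold f1 at 1, f2 at 2. rewrite transform_left, transform_right by auto.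
  assert (CF : forall w, Rabs w < eps -> continuous (F a) w).
  { intros w Hw. apply (conv_continuous eps (Sc A B a)); auto. apply (conv_S A B eps tau dtau); auto. }
  assert (CF2 : forall w, om <= w <= e0 -> continuous (fun w => F a (- w)) w).
  { intros w Hw. apply (continuous_comp (fun w => - w) (F a)). smooth; auto. apply CF. rewrite Rabs_Ropp, Rabs_right; lra. }
  assert (Ce : forall w, continuous (fun w => exp (- (s * w ^ 2 / 2))) w) by (intros; smooth; auto).
  assert (Ci : forall w, om <= w <= e0 -> continuous (fun w => / w) w) by (intros; apply continuous_Rinv; lra).
  assert (EE : RInt (gw s (fun w => (F a w + F a (- w)) / 2)) om e0 =
    RInt (fun w => / 2 * (exp (- (s * w ^ 2 / 2)) * (F a (- w) + / w))) om e0 - RInt (fun w => - / 2 * (exp (- (s * w ^ 2 / 2)) * (F a w - / w))) om e0).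
  { rewrite (RInt_ext _ (fun w => minus (/ 2 * (exp (- (s * w ^ 2 / 2)) * (F a (- w) + / w))) (- / 2 * (exp (- (s * w ^ 2 / 2)) * (F a w - / w))))).
    - apply (RInt_minus (fun w => / 2 * (exp (- (s * w ^ 2 / 2)) * (F a (- w) + / w)))).
      + apply ex_RInt_cont. intros w Hw. rewrite Rmin_left, Rmax_right in Hw by lra.
        apply (continuous_mult (K := R_AbsRing)). apply continuous_const. apply (continuous_mult (K := R_AbsRing)); auto.
        apply (continuous_plus (V := R_NormedModule) (fun w => F a (- w)) Rinv); auto.
      + apply ex_RInt_cont. intros w Hw. rewrite Rmin_left, Rmax_right in Hw by lra.
        apply (continuous_mult (K := R_AbsRing)). apply continuous_const. apply (continuous_mult (K := R_AbsRing)); auto.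
        apply (continuous_minus (V := R_NormedModule) (F a) Rinv); auto. apply CF. rewrite Rabs_right; lra.
    - intros w Hw. match goal with |- _ = minus ?x ?y => change (minus x y) with (x - y) end. unfold gw.
      apply Rminus_diag_uniq. field. rewrite Rmin_left in Hw by lra. lra. }
  rewrite EE. rring.
Qed.

(** At fixed s the cut-off [om] tends to 0. Both images of the cut-off equal [lser A 1 * om] up to
    O(om^2), so the strip has length O(om^2) while its integrand is O(1 / om). *)
Lemma Rem_local (bd : R) (n : nat) : 0 <= bd -> exists e0 K kap s0, 0 < e0 /\ 0 <= K /\ 0 < kap /\ 1 <= s0 /\
  forall s a, s0 <= s -> Rabs a <= bd ->
   Rabs (exp s * Rem s (s + a - 1) - sum_range (fun j => Sc A B a (2 * j) * moment e0 s j) 0 n)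
     <= K * moment e0 s n + K * exp (- kap * s).
Proof.
  intros Hbd. destruct window_exists as (e0 & He0 & He & Heh & HL).
  destruct (F_even_uniform A B eps tau dtau Heps Htau HA HB bd e0 n Hbd ltac:(lra)) as (K1 & HK1 & HF).
  destruct (HL e0 ltac:(lra)) as [P3 P4].
  destruct (Ea_tail bd (L e0) Hbd ltac:(lra)) as (s1 & k1 & Hk1 & Hs1 & T1).
  destruct (Ea_tail bd (- L (- e0)) Hbd ltac:(lra)) as (s2 & k2 & Hk2 & Hs2 & T2).
  destruct (conv_tail eps e0 2 _ _ ltac:(lra) (conv_L A eps tau dtau Heps Htau HA)) as (K2 & HK2 & HLt).
  set (K3 := / L e0 + / - L (- e0)).
  assert (i1 : 0 < / L e0) by (apply Rinv_0_lt_compat; lra). assert (i2 : 0 < / - L (- e0)) by (apply Rinv_0_lt_compat; lra).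
  (* The entry bd + 1 keeps M = s + a - 1 nonnegative. *)
  exists e0, (K1 + K3), (Rmin k1 k2), (Rmax (Rmax s1 s2) (bd + 1)).
  split; auto. split; [unfold K3; lra|]. split; [apply Rmin_glb_lt; auto|].
  split. { eapply Rle_trans; [|apply Rmax_r]. lra. }
  intros s a Hs Ha.
  assert (H1 : s1 <= s) by (eapply Rle_trans; [|exact Hs]; eapply Rle_trans; [apply Rmax_l|apply Rmax_l]).
  assert (H2 : s2 <= s) by (eapply Rle_trans; [|exact Hs]; eapply Rle_trans; [apply Rmax_r|apply Rmax_l]).
  assert (H3 : bd + 1 <= s) by (eapply Rle_trans; [|exact Hs]; apply Rmax_r).
  assert (Hs0 : 0 < s) by lra. assert (Ha' := Ha). apply Rabs_le_between in Ha'.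
  assert (HM : 0 <= s + a - 1) by lra.
  destruct (Gk_bounded s (s + a - 1) Hs0 HM) as [Bg HBg].
  set (B' := exp s * Bg). assert (HB' : forall y, Ea s a y <= B').
  { intros y. rewrite <- Ea_Gk. apply Rmult_le_compat_l; [left; apply exp_pos|auto]. }
  assert (HB0 : 0 < B') by (eapply Rlt_le_trans; [apply exp_pos|apply (HB' 0)]).
  destruct (Rem_IG s (s + a - 1) Hs0 HM) as [Exk Lk].
  set (P := fun w => sum_range (fun j => Sc A B a (2 * j) * w ^ (2 * j)) 0 n).
  assert (CP : forall w, continuous P w).
  { intros w. unfold P. clear. induction n as [|n IH]. apply continuous_const.
    apply continuous_ext with (fun w => sum_range (fun j => Sc A B a (2 * j) * w ^ (2 * j)) 0 n + Sc A B a (2 * n) * w ^ (2 * n)).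
    intros; symmetry; apply sum_range_S. apply (continuous_plus (V := R_NormedModule) (fun w => sum_range (fun j => Sc A B a (2 * j) * w ^ (2 * j)) 0 n)); auto.
    smooth; auto. }
  assert (Ce : forall w, continuous (fun w => exp (- (s * w ^ 2 / 2))) w) by (intros; smooth; auto).
  assert (CPg : forall w, continuous (gw s P) w) by (intros; apply (continuous_mult (K := R_AbsRing)); auto).
  assert (IP : sum_range (fun j => Sc A B a (2 * j) * moment e0 s j) 0 n = RInt (gw s P) 0 e0).
  { unfold gw, P. clear - He0. induction n as [|n IH].
    - rewrite sum_range_0. rewrite (RInt_ext _ (fun _ => 0)). rewrite RInt_const. symmetry. apply Rmult_0_r.
      intros; rewrite sum_range_0. rring.
    - rewrite sum_range_S, IH. unfold moment. rewrite <- RInt_mulc by (apply ex_RInt_cont; intros; apply moment_cont).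
      rewrite <- RInt_add.
      + apply RInt_ext. intros w _. rewrite sum_range_S. rring.
      + apply ex_RInt_cont. intros w _. apply (continuous_mult (K := R_AbsRing)); [|smooth; auto].
        clear. induction n as [|n IH]. apply continuous_const.
        apply continuous_ext with (fun w => sum_range (fun j => Sc A B a (2 * j) * w ^ (2 * j)) 0 n + Sc A B a (2 * n) * w ^ (2 * n)).
        intros; symmetry; apply sum_range_S. apply (continuous_plus (V := R_NormedModule) (fun w => sum_range (fun j => Sc A B a (2 * j) * w ^ (2 * j)) 0 n)); auto.
        smooth; auto.
      + apply ex_RInt_cont. intros w _. smooth; auto. }
  rewrite IP.
  destruct (continuity_ab_maj (fun w => Rabs (P w)) 0 e0) as (wm & Hwm & _); [lra| |].
  { intros w _. apply continuity_pt_filterlim. apply (continuous_comp P Rabs); auto. apply continuous_Rabs. }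
  set (PM := Rabs (P wm)) in *. assert (HPM : 0 <= PM) by apply Rabs_pos.
  apply le_epsilon. intros t Ht.
  destruct (Lk (t / 4 * exp (- s))) as (d & Y0 & Hd & HY0 & Hdy).
  { apply Rmult_lt_0_compat; [lra|apply exp_pos]. }
  (* [Q] collects the errors linear in [om]: the missing piece [0, om] of the Gaussian integral and
     the strip. [CL] below keeps [L om] under d. *)
  set (Q := PM + 8 * B' * K2 + 1). assert (HQ : 0 < Q) by (unfold Q; nra).
  set (CL := 2 * (Rabs (lser A 1) + K2) + 1). assert (HCL : 0 < CL) by (unfold CL; pose proof (Rabs_pos (lser A 1)); lra).
  set (om := Rmin e0 (Rmin (t / (4 * Q)) (d / CL))).
  assert (Hom : 0 < om) by (unfold om; repeat apply Rmin_glb_lt; auto; apply Rdiv_lt_0_compat; lra).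
  assert (o1 : om <= e0) by apply Rmin_l.
  assert (o2 : om <= t / (4 * Q)) by (unfold om; eapply Rle_trans; [apply Rmin_r|apply Rmin_l]).
  assert (o3 : om <= d / CL) by (unfold om; eapply Rle_trans; [apply Rmin_r|apply Rmin_r]).
  destruct (HL om ltac:(lra)) as [P1 P2].
  set (Y := Y0 + 1 + L e0 + - L (- e0)).
  assert (E1 : Rabs (L om - lser A 1 * om) <= K2 * om ^ 2).
  { specialize (HLt om ltac:(rewrite Rabs_right; lra)). unfold psum in HLt. rewrite !sum_range_S, sum_range_0 in HLt.
    change (lser A 0) with 0 in HLt. rewrite (Rabs_right om) in HLt by lra.
    replace (ln (tau om) - (0 + 0 * om ^ 0 + lser A 1 * om ^ 1)) with (L om - lser A 1 * om) in HLt by (unfold L; rring). exact HLt. }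
  assert (E2 : Rabs (- L (- om) - lser A 1 * om) <= K2 * om ^ 2).
  { specialize (HLt (- om) ltac:(rewrite Rabs_Ropp, Rabs_right; lra)). unfold psum in HLt. rewrite !sum_range_S, sum_range_0 in HLt.
    change (lser A 0) with 0 in HLt. rewrite Rabs_Ropp, (Rabs_right om) in HLt by lra.
    rewrite <- Rabs_Ropp in HLt.
    replace (- (ln (tau (- om)) - (0 + 0 * (- om) ^ 0 + lser A 1 * (- om) ^ 1))) with (- L (- om) - lser A 1 * om) in HLt by (unfold L; rring). exact HLt. }
  assert (Hdl : 0 < L om < d).
  { split; [lra|]. apply Rabs_le_between in E1. pose proof (Rle_abs (lser A 1)).
    assert (om ^ 2 <= om) by nra.
    assert (L om <= (Rabs (lser A 1) + K2) * om) by nra.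
    assert (HC4 : om * CL <= d). { apply (Rmult_le_compat_r CL) in o3; [|lra]. unfold Rdiv in o3. rewrite Rmult_assoc, Rinv_l in o3 by lra. lra. }
    assert (0 <= (Rabs (lser A 1) + K2) * om) by (apply Rmult_le_pos; [pose proof (Rabs_pos (lser A 1))|]; lra).
    unfold CL in HC4. lra. }
  specialize (Hdy (L om) Y Hdl ltac:(unfold Y; lra)).
  pose proof (window_identity s a om e0 Y Hs0 ltac:(lra) He HL ltac:(unfold Y; lra) ltac:(unfold Y; lra)) as W.
  set (I0 := RInt (Rk s (s + a - 1)) (L om) Y) in *.
  pose proof (T1 s a Y 1 H1 Ha ltac:(unfold Y; lra) (or_introl eq_refl)) as B1.
  pose proof (T2 s a Y (-1) H2 Ha ltac:(unfold Y; lra) (or_intror eq_refl)) as B2.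
  set (R3 := RInt (fun y => Ea s a (1 * y) / (exp y - exp (- y))) (L e0) Y) in *.
  set (R2 := RInt (fun y => Ea s a (-1 * y) / (exp y - exp (- y))) (- L (- e0)) Y) in *.
  assert (B3 : Rabs (RInt (fun y => Ea s a (-1 * y) / (exp y - exp (- y))) (L om) (- L (- om))) <= 8 * B' * K2 * om).
  { assert (Ex3 : ex_RInt (fun y => Ea s a (-1 * y) / (exp y - exp (- y))) (L om) (- L (- om))).
    { apply ex_RInt_cont. intros y Hy. apply Ea_quot_continuous, (pos_of_between (L om) (- L (- om))); auto; lra. }
    eapply Rle_trans.
    - apply (RInt_dom_abs _ (fun _ => B' * (4 / om))); auto; [|apply ex_RInt_const].
      intros y Hy. assert (Hy4 : om / 4 <= y) by (eapply Rle_trans; [|apply Hy]; apply Rmin_glb; lra).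
      pose proof (exp_gap y ltac:(lra)). unfold Rdiv. rewrite Rabs_mult, Rabs_right by (left; apply exp_pos).
      rewrite (Rabs_right (/ _)) by (left; apply Rinv_0_lt_compat; lra). apply Rmult_le_compat.
      left; apply exp_pos. left; apply Rinv_0_lt_compat; lra. apply HB'.
      apply Rle_trans with (/ (om / 4)). apply Rinv_le_contravar; lra. right; field; lra.
    - rewrite RInt_const. match goal with |- Rabs (scal ?x ?y) <= _ => change (Rabs (x * y) <= 8 * B' * K2 * om) end.
      rewrite Rabs_mult, (Rabs_right (B' * _)) by (apply Rle_ge, Rmult_le_pos; [lra|left; apply Rdiv_lt_0_compat; lra]).
      assert (X : Rabs (- L (- om) - L om) <= 2 * K2 * om ^ 2).
      { replace (- L (- om) - L om) with ((- L (- om) - lser A 1 * om) + - (L om - lser A 1 * om)) by rring.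
        eapply Rle_trans; [apply Rabs_triang|]. rewrite Rabs_Ropp. lra. }
      apply Rle_trans with (2 * K2 * om ^ 2 * (B' * (4 / om))).
      apply Rmult_le_compat_r; auto. apply Rmult_le_pos; [lra|left; apply Rdiv_lt_0_compat; lra].
      right. field. lra. }
  set (R1 := RInt (fun y => Ea s a (-1 * y) / (exp y - exp (- y))) (L om) (- L (- om))) in *.
  assert (CF : forall w, Rabs w < eps -> continuous (F a) w).
  { intros w Hw. apply (conv_continuous eps (Sc A B a)); auto. apply (conv_S A B eps tau dtau); auto. }
  assert (CFe : forall w, om <= w <= e0 -> continuous (gw s (fun w => (F a w + F a (- w)) / 2)) w).
  { intros w Hw. apply (continuous_mult (K := R_AbsRing) (fun w => (F a w + F a (- w)) / 2)); auto.
    apply (continuous_mult (K := R_AbsRing) (fun w => F a w + F a (- w))); [|apply continuous_const].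
    apply (continuous_plus (V := R_NormedModule) (F a) (fun w => F a (- w))). apply CF; rewrite Rabs_right; lra.
    apply (continuous_comp (fun w => - w) (F a)). smooth; auto. apply CF. rewrite Rabs_Ropp, Rabs_right; lra. }
  assert (B4 : Rabs (RInt (gw s (fun w => (F a w + F a (- w)) / 2)) om e0 - RInt (gw s P) om e0) <= K1 * moment e0 s n).
  { assert (Ed : RInt (gw s (fun w => (F a w + F a (- w)) / 2)) om e0 - RInt (gw s P) om e0 =
      RInt (fun w => gw s (fun w => (F a w + F a (- w)) / 2) w - gw s P w) om e0).
    { symmetry. apply (RInt_minus (gw s (fun w => (F a w + F a (- w)) / 2)) (gw s P)); apply ex_RInt_cont; intros w Hw; auto.
      rewrite Rmin_left, Rmax_right in Hw by lra. auto. }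
    rewrite Ed. unfold moment. rewrite <- RInt_mulc by (apply ex_RInt_cont; intros; apply moment_cont).
    assert (Cm : forall w, continuous (fun w => K1 * (w ^ (2 * n) * exp (- (s * w ^ 2 / 2)))) w).
    { intros w. apply (continuous_mult (K := R_AbsRing)). apply continuous_const. apply moment_cont. }
    apply Rle_trans with (RInt (fun w => K1 * (w ^ (2 * n) * exp (- (s * w ^ 2 / 2)))) om e0).
    - apply RInt_dom; auto.
      + apply ex_RInt_cont. intros w Hw. rewrite Rmin_left, Rmax_right in Hw by lra.
        apply (continuous_minus (V := R_NormedModule) (gw s (fun w => (F a w + F a (- w)) / 2)) (gw s P)); auto.
      + apply ex_RInt_cont; auto.
      + intros w Hw. unfold gw. rewrite <- Rmult_minus_distr_r, Rabs_mult, (Rabs_right (exp _)) by (left; apply exp_pos).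
        rewrite <- Rmult_assoc. apply Rmult_le_compat_r; [left; apply exp_pos|].
        apply HF; auto. rewrite Rabs_right; lra. lra.
    - rewrite (RInt_split _ 0 om e0) by (apply ex_RInt_cont; auto).
      assert (0 <= RInt (fun w => K1 * (w ^ (2 * n) * exp (- (s * w ^ 2 / 2)))) 0 om); [|lra].
      apply RInt_ge_0; [lra|apply ex_RInt_cont; auto|]. intros w Hw. apply Rmult_le_pos; auto.
      apply Rmult_le_pos; [apply pow_le; lra|left; apply exp_pos]. }
  assert (B5 : Rabs (RInt (gw s P) 0 om) <= PM * om).
  { replace (PM * om) with ((om - 0) * PM) by rring. apply abs_RInt_const; [lra|apply ex_RInt_cont; auto|].
    intros w Hw. unfold gw. rewrite Rabs_mult, (Rabs_right (exp _)) by (left; apply exp_pos).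
    rewrite <- (Rmult_1_r PM). apply Rmult_le_compat. apply Rabs_pos. left; apply exp_pos. apply Hwm; lra.
    rewrite <- exp_0. apply exp_le. pose proof (pow2_ge_0 w). nra. }
  assert (S0 : RInt (gw s P) 0 e0 = RInt (gw s P) 0 om + RInt (gw s P) om e0) by (apply RInt_split; apply ex_RInt_cont; auto).
  assert (B6 : Rabs (exp s * I0 - exp s * Rem s (s + a - 1)) <= t / 4).
  { rewrite <- Rmult_minus_distr_l, Rabs_mult, (Rabs_right (exp s)) by (left; apply exp_pos).
    apply Rle_trans with (exp s * (t / 4 * exp (- s))). apply Rmult_le_compat_l; [left; apply exp_pos|lra].
    right. replace (exp s * (t / 4 * exp (- s))) with (t / 4 * (exp s * exp (- s))) by rring.
    rewrite <- exp_plus, Rplus_opp_r, exp_0. rring. }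
  assert (B7 : om * (4 * Q) <= t).
  { apply (Rmult_le_compat_r (4 * Q)) in o2; [|lra]. unfold Rdiv in o2. rewrite Rmult_assoc, Rinv_l in o2 by lra. lra. }
  assert (B8 : / L e0 * exp (- k1 * s) + / - L (- e0) * exp (- k2 * s) <= K3 * exp (- Rmin k1 k2 * s)).
  { unfold K3. rewrite Rmult_plus_distr_r. pose proof (Rmin_l k1 k2). pose proof (Rmin_r k1 k2).
    apply Rplus_le_compat; apply Rmult_le_compat_l; try lra; apply exp_le; nra. }
  assert (M0 : 0 <= moment e0 s n).
  { apply RInt_ge_0; [lra|apply ex_RInt_cont; intros; apply moment_cont|]. intros w Hw.
    apply Rmult_le_pos; [apply pow_le; lra|left; apply exp_pos]. }
  pose proof (exp_pos (- Rmin k1 k2 * s)) as Xp.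
  rewrite S0. set (J1 := RInt (gw s P) om e0) in *. set (J0 := RInt (gw s P) 0 om) in *.
  set (J2 := RInt (gw s (fun w => (F a w + F a (- w)) / 2)) om e0) in *.
  replace (exp s * Rem s (s + a - 1) - (J0 + J1)) with
    (- (exp s * I0 - exp s * Rem s (s + a - 1)) + (J2 - J1) + R1 + R2 - R3 - J0) by (rewrite W; rring).
  assert (Hfin : forall x1 x2 x3 x4 x5 x6, Rabs (- x1 + x2 + x3 + x4 - x5 - x6) <= Rabs x1 + Rabs x2 + Rabs x3 + Rabs x4 + Rabs x5 + Rabs x6).
  { intros. unfold Rabs. repeat destruct Rcase_abs; lra. }
  eapply Rle_trans; [apply Hfin|]. unfold Q in B7.
  assert (K1 * moment e0 s n <= (K1 + K3) * moment e0 s n) by (apply Rmult_le_compat_r; unfold K3; lra).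
  assert (K3 * exp (- Rmin k1 k2 * s) <= (K1 + K3) * exp (- Rmin k1 k2 * s)) by (apply Rmult_le_compat_r; lra).
  lra.
Qed.
End Laplace.

(* [2 x + a - 1] is the index [2 N_k] when [x = pi k t] and [a = a_k]. *)
Definition Trem (a x : R) : R := 2 * exp (2 * x) * sqrt (x / PI) * Rem (2 * x) (2 * x + a - 1).

Lemma GamR_ratio (s : nat) : GamR (INR s + / 2) 0 / GamR (/ 2) 0 = rfact s.
Proof.
  pose proof (GamR_pos (/ 2) ltac:(lra)) as H0.
  induction s. simpl. rewrite Rplus_0_l. field. lra.
  pose proof (pos_INR s). destruct (Gam_succ (INR s + / 2) 0 ltac:(lra)) as [E _].
  rewrite S_INR. replace (INR s + 1 + / 2) with (INR s + / 2 + 1) by ring. rewrite E. simpl rfact. rewrite <- IHs. field. lra.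
Qed.

Lemma C_coeff_Sc (A B : R -> nat -> R) (s : nat) (a : R) : C_coeff A B s a = Sc A B a (2 * s) * rfact s.
Proof. unfold C_coeff. rewrite <- GamR_ratio. reflexivity. Qed.

(** * Expansion of the normalised remainder *)

Section Expansion.
Variables (A B : R -> nat -> R).
Hypothesis HAB : are_AB_coefficients A B.

Lemma Sc_bound_AB (s : nat) : exists K, 0 <= K /\ forall a, Rabs (Sc A B a s) <= K * (1 + Rabs a) ^ (s + 2).
Proof.
  destruct HAB as (eps & tau & dtau & Heps & Htau & Hlim & HA & HB).
  apply (Sc_bound A B eps tau dtau); auto.
Qed.

(** The factor 2 sqrt (x / pi) cancels the Gaussian constant and the moments supply
    [rfact j * x^(-j)], so that [Sc] becomes [C_coeff]. What the truncation of the moments leaves is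
    exponentially small and fits under x^(-n). *)
Lemma Trem_expansion : has_inner_expansion (C_coeff A B) Trem.
Proof.
  intros n bound. destruct HAB as (eps & tau & dtau & Heps & Htau & Hlim & HA & HB).
  set (bd := Rabs bound). assert (Hbd : 0 <= bd) by apply Rabs_pos.
  destruct (Rem_local A B eps tau dtau Heps Htau Hlim HA HB bd n Hbd) as (e0 & K & kap & s0 & He0 & HK & Hkap & Hs0 & HR).
  set (k2 := e0 ^ 2 / 2). assert (Hk2 : 0 < k2) by (unfold k2; nra).
  set (km := Rmin kap k2). assert (Hkm : 0 < km) by (apply Rmin_glb_lt; auto).
  assert (HS : forall m, exists D, 0 <= D /\ forall s a, 1 <= s -> Rabs a <= bd ->
     Rabs (sum_range (fun j => Sc A B a (2 * j) * moment e0 s j) 0 m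
        - sum_range (fun j => Sc A B a (2 * j) * (rfact j * (2 / s) ^ j * (sqrt (2 / s) * (sqrt PI / 2)))) 0 m) <= D * exp (- km * s)).
  { induction m as [|m (D & HD & H)].
    - exists 0. split; [lra|]. intros. rewrite !sum_range_0, Rminus_eq_0, Rabs_R0. lra.
    - destruct (Sc_bound_AB (2 * m)) as (Ks & HKs & HSb).
      destruct (moment_asymptotic e0 m He0) as (C & HC & Hm).
      exists (D + Ks * (1 + bd) ^ (2 * m + 2) * C).
      assert (P0 : 0 <= Ks * (1 + bd) ^ (2 * m + 2)) by (apply Rmult_le_pos; [auto|apply pow_le; lra]).
      split. { apply Rplus_le_le_0_compat; [auto|apply Rmult_le_pos; auto]. }
      intros s a Hs Ha. rewrite !sum_range_S. specialize (H s a Hs Ha). specialize (Hm s Hs). specialize (HSb a).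
      set (X := sum_range (fun j => Sc A B a (2 * j) * moment e0 s j) 0 m) in *.
      set (Y := sum_range (fun j => Sc A B a (2 * j) * (rfact j * (2 / s) ^ j * (sqrt (2 / s) * (sqrt PI / 2)))) 0 m) in *.
      set (M := moment e0 s m) in *. set (N := rfact m * (2 / s) ^ m * (sqrt (2 / s) * (sqrt PI / 2))) in *.
      replace (X + Sc A B a (2 * m) * M - (Y + Sc A B a (2 * m) * N)) with ((X - Y) + Sc A B a (2 * m) * (M - N)) by ring.
      eapply Rle_trans; [apply Rabs_triang|]. rewrite Rmult_plus_distr_r. apply Rplus_le_compat; auto.
      rewrite Rabs_mult, Rmult_assoc. apply Rmult_le_compat; try apply Rabs_pos.
      + eapply Rle_trans; [exact HSb|]. apply Rmult_le_compat_l; auto. apply pow_incr. pose proof (Rabs_pos a). lra.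
      + eapply Rle_trans; [exact Hm|]. apply Rmult_le_compat_l; auto. apply exp_le.
        replace (- (s * e0 ^ 2 / 2)) with (- k2 * s) by (unfold k2; field). assert (km <= k2) by apply Rmin_r. nra. }
  destruct (HS n) as (D & HD & HSn).
  destruct (moment_asymptotic e0 n He0) as (C & HC & Hm).
  (* The extra power leaves room for the factor sqrt (x / PI) <= x. *)
  destruct (pow_le_exp (n + 1) (2 * km) ltac:(lra)) as (Cp & HCp & Hpow).
  exists (K * rfact n + 2 * (K * C + K + D) * Cp).
  exists (Rmax s0 1). intros x Hx a Ha.
  assert (Hx1 : 1 < x) by (eapply Rle_lt_trans; [apply Rmax_r|exact Hx]).
  assert (Hxs : s0 < x) by (eapply Rle_lt_trans; [apply Rmax_l|exact Hx]).
  assert (Ha' : Rabs a <= bd) by (eapply Rle_trans; [exact Ha|apply Rle_abs]).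
  pose proof PI_RGT_0 as HP.
  specialize (HR (2 * x) a ltac:(lra) Ha'). specialize (HSn (2 * x) a ltac:(lra) Ha'). specialize (Hm (2 * x) ltac:(lra)).
  replace (2 / (2 * x)) with (/ x) in HSn, Hm by (field; lra).
  set (q := sqrt (x / PI)). set (w := sqrt (/ x) * (sqrt PI / 2)) in *.
  assert (Qw : 2 * q * w = 1).
  { unfold q, w. replace (2 * sqrt (x / PI) * (sqrt (/ x) * (sqrt PI / 2))) with (sqrt (x / PI) * sqrt (/ x) * sqrt PI) by field.
    rewrite <- !sqrt_mult_alt; try (left; apply Rdiv_lt_0_compat; lra).
    replace (x / PI * / x * PI) with 1 by (field; lra). apply sqrt_1.
    left; apply Rmult_lt_0_compat; [apply Rdiv_lt_0_compat|apply Rinv_0_lt_compat]; lra. }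
  assert (Hq : 0 < q <= x).
  { split. apply sqrt_lt_R0, Rdiv_lt_0_compat; lra. apply Rle_trans with (sqrt (x * x)).
    apply sqrt_le_1; try nra. left; apply Rdiv_lt_0_compat; lra.
    unfold Rdiv. apply Rmult_le_compat_l; [lra|]. apply Rle_trans with 1; [|lra]. rewrite <- Rinv_1. apply Rinv_le_contravar; [lra|]. pose proof PI2_1; lra.
    rewrite sqrt_square; lra. }
  assert (Hw : 0 < w) by nra.
  assert (EI : inner_sum (C_coeff A B) n a x = 2 * q * sum_range (fun j => Sc A B a (2 * j) * (rfact j * (/ x) ^ j * w)) 0 n).
  { unfold inner_sum. rewrite <- sum_range_scal. apply sum_range_ext. intros j _. rewrite C_coeff_Sc, pow_inv.
    replace (2 * q * (Sc A B a (2 * j) * (rfact j * / x ^ j * w))) with (Sc A B a (2 * j) * rfact j * / x ^ j * (2 * q * w)) by ring.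
    rewrite Qw. unfold Rdiv. ring. }
  rewrite EI. unfold Trem. fold q.
  set (S1 := sum_range (fun j => Sc A B a (2 * j) * moment e0 (2 * x) j) 0 n) in *.
  set (S2 := sum_range (fun j => Sc A B a (2 * j) * (rfact j * (/ x) ^ j * w)) 0 n) in *.
  replace (2 * exp (2 * x) * q * Rem (2 * x) (2 * x + a - 1) - 2 * q * S2) with
    (2 * q * ((exp (2 * x) * Rem (2 * x) (2 * x + a - 1) - S1) + (S1 - S2))) by ring.
  rewrite Rabs_mult, (Rabs_right (2 * q)) by lra.
  set (E := exp (- km * (2 * x))) in *. assert (HE : 0 < E) by apply exp_pos.
  assert (E1 : exp (- kap * (2 * x)) <= E) by (apply exp_le; assert (km <= kap) by apply Rmin_l; nra).
  assert (E2 : exp (- (2 * x * e0 ^ 2 / 2)) <= E).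
  { apply exp_le. replace (- (2 * x * e0 ^ 2 / 2)) with (- k2 * (2 * x)) by (unfold k2; field). assert (km <= k2) by apply Rmin_r. nra. }
  assert (M1 : moment e0 (2 * x) n <= rfact n * (/ x) ^ n * w + C * E).
  { apply Rabs_le_between in Hm. assert (C * exp (- (2 * x * e0 ^ 2 / 2)) <= C * E) by (apply Rmult_le_compat_l; auto). lra. }
  assert (Tot : Rabs ((exp (2 * x) * Rem (2 * x) (2 * x + a - 1) - S1) + (S1 - S2)) <= K * (rfact n * (/ x) ^ n * w) + (K * C + K + D) * E).
  { eapply Rle_trans; [apply Rabs_triang|].
    assert (K * moment e0 (2 * x) n <= K * (rfact n * (/ x) ^ n * w + C * E)) by (apply Rmult_le_compat_l; auto).
    assert (K * exp (- kap * (2 * x)) <= K * E) by (apply Rmult_le_compat_l; auto). lra. }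
  apply (Rmult_le_compat_l (2 * q)) in Tot; [|lra]. eapply Rle_trans; [exact Tot|].
  rewrite Rmult_plus_distr_l.
  replace (2 * q * (K * (rfact n * (/ x) ^ n * w))) with (K * rfact n * (/ x) ^ n * (2 * q * w)) by ring. rewrite Qw, Rmult_1_r.
  unfold Rdiv. rewrite pow_inv.
  replace ((K * rfact n + 2 * (K * C + K + D) * Cp) * / x ^ n) with (K * rfact n * / x ^ n + 2 * (K * C + K + D) * Cp * / x ^ n) by ring.
  apply Rplus_le_compat_l.
  assert (Hxn : 0 < x ^ n) by (apply pow_lt; lra).
  apply (Rmult_le_reg_r (x ^ n)); auto. rewrite (Rmult_assoc _ (/ x ^ n)), Rinv_l, Rmult_1_r by lra.
  specialize (Hpow x ltac:(lra)). rewrite pow_add, pow_1 in Hpow.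
  assert (Ee : E * exp (2 * km * x) = 1).
  { unfold E. rewrite <- exp_plus. replace (- km * (2 * x) + 2 * km * x) with 0 by ring. apply exp_0. }
  assert (X1 : E * (x ^ n * x) <= Cp).
  { apply Rle_trans with (E * (Cp * exp (2 * km * x))). apply Rmult_le_compat_l; lra.
    right. replace (E * (Cp * exp (2 * km * x))) with (Cp * (E * exp (2 * km * x))) by ring. rewrite Ee. ring. }
  assert (HKK : 0 <= K * C + K + D). { assert (0 <= K * C) by (apply Rmult_le_pos; auto). lra. }
  apply Rle_trans with (2 * (K * C + K + D) * (E * (x ^ n * x))).
  - replace (2 * q * ((K * C + K + D) * E) * x ^ n) with (2 * (K * C + K + D) * (E * (x ^ n * q))) by ring.
    apply Rmult_le_compat_l; [lra|]. apply Rmult_le_compat_l; [lra|]. apply Rmult_le_compat_l; lra.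
  - apply Rmult_le_compat_l; lra.
Qed.
End Expansion.

(** * The first coefficients *)

Section Recurrences.
(** The sequences stand for sigma = (tau - 1) / w, tau^(a-1) tau' and 1 - w F(a, w), and [d] below
    for 1 + tau. The recurrences express tau' sigma = tau, the derivative of sigma tau^(a-1) tau' =
    tau^a, and (1 - w F) sigma (1 + tau) = 2 tau^(a-1) tau'. Each is triangular, with the newest
    coefficient as its only unknown. *)
Variables (s h t : nat -> R) (a : R).
Hypothesis Hs0 : s 0%nat = 1.
Hypothesis Hs : forall n, sum_f_R0 (fun k => INR (S k) * s k * s (S n - k)%nat) (S n) = s n.
Hypothesis Hh0 : h 0%nat = 1.
Hypothesis Hh : forall n, INR (S n) * sum_f_R0 (fun k => s k * h (S n - k)%nat) (S n) = a * h n.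
Let d (n : nat) : R := match n with O => 2 | S m => s m end.
Hypothesis Ht : forall n, sum_f_R0 (fun k => t k * PS_mult s d (n - k)%nat) n = 2 * h n.

Ltac expand H := cbn [sum_f_R0 Nat.sub] in H; rewrite ?S_INR, ?INR_0 in H; cbn [INR] in H.

Let s1 : s 1%nat = 1 / 3.
Proof. pose proof (Hs 0) as E. expand E. rewrite Hs0 in E. lra. Qed.
Let s2 : s 2%nat = 1 / 36.
Proof. pose proof (Hs 1) as E. expand E. rewrite Hs0, s1 in E. lra. Qed.
Let s3 : s 3%nat = - (1 / 270).
Proof. pose proof (Hs 2) as E. expand E. rewrite Hs0, s1, s2 in E. lra. Qed.
Let s4 : s 4%nat = 1 / 4320.
Proof. pose proof (Hs 3) as E. expand E. rewrite Hs0, s1, s2, s3 in E. lra. Qed.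
Let s5 : s 5%nat = 1 / 17010.
Proof. pose proof (Hs 4) as E. expand E. rewrite Hs0, s1, s2, s3, s4 in E. lra. Qed.
Let s6 : s 6%nat = - (139 / 5443200).
Proof. pose proof (Hs 5) as E. expand E. rewrite Hs0, s1, s2, s3, s4, s5 in E. lra. Qed.
Let s7 : s 7%nat = 1 / 204120.
Proof. pose proof (Hs 6) as E. expand E. rewrite Hs0, s1, s2, s3, s4, s5, s6 in E. lra. Qed.
Let s8 : s 8%nat = - (571 / 2351462400).
Proof. pose proof (Hs 7) as E. expand E. rewrite Hs0, s1, s2, s3, s4, s5, s6, s7 in E. lra. Qed.
Let s9 : s 9%nat = - (281 / 1515591000).
Proof. pose proof (Hs 8) as E. expand E. rewrite Hs0, s1, s2, s3, s4, s5, s6, s7, s8 in E. lra. Qed.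
Let s10 : s 10%nat = 163879 / 2172751257600.
Proof. pose proof (Hs 9) as E. expand E. rewrite Hs0, s1, s2, s3, s4, s5, s6, s7, s8, s9 in E. lra. Qed.
Let s11 : s 11%nat = - (5221 / 354648294000).
Proof. pose proof (Hs 10) as E. expand E. rewrite Hs0, s1, s2, s3, s4, s5, s6, s7, s8, s9, s10 in E. lra. Qed.
Let u0 : PS_mult s d 0 = 2.
Proof. unfold PS_mult. cbn [sum_f_R0 Nat.sub]. unfold d. rewrite Hs0. lra. Qed.
Let u1 : PS_mult s d 1 = 5 / 3.
Proof. unfold PS_mult. cbn [sum_f_R0 Nat.sub]. unfold d. rewrite Hs0, s1. lra. Qed.
Let u2 : PS_mult s d 2 = 13 / 18.
Proof. unfold PS_mult. cbn [sum_f_R0 Nat.sub]. unfold d. rewrite Hs0, s1, s2. lra. Qed.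
Let u3 : PS_mult s d 3 = 43 / 270.
Proof. unfold PS_mult. cbn [sum_f_R0 Nat.sub]. unfold d. rewrite Hs0, s1, s2, s3. lra. Qed.
Let u4 : PS_mult s d 4 = 5 / 432.
Proof. unfold PS_mult. cbn [sum_f_R0 Nat.sub]. unfold d. rewrite Hs0, s1, s2, s3, s4. lra. Qed.
Let u5 : PS_mult s d 5 = - (19 / 17010).
Proof. unfold PS_mult. cbn [sum_f_R0 Nat.sub]. unfold d. rewrite Hs0, s1, s2, s3, s4, s5. lra. Qed.
Let u6 : PS_mult s d 6 = 41 / 2721600.
Proof. unfold PS_mult. cbn [sum_f_R0 Nat.sub]. unfold d. rewrite Hs0, s1, s2, s3, s4, s5, s6. lra. Qed.
Let u7 : PS_mult s d 7 = 1 / 40824.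
Proof. unfold PS_mult. cbn [sum_f_R0 Nat.sub]. unfold d. rewrite Hs0, s1, s2, s3, s4, s5, s6, s7. lra. Qed.
Let u8 : PS_mult s d 8 = - (7243 / 1175731200).
Proof. unfold PS_mult. cbn [sum_f_R0 Nat.sub]. unfold d. rewrite Hs0, s1, s2, s3, s4, s5, s6, s7, s8. lra. Qed.
Let u9 : PS_mult s d 9 = 923 / 1515591000.
Proof. unfold PS_mult. cbn [sum_f_R0 Nat.sub]. unfold d. rewrite Hs0, s1, s2, s3, s4, s5, s6, s7, s8, s9. lra. Qed.
Let u10 : PS_mult s d 10 = 23183 / 217275125760.
Proof. unfold PS_mult. cbn [sum_f_R0 Nat.sub]. unfold d. rewrite Hs0, s1, s2, s3, s4, s5, s6, s7, s8, s9, s10. lra. Qed.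
Let u11 : PS_mult s d 11 = - (21401 / 354648294000).
Proof. unfold PS_mult. cbn [sum_f_R0 Nat.sub]. unfold d. rewrite Hs0, s1, s2, s3, s4, s5, s6, s7, s8, s9, s10, s11. lra. Qed.
Let h1 : h 1%nat = (- 1 + 3 * a) / 3.
Proof. pose proof (Hh 0) as E. expand E. rewrite Hs0, s1, Hh0 in E. lra. Qed.
Let h2 : h 2%nat = (1 - 6 * a + 6 * a ^ 2) / 12.
Proof. pose proof (Hh 1) as E. expand E. rewrite Hs0, s1, s2, Hh0, h1 in E. lra. Qed.
Let h3 : h 3%nat = (- 4 + 45 * a - 90 * a ^ 2 + 45 * a ^ 3) / 270.
Proof. pose proof (Hh 2) as E. expand E. rewrite Hs0, s1, s2, s3, Hh0, h1, h2 in E. lra. Qed.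
Let h4 : h 4%nat = (1 - 36 * a + 120 * a ^ 2 - 120 * a ^ 3 + 36 * a ^ 4) / 864.
Proof. pose proof (Hh 3) as E. expand E. rewrite Hs0, s1, s2, s3, s4, Hh0, h1, h2, h3 in E. lra. Qed.
Let h5 : h 5%nat = (8 + 168 * a - 987 * a ^ 2 + 1575 * a ^ 3 - 945 * a ^ 4 + 189 * a ^ 5) / 22680.
Proof. pose proof (Hh 4) as E. expand E. rewrite Hs0, s1, s2, s3, s4, s5, Hh0, h1, h2, h3, h4 in E. lra. Qed.
Let h6 : h 6%nat = (- 139 - 450 * a + 8190 * a ^ 2 - 20160 * a ^ 3 + 18900 * a ^ 4 - 7560 * a ^ 5 + 1080 * a ^ 6) / 777600.
Proof. pose proof (Hh 5) as E. expand E. rewrite Hs0, s1, s2, s3, s4, s5, s6, Hh0, h1, h2, h3, h4, h5 in E. lra. Qed.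
Let h7 : h 7%nat = (16 - 72 * a - 744 * a ^ 2 + 3129 * a ^ 3 - 4284 * a ^ 4 + 2646 * a ^ 5 - 756 * a ^ 6 + 81 * a ^ 7) / 408240.
Proof. pose proof (Hh 6) as E. expand E. rewrite Hs0, s1, s2, s3, s4, s5, s6, s7, Hh0, h1, h2, h3, h4, h5, h6 in E. lra. Qed.
Let h8 : h 8%nat = (- 571 + 23352 * a + 34464 * a ^ 2 - 465840 * a ^ 3 + 945000 * a ^ 4 - 828576 * a ^ 5 + 362880 * a ^ 6 - 77760 * a ^ 7 + 6480 * a ^ 8) / 261273600.
Proof. pose proof (Hh 7) as E. expand E. rewrite Hs0, s1, s2, s3, s4, s5, s6, s7, s8, Hh0, h1, h2, h3, h4, h5, h6, h7 in E. lra. Qed.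
Let h9 : h 9%nat = (- 8992 - 95040 * a + 225720 * a ^ 2 + 1437480 * a ^ 3 - 4922775 * a ^ 4 + 6018705 * a ^ 5 - 3679830 * a ^ 6 + 1202850 * a ^ 7 - 200475 * a ^ 8 + 13365 * a ^ 9) / 4849891200.
Proof. pose proof (Hh 8) as E. expand E. rewrite Hs0, s1, s2, s3, s4, s5, s6, s7, s8, s9, Hh0, h1, h2, h3, h4, h5, h6, h7, h8 in E. lra. Qed.
Let h10 : h 10%nat = (163879 + 215838 * a - 4437510 * a ^ 2 - 3688608 * a ^ 3 + 44745624 * a ^ 4 - 79268112 * a ^ 5 + 65430288 * a ^ 6 - 29538432 * a ^ 7 + 7484400 * a ^ 8 - 997920 * a ^ 9 + 54432 * a ^ 10) / 197522841600.
Proof. pose proof (Hh 9) as E. expand E. rewrite Hs0, s1, s2, s3, s4, s5, s6, s7, s8, s9, s10, Hh0, h1, h2, h3, h4, h5, h6, h7, h8, h9 in E. lra. Qed.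
Let h11 : h 11%nat = (- 334144 + 1753440 * a + 9091056 * a ^ 2 - 15907320 * a ^ 3 - 67876380 * a ^ 4 + 203200569 * a ^ 5 - 227605950 * a ^ 6 + 136042335 * a ^ 7 - 47258640 * a ^ 8 + 9555975 * a ^ 9 - 1042470 * a ^ 10 + 47385 * a ^ 11) / 1891457568000.
Proof. pose proof (Hh 10) as E. expand E. rewrite Hs0, s1, s2, s3, s4, s5, s6, s7, s8, s9, s10, s11, Hh0, h1, h2, h3, h4, h5, h6, h7, h8, h9, h10 in E. lra. Qed.
Let t0 : t 0%nat = (1).
Proof. pose proof (Ht 0) as E. cbn [sum_f_R0 Nat.sub] in E. rewrite u0, Hh0 in E. lra. Qed.
Let t1 : t 1%nat = (- 7 + 6 * a) / 6.
Proof. pose proof (Ht 1) as E. cbn [sum_f_R0 Nat.sub] in E. rewrite u0, u1, t0, h1 in E. lra. Qed.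
Let t2 : t 2%nat = (25 - 48 * a + 18 * a ^ 2) / 36.
Proof. pose proof (Ht 2) as E. cbn [sum_f_R0 Nat.sub] in E. rewrite u0, u1, u2, t0, t1, h2 in E. lra. Qed.
Let t3 : t 3%nat = (- 136 + 495 * a - 405 * a ^ 2 + 90 * a ^ 3) / 540.
Proof. pose proof (Ht 3) as E. cbn [sum_f_R0 Nat.sub] in E. rewrite u0, u1, u2, u3, t0, t1, t2, h3 in E. lra. Qed.
Let t4 : t 4%nat = (307 - 2616 * a + 3780 * a ^ 2 - 1800 * a ^ 3 + 270 * a ^ 4) / 6480.
Proof. pose proof (Ht 4) as E. cbn [sum_f_R0 Nat.sub] in E. rewrite u0, u1, u2, u3, u4, t0, t1, t2, t3, h4 in E. lra. Qed.
Let t5 : t 5%nat = (695 + 20538 * a - 54180 * a ^ 2 + 43680 * a ^ 3 - 13860 * a ^ 4 + 1512 * a ^ 5) / 181440.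
Proof. pose proof (Ht 5) as E. cbn [sum_f_R0 Nat.sub] in E. rewrite u0, u1, u2, u3, u4, u5, t0, t1, t2, t3, t4, h5 in E. lra. Qed.
Let t6 : t 6%nat = (- 41657 - 113040 * a + 861840 * a ^ 2 - 1139040 * a ^ 3 + 595350 * a ^ 4 - 136080 * a ^ 5 + 11340 * a ^ 6) / 8164800.
Proof. pose proof (Ht 6) as E. cbn [sum_f_R0 Nat.sub] in E. rewrite u0, u1, u2, u3, u4, u5, u6, t0, t1, t2, t3, t4, t5, h6 in E. lra. Qed.
Let t7 : t 7%nat = (15953 - 55929 * a - 388395 * a ^ 2 + 949410 * a ^ 3 - 767340 * a ^ 4 + 283500 * a ^ 5 - 49140 * a ^ 6 + 3240 * a ^ 7) / 16329600.
Proof. pose proof (Ht 7) as E. cbn [sum_f_R0 Nat.sub] in E. rewrite u0, u1, u2, u3, u4, u5, u6, u7, t0, t1, t2, t3, t4, t5, t6, h7 in E. lra. Qed.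
Let t8 : t 8%nat = (31195 + 173952 * a + 177840 * a ^ 2 - 1697520 * a ^ 3 + 2183580 * a ^ 4 - 1203552 * a ^ 5 + 332640 * a ^ 6 - 45360 * a ^ 7 + 2430 * a ^ 8) / 97977600.
Proof. pose proof (Ht 8) as E. cbn [sum_f_R0 Nat.sub] in E. rewrite u0, u1, u2, u3, u4, u5, u6, u7, u8, t0, t1, t2, t3, t4, t5, t6, t7, h8 in E. lra. Qed.
Let t9 : t 9%nat = (- 170640893 - 21630510 * a + 598217400 * a ^ 2 + 2559569760 * a ^ 3 - 6176233800 * a ^ 4 + 5034007440 * a ^ 5 - 2026775520 * a ^ 6 + 436233600 * a ^ 7 - 48114000 * a ^ 8 + 2138400 * a ^ 9) / 775982592000.
Proof. pose proof (Ht 9) as E. cbn [sum_f_R0 Nat.sub] in E. rewrite u0, u1, u2, u3, u4, u5, u6, u7, u8, u9, t0, t1, t2, t3, t4, t5, t6, t7, t8, h9 in E. lra. Qed.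
Let t10 : t 10%nat = (22935067 - 173818176 * a - 161064288 * a ^ 2 - 161995680 * a ^ 3 + 1701453600 * a ^ 4 - 2161494720 * a ^ 5 + 1233104796 * a ^ 6 - 380207520 * a ^ 7 + 65675610 * a ^ 8 - 5987520 * a ^ 9 + 224532 * a ^ 10) / 814781721600.
Proof. pose proof (Ht 10) as E. cbn [sum_f_R0 Nat.sub] in E. rewrite u0, u1, u2, u3, u4, u5, u6, u7, u8, u9, u10, t0, t1, t2, t3, t4, t5, t6, t7, t8, t9, h10 in E. lra. Qed.
Let t11 : t 11%nat = (8649703370 + 28280511909 * a - 27178306155 * a ^ 2 - 28170272130 * a ^ 3 - 154158404400 * a ^ 4 + 357524183016 * a ^ 5 - 292552139880 * a ^ 6 + 124352308080 * a ^ 7 - 30395645280 * a ^ 8 + 4313509200 * a ^ 9 - 330810480 * a ^ 10 + 10614240 * a ^ 11) / 423686495232000.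
Proof. pose proof (Ht 11) as E. cbn [sum_f_R0 Nat.sub] in E. rewrite u0, u1, u2, u3, u4, u5, u6, u7, u8, u9, u10, u11, t0, t1, t2, t3, t4, t5, t6, t7, t8, t9, t10, h11 in E. lra. Qed.

(** The coefficient 2s of F appears, with opposite sign, at place 2s + 1; place 11 thus reaches
    C_5. *)
Lemma odd_coefficients :
  t 1%nat = (- 7 + 6 * a) / 6 /\
  t 3%nat = (- 136 + 495 * a - 405 * a ^ 2 + 90 * a ^ 3) / 540 /\
  t 5%nat = (695 + 20538 * a - 54180 * a ^ 2 + 43680 * a ^ 3 - 13860 * a ^ 4 + 1512 * a ^ 5) / 181440 /\
  t 7%nat = (15953 - 55929 * a - 388395 * a ^ 2 + 949410 * a ^ 3 - 767340 * a ^ 4 + 283500 * a ^ 5 - 49140 * a ^ 6 + 3240 * a ^ 7) / 16329600 /\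
  t 9%nat = (- 170640893 - 21630510 * a + 598217400 * a ^ 2 + 2559569760 * a ^ 3 - 6176233800 * a ^ 4 + 5034007440 * a ^ 5 - 2026775520 * a ^ 6 + 436233600 * a ^ 7 - 48114000 * a ^ 8 + 2138400 * a ^ 9) / 775982592000 /\
  t 11%nat = (8649703370 + 28280511909 * a - 27178306155 * a ^ 2 - 28170272130 * a ^ 3 - 154158404400 * a ^ 4 + 357524183016 * a ^ 5 - 292552139880 * a ^ 6 + 124352308080 * a ^ 7 - 30395645280 * a ^ 8 + 4313509200 * a ^ 9 - 330810480 * a ^ 10 + 10614240 * a ^ 11) / 423686495232000.
Proof. repeat split; [exact t1|exact t3|exact t5|exact t7|exact t9|exact t11]. Qed.
End Recurrences.

Section CoefficientSeries.
Variables (A B : R -> nat -> R) (eps : R) (tau dtau : R -> R).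
Hypothesis Heps : 0 < eps.
Hypothesis Htau : forall w, Rabs w < eps ->
  0 < tau w /\ w ^ 2 / 2 = tau w - ln (tau w) - 1 /\ is_derive tau w (dtau w).
Hypothesis Hlim : is_lim (fun w => (tau w - 1) / w) 0 1.
Hypothesis HA : forall a w, Rabs w < eps -> is_pseries (A a) w (2 * (Rpower (tau w) (a - 1) / (1 + tau w) * dtau w)).
Hypothesis HB : forall a w, Rabs w < eps -> w <> 0 -> is_pseries (B a) w (Rpower (tau w) (a - 1) / (1 - tau w) * dtau w + / w).

Let dser (n : nat) : R := / 2 * A 1 n + / 2 * A 2 n.
(* The coefficients of [(tau - 1) / w], [tau] and [tau^(a-1) tau']; the latter is free
   of [B] because [tau^(a-1) = (tau^(a-1) + tau^a) / (1 + tau)]. *)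
Let s (n : nat) : R := PS_Int dser (S n).
Let c (n : nat) : R := match n with O => 1 | S m => s m end.
Let h (a : R) (n : nat) : R := / 2 * A a n + / 2 * A (a + 1) n.

Let conv_d : conv eps dser dtau.
Proof.
  apply conv_ext with (2 := conv_plus _ _ _ _ _ (conv_scal _ (/ 2) _ _ (conv_A A eps tau dtau HA 1)) (conv_scal _ (/ 2) _ _ (conv_A A eps tau dtau HA 2))).
  intros w Hw. cbv beta. destruct (Htau w Hw) as (P & _ & _).
  replace (1 - 1) with 0 by ring. replace (2 - 1) with 1 by ring. rewrite Rpower_1, Rpower_O by auto. field. lra.
Qed.

Let s_exists : exists sg, conv eps s sg /\ forall w, Rabs w < eps -> tau w = 1 + w * sg w.
Proof.
  assert (C : conv eps (PS_Int dser) (fun w => tau w - 1)).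
  { apply conv_int with dtau; auto.
    - intros w Hw. evar_last. apply (is_derive_minus tau (fun _ => 1) w (dtau w) 0). apply Htau; auto. apply (is_derive_const 1 w).
      match goal with |- minus ?x ?y = _ => change (minus x y) with (x - y) end. ring.
    - rewrite (tau_zero eps tau dtau Heps Htau). ring. }
  destruct (conv_decr eps _ _ Heps C) as (g & Hg & E). exists g. split; auto.
  intros w Hw. specialize (E w Hw). change (PS_Int dser 0) with 0 in E. lra.
Qed.

Let conv_c : conv eps c tau.
Proof.
  destruct s_exists as (sg & Hs & E). apply conv_ext with (fun w => 1 + w * sg w). { intros; rewrite E; auto. }
  apply conv_coef with (fun n => cst 1 n + PS_incr_1 s n).
  { intros [|n]; simpl. change (1 + 0 = 1). ring. ring. }
  apply (conv_plus eps (cst 1) (PS_incr_1 s) (fun _ => 1) (fun w => w * sg w)). apply conv_cst. apply conv_incr. auto.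
Qed.

(** The identities between tau, sigma and F are derived by dividing by w; multiplication by w
    restores equality at w = 0 as well. *)
Lemma conv_cancel_w (a b : nat -> R) (f g : R -> R) : conv eps a f -> conv eps b g ->
  (forall w, Rabs w < eps -> w <> 0 -> f w = g w) -> forall n, a n = b n.
Proof.
  intros Ha Hb H n.
  apply (conv_unique eps (PS_incr_1 a) (PS_incr_1 b) (fun w => w * f w) (S n) Heps).
  - apply conv_incr; auto.
  - apply conv_ext with (fun w => w * g w); [|apply conv_incr; auto].
    intros w Hw. destruct (Req_dec w 0) as [->|N]. ring. rewrite H; auto.
Qed.

(** [tau_ode] with tau - 1 = w sigma and one w cancelled. *)
Let s_rec (n : nat) : PS_mult dser s n = c n.
Proof.
  destruct s_exists as (sg & Hs & E). revert n.
  apply (conv_cancel_w _ _ (fun w => dtau w * sg w) tau). apply conv_mult; auto. apply conv_c.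
  intros w Hw N. pose proof (tau_ode eps tau dtau Htau w Hw) as O. rewrite (E w Hw) in O at 1.
  apply (Rmult_eq_reg_l w); auto. rewrite <- O. ring.
Qed.

Let dser_s (n : nat) : dser n = INR (S n) * s n.
Proof. unfold s. cbn [PS_Int]. field. apply not_0_INR. lia. Qed.

(** The recurrence alone gives s_0^2 = 1; the branch w ~ tau - 1 fixes the sign. *)
Let s_zero : s 0%nat = 1.
Proof.
  destruct s_exists as (sg & Hs & E).
  assert (S0 : sg 0 = s 0%nat).
  { rewrite <- (conv_PSeries eps s sg 0 Hs) by (rewrite Rabs_R0; auto). apply PSeries_0. }
  assert (L : is_lim (fun w => (tau w - 1) / w) 0 (sg 0)).
  { apply is_lim_ext_loc with sg.
    - exists (mkposreal eps Heps). intros y Hy Hy0. unfold ball in Hy; simpl in Hy.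
      unfold AbsRing_ball, abs, minus, plus, opp in Hy; simpl in Hy. rewrite Ropp_0, Rplus_0_r in Hy.
      rewrite (E y Hy). apply Rminus_diag_uniq. field. auto.
    - apply is_lim_continuity. apply continuity_pt_filterlim. apply (conv_continuous eps s); auto. rewrite Rabs_R0; auto. }
  apply is_lim_unique in L. apply is_lim_unique in Hlim. rewrite Hlim in L. apply Rbar_finite_eq in L. lra.
Qed.

Let conv_h (a : R) : conv eps (h a) (fun w => Rpower (tau w) (a - 1) * dtau w).
Proof.
  apply conv_ext with (2 := conv_plus _ _ _ _ _ (conv_scal _ (/ 2) _ _ (conv_A A eps tau dtau HA a)) (conv_scal _ (/ 2) _ _ (conv_A A eps tau dtau HA (a + 1)))).
  intros w Hw. cbv beta. destruct (Htau w Hw) as (P & _ & _).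
  replace (a + 1 - 1) with (a - 1 + 1) by ring. rewrite Rpower_plus, Rpower_1 by auto. field. lra.
Qed.

(** By [s_rec], sigma tau^(a-1) tau' = tau^a; comparing coefficients of the derivative gives the
    recurrence. *)
Let h_rec (a : R) (n : nat) : INR (S n) * PS_mult s (h a) (S n) = a * h a n.
Proof.
  destruct s_exists as (sg & Hs & E).
  assert (Eq : forall w, Rabs w < eps -> dtau w * sg w = tau w).
  { intros w Hw. pose proof (conv_mult _ _ _ _ _ conv_d Hs w Hw) as X. cbv beta in X.
    apply is_pseries_unique in X. rewrite <- X, <- (conv_PSeries eps c tau w conv_c Hw). apply PSeries_ext. apply s_rec. }
  assert (C1 : conv eps (PS_mult s (h a)) (fun w => Rpower (tau w) a)).
  { apply conv_ext with (2 := conv_mult _ _ _ _ _ Hs (conv_h a)). intros w Hw. cbv beta.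
    replace (sg w * (Rpower (tau w) (a - 1) * dtau w)) with (Rpower (tau w) (a - 1) * (dtau w * sg w)) by ring.
    rewrite (Eq w Hw). destruct (Htau w Hw) as (P & _ & _).
    replace a with (a - 1 + 1) at 2 by ring. rewrite Rpower_plus, Rpower_1 by auto. reflexivity. }
  assert (C2 : conv eps (PS_derive (PS_mult s (h a))) (fun w => a * (Rpower (tau w) (a - 1) * dtau w))).
  { apply (conv_derive eps _ _ _ C1). intros w Hw. destruct (Htau w Hw) as (P & _ & D). unfold Rpower.
    evar_last.
    - apply (is_derive_comp exp (fun w => a * ln (tau w))). apply is_derive_exp.
      apply (is_derive_scal (fun w => ln (tau w)) w a (dtau w / tau w)). apply (L_derive eps tau dtau Htau w Hw).
    - match goal with |- scal ?x ?y = _ => change (scal x y) with (x * y) end.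
      replace ((a - 1) * ln (tau w)) with (a * ln (tau w) + - ln (tau w)) by ring.
      rewrite exp_plus, (exp_Ropp (ln (tau w))), exp_ln by auto. field. lra. }
  exact (conv_unique eps _ _ _ n Heps C2 (conv_scal eps a (h a) _ (conv_h a))).
Qed.

Let h_zero (a : R) : h a 0%nat = 1.
Proof.
  assert (H0 : Rabs 0 < eps) by (rewrite Rabs_R0; auto).
  assert (E : dtau 0 = 1).
  { rewrite <- (conv_PSeries eps dser dtau 0 conv_d H0), PSeries_0, dser_s, s_zero. simpl. ring. }
  rewrite <- (PSeries_0 (h a)). rewrite (conv_PSeries eps (h a) _ 0 (conv_h a) H0).
  rewrite (tau_zero eps tau dtau Heps Htau), E. unfold Rpower. rewrite ln_1, Rmult_0_r, exp_0. ring.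
Qed.

Let t_rec (a : R) (n : nat) :
  PS_mult (tser A B a) (PS_mult s (fun n => match n with O => 2 | S m => s m end)) n = 2 * h a n.
Proof.
  destruct s_exists as (sg & Hs & E).
  assert (Cp : conv eps (fun n => match n with O => 2 | S m => s m end) (fun w => 1 + tau w)).
  { apply conv_coef with (fun n => cst 1 n + c n). { intros [|m]; simpl; ring. }
    apply (conv_plus eps (cst 1) c (fun _ => 1) tau). apply conv_cst. apply conv_c. }
  revert n. apply (conv_cancel_w _ _ _ _
    (conv_mult _ _ _ _ _ (conv_T A B eps tau dtau HA HB a) (conv_mult _ _ _ _ _ Hs Cp))
    (conv_scal eps 2 (h a) _ (conv_h a))).
  intros w Hw N. cbv beta. rewrite (F_val A B eps tau dtau Htau HA HB a w Hw N).
  destruct (Htau w Hw) as (P & _ & _). pose proof (tau_ne_1 eps tau dtau Htau w Hw N) as Ne.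
  assert (Sg : sg w = (tau w - 1) / w) by (rewrite (E w Hw); field; auto).
  rewrite Sg. field. split; auto. nra.
Qed.

Lemma tser_odd (a : R) :
  tser A B a 1%nat = (- 7 + 6 * a) / 6 /\
  tser A B a 3%nat = (- 136 + 495 * a - 405 * a ^ 2 + 90 * a ^ 3) / 540 /\
  tser A B a 5%nat = (695 + 20538 * a - 54180 * a ^ 2 + 43680 * a ^ 3 - 13860 * a ^ 4 + 1512 * a ^ 5) / 181440 /\
  tser A B a 7%nat = (15953 - 55929 * a - 388395 * a ^ 2 + 949410 * a ^ 3 - 767340 * a ^ 4 + 283500 * a ^ 5 - 49140 * a ^ 6 + 3240 * a ^ 7) / 16329600 /\
  tser A B a 9%nat = (- 170640893 - 21630510 * a + 598217400 * a ^ 2 + 2559569760 * a ^ 3 - 6176233800 * a ^ 4 + 5034007440 * a ^ 5 - 2026775520 * a ^ 6 + 436233600 * a ^ 7 - 48114000 * a ^ 8 + 2138400 * a ^ 9) / 775982592000 /\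
  tser A B a 11%nat = (8649703370 + 28280511909 * a - 27178306155 * a ^ 2 - 28170272130 * a ^ 3 - 154158404400 * a ^ 4 + 357524183016 * a ^ 5 - 292552139880 * a ^ 6 + 124352308080 * a ^ 7 - 30395645280 * a ^ 8 + 4313509200 * a ^ 9 - 330810480 * a ^ 10 + 10614240 * a ^ 11) / 423686495232000.
Proof.
  apply (odd_coefficients s (h a) (tser A B a) a).
  - exact s_zero.
  - intros n. change (s n) with (c (S n)). rewrite <- s_rec. unfold PS_mult.
    apply sum_eq. intros i _. rewrite dser_s. reflexivity.
  - apply h_zero.
  - exact (h_rec a).
  - exact (t_rec a).
Qed.
End CoefficientSeries.

Lemma coefficient_values (A B : R -> nat -> R) (a : R) : are_AB_coefficients A B ->
  C_coeff A B 0 a = 7 / 6 - a /\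
     C_coeff A B 1 a =
       1 / (30 * 6 ^ 2) * (136 - 495 * a + 405 * a ^ 2 - 90 * a ^ 3) /\
     C_coeff A B 2 a =
       1 / (1120 * 6 ^ 3) *
       (- 695 - 20538 * a + 54180 * a ^ 2 - 43680 * a ^ 3 + 13860 * a ^ 4
        - 1512 * a ^ 5) /\
     C_coeff A B 3 a =
       1 / (1120 * 6 ^ 5) *
       (- 15953 + 55929 * a + 388395 * a ^ 2 - 949410 * a ^ 3 + 767340 * a ^ 4
        - 283500 * a ^ 5 + 49140 * a ^ 6 - 3240 * a ^ 7) /\
     C_coeff A B 4 a =
       1 / (70400 * 6 ^ 8) *
       (170640893 + 21630510 * a - 598217400 * a ^ 2 - 2559569760 * a ^ 3
        + 6176233800 * a ^ 4 - 5034007440 * a ^ 5 + 2026775520 * a ^ 6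
        - 436233600 * a ^ 7 + 48114000 * a ^ 8 - 2138400 * a ^ 9) /\
     C_coeff A B 5 a =
       1 / (25025 * 2 ^ 11 * 6 ^ 7) *
       (- 8649703370 - 28280511909 * a + 27178306155 * a ^ 2
        + 28170272130 * a ^ 3 + 154158404400 * a ^ 4 - 357524183016 * a ^ 5
        + 292552139880 * a ^ 6 - 124352308080 * a ^ 7 + 30395645280 * a ^ 8
        - 4313509200 * a ^ 9 + 330810480 * a ^ 10 - 10614240 * a ^ 11).
Proof.
  intros (eps & tau & dtau & Heps & Htau & Hlim & HA & HB).
  destruct (tser_odd A B eps tau dtau Heps Htau Hlim HA HB a) as (E1 & E3 & E5 & E7 & E9 & E11).
  cbn [tser] in E1, E3, E5, E7, E9, E11.
  assert (V : forall x y, - x = y -> x = - y) by (intros; lra).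
  apply V in E1. apply V in E3. apply V in E5. apply V in E7. apply V in E9. apply V in E11.
  rewrite !C_coeff_Sc. cbn [Nat.mul Nat.add]. rewrite E1, E3, E5, E7, E9, E11.
  cbn [rfact INR]. repeat split; field.
Qed.

(** * Resummation of the truncated series *)

Lemma sum_range_split (f : nat -> R) (m n : nat) : (m <= n)%nat -> sum_range f 0 n = sum_range f 0 m + sum_range f m n.
Proof.
  intros H. unfold sum_range. rewrite !Nat.sub_0_r. replace n with (m + (n - m))%nat at 1 by lia.
  rewrite seq_app, map_app, fold_right_app, fold_plus. simpl. rring.
Qed.

Lemma hurwitz_zeta_nat (r m : nat) : (0 < m)%nat ->
  hurwitz_zeta (2 * INR r + 2) (INR m) = Series (fun k => / INR (m + k) ^ (2 * r + 2)).
Proof.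
  intros Hm. apply Series_ext. intros k. pose proof (lt_0_INR (m + k) ltac:(lia)).
  replace (2 * INR r + 2) with (INR (2 * r + 2)) by (rewrite plus_INR, mult_INR; simpl; rring).
  rewrite Rpower_Ropp, <- plus_INR, Nat.add_comm, Rpower_pow by auto. reflexivity.
Qed.

Lemma ex_zeta (r m : nat) : (0 < m)%nat -> ex_series (fun k => / INR (m + k) ^ (2 * r + 2)).
Proof.
  intros Hm. destruct m as [|m]; [lia|]. apply ex_series_dom with (fun k => / INR (S (m + k)) ^ 2); [|apply (inv_sq_tail m)].
  intros k. change (S m + k)%nat with (S (m + k)). assert (1 <= INR (S (m + k))) by (apply (le_INR 1); lia).
  set (x := INR (S (m + k))) in *. rewrite Rabs_right by (left; apply Rinv_0_lt_compat, pow_lt; lra).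
  apply Rinv_le_contravar. apply pow_lt; lra. apply Rle_pow; auto. lia.
Qed.

Lemma Series_sum_range (f : nat -> nat -> R) (n : nat) : (forall r, ex_series (f r)) ->
  ex_series (fun k => sum_range (fun r => f r k) 0 n) /\
  Series (fun k => sum_range (fun r => f r k) 0 n) = sum_range (fun r => Series (f r)) 0 n.
Proof.
  intros H. induction n as [|n [E1 E2]].
  - split.
    + exists 0. apply (is_series_ext (fun _ => 0 * 0)). intros; rewrite sum_range_0; rring.
      change (is_lim_seq (sum_n (fun _ => 0 * 0)) 0). apply is_lim_seq_ext with (fun _ => 0). intros; rewrite sum_n_const; rring. apply is_lim_seq_const.
    + rewrite sum_range_0. rewrite (Series_ext _ (fun k => 0 * 0)) by (intros; rewrite sum_range_0; rring).
      rewrite Series_scal_l. rring.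
  - assert (E : forall k, sum_range (fun r => f r k) 0 n + f n k = sum_range (fun r => f r k) 0 (S n)) by (intros; rewrite sum_range_S; rring).
    split.
    + apply ex_series_ext with (1 := E). apply (ex_series_plus (fun k => sum_range (fun r => f r k) 0 n)); auto.
    + rewrite <- (Series_ext _ _ E), sum_range_S, <- E2. apply Series_plus; auto.
Qed.

Lemma sum_range_nonneg (f : nat -> R) (n : nat) : (forall r, 0 <= f r) -> 0 <= sum_range f 0 n.
Proof. intros H. induction n. rewrite sum_range_0; lra. rewrite sum_range_S. specialize (H n). lra. Qed.

Section Resummation.
Variables (X : R) (n : nat -> nat).
Hypothesis HX : 0 < X.
Hypothesis Hn0 : n 0%nat = 0%nat.
Hypothesis Hn : forall k, (n k <= n (S k))%nat.

Let cr (r : nat) : R := INR (fact (2 * r)) / X ^ (2 * r + 1).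
Let comp (k : nat) : R := sum_range (fun r => INR (fact (2 * r)) / (X * INR k) ^ (2 * r + 1)) 0 (n k) / INR k.
Let block (m : nat) : R :=
  sum_range (fun r => INR (fact (2 * r)) * hurwitz_zeta (2 * INR r + 2) (INR m) / X ^ (2 * r + 1)) (n (m - 1)%nat) (n m).
(** What the components with index above M contribute when only the first [n M] terms of each are
    kept. *)
Let W (M : nat) : R := sum_range (fun r => cr r * hurwitz_zeta (2 * INR r + 2) (INR (S M))) 0 (n M).

Let cr_pos (r : nat) : 0 <= cr r.
Proof. left. apply Rdiv_lt_0_compat. apply INR_fact_lt_0. apply pow_lt; auto. Qed.

Let comp_eq (k : nat) : (0 < k)%nat -> comp k = sum_range (fun r => cr r * / INR k ^ (2 * r + 2)) 0 (n k).
Proof.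
  intros Hk. pose proof (lt_0_INR k Hk). unfold comp, Rdiv. rewrite Rmult_comm, <- sum_range_scal. apply sum_range_ext.
  intros r _. unfold cr. rewrite Rpow_mult_distr. replace (2 * r + 2)%nat with (S (2 * r + 1)) by lia. simpl pow.
  field. repeat split; try lra; apply pow_nonzero; lra.
Qed.

Let zeta_step (r m : nat) : (0 < m)%nat ->
  hurwitz_zeta (2 * INR r + 2) (INR m) = / INR m ^ (2 * r + 2) + hurwitz_zeta (2 * INR r + 2) (INR (S m)).
Proof.
  intros Hm. rewrite !hurwitz_zeta_nat by lia. rewrite Series_incr_1 by (apply ex_zeta; auto).
  rewrite Nat.add_0_r. f_equal. apply Series_ext. intros k. do 3 f_equal. lia.
Qed.

(** Peeling the first term off every zeta value gives W(M) + block(M+1) = comp(M+1) + W(M+1), which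
    telescopes from W(0) = 0. *)
Let partial (M : nat) : sum_n (fun j => block (S j)) M = sum_n (fun j => comp (S j)) M + W (S M).
Proof.
  assert (St : forall M, W M + block (S M) = comp (S M) + W (S M)).
  { intros m. unfold W, block. replace (S m - 1)%nat with m by lia. rewrite comp_eq by lia.
    rewrite (sum_range_ext (fun r => cr r * hurwitz_zeta (2 * INR r + 2) (INR (S m)))
      (fun r => INR (fact (2 * r)) * hurwitz_zeta (2 * INR r + 2) (INR (S m)) / X ^ (2 * r + 1))) by (intros; unfold cr, Rdiv; rring).
    rewrite <- sum_range_split by apply Hn. rewrite <- sum_range_plus. apply sum_range_ext. intros r _.
    rewrite (zeta_step r (S m)) by lia. unfold cr, Rdiv. rring. }
  induction M as [|M IH].
  - rewrite !sum_O, <- St. unfold W. rewrite Hn0, sum_range_0. rring.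
  - rewrite !sum_SnR, IH, Rplus_assoc, St. rring.
Qed.

(** All terms are nonnegative and [n] is nondecreasing, so [W (S M)] lies between 0 and the tail of
    the component series. *)
Lemma resummation : ex_series (fun j => comp (S j)) ->
  is_series (fun j => block (S j)) (Series (fun j => comp (S j))).
Proof.
  intros Hex. set (U := Series (fun j => comp (S j))).
  assert (HW : forall M, 0 <= W (S M) <= U - sum_n (fun j => comp (S j)) M).
  { intros M. set (f := fun r k => cr r * / INR (S (S M) + k) ^ (2 * r + 2)).
    assert (Ef : forall r, ex_series (f r)) by (intros r; apply (ex_series_scal (cr r) (fun k => / INR (S (S M) + k) ^ (2 * r + 2))), ex_zeta; lia).
    destruct (Series_sum_range f (n (S M)) Ef) as [E1 E2].
    assert (EW : W (S M) = Series (fun k => sum_range (fun r => f r k) 0 (n (S M)))).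
    { rewrite E2. unfold W. apply sum_range_ext. intros r _. unfold f. rewrite Series_scal_l, hurwitz_zeta_nat by lia. reflexivity. }
    assert (Fp : forall r k, 0 <= f r k).
    { intros r k. apply Rmult_le_pos; [apply cr_pos|left; apply Rinv_0_lt_compat, pow_lt, lt_0_INR; lia]. }
    assert (ET : U - sum_n (fun j => comp (S j)) M = Series (fun k => comp (S (S M + k)))).
    { unfold U. rewrite (Series_incr_n (fun j => comp (S j)) (S M)) by (auto; lia). rewrite sum_n_Reals. simpl pred. rring. }
    rewrite EW, ET. split.
    - apply Series_ge0; auto. intros k. apply sum_range_nonneg. intros; apply Fp.
    - apply Series_le.
      + intros k. split. apply sum_range_nonneg; intros; apply Fp.
        rewrite comp_eq by lia. change (S (S M + k)) with (S (S M) + k)%nat. fold (f 0%nat k).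
        assert (Mono : (n (S M) <= n (S (S M) + k))%nat).
        { induction k. rewrite Nat.add_0_r; apply Hn. eapply Nat.le_trans; [exact IHk|]. rewrite Nat.add_succ_r. apply Hn. }
        rewrite (sum_range_split _ _ _ Mono).
        assert (0 <= sum_range (fun r => cr r * / INR (S (S M) + k) ^ (2 * r + 2)) (n (S M)) (n (S (S M) + k))); [|unfold f; lra].
        unfold sum_range. generalize (seq (n (S M)) (n (S (S M) + k) - n (S M))). intros l. induction l; simpl; [lra|].
        pose proof (Fp a k) as Q. unfold f in Q. simpl in *. lra.
      + apply (ex_series_incr_n (fun j => comp (S j)) (S M)); auto. }
  change (is_lim_seq (sum_n (fun j => block (S j))) U).
  assert (LU : is_lim_seq (sum_n (fun j => comp (S j))) U) by (apply (Series_correct (fun j => comp (S j))); auto).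
  apply is_lim_seq_le_le with (sum_n (fun j => comp (S j))) (fun _ => U).
  - intros M. rewrite partial. specialize (HW M). lra.
  - exact LU.
  - apply is_lim_seq_const.
Qed.
End Resummation.

(** * The exact expansion *)

(** The remainder of the component of scale 2 pi k t after N_k terms, divided by k; [rho2] is the
    one of scale 4 pi k t after 2 N_k terms. Under N_(2k) = 2 N_k, [rho2] at k is twice [rho] at
    2k. *)
Definition rho (N : nat -> R -> nat) (t : R) (k : nat) : R := Rem (2 * PI * t * INR k) (INR (2 * N k t)) / INR k.
Definition rho2 (N : nat -> R -> nat) (t : R) (k : nat) : R := Rem (4 * PI * t * INR k) (INR (2 * (2 * N k t))) / INR k.

(** What [optimal_truncation] yields at one large t for all k at once; 1/4 is the tolerance of
    [Rem_crude]. *)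
Definition regular (N : nat -> R -> nat) (t : R) : Prop :=
  1 <= t /\ N 0%nat t = 0%nat /\ (forall k, (N k t <= N (S k) t)%nat) /\
  (forall k, (1 <= k)%nat -> Rabs (INR (N k t) / (PI * INR k * t) - 1) <= / 4).

Lemma eventually_regular (N : nat -> R -> nat) : optimal_truncation N -> Rbar_locally p_infty (regular N).
Proof.
  intros (H0 & H1 & _ & H2). specialize (H2 (/ 4) ltac:(lra)).
  assert (HT : Rbar_locally p_infty (fun t => 1 <= t)) by (exists 1; intros; lra).
  apply filter_imp with (2 := filter_and _ _ (filter_and _ _ HT H1) H2).
  intros t [[A1 A2] A3]. repeat split; auto.
Qed.

Lemma rho_bound (N : nat -> R -> nat) (t : R) (k : nat) : regular N t -> (1 <= k)%nat ->
  Rabs (rho N t k) <= 500 * exp (- (7 / 4) * PI * t * INR k) /\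
  Rabs (rho2 N t k) <= 500 * exp (- (7 / 2) * PI * t * INR k).
Proof.
  intros (Ht & _ & _ & Hr) Hk. specialize (Hr k Hk). pose proof PI_RGT_0 as HP.
  assert (Hk1 : 1 <= INR k) by (apply (le_INR 1); auto).
  assert (Hkt : 0 < PI * t * INR k) by (apply Rmult_lt_0_compat; [apply Rmult_lt_0_compat|]; lra).
  assert (Hi : 0 < / INR k <= 1) by (split; [apply Rinv_0_lt_compat; lra|rewrite <- Rinv_1; apply Rinv_le_contravar; lra]).
  assert (Dv : forall x b, Rabs x <= b -> Rabs (x / INR k) <= b).
  { intros x b Hx. unfold Rdiv. rewrite Rabs_mult, (Rabs_right (/ INR k)) by lra. pose proof (Rabs_pos x). nra. }
  split; apply Dv.
  - replace (- (7 / 4) * PI * t * INR k) with (- (7 / 8) * (2 * PI * t * INR k)) by field.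
    apply Rem_crude; [lra|].
    replace (INR (2 * N k t) / (2 * PI * t * INR k)) with (INR (N k t) / (PI * INR k * t)); auto.
    rewrite mult_INR. simpl (INR 2). field. lra.
  - replace (- (7 / 2) * PI * t * INR k) with (- (7 / 8) * (4 * PI * t * INR k)) by field.
    apply Rem_crude; [lra|].
    replace (INR (2 * (2 * N k t)) / (4 * PI * t * INR k)) with (INR (N k t) / (PI * INR k * t)); auto.
    rewrite !mult_INR. simpl (INR 2). field. lra.
Qed.

(** For c >= 1 the ratio exp (- c) is at most 1/2, whence the factor 2. *)
Lemma geom_tail (C c : R) (m : nat) (f : nat -> R) : 0 <= C -> 1 <= c ->
  (forall k, (m <= k)%nat -> Rabs (f k) <= C * exp (- c * INR k)) ->
  ex_series (fun j => f (m + j)%nat) /\ Rabs (Series (fun j => f (m + j)%nat)) <= 2 * C * exp (- c * INR m).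
Proof.
  intros HC Hc H. set (q := exp (- c)).
  assert (Hq : 0 < q <= / 2).
  { split; [apply exp_pos|]. unfold q. rewrite exp_Ropp. apply Rinv_le_contravar; [lra|]. pose proof (exp_ge_1 c); lra. }
  assert (Eq : forall k, exp (- c * INR k) = q ^ k).
  { induction k. simpl. rewrite Rmult_0_r, exp_0. auto. rewrite S_INR, Rmult_plus_distr_l, exp_plus, IHk, Rmult_1_r. simpl. unfold q. rring. }
  assert (B : forall j, Rabs (f (m + j)%nat) <= C * q ^ m * q ^ j).
  { intros j. rewrite Rmult_assoc, <- pow_add, <- Eq. apply H. lia. }
  assert (G : is_series (fun j => q ^ j) (/ (1 - q))) by (apply is_series_geom; rewrite Rabs_right; lra).
  assert (Ex : ex_series (fun j => C * q ^ m * q ^ j)) by (apply (ex_series_scal (C * q ^ m) (fun j => q ^ j)); eexists; exact G).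
  split. apply ex_series_dom with (1 := B); auto.
  eapply Rle_trans; [apply Series_dom with (1 := B); auto|].
  rewrite (Series_scal_l (C * q ^ m) (fun j => q ^ j)), (is_series_unique _ _ G : Series (fun j => q ^ j) = _), Eq.
  assert (/ (1 - q) <= 2).
  { apply Rle_trans with (/ / 2); [apply Rinv_le_contravar; lra|lra]. }
  assert (0 <= C * q ^ m) by (apply Rmult_le_pos; [auto|apply pow_le; lra]). nra.
Qed.

Lemma PI_ge_2 : 2 < PI.
Proof. pose proof PI2_1. lra. Qed.

Lemma rho_series (N : nat -> R -> nat) (t : R) : regular N t ->
  ex_series (fun j => rho N t (S j)) /\ ex_series (fun j => rho2 N t (S j)).
Proof.
  intros Hg. assert (Ht := proj1 Hg). pose proof PI_ge_2. split.
  - refine (proj1 (geom_tail 500 (7 / 4 * PI * t) 1 (rho N t) ltac:(lra) ltac:(nra) _)). intros k Hk.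
    replace (- (7 / 4 * PI * t) * INR k) with (- (7 / 4) * PI * t * INR k) by rring. exact (proj1 (rho_bound N t k Hg Hk)).
  - refine (proj1 (geom_tail 500 (7 / 2 * PI * t) 1 (rho2 N t) ltac:(lra) ltac:(nra) _)). intros k Hk.
    replace (- (7 / 2 * PI * t) * INR k) with (- (7 / 2) * PI * t * INR k) by rring. exact (proj2 (rho_bound N t k Hg Hk)).
Qed.

(** Every [Rem s 0] is truncated at its own index and the finite parts are resummed into the blocks.
    The identity is exact; estimates enter only when the two remainder series are bounded. *)
Lemma theta_regular (theta : R -> R) (N : nat -> R -> nat) (t : R) : is_RS_theta theta -> regular N t ->
  ex_series (fun j => bracket N t (S j)) /\
  theta t = algebraic_part N t + / (2 * PI) * (Series (fun j => rho N t (S j)) - Series (fun j => rho2 N t (S j))).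
Proof.
  intros Hth Hg. destruct (rho_series N t Hg) as [X1 X2]. destruct Hg as (Ht & H0 & Hm & _). pose proof PI_RGT_0 as HP.
  assert (c1 : 0 < 2 * PI * t) by nra. assert (c2 : 0 < 4 * PI * t) by nra.
  set (u := fun k => sum_range (fun r => INR (fact (2 * r)) / (2 * PI * t * INR k) ^ (2 * r + 1)) 0 (N k t) / INR k).
  set (v := fun k => sum_range (fun r => INR (fact (2 * r)) / (4 * PI * t * INR k) ^ (2 * r + 1)) 0 (2 * N k t) / INR k).
  assert (Eu : forall j, Rem (2 * PI * t * INR (S j)) 0 / INR (S j) - rho N t (S j) = u (S j)).
  { intros j. pose proof (lt_0_INR (S j) ltac:(lia)) as Hk. unfold rho, u.
    rewrite (Rem_truncate _ (N (S j) t)) by (apply Rmult_lt_0_compat; auto). unfold Rdiv. rring. }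
  assert (Ev : forall j, Rem (4 * PI * t * INR (S j)) 0 / INR (S j) - rho2 N t (S j) = v (S j)).
  { intros j. pose proof (lt_0_INR (S j) ltac:(lia)) as Hk. unfold rho2, v.
    rewrite (Rem_truncate _ (2 * N (S j) t)) by (apply Rmult_lt_0_compat; auto). unfold Rdiv. rring. }
  pose proof (ex_series_Rem_0 _ c1) as Y1. pose proof (ex_series_Rem_0 _ c2) as Y2.
  assert (Xu : ex_series (fun j => u (S j))) by (apply ex_series_ext with (1 := Eu); apply (ex_series_minus (fun j => Rem (2 * PI * t * INR (S j)) 0 / INR (S j))); auto).
  assert (Xv : ex_series (fun j => v (S j))) by (apply ex_series_ext with (1 := Ev); apply (ex_series_minus (fun j => Rem (4 * PI * t * INR (S j)) 0 / INR (S j))); auto).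
  assert (B1 := resummation (2 * PI * t) (fun k => N k t) c1 H0 Hm Xu).
  assert (B2 := resummation (4 * PI * t) (fun k => (2 * N k t)%nat) c2 ltac:(cbv beta; rewrite H0; reflexivity) ltac:(intros k; cbv beta; specialize (Hm k); lia) Xv).
  assert (Bs : is_series (fun j => bracket N t (S j)) (Series (fun j => u (S j)) - Series (fun j => v (S j)))).
  { exact (is_series_minus _ _ _ _ B1 B2). }
  split. { eexists; exact Bs. }
  unfold algebraic_part. rewrite (is_series_unique _ _ Bs).
  rewrite <- (Series_ext _ _ Eu), <- (Series_ext _ _ Ev), !Series_minus by auto.
  rewrite (theta_exact theta t Hth ltac:(lra)). apply Rminus_diag_uniq. field. lra.
Qed.

(** The factor exp (2x) of [Trem] cancels the exponential weight, and sqrt (x / pi) = sqrt (k t)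
    reduces k^(3/2) to k. *)
Lemma Trem_rho (N : nat -> R -> nat) (t : R) (k : nat) : 0 < t -> (1 <= k)%nat ->
  exponential_term t (fun k => Trem (a_param N k t) (PI * INR k * t)) k = (-1) ^ (k - 1) * (2 * sqrt t * rho N t k).
Proof.
  intros Ht Hk. pose proof PI_RGT_0 as HP. assert (Hk1 : 1 <= INR k) by (apply (le_INR 1); auto).
  unfold exponential_term, Trem, rho, a_param.
  replace (PI * INR k * t / PI) with (INR k * t) by (field; lra). rewrite sqrt_mult by lra.
  replace (2 * (PI * INR k * t) + (2 * (INR (N k t) - PI * INR k * t) + 1) - 1) with (INR (2 * N k t)) by (rewrite mult_INR; simpl (INR 2); rring).
  replace (2 * (PI * INR k * t)) with (2 * PI * t * INR k) by rring.
  assert (E : exp (- 2 * PI * INR k * t) * exp (2 * PI * t * INR k) = 1).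
  { rewrite <- exp_plus. replace (-2 * PI * INR k * t + 2 * PI * t * INR k) with 0 by rring. apply exp_0. }
  assert (Rp : Rpower (INR k) (3 / 2) = INR k * sqrt (INR k)).
  { replace (3 / 2) with (1 + / 2) by field. rewrite Rpower_plus, Rpower_1, Rpower_sqrt by lra. reflexivity. }
  rewrite Rp. assert (Hs : 0 < sqrt (INR k)) by (apply sqrt_lt_R0; lra).
  set (Rm := Rem _ _). set (x := exp (-2 * PI * INR k * t)) in *. set (y := exp (2 * PI * t * INR k)) in *.
  transitivity ((-1) ^ (k - 1) * (x * y) * (2 * sqrt t * (Rm / INR k))).
  - field. split; lra.
  - rewrite E. rring.
Qed.

(** Compatibility makes [rho2] at k equal to twice [rho] at 2k, so the difference of the two
    remainder series is a single alternating one. *)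
Lemma exact_expansion (theta : R -> R) (N : nat -> R -> nat) (t : R) : is_RS_theta theta -> regular N t ->
  (forall k : nat, N (2 * k)%nat t = (2 * N k t)%nat) ->
  let E := fun k => Trem (a_param N k t) (PI * INR k * t) in
  ex_series (fun j => exponential_term t E (S j)) /\
  theta t = algebraic_part N t + exponential_part t E.
Proof.
  intros Hth Hg Hc E. destruct (theta_regular theta N t Hth Hg) as [_ T]. destruct (rho_series N t Hg) as [X1 X2].
  assert (Ht : 1 <= t) by apply Hg. pose proof PI_RGT_0 as HP.
  assert (Al : is_series (fun j => (-1) ^ j * rho N t (S j)) (Series (fun j => rho N t (S j)) - Series (fun j => rho2 N t (S j)))).
  { apply is_series_alternate. apply Series_correct; auto.
    apply is_series_ext with (fun j => rho2 N t (S j)); [|apply Series_correct; auto].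
    intros j. pose proof (lt_0_INR (S j) ltac:(lia)). unfold rho, rho2. rewrite Hc, (mult_INR 2 (S j)). simpl (INR 2).
    replace (2 * PI * t * ((1 + 1) * INR (S j))) with (4 * PI * t * INR (S j)) by rring.
    set (k := INR (S j)) in *. apply Rminus_diag_uniq. field. lra. }
  assert (Al2 : is_series (fun j => exponential_term t E (S j)) (2 * sqrt t * (Series (fun j => rho N t (S j)) - Series (fun j => rho2 N t (S j))))).
  { apply is_series_ext with (2 := is_series_scal (2 * sqrt t) _ _ Al). intros j. unfold E. rewrite Trem_rho by (lra || lia).
    replace (S j - 1)%nat with j by lia. match goal with |- scal ?x ?y = _ => change (scal x y) with (x * y) end. rring. }
  split. eexists; exact Al2.
  rewrite T. unfold exponential_part. rewrite (is_series_unique _ _ Al2). f_equal.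
  assert (0 < sqrt t) by (apply sqrt_lt_R0; lra). field. split; lra.
Qed.

(** * The asymptotic expansion *)

(** Consecutive terms have ratio (2r+1)(2r+2) / s^2. Comparison of L with its two neighbours puts s
    within 2 of 2 L. *)
Lemma least_index (t : R) (L : nat) : 0 < t -> is_least_term_index 1 t L -> Rabs (2 * INR L - 2 * PI * t) <= 2.
Proof.
  intros Ht H. pose proof PI_RGT_0 as HP. set (s := 2 * PI * t). assert (Hs : 0 < s) by (unfold s; nra).
  assert (F : forall r, component_term 1 t r = INR (fact (2 * r)) / s ^ (2 * r + 1)).
  { intros r. unfold component_term, s. simpl (INR 1). replace (2 * PI * 1 * t) with (2 * PI * t) by rring. field.
    apply pow_nonzero. unfold s in Hs. lra. }
  assert (St : forall r, component_term 1 t (S r) = component_term 1 t r * ((2 * INR r + 2) * (2 * INR r + 1) / s ^ 2)).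
  { intros r. rewrite !F. replace (2 * S r)%nat with (S (S (2 * r))) by lia. rewrite !fact_simpl, !mult_INR, !S_INR, mult_INR.
    replace (S (S (2 * r)) + 1)%nat with (2 * r + 1 + 2)%nat by lia. rewrite (pow_add s (2 * r + 1)). simpl (INR 2). field.
    split; [lra|apply pow_nonzero; lra]. }
  assert (Ps : forall r, 0 < component_term 1 t r) by (intros r; rewrite F; apply Rdiv_lt_0_compat; [apply INR_fact_lt_0|apply pow_lt; auto]).
  pose proof (pos_INR L) as HL.
  assert (A1 : s <= 2 * INR L + 2).
  { pose proof (H (S L)) as Q. rewrite St in Q. pose proof (Ps L).
    assert (1 <= (2 * INR L + 2) * (2 * INR L + 1) / s ^ 2) by nra.
    apply (Rmult_le_compat_r (s ^ 2)) in H1; [|nra]. unfold Rdiv in H1. rewrite Rmult_assoc, Rinv_l in H1 by nra. nra. }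
  (* At L = 0 there is no left neighbour, and s <= 2 from the right one suffices. *)
  destruct L as [|L].
  - simpl INR in *. apply Rabs_le. lra.
  - pose proof (H L) as Q. rewrite St in Q. pose proof (Ps L). pose proof (pos_INR L).
    assert ((2 * INR L + 2) * (2 * INR L + 1) / s ^ 2 <= 1) by nra.
    apply (Rmult_le_compat_r (s ^ 2)) in H2; [|nra]. unfold Rdiv in H2. rewrite Rmult_assoc, Rinv_l in H2 by nra.
    rewrite S_INR in *. apply Rabs_le. split; nra.
Qed.

(** The term k = 1 is the one compared with its expansion, which is uniform only for bounded a;
    [least_index] ties its truncation index to pi t. *)
Lemma first_parameter_bounded (N : nat -> R -> nat) : optimal_truncation N ->
  exists D, Rbar_locally p_infty (fun t => Rabs (a_param N 1 t) <= D).
Proof.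
  intros (_ & _ & H & _). destruct (H 1%nat (le_n 1)) as [D HD]. exists (2 * D + 3).
  assert (HT : Rbar_locally p_infty (fun t => 1 <= t)) by (exists 1; intros; lra).
  apply filter_imp with (2 := filter_and _ _ HT HD). intros t [Ht (L & HL & HN)].
  pose proof (least_index t L ltac:(lra) HL) as B. unfold a_param. simpl (INR 1).
  replace (2 * (INR (N 1%nat t) - PI * 1 * t) + 1) with (2 * (INR (N 1%nat t) - INR L) + (2 * INR L - 2 * PI * t) + 1) by rring.
  apply Rabs_le_between in B. apply Rabs_le_between in HN. apply Rabs_le. lra.
Qed.

(** A relative deviation of 1/4 lets |a_k| reach x / 2 + 1 at x = pi k t. The growth of the
    coefficients in a is polynomial, hence below exp (x / 4), and the k-th term keeps a decay exp (-
    7 pi k t / 4). *)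
Lemma inner_sum_bound (A B : R -> nat -> R) (n : nat) : are_AB_coefficients A B ->
  exists C, 0 <= C /\ forall a x, 1 <= x -> Rabs a <= x / 2 + 1 -> Rabs (inner_sum (C_coeff A B) n a x) <= C * exp (x / 4).
Proof.
  intros HAB. unfold inner_sum. induction n as [|n (C & HC & IH)].
  - exists 0. split; [lra|]. intros. rewrite sum_range_0, Rabs_R0. lra.
  - destruct (Sc_bound_AB A B HAB (2 * n)) as (K & HK & HS).
    destruct (pow_le_exp (2 * n + 2) (/ 4) ltac:(lra)) as (Cp & HCp & Hp).
    pose proof (rfact_pos n) as Hr.
    exists (C + K * (3 ^ (2 * n + 2) * Cp) * rfact n).
    assert (0 < 3 ^ (2 * n + 2)) by (apply pow_lt; lra).
    split. { apply Rplus_le_le_0_compat; auto. apply Rmult_le_pos; [|lra]. apply Rmult_le_pos; auto. apply Rmult_le_pos; lra. }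
    intros a x Hx Ha. rewrite sum_range_S. eapply Rle_trans; [apply Rabs_triang|]. rewrite Rmult_plus_distr_r.
    apply Rplus_le_compat; [apply IH; auto|].
    rewrite C_coeff_Sc. unfold Rdiv. rewrite !Rabs_mult, (Rabs_right (rfact n)) by lra.
    assert (Hxn : 0 < / x ^ n <= 1).
    { split. apply Rinv_0_lt_compat, pow_lt; lra. rewrite <- Rinv_1. apply Rinv_le_contravar; [lra|]. apply pow_R1_Rle; auto. }
    rewrite (Rabs_right (/ x ^ n)) by lra.
    assert (B1 : Rabs (Sc A B a (2 * n)) <= K * (3 ^ (2 * n + 2) * Cp) * exp (x / 4)).
    { eapply Rle_trans; [apply HS|]. rewrite Rmult_assoc. apply Rmult_le_compat_l; auto. rewrite Rmult_assoc.
      (* For x >= 1, 1 + |a| <= x / 2 + 2 <= 3 x. *)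
      apply Rle_trans with ((3 * x) ^ (2 * n + 2)).
      - apply pow_incr. pose proof (Rabs_pos a). lra.
      - rewrite Rpow_mult_distr. apply Rmult_le_compat_l; [lra|]. replace (x / 4) with (/ 4 * x) by field. apply Hp; lra. }
    pose proof (Rabs_pos (Sc A B a (2 * n))).
    apply Rle_trans with (K * (3 ^ (2 * n + 2) * Cp) * exp (x / 4) * rfact n * 1); [|right; change (x * / 4) with (x / 4); rring].
    apply Rmult_le_compat; try lra. apply Rmult_le_pos; lra. apply Rmult_le_compat_r; lra.
Qed.

(** At k = 1 the exact remainder is replaced by its truncated expansion, with an error given by
    [Trem_expansion]. The rest consists of [rho] from k = 2, [rho2] from k = 1 and the exponential
    terms from k = 2, each of order z = exp (- 7 pi t / 2) and only estimated. *)
Lemma asymptotic_expansion (theta : R -> R) (A B : R -> nat -> R) (N : nat -> R -> nat) (n : nat) :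
  is_RS_theta theta -> are_AB_coefficients A B -> optimal_truncation N ->
  exists K : R, Rbar_locally p_infty (fun t =>
    let E := fun k => inner_sum (C_coeff A B) n (a_param N k t) (PI * INR k * t) in
    ex_series (fun j => exponential_term t E (S j)) /\
    Rabs (theta t - (algebraic_part N t + exponential_part t E)) <= K * (exp (- 2 * PI * t) / (sqrt t * t ^ n))).
Proof.
  intros Hth HAB HN. pose proof PI_ge_2 as HP.
  destruct (first_parameter_bounded N HN) as [D HD].
  destruct (Trem_expansion A B HAB n D) as [K1 HK1].
  destruct (inner_sum_bound A B n HAB) as (C & HC & HI).
  (* z falls short of exp (- 2 pi t) by exp (- 3 pi t / 2), which absorbs sqrt t * t^n <=
     t^(n+1). *)
  destruct (pow_le_exp (n + 1) (3 / 2 * PI) ltac:(lra)) as (Cp & HCp & Hpow).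
  (* [geom_tail] gives 2 * 500 z for each of [rho] and [rho2], and 2 C z for the exponential terms
     from k = 2. *)
  exists (Rabs K1 + (2000 + 2 * C) * Cp).
  assert (HK2 : Rbar_locally p_infty (fun t => forall a, Rabs a <= D -> Rabs (Trem a (PI * 1 * t) - inner_sum (C_coeff A B) n a (PI * 1 * t)) <= K1 / (PI * 1 * t) ^ n)).
  { destruct HK1 as [X0 HX0]. exists (Rmax X0 0). intros t Ht. apply HX0.
    assert (X0 < t) by (eapply Rle_lt_trans; [apply Rmax_l|exact Ht]). assert (0 < t) by (eapply Rle_lt_trans; [apply Rmax_r|exact Ht]). nra. }
  apply filter_imp with (2 := filter_and _ _ (filter_and _ _ (eventually_regular N HN) HD) HK2).
  intros t [[Hg Ha1] HT] E. destruct (theta_regular theta N t Hth Hg) as [_ Tg]. assert (Hg' := Hg). destruct Hg' as (Ht & _ & _ & Hr).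
  assert (Hst : 1 <= sqrt t) by (rewrite <- sqrt_1; apply sqrt_le_1; lra).
  assert (TE : forall k, (1 <= k)%nat -> Rabs (exponential_term t E k) <= C * exp (- (7 / 4 * PI * t) * INR k)).
  { intros k Hk. assert (Hk1 : 1 <= INR k) by (apply (le_INR 1); auto).
    assert (Hx : 1 <= PI * INR k * t) by (assert (1 <= INR k * t) by nra; nra).
    assert (Ba : Rabs (a_param N k t) <= PI * INR k * t / 2 + 1).
    { specialize (Hr k Hk). unfold a_param. set (x := PI * INR k * t) in *.
      replace (2 * (INR (N k t) - x) + 1) with (2 * x * (INR (N k t) / x - 1) + 1) by (field; lra).
      apply Rabs_le_between in Hr. apply Rabs_le. split; nra. }
    specialize (HI (a_param N k t) (PI * INR k * t) Hx Ba). fold (E k) in HI.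
    unfold exponential_term, Rdiv. rewrite !Rabs_mult, pow_1_abs, (Rabs_right (exp _)) by (left; apply exp_pos).
    assert (Rp : Rabs (/ Rpower (INR k) (3 * / 2)) <= 1).
    { rewrite Rabs_right by (left; apply Rinv_0_lt_compat, Rpower_pos). rewrite <- Rinv_1. apply Rinv_le_contravar; [lra|].
      rewrite <- (Rpower_O (INR k)) by lra. apply Rle_Rpower; lra. }
    pose proof (exp_pos (-2 * PI * INR k * t)) as Xp. rewrite Rmult_1_l.
    apply Rle_trans with (exp (-2 * PI * INR k * t) * 1 * (C * exp (PI * INR k * t / 4))).
    - apply Rmult_le_compat; try apply Rabs_pos; auto. apply Rmult_le_pos; [lra|apply Rabs_pos]. apply Rmult_le_compat_l; lra.
    - right. replace (- (7 * / 4 * PI * t) * INR k) with (-2 * PI * INR k * t + PI * INR k * t / 4) by field. rewrite exp_plus. rring. }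
  assert (Hc1 : 1 <= 7 / 4 * PI * t) by nra. assert (Hc2 : 1 <= 7 / 2 * PI * t) by nra.
  destruct (geom_tail C (7 / 4 * PI * t) 1 (exponential_term t E) HC Hc1 TE) as [Ex1 _].
  destruct (geom_tail C (7 / 4 * PI * t) 2 (exponential_term t E) HC Hc1 ltac:(intros k Hk; apply TE; lia)) as [_ Bd1].
  destruct (geom_tail 500 (7 / 4 * PI * t) 2 (rho N t) ltac:(lra) Hc1) as [_ Bd2].
  { intros k Hk. replace (- (7 / 4 * PI * t) * INR k) with (- (7 / 4) * PI * t * INR k) by rring. exact (proj1 (rho_bound N t k Hg ltac:(lia))). }
  destruct (geom_tail 500 (7 / 2 * PI * t) 1 (rho2 N t) ltac:(lra) Hc2) as [_ Bd3].
  { intros k Hk. replace (- (7 / 2 * PI * t) * INR k) with (- (7 / 2) * PI * t * INR k) by rring. exact (proj2 (rho_bound N t k Hg Hk)). }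
  split; [exact Ex1|].
  set (z := exp (- (7 / 2) * PI * t)).
  assert (Z1 : exp (- (7 / 4 * PI * t) * INR 2) = z) by (unfold z; f_equal; simpl (INR 2); field).
  assert (Z2 : exp (- (7 / 2 * PI * t) * INR 1) = z) by (unfold z; f_equal; simpl (INR 1); field).
  rewrite Z1 in Bd1, Bd2. rewrite Z2 in Bd3.
  rewrite Tg. unfold exponential_part.
  destruct (rho_series N t Hg) as [X1 X2].
  rewrite (Series_incr_1 (fun j => exponential_term t E (S j))) by auto.
  rewrite (Series_incr_1 (fun j => rho N t (S j))) by auto.
  change (fun k => exponential_term t E (S (S k))) with (fun k => exponential_term t E (2 + k)%nat).
  change (fun k => rho N t (S (S k))) with (fun k => rho N t (2 + k)%nat).
  change (fun j => rho2 N t (S j)) with (fun j => rho2 N t (1 + j)%nat).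
  set (S1 := Series (fun k => exponential_term t E (2 + k)%nat)) in *.
  set (S2 := Series (fun k => rho N t (2 + k)%nat)) in *.
  set (S3 := Series (fun k => rho2 N t (1 + k)%nat)) in *.
  pose proof (Trem_rho N t 1 ltac:(lra) (le_n 1)) as L1. cbn [Nat.sub pow] in L1. rewrite Rmult_1_l in L1.
  set (e1 := exponential_term t E 1) in *.
  assert (Ld : Rabs (2 * sqrt t * rho N t 1 - e1) <= exp (- 2 * PI * t) * (Rabs K1 / t ^ n)).
  { rewrite <- L1. unfold e1, exponential_term. cbn [Nat.sub pow INR].
    replace (Rpower 1 (3 / 2)) with 1 by (unfold Rpower; rewrite ln_1, Rmult_0_r, exp_0; auto).
    replace (-2 * PI * 1 * t) with (-2 * PI * t) by rring.
    unfold E. cbn [INR].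
    set (T1 := Trem _ _). set (I1 := inner_sum _ _ _ _).
    replace (1 * exp (-2 * PI * t) / 1 * T1 - 1 * exp (-2 * PI * t) / 1 * I1) with (exp (-2 * PI * t) * (T1 - I1)) by field.
    rewrite Rabs_mult, (Rabs_right (exp _)) by (left; apply exp_pos). apply Rmult_le_compat_l; [left; apply exp_pos|].
    eapply Rle_trans; [apply HT; exact Ha1|].
    assert (Pt : t ^ n <= (PI * 1 * t) ^ n) by (apply pow_incr; nra). assert (0 < t ^ n) by (apply pow_lt; lra).
    unfold Rdiv. apply Rle_trans with (Rabs K1 * / (PI * 1 * t) ^ n).
    - apply Rmult_le_compat_r; [left; apply Rinv_0_lt_compat; lra|apply Rle_abs].
    - apply Rmult_le_compat_l; [apply Rabs_pos|]. apply Rinv_le_contravar; lra. }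
  assert (Hzp : 0 < z) by apply exp_pos.
  assert (c1 : 0 < / (4 * PI * sqrt t) <= / sqrt t).
  { split. apply Rinv_0_lt_compat; nra. apply Rinv_le_contravar; nra. }
  assert (c2 : 0 < / sqrt t <= 1) by (split; [apply Rinv_0_lt_compat; lra|rewrite <- Rinv_1; apply Rinv_le_contravar; lra]).
  assert (c3 : 0 < / (2 * PI) <= 1) by (split; [apply Rinv_0_lt_compat; lra|rewrite <- Rinv_1; apply Rinv_le_contravar; lra]).
  replace (algebraic_part N t + / (2 * PI) * (rho N t 1 + S2 - S3) - (algebraic_part N t + / (4 * PI * sqrt t) * (e1 + S1)))
    with (/ (4 * PI * sqrt t) * (2 * sqrt t * rho N t 1 - e1) + / (2 * PI) * (S2 - S3) - / (4 * PI * sqrt t) * S1) by (field; lra).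
  assert (W1 : Rabs (/ (4 * PI * sqrt t) * (2 * sqrt t * rho N t 1 - e1)) <= / sqrt t * (exp (- 2 * PI * t) * (Rabs K1 / t ^ n))).
  { rewrite Rabs_mult, (Rabs_right (/ (4 * PI * sqrt t))) by lra. apply Rmult_le_compat; try lra; apply Rabs_pos. }
  assert (W2 : Rabs (/ (2 * PI) * (S2 - S3)) <= 2000 * z).
  { rewrite Rabs_mult, (Rabs_right (/ (2 * PI))) by lra.
    assert (Rabs (S2 - S3) <= 2000 * z) by (unfold Rminus; eapply Rle_trans; [apply Rabs_triang|]; rewrite Rabs_Ropp; lra).
    pose proof (Rabs_pos (S2 - S3)). nra. }
  assert (W3 : Rabs (/ (4 * PI * sqrt t) * S1) <= 2 * C * z).
  { rewrite Rabs_mult, (Rabs_right (/ (4 * PI * sqrt t))) by lra. pose proof (Rabs_pos S1). nra. }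
  assert (Hfin : forall x1 x2 x3, Rabs (x1 + x2 - x3) <= Rabs x1 + Rabs x2 + Rabs x3) by (intros; unfold Rabs; repeat destruct Rcase_abs; lra).
  eapply Rle_trans; [apply Hfin|].
  assert (Ptn : 0 < t ^ n) by (apply pow_lt; lra).
  assert (Zb : z <= Cp * (exp (- 2 * PI * t) / (sqrt t * t ^ n))).
  { assert (Ez : z = exp (- 2 * PI * t) * exp (- (3 / 2 * PI * t))) by (unfold z; rewrite <- exp_plus; f_equal; field).
    rewrite Ez. replace (Cp * (exp (-2 * PI * t) / (sqrt t * t ^ n))) with (exp (-2 * PI * t) * (Cp * / (sqrt t * t ^ n))) by (unfold Rdiv; rring).
    apply Rmult_le_compat_l; [left; apply exp_pos|]. rewrite exp_Ropp.
    specialize (Hpow t ltac:(lra)). rewrite pow_add, pow_1 in Hpow.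
    assert (Hsq : sqrt t <= t). { rewrite <- (sqrt_square t) at 2 by lra. apply sqrt_le_1; nra. }
    pose proof (exp_pos (3 / 2 * PI * t)) as Xe.
    apply (Rmult_le_reg_r (exp (3 / 2 * PI * t) * (sqrt t * t ^ n))). { apply Rmult_lt_0_compat; nra. }
    replace (/ exp (3 / 2 * PI * t) * (exp (3 / 2 * PI * t) * (sqrt t * t ^ n))) with (sqrt t * t ^ n) by (field; lra).
    replace (Cp * / (sqrt t * t ^ n) * (exp (3 / 2 * PI * t) * (sqrt t * t ^ n))) with (Cp * exp (3 / 2 * PI * t)) by (field; split; lra).
    nra. }
  rewrite Rmult_plus_distr_r.
  replace (Rabs K1 * (exp (-2 * PI * t) / (sqrt t * t ^ n))) with (/ sqrt t * (exp (-2 * PI * t) * (Rabs K1 / t ^ n))) by (field; split; lra).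
  apply (Rmult_le_compat_l (2000 + 2 * C)) in Zb; [|lra]. lra.
Qed.

Theorem theorem1 :
  forall (theta : R -> R) (A B : R -> nat -> R),
  is_RS_theta theta ->
  are_AB_coefficients A B ->
  (forall N : nat -> R -> nat, optimal_truncation N ->
     Rbar_locally p_infty (fun t => ex_series (fun j => bracket N t (S j))) /\
     forall n : nat, exists K : R,
       Rbar_locally p_infty (fun t =>
         let E := fun k => inner_sum (C_coeff A B) n (a_param N k t) (PI * INR k * t) in
         ex_series (fun j => exponential_term t E (S j)) /\
         Rabs (theta t - (algebraic_part N t + exponential_part t E))
           <= K * (exp (- 2 * PI * t) / (sqrt t * t ^ n))))
  /\
  (exists T : R -> R -> R,
     has_inner_expansion (C_coeff A B) T /\
     forall N : nat -> R -> nat, optimal_truncation N -> compatible_truncation N ->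
       Rbar_locally p_infty (fun t =>
         let E := fun k => T (a_param N k t) (PI * INR k * t) in
         ex_series (fun j => bracket N t (S j)) /\
         ex_series (fun j => exponential_term t E (S j)) /\
         theta t = algebraic_part N t + exponential_part t E))
  /\
  (forall a : R,
     C_coeff A B 0 a = 7 / 6 - a /\
     C_coeff A B 1 a =
       1 / (30 * 6 ^ 2) * (136 - 495 * a + 405 * a ^ 2 - 90 * a ^ 3) /\
     C_coeff A B 2 a =
       1 / (1120 * 6 ^ 3) *
       (- 695 - 20538 * a + 54180 * a ^ 2 - 43680 * a ^ 3 + 13860 * a ^ 4
        - 1512 * a ^ 5) /\
     C_coeff A B 3 a =
       1 / (1120 * 6 ^ 5) *
       (- 15953 + 55929 * a + 388395 * a ^ 2 - 949410 * a ^ 3 + 767340 * a ^ 4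
        - 283500 * a ^ 5 + 49140 * a ^ 6 - 3240 * a ^ 7) /\
     C_coeff A B 4 a =
       1 / (70400 * 6 ^ 8) *
       (170640893 + 21630510 * a - 598217400 * a ^ 2 - 2559569760 * a ^ 3
        + 6176233800 * a ^ 4 - 5034007440 * a ^ 5 + 2026775520 * a ^ 6
        - 436233600 * a ^ 7 + 48114000 * a ^ 8 - 2138400 * a ^ 9) /\
     C_coeff A B 5 a =
       1 / (25025 * 2 ^ 11 * 6 ^ 7) *
       (- 8649703370 - 28280511909 * a + 27178306155 * a ^ 2
        + 28170272130 * a ^ 3 + 154158404400 * a ^ 4 - 357524183016 * a ^ 5
        + 292552139880 * a ^ 6 - 124352308080 * a ^ 7 + 30395645280 * a ^ 8
        - 4313509200 * a ^ 9 + 330810480 * a ^ 10 - 10614240 * a ^ 11)).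
Proof.
  intros theta A B Hth HAB. split; [|split].
  - intros N HN. split.
    + apply filter_imp with (2 := eventually_regular N HN). intros t Hg. apply (theta_regular theta N t Hth Hg).
    + intros n. apply asymptotic_expansion; auto.
  (* The witness is the normalised remainder itself, a function of a and x chosen before N. *)
  - exists Trem. split; [apply Trem_expansion; auto|]. intros N HN Hc.
    apply filter_imp with (2 := filter_and _ _ (eventually_regular N HN) Hc). intros t [Hg Hct] E.
    split; [apply (theta_regular theta N t Hth Hg)|]. apply exact_expansion; auto.
  - intros a. apply coefficient_values; auto.
Qed.
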